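(* Let $d>4$ and $P\in\mathcal{P}(d,n,s)$ with distinguished facet $F$ (the facet with $d+s$ vertices, all other facets being simplices). Let $\Delta_F$ be the polyhedral complex corresponding to the prime decomposition of $F$, and let $\Delta$ be the refinement of the boundary complex $\partial P$ obtained by refining $F$ by $\Delta_F$. Assume there is some $1\le i\le d-1$ for which $f_i(P)=f_i(S(d,n,s))$. Then all prime factors in the prime decomposition of $\Delta$ are $d$-simplices. In particular, $f(P)=f(S(d,n,s))$.
   Context: $f_i$ is the number of $i$-faces and $f(P)=(1,f_0(P),\dots,f_{d-1}(P))$. $\mathcal{P}(d,n,s)$ is the family of $d$-polytopes with $n$ vertices having a facet $F$ with exactly $d+s$ vertices such that every other facet is a simplex. $S(d,n,s)$: take a stacked $(d-1)$-polytope with $d+s$ vertices (stacked = obtained from a simplex by repeatedly adding a vertex beyond a facet and taking the convex hull), form a pyramid over it, then stack $n-d-s-1$ times over facets other than the base; its $f$-vector is $f_0=n$, $f_k=\binom{d}{k}n-\binom{d+1}{k+1}k$ for $1\le k\le d-3$, $f_{d-2}=\binom{d}{d-2}n-\binom{d+1}{d-1}(d-2)-s$, $f_{d-1}=(d-1)n-(d+1)(d-2)-s$. Prime decomposition: for an $m$-polytope (or polyhedral $(m-1)$-sphere) $Q$, $m\ge 3$, a missing $(m-1)$-face is a set $A$ of $m$ vertices such that the simplex on $A$ is not a face but the simplex on every proper subset of $A$ is a face. Inserting the simplex on $A$ cuts $Q$ into two pieces $Q_1,Q_2$ glued along this simplex ($Q=Q_1\#Q_2$, a connected sum). Repeating this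 on the pieces until no piece has a missing $(m-1)$-face gives a decomposition $Q=Q_1\#\cdots\#Q_t$, unique for $m\ge3$, called the prime decomposition; the $Q_i$ are the prime factors, and the polyhedral complex they form is the complex of the prime decomposition. Here $F$ is a simplicial $(d-1)$-polytope, $\Delta_F$ subdivides it into its prime factors, and $\Delta$ is the polyhedral $(d-1)$-sphere obtained from $\partial P$ by replacing $F$ with the cells of $\Delta_F$. *)

(* Defs.v *)
From HB Require Import structures.
From mathcomp Require Import all_boot all_order all_algebra.
From mathcomp Require Import finmap.
From mathcomp Require Import boolp classical_sets reals.

Set Implicit Arguments.
Unset Strict Implicit.
Unset Printing Implicit Defensive.

Import Order.TTheory GRing.Theory Num.Theory.
Local Open Scope fset_scope.
Local Open Scope ring_scope.

(* A polytope in R^N is given by its finite vertex set V, and each face by the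
   set of vertices lying on it; the empty face and V itself are faces. *)

Section Polytopes.
Variables (R : realType) (N : nat).
Implicit Types (V A B F G : {fset 'rV[R]_N}) (x c p : 'rV[R]_N) (b : R).

Definition dotp x c : R := \sum_(j < N) x ord0 j * c ord0 j.

Definition conv V : set 'rV[R]_N :=
  [set x | exists w : 'rV[R]_N -> R,
     [/\ forall p, p \in V -> 0 <= w p,
         \sum_(p <- V) w p = 1
       & x = \sum_(p <- V) w p *: p]]%classic.

Definition valid V c b : Prop := forall x, conv V x -> dotp x c <= b.

(* The vertices on the face {x in conv V | dotp x c = b}. *)
Definition contact V c b : {fset 'rV[R]_N} := [fset p in V | dotp p c == b].

Definition is_face V A : Prop := exists c b, valid V c b /\ A = contact V c b.

Definition is_polytope V : Prop := forall p, p \in V -> is_face V [fset p].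

Definition faces V : {fset {fset 'rV[R]_N}} :=
  [fset A in fpowerset V | `[< is_face V A >]].

(* One plus the dimension of the affine hull of A, so 0 for the empty set:
   the rank of the vectors (1, p), p in A. *)
Definition affrank A : nat :=
  \rank (\sum_(p <- A) <<row_mx (1%:M : 'M[R]_1) p>>)%MS.

Definition is_simplex A : Prop := affrank A = #|` A|.

Definition is_facet V G : Prop := is_face V G /\ (affrank G).+1 = affrank V.

Definition nfaces V (i : nat) : nat :=
  #|` [fset A in faces V | affrank A == i.+1]|.

Definition fvector (d : nat) V : seq nat := 1%N :: [seq nfaces V i | i <- iota 0 d].

(* The family P(d, n, s), with its distinguished facet F. *)
Definition in_P (d n s : nat) V F : Prop :=
  [/\ is_polytope V, affrank V = d.+1, #|` V| = n, is_facet V F /\ #|` F| = (d + s)%N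
    & forall G, is_facet V G -> G <> F -> is_simplex G].

(* x is beyond the facet G of V and beneath every other facet; the first
   condition places x in the affine hull of V, where the hyperplane spanned by
   a facet is unique. *)
Definition beyond_only V G x : Prop :=
  [/\ affrank (x |` V) = affrank V,
      exists c b, [/\ valid V c b, contact V c b = G & b < dotp x c]
    & forall H, is_facet V H -> H <> G ->
        exists c b, [/\ valid V c b, contact V c b = H & dotp x c < b]].

Inductive stacked : {fset 'rV[R]_N} -> Prop :=
| Stacked_simplex V : is_simplex V -> stacked V
| Stacked_step V G x :
    stacked V -> is_facet V G -> beyond_only V G x -> stacked (x |` V).

(* Obtained from a pyramid over the polytope B by stacking over facets other
   than the base B. *)
Inductive stacked_pyramid B : {fset 'rV[R]_N} -> Prop :=
| Stacked_pyramid_base x :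
    affrank (x |` B) = (affrank B).+1 -> stacked_pyramid B (x |` B)
| Stacked_pyramid_step V G x :
    stacked_pyramid B V -> is_facet V G -> G <> B -> beyond_only V G x ->
    stacked_pyramid B (x |` V).

(* V is a realization of S(d, n, s); having n vertices fixes the number of
   stackings to n - d - s - 1. *)
Definition is_S (d n s : nat) V : Prop :=
  exists B, [/\ stacked B, affrank B = d, #|` B| = (d + s)%N,
                stacked_pyramid B V & #|` V| = n].

Definition boundary V : {fset {fset 'rV[R]_N}} := faces V `\ V.

End Polytopes.

(* A polyhedral complex is given by the vertex sets of its cells, including the
   empty cell; a cell C is a face of a cell B iff C `<=` B. *)

Section Complexes.
Variable T : choiceType.
Implicit Types (K Q : {fset {fset T}}) (A B C : {fset T}) (L : seq {fset {fset T}}).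

Definition vertices K : {fset T} := \bigcup_(A <- K) A.

(* A missing (m-1)-face of an (m-1)-sphere K. *)
Definition missing_face (m : nat) K A : Prop :=
  [/\ #|` A| = m, A \notin K & forall B, B `<` A -> B \in K].

Definition face_closed_in K K1 : Prop :=
  forall B C, B \in K1 -> C \in K -> C `<=` B -> C \in K1.

(* Inserting the simplex on A cuts K into K1 and K2, glued along that simplex:
   K = K1 # K2.  The last condition excludes the degenerate cut in which one
   piece is only the inserted simplex with its faces. *)
Definition cut_along K A K1 K2 : Prop :=
  [/\ K1 `|` K2 = A |` K,
      K1 `&` K2 = fpowerset A,
      face_closed_in (A |` K) K1, face_closed_in (A |` K) K2
    & K1 <> fpowerset A /\ K2 <> fpowerset A].

(* L lists the prime factors of the (m-1)-sphere K. *)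
Inductive prime_decomposition (m : nat) : {fset {fset T}} -> seq {fset {fset T}} -> Prop :=
| Prime_factor K :
    (forall A, ~ missing_face m K A) -> prime_decomposition m K [:: K]
| Prime_cut K A K1 K2 L1 L2 :
    missing_face m K A -> cut_along K A K1 K2 ->
    prime_decomposition m K1 L1 -> prime_decomposition m K2 L2 ->
    prime_decomposition m K (L1 ++ L2).

(* The complex formed by the prime factors, each one being filled in by a cell
   spanned by all its vertices. *)
Definition decomposition_complex L : {fset {fset T}} :=
  \bigcup_(Q <- L) (vertices Q |` Q).

(* Q is the boundary complex of a d-simplex. *)
Definition simplex_sphere (d : nat) Q : Prop :=
  exists A, #|` A| = d.+1 /\ Q = fpowerset A `\ A.

End Complexes.

(* The boundary complex of V with the facet F replaced by the cells of DF. *)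
Definition refined_boundary (R : realType) (N : nat) (V F : {fset 'rV[R]_N})
    (DF : {fset {fset 'rV[R]_N}}) : {fset {fset 'rV[R]_N}} :=
  (boundary V `\ F) `|` DF.

(* Main.v *)
(* Place a point w beyond the facet F and beneath all others. The facets of the
   resulting simplicial polytope form a normal pseudomanifold X, and the boundary
   of P without F is X with w deleted.

   Minimal mod 2 cycles of facets are generically rigid (Fogelsanger: contract an
   edge and split the cycle into minimal pieces). Applied to X with the link of w
   placed in a hyperplane, this makes the boundary of P without F rigid, so that
   it has at least d n - C(d+1, 2) edges. The same holds in all vertex links, and
   counting each face through its vertices bounds every f_i from below by the
   value for S(d, n, s); equality for one i forces equality for the edges.

   With the minimal number of edges no vertex set of the refined sphere spans more
   edges than rigidity allows. This property passes to vertex links and to both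
   sides of a cut along a missing face, and a sphere having it without missing
   facets is the boundary of a simplex: a vertex star is already rigid, so the
   neighbours of a vertex span no edge outside its link. *)

Require Import Defs.
From mathcomp Require Import all_boot all_order all_algebra.
From mathcomp Require Import finmap.
From mathcomp Require Import boolp classical_sets reals.
From mathcomp Require Import zify lra ring.

Set Implicit Arguments.
Unset Strict Implicit.
Unset Printing Implicit Defensive.
Import Order.TTheory GRing.Theory Num.Theory.

(** * Mod 2 chains *)

Section Chains.
Local Open Scope fset_scope.
Variable T : choiceType.
Implicit Types (A B G H r s t W : {fset T}) (C Z K : {fset {fset T}}).

(** The coordinates of P serve only to describe its faces; the placements used for rigidity are
    chosen anew. Being generic means avoiding roots of polynomials along lines, which also works
    inside the linear family of placements that keep the neighbours of w in a hyperplane. Links of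
    minimal cycles need not be minimal; normality asks for minimality in every star and so passes to
    links, cuts and connected sums. The hyperplane is what accounts for F. A vertex of F may leave
    it without disturbing an edge inside F, so all but d vertices of F must be held by an additional
    edge not inside F. This surplus pays for the correction terms when the bounds of the vertex
    links are added up. In the case of equality it makes the boundary of F sparse in one dimension
    less, so that the prime factors of F are simplices; only then is the refined complex simplicial
    and open to the same argument. The condition d > 4 enters through F: its boundary has facets
    with d - 1 vertices, and the vertex links in it need facets with at least three vertices in
    order to be rigid. *)

Definition pure d Z : Prop := forall G, G \in Z -> #|` G| = d.

Definition star Z s : {fset {fset T}} := [fset G in Z | s `<=` G].

(* The mod 2 boundary of the chain Z, read at the cell r. *)
Definition par Z r : bool := \big[addb/false]_(G <- Z) (r `<=` G).

Definition symd (U : choiceType) (Z K : {fset U}) : {fset U} := (Z `\` K) `|` (K `\` Z).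

Lemma in_symd (U : choiceType) (Z K : {fset U}) (G : U) :
  (G \in symd Z K) = (G \in Z) (+) (G \in K).
Proof. by rewrite !inE; case: (G \in Z); case: (G \in K). Qed.

Lemma in_sep (U : choiceType) (Z : {fset U}) (P : pred U) (x : U) :
  (x \in [fset y in Z | P y]) = (x \in Z) && P x.
Proof. by rewrite !inE. Qed.

Lemma in_star Z s G : (G \in star Z s) = (G \in Z) && (s `<=` G).
Proof. by rewrite !inE. Qed.

Lemma star_sub Z s : star Z s `<=` Z.
Proof. by apply/fsubsetP => G; rewrite in_star => /andP[]. Qed.

Lemma star0 Z : star Z fset0 = Z.
Proof. by apply/fsetP => G; rewrite in_star fsub0set andbT. Qed.

Lemma pureS d Z K : K `<=` Z -> pure d Z -> pure d K.
Proof. by move=> /fsubsetP h p G /h /p. Qed.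

Lemma par_widen Z (W : {fset {fset T}}) r : Z `<=` W ->
  par Z r = \big[addb/false]_(G <- W) ((G \in Z) && (r `<=` G)).
Proof.
move=> ZW; rewrite /par -(big_fset_incl _ ZW); last by move=> G _ /negbTE->.
by rewrite !big_seq; apply: eq_bigr => G ->.
Qed.

Lemma par_symd Z K r : par (symd Z K) r = par Z r (+) par K r.
Proof.
have s1 : Z `<=` Z `|` K by exact: fsubsetUl.
have s2 : K `<=` Z `|` K by exact: fsubsetUr.
have s3 : symd Z K `<=` Z `|` K.
  by apply/fsubsetP => G; rewrite in_symd inE; case: (G \in Z).
rewrite (par_widen _ s1) (par_widen _ s2) (par_widen _ s3) -big_split /=.
by apply: eq_bigr => G _; rewrite in_symd -andb_addl.
Qed.

Lemma par_fset0 r : par fset0 r = false.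
Proof. exact: big_seq_fset0. Qed.

Lemma par_fset1 G r : par [fset G] r = (r `<=` G).
Proof. exact: big_seq_fset1. Qed.

Lemma par_none Z r : (forall G, G \in Z -> ~~ (r `<=` G)) -> par Z r = false.
Proof. by move=> h; rewrite /par big1_seq // => G /h /negbTE. Qed.

Lemma par_ex Z r : par Z r -> exists2 G, G \in Z & r `<=` G.
Proof.
move=> h; case: (pselect (exists2 G, G \in Z & r `<=` G)) => // n.
move: h; rewrite par_none // => G GZ; apply/negP => rG; apply: n; by exists G.
Qed.

Lemma par_disjU Z K r : [disjoint Z & K] -> par (Z `|` K) r = par Z r (+) par K r.
Proof.
move=> /fdisjointP d; rewrite -par_symd; congr (par _ r); apply/fsetP => G.
by rewrite in_symd inE; case: (boolP (G \in Z)) => //= /d /negbTE ->.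
Qed.

Lemma par_star Z s r : s `<=` r -> par (star Z s) r = par Z r.
Proof.
move=> sr; rewrite (par_widen _ (star_sub Z s)) /par.
rewrite !big_seq; apply: eq_bigr => G GZ; rewrite in_star GZ /=.
by case: (boolP (r `<=` G)) => [/(fsubset_trans sr)->|]; rewrite ?andbF.
Qed.

Lemma par_D1 Z G r : G \in Z -> par (Z `\ G) r = par Z r (+) (r `<=` G).
Proof. by move=> GZ; rewrite /par [in RHS](big_fsetD1 G) //= addbAC addbb. Qed.

(** A nonzero even number is at least two. This flip across a ridge is how facets avoiding a given
    vertex are found later. *)
Lemma par_other Z r G : ~~ par Z r -> G \in Z -> r `<=` G ->
  exists H, [/\ H \in Z, r `<=` H & H != G].
Proof.
move=> h GZ rG.
have /par_ex[H] : par (Z `\ G) r by rewrite par_D1 // rG (negbTE h).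
by rewrite !inE => /andP[? ?] ?; exists H.
Qed.

Lemma par_card Z r : par Z r = odd #|` star Z r|.
Proof.
rewrite card_fset_sum1 big_fset /= (big_morph odd oddD (erefl : odd 0 = false)).
by rewrite [RHS]big_mkcond /=; apply: eq_bigr => G _; case: ifP.
Qed.

(* Each facet through t contains exactly two of the ridges x |` t. *)
Lemma par_double d Z t W : pure d.+2 Z -> #|` t| = d ->
  (forall G, G \in Z -> G `<=` W) ->
  \big[addb/false]_(x <- W `\` t) par Z (x |` t) = false.
Proof.
move=> pZ ct ZW; rewrite exchange_big /=; apply: big1_seq => G /= GZ.
case: (boolP (t `<=` G)) => tG; last first.
  rewrite big1 // => x _; apply/negbTE; apply: contra tG => /(fsubset_trans _); apply.
  exact: fsubsetUr.
transitivity (\big[addb/false]_(x <- W `\` t) (x \in G)).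
  by apply: eq_bigr => x _; rewrite fsubUset tG andbT fsub1set.
have sG : G `\` t `<=` W `\` t by apply: fsetSD; exact: ZW.
rewrite -(big_fset_incl _ sG); last first.
  by move=> x; rewrite !inE => /andP[-> _] /= /negbTE.
transitivity (odd #|` G `\` t|); last by rewrite cardfsDS // pZ // ct subSn // subSnn.
rewrite card_fset_sum1 (big_morph odd oddD (erefl : odd 0 = false)).
by apply: eq_big_seq => x; rewrite !inE => /andP[_ ->].
Qed.

Lemma big_addb_fset (U : choiceType) (W : {fset U}) (P : pred U) :
  \big[addb/false]_(x <- W) P x = odd #|` [fset x in W | P x]|.
Proof.
rewrite card_fset_sum1 big_fset /= (big_morph odd oddD (erefl : odd 0 = false)).
by rewrite [RHS]big_mkcond /=; apply: eq_bigr => G _; case: ifP.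
Qed.

(** Fogelsanger's minimal cycles. The number [d] counts the vertices of a facet, so the complex has
    dimension d - 1 and is to be placed in R^d. *)
Definition mincycle d C : Prop :=
  [/\ C != fset0, pure d C, forall r, #|` r| = d.-1 -> ~~ par C r
    & forall Z, Z `<=` C -> (forall r, #|` r| = d.-1 -> ~~ par Z r) ->
        Z = fset0 \/ Z = C].

(* Every star, relative to its outer ridges, is a minimal mod 2 cycle: the links
   are connected and each ridge lies in exactly two facets. *)
Definition normal d C : Prop :=
  [/\ C != fset0, pure d C, forall r, #|` r| = d.-1 -> ~~ par C r
    & forall s, #|` s| < d -> forall Z, Z `<=` star C s ->
        (forall r, s `<=` r -> #|` r| = d.-1 -> ~~ par Z r) ->
        Z = fset0 \/ Z = star C s].

Lemma normal_mincycle d C : 0 < d -> normal d C -> mincycle d C.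
Proof.
move=> d0 [c0 p e m]; split=> // Z ZC h.
have := m fset0; rewrite cardfs0 star0 => /(_ d0 Z ZC); apply => r _; exact: h.
Qed.

Lemma mem_vertices C x : reflect (exists2 G, G \in C & x \in G) (x \in vertices C).
Proof.
apply: (iffP (bigfcupP _ _ _ _)) => [[G]|[G GC xG]].
  by rewrite andbT => GC xG; exists G.
by exists G; rewrite ?GC.
Qed.

Lemma sub_vertices C G : G \in C -> G `<=` vertices C.
Proof. by move=> GC; apply/fsubsetP => x xG; apply/mem_vertices; exists G. Qed.

Lemma vertices_sub C W : (forall G, G \in C -> G `<=` W) -> vertices C `<=` W.
Proof. by move=> h; apply/fsubsetP => x /mem_vertices[G /h /fsubsetP]; apply. Qed.

Lemma verticesS C Z : Z `<=` C -> vertices Z `<=` vertices C.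
Proof. by move=> /fsubsetP ZC; apply: vertices_sub => G /ZC; exact: sub_vertices. Qed.

End Chains.

(** * Infinitesimal rigidity *)

Section DotProduct.
Local Open Scope ring_scope.
Variables (R : realType) (N : nat).
Implicit Types (x y z : 'rV[R]_N) (a : R).

Lemma dotpE x y : dotp x y = (x *m y^T) ord0 ord0.
Proof. by rewrite mxE; apply: eq_bigr => j _; rewrite mxE. Qed.

Lemma dotpC x y : dotp x y = dotp y x.
Proof. by apply: eq_bigr => j _; rewrite mulrC. Qed.

Lemma dotpDl x y z : dotp (x + y) z = dotp x z + dotp y z.
Proof. by rewrite !dotpE mulmxDl mxE. Qed.

Lemma dotpZl a x z : dotp (a *: x) z = a * dotp x z.
Proof. by rewrite !dotpE -scalemxAl mxE. Qed.

Lemma dotpDr x y z : dotp z (x + y) = dotp z x + dotp z y.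
Proof. by rewrite dotpC dotpDl !(dotpC z). Qed.

Lemma dotpZr a x z : dotp z (a *: x) = a * dotp z x.
Proof. by rewrite dotpC dotpZl (dotpC z). Qed.

Lemma dotp0l z : dotp 0 z = 0.
Proof. by rewrite -(scale0r 0) dotpZl mul0r. Qed.

Lemma dotp0r z : dotp z 0 = 0.
Proof. by rewrite dotpC dotp0l. Qed.

Lemma dotpNl x z : dotp (- x) z = - dotp x z.
Proof. by rewrite -scaleN1r dotpZl mulN1r. Qed.

Lemma dotpNr x z : dotp z (- x) = - dotp z x.
Proof. by rewrite dotpC dotpNl dotpC. Qed.

Lemma dotpBl x y z : dotp (x - y) z = dotp x z - dotp y z.
Proof. by rewrite dotpDl dotpNl. Qed.

Lemma dotpBr x y z : dotp z (x - y) = dotp z x - dotp z y.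
Proof. by rewrite dotpDr dotpNr. Qed.

Lemma dotp_suml (I : Type) (s : seq I) (P : pred I) (F : I -> 'rV[R]_N) z :
  dotp (\sum_(i <- s | P i) F i) z = \sum_(i <- s | P i) dotp (F i) z.
Proof. exact: (big_morph (fun x => dotp x z) (fun x y => dotpDl x y z) (dotp0l z)). Qed.

Lemma dotp_mulmx x z (S : 'M[R]_N) : dotp (x *m S) z = dotp x (z *m S^T).
Proof. by rewrite !dotpE trmx_mul trmxK mulmxA. Qed.

Lemma dotp_delta x j : dotp x (delta_mx ord0 j) = x ord0 j.
Proof.
rewrite /dotp (bigD1 j) //= mxE !eqxx mulr1 big1 ?addr0 // => k /negbTE kj.
by rewrite mxE kj andbF mulr0.
Qed.

Lemma skew_dotp (S : 'M[R]_N) x z : S^T = - S -> dotp (x *m S) z = - dotp (z *m S) x.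
Proof. by move=> sS; rewrite dotp_mulmx sS mulmxN dotpNr dotpC. Qed.

End DotProduct.

Section Rigidity.
Local Open Scope fset_scope.
Local Open Scope ring_scope.
Variables (R : realType) (T : choiceType).
Implicit Types (A B G H V : {fset T}) (C Z K : {fset {fset T}}).

Definition indep n A (p : T -> 'rV[R]_n) : Prop :=
  forall c : T -> R, \sum_(a <- A) c a *: p a = 0 -> forall a, a \in A -> c a = 0.

Lemma indep_row_free m n (t : m.-tuple T) A (p : T -> 'rV[R]_n) :
  t = A :> seq T -> indep A p -> row_free (\matrix_(i < m) p (tnth t i)).
Proof.
move=> tA iA; rewrite -kermx_eq0; apply/rowV0P => u /sub_kermxP.
rewrite mulmx_sum_row => h.
pose c a := if insub (index a t) is Some i then u ord0 i else 0.
have ct i : c (tnth t i) = u ord0 i.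
  rewrite /c (tnth_nth (tnth t i)) index_uniq ?size_tuple //; last by rewrite tA.
  by rewrite valK.
have h' : \sum_(a <- A) c a *: p a = 0.
  rewrite -tA big_tuple -[RHS]h; apply: eq_bigr => i _; by rewrite ct rowK.
apply/rowP => i; rewrite mxE -ct; apply: (iA _ h').
by rewrite -[_ \in A]/(_ \in enum_fset A) -tA mem_tnth.
Qed.

Lemma row_free_ext n (M : 'M[R]_(n, n.+1)) : row_free M ->
  exists z : 'rV[R]_n.+1, (col_mx z M : 'M_n.+1) \in unitmx.
Proof.
move=> rfM.
have : ~~ [forall i, (row i (1%:M : 'M[R]_n.+1) <= M)%MS].
  apply/negP => /forallP /row_subP /mxrankS; rewrite mxrank1.
  by move: (rank_leq_row M) => h1 h2; move: (leq_trans h2 h1); rewrite ltnn.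
rewrite negb_forall => /existsP[i niM]; exists (row i 1%:M).
rewrite -row_free_unit -kermx_eq0; apply/rowV0P => u /sub_kermxP.
set a := lsubmx (u : 'rV_(1 + n)); set b := rsubmx (u : 'rV_(1 + n)).
have hu : u = row_mx a b by rewrite hsubmxK.
rewrite hu (mul_row_col a b (row i 1%:M) M) => h.
have a0 : a = 0.
  rewrite [a]mx11_scalar; case: (eqVneq (a ord0 ord0) 0) => [->|an].
    by apply/matrixP => i' j'; rewrite !mxE mul0rn.
  case/negP: niM; move: h; rewrite {1}[a]mx11_scalar mul_scalar_mx => h.
  have -> : row i 1%:M = - ((a ord0 ord0)^-1 *: b) *m M.
    apply: (scalerI an); rewrite mulNmx -scalemxAl scalerN scalerA divff // scale1r.
    by apply/eqP; rewrite -addr_eq0 h.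
  exact: submxMl.
rewrite a0 mul0mx add0r in h; rewrite a0.
have -> : b = 0 by apply: (row_free_inj rfM); rewrite h mul0mx.
by apply/matrixP => i' j; rewrite !mxE; case: (split _) => k; rewrite mxE.
Qed.

Lemma unit_dotp0 n (z v : 'rV[R]_n.+1) (M : 'M[R]_(n, n.+1)) :
  (col_mx z M : 'M_n.+1) \in unitmx ->
  (forall i, dotp v (row i M) = 0) -> dotp v z = 0 -> v = 0.
Proof.
move=> zu h1 h2; apply: trmx_inj; rewrite trmx0 -[v^T](mulKmx zu) (mul_col_mx z M v^T).
have -> : z *m v^T = 0.
  by apply/matrixP => i j; rewrite !ord1 -dotpE dotpC h2 mxE.
have -> : M *m v^T = 0.
  by apply/matrixP => i j; rewrite !ord1 mxE [RHS]mxE -[RHS](h1 i) dotpC;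
    apply: eq_bigr => k _; rewrite !mxE.
by rewrite (col_mx0 _ 1 n) mulmx0.
Qed.

Lemma unit_dotp_ex n (z : 'rV[R]_n.+1) (M : 'M[R]_(n, n.+1)) :
  (col_mx z M : 'M_n.+1) \in unitmx -> forall b (f : 'I_n -> R),
  exists v, dotp v z = b /\ forall i, dotp v (row i M) = f i.
Proof.
move=> zu b f; pose w : 'cV[R]_n.+1 := col_mx b%:M (\col_i f i).
exists (invmx (col_mx z M : 'M_n.+1) *m w)^T.
set v := (_ *m w)^T.
have : (col_mx z M : 'M_n.+1) *m v^T = w by rewrite trmxK mulKVmx.
rewrite (mul_col_mx z M v^T) /w => h; have [h1 h2] := @eq_col_mx _ 1 n _ _ _ _ _ h; split.
  by rewrite dotpC dotpE h1 mxE.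
move=> i; move/matrixP: h2 => /(_ i ord0); rewrite !mxE => <-.
by rewrite dotpC; apply: eq_bigr => k _; rewrite !mxE.
Qed.

(* Infinitesimal motions in homogeneous coordinates: a point of R^d is a vector of
   length d + 1, and a trivial motion is x |-> x *m S with S skew-symmetric. *)
Definition motion n C (p y : T -> 'rV[R]_n) : Prop :=
  forall G, G \in C -> forall a b, a \in G -> b \in G ->
    dotp (y a) (p b) + dotp (y b) (p a) = 0.

Definition rigid n C (p : T -> 'rV[R]_n) : Prop :=
  forall y, motion C p y ->
  exists S : 'M[R]_n, S^T = - S /\ forall a, a \in vertices C -> y a = p a *m S.

(** The points of A span a hyperplane killed by S. For a further basis vector z, the row z S is
    orthogonal to that hyperplane by skewness and to z because a skew form is alternating. *)
Lemma skew_eq0 d A (p : T -> 'rV[R]_d.+1) (S : 'M[R]_d.+1) : #|` A| = d ->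
  indep A p -> S^T = - S -> (forall a, a \in A -> p a *m S = 0) -> S = 0.
Proof.
move=> cA iA sS h.
pose t : d.-tuple T := tcast cA (in_tuple A).
have tA : t = A :> seq T by rewrite /t val_tcast.
have [z zu] := row_free_ext (indep_row_free tA iA).
set M := \matrix_(i < d) _ in zu.
have MS : M *m S = 0.
  apply/row_matrixP => i; rewrite row_mul rowK row0 h //.
  by rewrite -[_ \in A]/(_ \in enum_fset A) -tA mem_tnth.
have zS : z *m S = 0.
  apply: (unit_dotp0 zu) => [i|]; last first.
    by move: (skew_dotp z z sS) => /eqP; rewrite -addr_eq0 -mulr2n mulrn_eq0 /= => /eqP.
  by rewrite skew_dotp // -row_mul MS row0 dotp0l oppr0.
by rewrite -[S](mulKmx zu) (mul_col_mx z M S) zS MS (col_mx0 _ 1 d) mulmx0.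
Qed.

(** A simplex has only trivial motions: S is defined on the basis formed by the points of A and one
    more vector z, and its symmetric part W vanishes on all pairs of basis vectors. *)
Lemma motion_skew d A (p y : T -> 'rV[R]_d.+1) : #|` A| = d -> indep A p ->
  (forall a b, a \in A -> b \in A -> dotp (y a) (p b) + dotp (y b) (p a) = 0) ->
  exists S : 'M[R]_d.+1, S^T = - S /\ forall a, a \in A -> y a = p a *m S.
Proof.
move=> cA iA my.
pose t : d.-tuple T := tcast cA (in_tuple A).
have tA : t = A :> seq T by rewrite /t val_tcast.
have tI i : tnth t i \in A by rewrite -[_ \in A]/(_ \in enum_fset A) -tA mem_tnth.
have [z zu] := row_free_ext (indep_row_free tA iA).
set M := \matrix_(i < d) _ in zu.
pose Y : 'M_(d, d.+1) := \matrix_(i < d) y (tnth t i).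
pose B : 'M_d.+1 := col_mx z M.
(* The image v of z is forced by skewness: orthogonal to z, and paired with each point as the
   opposite of that point's velocity with z. *)
have [v [vz vM]] := unit_dotp_ex zu 0 (fun i => - dotp (y (tnth t i)) z).
pose D : 'M_d.+1 := col_mx v Y.
pose S := invmx B *m D.
have BS : B *m S = D by rewrite /S mulKVmx.
have MS : M *m S = Y.
  by move: BS; rewrite /B /D (mul_col_mx z M S) => h; have [] := @eq_col_mx _ 1 d _ _ _ _ _ h.
have zS : z *m S = v.
  by move: BS; rewrite /B /D (mul_col_mx z M S) => h; have [] := @eq_col_mx _ 1 d _ _ _ _ _ h.
have pS i : p (tnth t i) *m S = y (tnth t i).
  by move: (congr1 (row i) MS); rewrite row_mul !rowK.
exists S; split; last first.
  move=> a; rewrite -[_ \in A]/(_ \in enum_fset A) -tA => /tnthP[i ->].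
  by rewrite pS.
pose W := S^T + S.
suff W0 : W = 0 by apply/eqP; rewrite -addr_eq0; exact/eqP.
have WB x : (forall i, dotp (x *m W) (p (tnth t i)) = 0) -> dotp (x *m W) z = 0 -> x *m W = 0.
  move=> h1 h2; apply: (unit_dotp0 zu) => // i; by rewrite rowK.
have dW x x' : dotp (x *m W) x' = dotp (x' *m S) x + dotp (x *m S) x'.
  by rewrite /W mulmxDr dotpDl (dotp_mulmx x) trmxK (dotpC x).
have vM' i : dotp v (p (tnth t i)) = - dotp (y (tnth t i)) z by rewrite -vM rowK.
have zW : z *m W = 0.
  apply: WB => [i|]; rewrite dW zS ?vz ?addr0 //.
  by rewrite pS vM' addrN.
have MW : M *m W = 0.
  apply/row_matrixP => i; rewrite row_mul rowK row0; apply: WB => [j|]; rewrite dW pS.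
    by rewrite pS; apply: my.
  by rewrite zS vM' addNr.
by rewrite -[W](mulKmx zu) (mul_col_mx z M W) zW MW (col_mx0 _ 1 d) mulmx0.
Qed.

Lemma motion_sub n C K (p y : T -> 'rV[R]_n) : K `<=` C -> motion C p y -> motion K p y.
Proof. by move=> /fsubsetP KC my G /KC; exact: my. Qed.

Lemma skew_motion n C (p : T -> 'rV[R]_n) S : S^T = - S -> motion C p (fun a => p a *m S).
Proof. by move=> sS G _ a b _ _; rewrite skew_dotp // addNr. Qed.

Lemma motionB n C (p y y' : T -> 'rV[R]_n) : motion C p y -> motion C p y' ->
  motion C p (fun a => y a - y' a).
Proof.
move=> m m' G GC a b aG bG; rewrite !dotpBl addrACA -opprD.
by rewrite (m G) // (m' G) // subr0.
Qed.

(** Subtracting the trivial motion that agrees with y on G turns rigidity into injectivity of a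
    linear system, a form that can be perturbed and counted. *)
Lemma rigid_pinned d C G (p : T -> 'rV[R]_d.+1) : G \in C -> #|` G| = d -> indep G p ->
  (forall y, motion C p y -> (forall a, a \in G -> y a = 0) ->
     forall a, a \in vertices C -> y a = 0) -> rigid C p.
Proof.
move=> GC cG iG h y my.
have [S [sS yS]] := motion_skew cG iG (my G GC).
exists S; split=> // a aC; apply/eqP; rewrite -subr_eq0; apply/eqP.
apply: (h (fun a => y a - p a *m S)) aC; first by apply: motionB => //; exact: skew_motion.
by move=> b bG; rewrite yS // subrr.
Qed.

Lemma pinned_rigid d C G (p y : T -> 'rV[R]_d.+1) : rigid C p -> G \in C -> #|` G| = d ->
  indep G p -> motion C p y -> (forall a, a \in G -> y a = 0) ->
  forall a, a \in vertices C -> y a = 0.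
Proof.
move=> rC GC cG iG my y0; have [S [sS yS]] := rC y my => a aC.
rewrite yS // (skew_eq0 cG iG sS) ?mulmx0 // => b bG.
by rewrite -yS ?y0 //; apply/mem_vertices; exists G.
Qed.

(** This is the gluing principle: rigid pieces that share a facet with independent points carry the
    same trivial motion. *)
Lemma skew_inj d A (p : T -> 'rV[R]_d.+1) (S S' : 'M[R]_d.+1) : #|` A| = d -> indep A p ->
  S^T = - S -> S'^T = - S' -> (forall a, a \in A -> p a *m S = p a *m S') -> S = S'.
Proof.
move=> cA iA sS sS' h; apply/eqP; rewrite -subr_eq0; apply/eqP.
apply: (skew_eq0 cA iA) => [|a aA]; first by rewrite linearB /= sS sS' opprB opprK addrC.
by rewrite mulmxBr h // subrr.
Qed.

End Rigidity.

(** * Linear systems along lines and generic placements *)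

Section LinearSystems.
Local Open Scope fset_scope.
Local Open Scope ring_scope.
Variables (R : realType) (T : choiceType).
Implicit Types (A B G H V : {fset T}) (C Z K : {fset {fset T}}).

(** With D a right inverse of A, the determinant of (A + tB)D is a polynomial in t with value 1 at t
    = 0. *)
Lemma line_row_free (m n : nat) (A B : 'M[R]_(m, n)) : row_free A ->
  exists g : {poly R}, g != 0 /\ forall t, g.[t] != 0 -> row_free (A + t *: B).
Proof.
move=> /row_freeP[D AD].
pose M := map_mx polyC (A *m D) + 'X *: map_mx polyC (B *m D).
have Mt t : map_mx (horner_eval t) M = (A + t *: B) *m D.
  rewrite mulmxDl -scalemxAl; apply/matrixP => i j.
  by rewrite !mxE /horner_eval hornerD hornerM hornerX !hornerC.
have dt t : (\det M).[t] = \det ((A + t *: B) *m D).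
  by rewrite -Mt det_map_mx.
exists (\det M); split.
  apply/eqP => M0; have := dt 0; rewrite M0 horner0 scale0r addr0 AD det1 => /eqP.
  by rewrite eq_sym oner_eq0.
move=> t; rewrite dt => dn.
have u : (A + t *: B) *m D \in unitmx by rewrite unitmxE unitfE.
by apply/row_freeP; exists (D *m invmx ((A + t *: B) *m D)); rewrite mulmxA mulmxV.
Qed.

Lemma inj_line (I J : finType) (a b : I -> J -> R) :
  (forall c : I -> R, (forall j, \sum_i c i * a i j = 0) -> forall i, c i = 0) ->
  exists g : {poly R}, g != 0 /\ forall t, g.[t] != 0 ->
   forall c : I -> R, (forall j, \sum_i c i * (a i j + t * b i j) = 0) -> forall i, c i = 0.
Proof.
move=> inj; pose A := \matrix_(i < #|I|, j < #|J|) a (enum_val i) (enum_val j).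
pose B := \matrix_(i < #|I|, j < #|J|) b (enum_val i) (enum_val j).
have rfA : row_free A.
  rewrite -kermx_eq0; apply/rowV0P => u /sub_kermxP uA.
  have h : forall i, u ord0 (enum_rank i) = 0.
    apply: inj => j; move/rowP: uA => /(_ (enum_rank j)); rewrite !mxE => uA.
    rewrite -[RHS]uA (reindex _ (onW_bij _ (@enum_val_bij I))) /=.
    by apply: eq_bigr => i _; rewrite !mxE enum_valK enum_rankK.
  by apply/rowP => i; rewrite mxE -(enum_valK i) h.
have [g [g0 h]] := line_row_free B rfA; exists g; split=> // t /h rf c hc i.
pose u : 'rV[R]_#|I| := \row_i c (enum_val i).
have u0 : u = 0.
  apply: (row_free_inj rf); rewrite mul0mx; apply/rowP => j.
  rewrite !mxE -[RHS](hc (enum_val j)).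
  rewrite [RHS](reindex _ (onW_bij _ (@enum_val_bij I))) /=.
  by apply: eq_bigr => k _; rewrite !mxE.
by move/rowP: u0 => /(_ (enum_rank i)); rewrite !mxE enum_rankK.
Qed.

Lemma sum_pick n V a (y : T -> 'rV[R]_n) x : a \in V ->
  \sum_(v <- V) dotp (y v) ((v == a)%:R *: x) = dotp (y a) x.
Proof.
move=> aV; rewrite (big_fsetD1 a) //= eqxx scale1r big1_seq ?addr0 // => v /=.
by rewrite !inE => /andP[/negbTE -> _]; rewrite scale0r dotp0r.
Qed.

Lemma sum_fset_pair n V (y z : T -> 'rV[R]_n) :
  \sum_(v <- V) dotp (y v) (z v) =
  \sum_(vi : V * 'I_n) y (val vi.1) ord0 vi.2 * z (val vi.1) ord0 vi.2.
Proof. by rewrite big_seq_fsetE /= pair_bigA. Qed.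

Definition extend_by0 n V (c : V * 'I_n -> R) (x : T) : 'rV[R]_n :=
  \row_i if insub x is Some v then c (v, i) else 0.

Lemma extend_by0E n V (c : V * 'I_n -> R) (v : V) i :
  extend_by0 c (val v) ord0 i = c (v, i).
Proof. by rewrite mxE valK. Qed.

Lemma sys_line n V (J : finType) (al be : J -> T -> 'rV[R]_n) :
  (forall y : T -> 'rV[R]_n, (forall j, \sum_(v <- V) dotp (y v) (al j v) = 0) ->
     forall v, v \in V -> y v = 0) ->
  exists g : {poly R}, g != 0 /\ forall t, g.[t] != 0 -> forall y : T -> 'rV[R]_n,
    (forall j, \sum_(v <- V) dotp (y v) (al j v + t *: be j v) = 0) ->
    forall v, v \in V -> y v = 0.
Proof.
move=> h.
have [|g [g0 hg]] := @inj_line (V * 'I_n)%type J (fun vi j => al j (val vi.1) ord0 vi.2)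
    (fun vi j => be j (val vi.1) ord0 vi.2).
  move=> c hc [v i]; rewrite -extend_by0E.
  rewrite (h (extend_by0 c)) ?mxE //; last exact: fsvalP.
  move=> j; rewrite sum_fset_pair -[RHS](hc j); apply: eq_bigr => -[w k] _ /=.
  by rewrite extend_by0E.
exists g; split=> // t /hg ht y hy v vV; apply/rowP => i; rewrite mxE.
apply: (ht (fun vi => y (val vi.1) ord0 vi.2) _ ([` vV], i)) => j.
by rewrite -[RHS](hy j) sum_fset_pair; apply: eq_bigr => -[w k] _ /=; rewrite !mxE.
Qed.

Lemma sys_count n V (J : finType) (al : J -> T -> 'rV[R]_n) : (#|J| < #|` V| * n)%N ->
  exists y : T -> 'rV[R]_n, (forall j, \sum_(v <- V) dotp (y v) (al j v) = 0) /\
    exists2 v, v \in V & y v != 0.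
Proof.
move=> lt; set I := (V * 'I_n)%type.
pose A := \matrix_(i < #|{: I}|, j < #|J|) al (enum_val j) (val (enum_val i).1) ord0 (enum_val i).2.
have : kermx A != 0.
  rewrite kermx_eq0 /row_free neq_ltn; apply/orP; left; apply: leq_ltn_trans (rank_leq_col _) _.
  by rewrite card_prod card_ord -cardfE.
move=> /rowV0Pn[u /sub_kermxP uA un].
pose c (i : I) := u ord0 (enum_rank i); exists (extend_by0 c); split.
  move=> j; move/rowP: uA => /(_ (enum_rank j)); rewrite !mxE => uA.
  rewrite -[RHS]uA sum_fset_pair [LHS](reindex _ (onW_bij _ (@enum_val_bij I))) /=.
  apply: eq_bigr => i _; rewrite !mxE enum_rankK /=.
  case E: (enum_val i) => [w k] /=; by rewrite valK /c -E enum_valK.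
apply: contrapT => H; case/eqP: un; apply/rowP => i; rewrite mxE.
case E: (enum_val i) => [w k].
have -> : u ord0 i = extend_by0 c (val w) ord0 k by rewrite extend_by0E /c -E enum_valK.
case: (eqVneq (extend_by0 c (val w)) 0) => [->|n0]; first by rewrite mxE.
by case: H; exists (val w) => //; exact: fsvalP.
Qed.

(* A substitute for Zariski openness. *)
Definition line_open n (U : (T -> 'rV[R]_n) -> Prop) : Prop :=
  forall p q, U p -> exists g : {poly R}, g != 0 /\
    forall t, g.[t] != 0 -> U (fun a => p a + t *: (q a - p a)).

Lemma poly_nonroot (g : {poly R}) : g != 0 -> exists t, g.[t] != 0.
Proof.
move=> g0; apply: contrapT => h.
have := max_poly_roots g0 (rs := [seq k%:R | k <- iota 0 (size g)]).
rewrite size_map size_iota ltnn; move=> H.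
have : false; last by [].
apply: H; last first.
  by rewrite map_inj_uniq ?iota_uniq // => i j /eqP; rewrite eqr_nat => /eqP.
apply/allP => t _; apply/negPn/negP => tn; by apply: h; exists t.
Qed.

Lemma line_openI n (U U' : (T -> 'rV[R]_n) -> Prop) :
  line_open U -> line_open U' -> line_open (fun p => U p /\ U' p).
Proof.
move=> o o' p q [Up U'p]; have [g [g0 h]] := o p q Up; have [g' [g'0 h']] := o' p q U'p.
exists (g * g'); split; first by rewrite mulf_neq0.
by move=> t; rewrite hornerM mulf_eq0 negb_or => /andP[/h ? /h' ?].
Qed.

Lemma line_open_all n (I : eqType) (s : seq I) (U : I -> (T -> 'rV[R]_n) -> Prop) :
  (forall i, i \in s -> line_open (U i)) -> line_open (fun p => forall i, i \in s -> U i p).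
Proof.
elim: s => [|i s IH] h.
  by move=> p q _; exists 1; split; rewrite ?oner_eq0.
move=> p q Up.
have hs j : j \in s -> line_open (U j) by move=> js; apply: h; rewrite inE js orbT.
have U2 : U i p /\ (forall j, j \in s -> U j p).
  by split=> [|j js]; apply: Up; rewrite inE ?eqxx ?js ?orbT.
have [g [g0 hg]] := line_openI (h i (mem_head _ _)) (IH hs) q U2.
exists g; split=> // t /hg[h1 h2] j; rewrite inE => /predU1P[->|] //; exact: h2.
Qed.

(* For instance the configurations with some points in a fixed hyperplane. *)
Definition line_closed n (L : (T -> 'rV[R]_n) -> Prop) : Prop :=
  forall p q t, L p -> L q -> L (fun a => p a + t *: (q a - p a)).

(** On the line joining a point of U to a point of U', the first condition holds off the roots of g
    in t and the second off the roots of g' in 1 - t. A product of two nonzero polynomials has a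
    nonroot. *)
Lemma line_open_meet n (L U U' : (T -> 'rV[R]_n) -> Prop) : line_closed L ->
  line_open U -> line_open U' -> (exists2 p, L p & U p) -> (exists2 p, L p & U' p) ->
  exists p, [/\ L p, U p & U' p].
Proof.
move=> cL o o' [p Lp Up] [q Lq U'q].
have [g [g0 h]] := o p q Up; have [g' [g'0 h']] := o' q p U'q.
pose f : {poly R} := 1 - 'X.
(* Substituting 1 - X is an involution, so it keeps g' nonzero. *)
have nz : g * (g' \Po f) != 0.
  rewrite mulf_neq0 //; apply/eqP => /(congr1 (fun k : {poly R} => k \Po f)).
  have -> : (g' \Po f) \Po f = g'.
    by rewrite -comp_polyA /f comp_polyB comp_polyC comp_polyX opprB addrC subrK comp_polyXr.
  by rewrite comp_poly0; apply/eqP.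
have [t] := poly_nonroot nz; rewrite hornerM mulf_eq0 negb_or horner_comp /f !hornerE => /andP[gt g't].
exists (fun a => p a + t *: (q a - p a)); split; [exact: cL | exact: h |].
suff -> : (fun a => p a + t *: (q a - p a)) = (fun a => q a + (1 - t) *: (p a - q a)).
  exact: h'.
apply: funext => a; rewrite !scalerBr !scalerBl !scale1r.
by apply/rowP => i; rewrite !mxE; ring.
Qed.

Lemma line_open_meet_all n (I : eqType) (s : seq I) (L : (T -> 'rV[R]_n) -> Prop)
    (U : I -> (T -> 'rV[R]_n) -> Prop) : line_closed L -> (exists p, L p) ->
  (forall i, i \in s -> line_open (U i)) ->
  (forall i, i \in s -> exists2 p, L p & U i p) ->
  exists2 p, L p & forall i, i \in s -> U i p.
Proof.
move=> cL exL; elim: s => [|i s IH] o e; first by case: exL => p Lp; exists p.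
have os j : j \in s -> line_open (U j) by move=> js; apply: o; rewrite inE js orbT.
have [p [Lp Up Up']] := line_open_meet cL (o i (mem_head _ _)) (line_open_all os)
   (e i (mem_head _ _)) (IH os (fun j js => e j (mem_behead (s := i :: s) js))).
by exists p => // j; rewrite inE => /predU1P[->|] //; exact: Up'.
Qed.

Lemma line_open_indep n A : line_open (@indep R T n A).
Proof.
move=> p q iA.
have [|g [g0 hg]] := @inj_line A 'I_n (fun a j => p (val a) ord0 j)
   (fun a j => (q (val a) - p (val a)) ord0 j).
  move=> c hc a; pose c' x := if insub x is Some v then c v else 0.
  have -> : c a = c' (val a) by rewrite /c' valK.
  apply: iA (fsvalP a); rewrite big_seq_fsetE /=; apply/rowP => j; rewrite summxE mxE.
  by rewrite -[RHS](hc j); apply: eq_bigr => v _; rewrite mxE /c' valK.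
exists g; split=> // t /hg ht c hc a aA.
apply: (ht (fun a => c (val a)) _ [` aA]) => j.
move/rowP: hc => /(_ j); rewrite big_seq_fsetE summxE mxE /= => hc; rewrite -[RHS]hc.
by apply: eq_bigr => v _; rewrite !mxE.
Qed.

Definition adjacent C a b : bool := has (fun G => (a \in G) && (b \in G)) C.

Lemma adjacentP C a b :
  reflect (exists G, [/\ G \in C, a \in G & b \in G]) (adjacent C a b).
Proof.
apply: (iffP hasP) => [[G GC /andP[aG bG]]|[G [GC aG bG]]]; first by exists G.
by exists G; rewrite ?aG.
Qed.

(** All equations of a motion that vanishes on G, as one system over a fixed index type: nonadjacent
    pairs and unpinned vertices give the zero equation. *)
Definition motion_eq n C G (p : T -> 'rV[R]_n) V (j : (V * V) + (V * 'I_n)) v : 'rV[R]_n :=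
  match j with
  | inl (a, b) => (adjacent C (val a) (val b))%:R *:
                  ((v == val a)%:R *: p (val b) + (v == val b)%:R *: p (val a))
  | inr (a, i) => (val a \in G)%:R *: ((v == val a)%:R *: delta_mx ord0 i)
  end.

Lemma motion_eqP n C G (p y : T -> 'rV[R]_n) V : vertices C `<=` V -> G `<=` V ->
  (forall j, \sum_(v <- V) dotp (y v) (@motion_eq n C G p V j v) = 0) <->
  (motion C p y /\ forall a, a \in G -> y a = 0).
Proof.
move=> sC sG.
have El (a b : V) : \sum_(v <- V) dotp (y v) (@motion_eq n C G p V (inl (a, b)) v) =
   (adjacent C (val a) (val b))%:R *
     (dotp (y (val a)) (p (val b)) + dotp (y (val b)) (p (val a))).
  rewrite /=; under eq_bigr do rewrite dotpZr dotpDr.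
  by rewrite -mulr_sumr big_split /= !sum_pick ?fsvalP.
have Er (a : V) i : \sum_(v <- V) dotp (y v) (@motion_eq n C G p V (inr (a, i)) v) =
   (val a \in G)%:R * y (val a) ord0 i.
  rewrite /=; under eq_bigr do rewrite dotpZr.
  by rewrite -mulr_sumr sum_pick ?fsvalP // dotp_delta.
split=> [h|[my y0] [[a b]|[a i]]].
- split=> [F FC a b aF bF|a aG].
    have aV : a \in V by apply: (fsubsetP sC); apply/mem_vertices; exists F.
    have bV : b \in V by apply: (fsubsetP sC); apply/mem_vertices; exists F.
    have := h (inl ([` aV], [` bV])); rewrite El /=.
    have -> : adjacent C a b by apply/adjacentP; exists F.
    by rewrite mul1r.
  apply/rowP => i; rewrite mxE; have := h (inr ([` (fsubsetP sG _ aG)], i)).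
  by rewrite Er /= aG mul1r.
- rewrite El; case: adjacentP => [[F [FC aF bF]]|]; rewrite ?mul0r // mul1r.
  exact: my FC _ _ aF bF.
- by rewrite Er; case: (boolP (val a \in G)) => [/y0->|]; rewrite ?mul0r // mxE mulr0.
Qed.

Lemma line_open_rigid d C G : G \in C -> #|` G| = d ->
  line_open (fun p : T -> 'rV[R]_d.+1 => indep G p /\ rigid C p).
Proof.
move=> GC cG p q [iG rC].
have sG := sub_vertices GC; set V := vertices C in sG.
have sC : vertices C `<=` V by [].
(* The perturbation has an empty pinned set because the pinning equations do not depend on the
   placement. *)
have [|g [g0 hg]] := @sys_line d.+1 V _ (@motion_eq _ C G p V)
    (@motion_eq _ C fset0 (fun a => q a - p a) V).
  by move=> y hy v vV; have [m y0] := (motion_eqP p y sC sG).1 hy; exact: (pinned_rigid rC GC cG iG m y0 vV).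
have [g' [g'0 hg']] := line_open_indep q iG.
exists (g * g'); split; first by rewrite mulf_neq0.
move=> t; rewrite hornerM mulf_eq0 negb_or => /andP[gt g't]; split; first exact: hg'.
apply: (rigid_pinned GC cG (hg' t g't)) => y my y0 a aC; apply: (hg t gt y) aC => j.
have := (motion_eqP _ y sC sG).2 (conj my y0) j; move=> h; rewrite -[RHS]h.
apply: eq_bigr => v _; congr dotp; case: j {h} => -[b c] /=; last first.
  by rewrite scale0r scaler0 addr0.
by rewrite !scalerDr !scalerA; apply/rowP => i; rewrite !mxE; ring.
Qed.

End LinearSystems.

(** * Generic rigidity of minimal cycles *)

Section Contraction.
Local Open Scope fset_scope.
Variables (T : choiceType) (d : nat) (u v : T).
Hypothesis uv : u != v.
Implicit Types (A B G H r s t W : {fset T}) (C Z K : {fset {fset T}}).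

Definition avoids C : Prop := forall G, G \in C -> ~~ ((u \in G) && (v \in G)).

(* K becomes a cycle once the edge {u, v} is contracted. *)
Definition relcycle K : Prop :=
  (forall r, #|` r| = d.+1 -> u \notin r -> v \notin r -> ~~ par K r) /\
  (forall t, #|` t| = d -> u \notin t -> v \notin t -> par K (u |` t) = par K (v |` t)).

Definition contract G := if u \in G then v |` (G `\ u) else G.

Definition outside C := [fset G in C | ~~ ((u \in G) && (v \in G))].

(** The facets through u and v that close K up: each odd ridge of K through u is joined with v. They
    need not belong to the complex from which K is taken. *)
Definition filling K : {fset {fset T}} :=
  [fset v |` r | r in [fset r in \bigcup_(G <- K) fpowerset G |
     [&& u \in r, #|` r| == d.+1 & par K r]]].

Definition completion K := K `|` filling K.

Lemma in_outside C G : (G \in outside C) = (G \in C) && ~~ ((u \in G) && (v \in G)).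
Proof. by rewrite !inE. Qed.

Lemma outside_sub C : outside C `<=` C.
Proof. by apply/fsubsetP => G; rewrite in_outside => /andP[]. Qed.

Lemma outside_avoids C : avoids (outside C).
Proof. by move=> G; rewrite in_outside => /andP[]. Qed.

Lemma avoidsS C K : K `<=` C -> avoids C -> avoids K.
Proof. by move=> /fsubsetP KC a G /KC; exact: a. Qed.

Lemma relcycle0 : relcycle fset0.
Proof. by split=> *; rewrite !par_fset0. Qed.

Lemma relcycle_symd K Z : relcycle K -> relcycle Z -> relcycle (symd K Z).
Proof.
move=> [a b] [a' b']; split=> r cr ur vr; rewrite !par_symd.
  by rewrite (negbTE (a _ _ _ _)) // (negbTE (a' _ _ _ _)).
by rewrite b // b'.
Qed.

Lemma in_filling K H : avoids K ->
  (H \in filling K) = [&& u \in H, v \in H, #|` H| == d.+2 & par K (H `\ v)].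
Proof.
move=> aK; apply/imfsetP/and4P => [[r /=]|[uH vH /eqP cH pH]].
  rewrite !inE => /andP[/bigfcupP[G]]; rewrite andbT fpowersetE => GK rG.
  move=> /and3P[ur /eqP cr pr] ->.
  have vr : v \notin r.
    by apply: contra (aK G GK) => /(fsubsetP rG) ->; rewrite (fsubsetP rG _ ur).
  by split; rewrite ?cardfsU1 ?vr ?cr ?fsetU1K // !inE ?ur ?eqxx ?orbT.
exists (H `\ v) => /=; last by rewrite fsetD1K.
rewrite !inE uv uH pH /= andbT; have [G GK HG] := par_ex pH.
have := cardfsD1 v H; rewrite vH cH add1n => -[<-]; rewrite eqxx andbT.
by apply/bigfcupP; exists G; rewrite ?GK // fpowersetE.
Qed.

Lemma completion_sub C K : pure d.+2 C -> K `<=` C -> avoids K -> pure d.+2 (completion K).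
Proof.
move=> pC KC aK H; rewrite inE => /orP[/(fsubsetP KC)/pC //|].
by rewrite in_filling // => /and4P[_ _ /eqP].
Qed.

Lemma par_completion K r : avoids K -> par (completion K) r = par K r (+) par (filling K) r.
Proof.
move=> aK; apply: par_disjU; apply/fdisjointP => G /aK; rewrite in_filling //.
by apply: contra => /and4P[-> ->].
Qed.

Lemma par_filling1 K r H : avoids K -> #|` H| = d.+2 -> u \in H -> v \in H ->
  (forall H', H' \in filling K -> r `<=` H' -> H' = H) -> r `<=` H ->
  par (filling K) r = par K (H `\ v).
Proof.
move=> aK cH uH vH h rH; case: (boolP (H \in filling K)) => HF; last first.
  have -> : par K (H `\ v) = false.
    by apply: contraNF HF => pH; rewrite in_filling // uH vH cH eqxx pH.
  apply: par_none => H' H'F; apply: contra HF => /(h _ H'F) <-; exact: H'F.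
have -> : par K (H `\ v) by move: HF; rewrite in_filling // => /and4P[].
rewrite par_card; have -> : star (filling K) r = [fset H].
  apply/fsetP => H'; rewrite in_star !inE; apply/andP/eqP => [[]|->]; first exact: h.
  by [].
by rewrite cardfs1.
Qed.

Lemma completion_cycle K : pure d.+2 K -> avoids K -> relcycle K ->
  forall r, #|` r| = d.+1 -> ~~ par (completion K) r.
Proof.
move=> pK aK [R1 R2] r cr; rewrite par_completion //.
case: (boolP (u \in r)) => ur; case: (boolP (v \in r)) => vr.
(* No facet of K contains both u and v. The filling facets over r correspond to the vertices x for
   which x together with [r \ v] is an odd ridge of K; their number is even because the boundary of
   a boundary vanishes. *)
- have -> : par K r = false.
    apply: par_none => G /aK; apply: contra => /fsubsetP rG; by rewrite !rG.
  rewrite addFb par_card.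
  pose t := r `\ v; have ct : #|` t| = d.
    by have := cardfsD1 v r; rewrite vr cr add1n => -[].
  pose W := r `|` vertices K.
  have : \big[addb/false]_(x <- W `\` t) par K (x |` t) = false.
    apply: (par_double pK ct) => G GK; apply: fsubset_trans (sub_vertices GK) _.
    exact: fsubsetUr.
  rewrite big_addb_fset => /negbT.
  set X := [fset x in _ | _]; have -> : star (filling K) r = [fset x |` r | x in X].
    apply/fsetP => H; rewrite in_star in_filling //.
    apply/andP/imfsetP => [[/and4P[uH vH /eqP cH pH] rH]|[x /=]].
      have : #|` H `\` r| == 1 by rewrite cardfsDS // cH cr subSn // subnn.
      case/cardfs1P => x Hr; have : x \in H `\` r by rewrite Hr inE.
      rewrite inE => /andP[xr xH].
      have eH : H = x |` r.
        rewrite -Hr; apply/fsetP => y; rewrite !inE; have := fsubsetP rH y.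
        by case: (y \in r); case: (y \in H) => //= /(_ isT).
      have xv : v != x by apply: contraNneq xr => <-.
      have et : H `\ v = x |` t.
        rewrite eH /t; apply/fsetP => y; rewrite !inE.
        by case: (eqVneq y x) => //= ->; rewrite eq_sym xv.
      exists x => //=; rewrite !inE -et pH andbT (negbTE xr) andbF /=.
      have [G GK HG] := par_ex pH; apply/mem_vertices; exists G => //.
      by apply: (fsubsetP HG); rewrite !inE eq_sym xv xH.
    rewrite !inE => /andP[/andP[xt xW] px] ->.
    have xv : x != v.
      apply: contraTneq px => ->; rewrite /t fsetD1K //.
      apply/negP => /par_ex[G /aK /negP h /fsubsetP rG]; apply: h; by rewrite !rG.
    have xr : x \notin r by move: xt; rewrite xv.
    split; last exact: fsubsetUr.
    rewrite !inE ur vr !orbT cardfsU1 xr cr /= add1n eqxx /=.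
    have -> // : (x |` r) `\ v = x |` t.
    by apply/fsetP => y; rewrite !inE; case: (eqVneq y x) => [->|_] //=; rewrite xv.
  suff -> : #|` [fset x |` r | x in X]| = #|` X| by [].
  apply: card_in_imfset => x y; rewrite !inE => /andP[/andP[xt _] px] /andP[/andP[yt _] py].
  have h z : z \notin t -> par K (z |` t) -> z \notin r.
    move=> zt pz; have zv : z != v.
      apply: contraTneq pz => ->; rewrite /t fsetD1K //.
      apply/negP => /par_ex[G /aK /negP h /fsubsetP rG]; apply: h; by rewrite !rG.
    by move: zt; rewrite /t !inE zv.
  have xr : x \notin r by apply: h px; rewrite /t !inE.
  move=> /fsetP /(_ x); rewrite !inE eqxx (negbTE xr) !orbF => /esym /eqP.
  exact.
(* Only v together with r can be a filling facet over r, and it is one exactly when r is odd in K,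
   so the two contributions cancel. *)
- rewrite (par_filling1 (H := v |` r)) //.
  + by rewrite fsetU1K // addbb.
  + by rewrite cardfsU1 vr cr.
  + by rewrite !inE ur orbT.
  + by rewrite !inE eqxx.
  + move=> H'; rewrite in_filling // => /and4P[_ vH /eqP cH _] rH.
    apply/esym/eqP; rewrite eqEfcard fsubUset fsub1set vH rH cH cardfsU1 vr cr.
    by rewrite /= add1n leqnn.
  + exact: fsubsetUr.
(* Whether u together with r is a filling facet is decided by a ridge through u; the second clause
   of [relcycle] transfers its parity to r. *)
- rewrite (par_filling1 (H := u |` r)) //.
  + have -> : (u |` r) `\ v = u |` (r `\ v).
      by apply/fsetP => y; rewrite !inE; case: (eqVneq y u) => //= ->; rewrite uv.
    rewrite R2 ?inE ?(negbTE ur) ?andbF ?eqxx //.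
      by rewrite fsetD1K // addbb.
    by have := cardfsD1 v r; rewrite vr cr add1n => -[].
  + by rewrite cardfsU1 ur cr.
  + by rewrite !inE eqxx.
  + by rewrite !inE vr orbT.
  + move=> H'; rewrite in_filling // => /and4P[uH _ /eqP cH _] rH.
    apply/esym/eqP; rewrite eqEfcard fsubUset fsub1set uH rH cH cardfsU1 ur cr.
    by rewrite /= add1n leqnn.
  + exact: fsubsetUr.
- rewrite (negbTE (R1 r cr ur vr)) par_none //.
  move=> H; rewrite in_filling // => /and4P[uH vH /eqP cH _]; apply/negP => rH.
  have : u |` (v |` r) `<=` H by rewrite !fsubUset !fsub1set uH vH.
  by move/fsubset_leq_card; rewrite cH !cardfsU1 !inE (negbTE uv) (negbTE ur) (negbTE vr) cr /= !add1n ltnn.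
Qed.

Lemma par_outside C r : par (outside C) r = par C r (+) par (star C [fset u; v]) r.
Proof.
rewrite -par_symd; congr (par _ r); apply/fsetP => G.
rewrite in_symd in_outside in_star fsubUset !fsub1set.
by case: (G \in C); case: (u \in G); case: (v \in G).
Qed.

Lemma outside_relcycle C : pure d.+2 C -> (forall r, #|` r| = d.+1 -> ~~ par C r) ->
  relcycle (outside C).
Proof.
move=> pC cC; split=> [r cr ur vr|t ct ut vt]; rewrite !par_outside.
  rewrite (negbTE (cC r cr)) par_none // => H; rewrite in_star fsubUset !fsub1set.
  move=> /and3P[HC uH vH]; apply/negP => rH.
  have : u |` (v |` r) `<=` H by rewrite !fsubUset !fsub1set uH vH.
  move/fsubset_leq_card; rewrite (pC _ HC) !cardfsU1 !inE (negbTE uv) (negbTE ur) (negbTE vr) cr.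
  by rewrite /= !add1n ltnn.
rewrite !(negbTE (cC _ _)) ?cardfsU1 ?ut ?vt ?ct //=.
apply: eq_big_seq => H; rewrite in_star !fsubUset !fsub1set => /and3P[_ -> ->] //.
Qed.

(** Since r is even in C, leaving out the facets through both u and v changes its parity by the one
    candidate made of v and r. Filling the outside therefore recovers exactly the facets left
    out. *)
Lemma par_outside_filling C r : pure d.+2 C -> (forall r, #|` r| = d.+1 -> ~~ par C r) ->
  #|` r| = d.+1 -> u \in r -> v \notin r -> par (outside C) r = (v |` r \in C).
Proof.
move=> pC cC cr ur vr; rewrite par_outside (negbTE (cC r cr)) addFb.
have e H : H \in star C [fset u; v] -> r `<=` H -> H = v |` r.
  rewrite in_star fsubUset !fsub1set => /and3P[HC uH vH] rH.
  by apply/esym/eqP; rewrite eqEfcard fsubUset fsub1set vH rH (pC _ HC) cardfsU1 vr cr /= add1n leqnn.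
case: (boolP (v |` r \in C)) => h.
  rewrite par_card; have -> : star (star C [fset u; v]) r = [fset v |` r].
    apply/fsetP => H; rewrite in_star inE; apply/andP/eqP => [[]|->]; first exact: e.
    by rewrite in_star fsubUset !fsub1set h !inE ur eqxx orbT fsubsetUr.
  by rewrite cardfs1.
apply: par_none => H HS; apply: contra h => /(e _ HS) <-.
exact: (fsubsetP (star_sub _ _) _ HS).
Qed.

Lemma par_contract K r : avoids K -> {in K &, injective contract} -> u \notin r ->
  par [fset contract G | G in K] r =
  if v \in r then par K (u |` (r `\ v)) (+) par K r else par K r.
Proof.
move=> aK iK ur; rewrite /par big_imfset //= -big_split /=.
have [vr|vr] := boolP (v \in r).
  apply: eq_big_seq => G /aK; rewrite /contract.
  case: (boolP (u \in G)) => uG /= vG.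
    have -> : (r `<=` G) = false.
      by apply/negbTE; apply: contra vG => /fsubsetP /(_ _ vr).
    rewrite addbF fsubUset fsub1set uG /= -fsubDset.
    by rewrite fsubsetD1 !inE (negbTE ur) andbF andbT.
  by rewrite fsubUset fsub1set (negbTE uG).
apply: eq_big_seq => G /aK; rewrite /contract.
case: (boolP (u \in G)) => uG //= vG.
apply/idP/idP => /fsubsetP h; apply/fsubsetP => y yr; have := h y yr; rewrite !inE.
  by case: eqP yr => [->|_ _ /andP[]] //; rewrite (negbTE vr).
by move=> ->; rewrite andbT; apply/orP; right; apply: contraNneq ur => <-.
Qed.

Definition minrel K : Prop :=
  [/\ K != fset0, relcycle K & forall Z, Z `<=` K -> relcycle Z -> Z = fset0 \/ Z = K].

Lemma minrel_ex Z : Z != fset0 -> relcycle Z -> exists2 K, K `<=` Z & minrel K.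
Proof.
elim: {Z}#|` Z| {-2}Z (leqnn #|` Z|) => [|n IH] Z cZ Z0 rZ.
  by move: cZ; rewrite leqn0 cardfs_eq0 (negbTE Z0).
case: (pselect (minrel Z)) => [m|nm]; first by exists Z.
have [K [KZ rK K0 KnZ]] : exists K, [/\ K `<=` Z, relcycle K, K != fset0 & K != Z].
  apply: contrapT => h; apply: nm; split=> // K KZ rK.
  case: (eqVneq K fset0) => K0; first by left.
  case: (eqVneq K Z) => KnZ; first by right.
  by case: h; exists K.
have KpZ : K `<` Z by rewrite fproperEneq KnZ.
have [|//|//|K' KK' m] := IH K; first by rewrite -ltnS; apply: leq_trans (fproper_ltn_card KpZ) cZ.
by exists K' => //; exact: fsubset_trans KK' KZ.
Qed.

(** Z is a disjoint union of minimal relative cycles, removed one at a time. A set crossed by no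
    minimal relative cycle is the union of the pieces it contains, so each of its odd ridges is odd
    in one of them. *)
Lemma relcycle_saturated Z S : relcycle Z -> S `<=` Z ->
  (forall K, K `<=` Z -> minrel K -> K `<=` S \/ [disjoint K & S]) ->
  relcycle S /\ forall r, par S r -> exists K, [/\ K `<=` S, minrel K & par K r].
Proof.
elim: {Z}#|` Z| {-2}Z (leqnn #|` Z|) S => [|n IH] Z cZ S rZ SZ h.
  move: cZ; rewrite leqn0 cardfs_eq0 => /eqP Z0; move: SZ; rewrite Z0 fsubset0 => /eqP ->.
  by split=> [|r]; [exact: relcycle0 | rewrite par_fset0].
case: (eqVneq Z fset0) => [Z0|Z0].
  move: SZ; rewrite Z0 fsubset0 => /eqP ->.
  by split=> [|r]; [exact: relcycle0 | rewrite par_fset0].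
have [K KZ mK] := minrel_ex Z0 rZ; have [K0 rK _] := mK.
have e : symd Z K = Z `\` K.
  by rewrite /symd; move: KZ; rewrite -fsetD_eq0 => /eqP ->; rewrite fsetU0.
have rZ' : relcycle (Z `\` K) by rewrite -e; exact: relcycle_symd.
have cZ' : #|` Z `\` K| <= n.
  rewrite cardfsDS // leq_subLR; apply: leq_trans cZ _.
  by rewrite -add1n leq_add2r cardfs_gt0.
have [|K' K'Z mK'|rS' pS'] := IH _ cZ' (S `\` K) rZ'; first exact: fsetSD.
  have K'Z2 : K' `<=` Z by apply: fsubset_trans K'Z _; exact: fsubsetDl.
  case: (h K' K'Z2 mK') => [K'S|K'S].
    left; apply/fsubsetP => G GK'; rewrite inE (fsubsetP K'S) // andbT.
    by move: (fsubsetP K'Z _ GK'); rewrite inE => /andP[].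
  by right; apply/fdisjointP => G /(fdisjointP K'S) GS; rewrite inE (negbTE GS) andbF.
case: (h K KZ mK) => [KS|KS].
  have e' : symd (S `\` K) K = S.
    apply/fsetP => G; rewrite in_symd !inE; have := fsubsetP KS G.
    by case: (G \in K) => /=; [move=> -> | rewrite addbF].
  split=> [|r]; first by rewrite -e'; exact: relcycle_symd.
  rewrite -{1}e' par_symd; case: (boolP (par K r)) => pK.
    by move=> _; exists K.
  rewrite addbF => /pS'[K' [K'S mK' pK']]; exists K'; split=> //.
  by apply: fsubset_trans K'S _; exact: fsubsetDl.
have e' : S `\` K = S.
  apply/fsetP => G; rewrite inE; case: (boolP (G \in S)) => GS; rewrite ?andbF // andbT.
  by apply/negP => /(fdisjointP KS); rewrite GS.
by rewrite e' in rS' pS'.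
Qed.

End Contraction.

(** * Rigidity of the pieces of a contraction and of the whole cycle *)

Section Fogelsanger.
Local Open Scope fset_scope.
Local Open Scope ring_scope.
Variables (R : realType) (T : choiceType).
Implicit Types (A B G H V : {fset T}) (C Z K : {fset {fset T}}).

Lemma indep_ex n A : (#|` A| <= n)%N ->
  indep A (fun a => \row_(j < n) ((j : nat) == index a A)%:R : 'rV[R]_n).
Proof.
move=> cA c hc a aA; have ia : (index a A < n)%N by apply: leq_trans cA; rewrite index_mem.
move/rowP: hc => /(_ (Ordinal ia)); rewrite summxE mxE (big_fsetD1 a) //= !mxE eqxx mulr1.
rewrite big1_seq ?addr0 // => b /=; rewrite !inE => /andP[ba bA]; rewrite !mxE.
case: eqP => /= e; rewrite ?mulr0 //; case/eqP: ba.
by rewrite -(nth_index a bA) -e nth_index.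
Qed.

Lemma indepS n A B (p : T -> 'rV[R]_n) : B `<=` A -> indep A p -> indep B p.
Proof.
move=> BA iA c hc b bB.
have := iA (fun a => if a \in B then c a else 0); move/(_ _ b (fsubsetP BA b bB)).
rewrite bB; apply; rewrite -[RHS]hc -(big_fset_incl _ BA) /=; last first.
  by move=> x _ xB; rewrite (negbTE xB) scale0r.
by apply: eq_big_seq => x xB; rewrite ifT.
Qed.

Lemma eq_indep n A (p q : T -> 'rV[R]_n) : {in A, p =1 q} -> indep A p -> indep A q.
Proof.
move=> pq iA c hc; apply: iA; rewrite -[RHS]hc; apply: eq_big_seq => a aA.
by rewrite pq.
Qed.

Lemma indep_dotp0 n A (p : T -> 'rV[R]_n) w : #|` A| = n -> indep A p ->
  (forall a, a \in A -> dotp w (p a) = 0) -> w = 0.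
Proof.
move=> cA iA h; pose t : n.-tuple T := tcast cA (in_tuple A).
have tA : t = A :> seq T by rewrite /t val_tcast.
have := indep_row_free tA iA; set M := \matrix_(i < n) _ => rf.
have Mu : M \in unitmx by rewrite -row_free_unit.
apply: trmx_inj; rewrite trmx0 -[w^T](mulKmx Mu); suff -> : M *m w^T = 0 by rewrite mulmx0.
apply/matrixP => i j; rewrite ord1 !mxE -[RHS](h (tnth t i)).
  by rewrite dotpC; apply: eq_bigr => k _; rewrite !mxE.
by rewrite -[_ \in A]/(_ \in enum_fset A) -tA mem_tnth.
Qed.

Lemma indep_normal d A (p : T -> 'rV[R]_d.+1) : #|` A| = d -> indep A p ->
  exists z, forall w, (forall a, a \in A -> dotp w (p a) = 0) -> dotp w z = 0 -> w = 0.
Proof.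
move=> cA iA; pose t : d.-tuple T := tcast cA (in_tuple A).
have tA : t = A :> seq T by rewrite /t val_tcast.
have [z zu] := row_free_ext (indep_row_free tA iA); exists z => w h hz.
apply: (unit_dotp0 zu) => // i; rewrite rowK; apply: h.
by rewrite -[_ \in A]/(_ \in enum_fset A) -tA mem_tnth.
Qed.

Definition grigid d C (p : T -> 'rV[R]_d.+1) : Prop :=
  exists2 G, G \in C & indep G p /\ rigid C p.

Lemma line_open_grigid d C : pure d C -> line_open (@grigid d C).
Proof.
move=> pC p q [G GC h]; have [g [g0 hg]] := line_open_rigid GC (pC G GC) q h.
by exists g; split=> // t /hg; exists G.
Qed.

Lemma line_closedT n : line_closed (fun _ : T -> 'rV[R]_n => True).
Proof. by []. Qed.

(** Removing v from a filling facet leaves an odd ridge of K by definition, removing u leaves one by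
    the symmetry in [relcycle]. So every pair in the facet except u, v is an edge of K. *)
Lemma filling_facets d u v K H : u != v -> avoids u v K -> relcycle d u v K -> H \in filling d u v K ->
  [/\ u \in H, v \in H, #|` H| = d.+2, (exists2 G, G \in K & H `\ v `<=` G)
    & exists2 G, G \in K & H `\ u `<=` G].
Proof.
move=> uv aK rK; rewrite in_filling // => /and4P[uH vH /eqP cH pH]; split=> //; first exact: par_ex.
apply: par_ex; have e x : x \in [fset u; v] -> H `\ x = (if x == u then v else u) |` (H `\ u `\ v).
  rewrite !inE => xuv; apply/fsetP => y; rewrite !inE.
  case: (eqVneq x u) xuv => [->|xu] /= xuv.
    by case: (eqVneq y v) => [->|]; rewrite ?vH ?andbT ?(eq_sym v) ?uv.
  move/eqP: xuv => ->; by case: (eqVneq y u) => [->|] //=; rewrite uH uv.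
have cHuv : #|` H `\ u `\ v| = d.
  have := cardfsD1 u H; rewrite uH cH add1n => -[e1].
  by have := cardfsD1 v (H `\ u); rewrite !inE vH eq_sym uv -e1 add1n => -[].
rewrite e ?inE ?eqxx // -rK.2 ?inE ?eqxx ?andbF //; move: pH.
by rewrite e ?inE ?eqxx ?orbT // (eq_sym v) (negbTE uv).
Qed.

Section Piece.
Variables (d : nat) (u v : T) (C K : {fset {fset T}}).
Hypotheses (uv : u != v) (d0 : (0 < d)%N) (mC : mincycle d.+2 C).
Hypotheses (euv : adjacent C u v) (KC : K `<=` outside u v C) (mK : minrel d u v K).

Let aK : avoids u v K. Proof. exact: avoidsS KC (@outside_avoids _ u v C). Qed.
Let KC' : K `<=` C. Proof. exact: fsubset_trans KC (outside_sub _ _ _). Qed.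
Let pK : pure d.+2 K. Proof. by case: mC => _ pC _ _; exact: pureS KC' pC. Qed.
Let rK : relcycle d u v K. Proof. by case: mK. Qed.
Let cpl := completion d u v K.

(** Otherwise K would itself be a cycle inside the minimal cycle C, hence all of C; but C has a
    facet through both u and v. *)
Lemma filling_ex : exists H, H \in filling d u v K.
Proof.
apply: contrapT => h; case: (mC) => _ pC _ m.
have e : cpl = K.
  apply/fsetP => H; rewrite inE; case: (boolP (H \in filling d u v K)) => [HF|]; last by rewrite orbF.
  by case: h; exists H.
have [|K0|KeC] := m K KC'.
- by move=> r cr; rewrite -e; exact: completion_cycle cr.
- by case: mK => /eqP; rewrite K0.
- case/adjacentP: euv => G [GC uG vG]; move: (aK (G := G)).
  by rewrite KeC GC uG vG => /(_ isT).
Qed.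

Lemma fillingP H : H \in filling d u v K ->
  [/\ u \in H, v \in H, #|` H| = d.+2, (exists2 G, G \in K & H `\ v `<=` G)
    & exists2 G, G \in K & H `\ u `<=` G].
Proof. exact: filling_facets. Qed.

(** Completing K creates no edge outside C: the pair u, v is an edge of C by assumption, and any
    other pair of a filling facet lies in a facet of K. *)
Lemma cpl_motion p (y : T -> 'rV[R]_d.+3) : motion C p y -> motion cpl p y.
Proof.
move=> my H; rewrite inE => /orP[/(fsubsetP KC')|HF]; first exact: my.
have [uH vH cH [G GK HG] [G' G'K HG']] := fillingP HF.
case/adjacentP: euv => E [EC uE vE] a b aH bH.
have GC := fsubsetP KC' _ GK; have G'C := fsubsetP KC' _ G'K.
have HvG x : x \in H -> x != v -> x \in G by move=> xH xv; apply: (fsubsetP HG); rewrite !inE xv.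
have HuG x : x \in H -> x != u -> x \in G' by move=> xH xv; apply: (fsubsetP HG'); rewrite !inE xv.
case: (eqVneq a v) => [av|av]; case: (eqVneq b v) => [bv|bv].
- by apply: (my E EC); rewrite ?av ?bv.
- case: (eqVneq b u) => [bu|bu]; first by apply: (my E EC); rewrite ?av ?bu.
  by apply: (my G' G'C); apply: HuG => //; rewrite av eq_sym.
- case: (eqVneq a u) => [au|au]; first by apply: (my E EC); rewrite ?au ?bv.
  by apply: (my G' G'C); apply: HuG => //; rewrite bv eq_sym.
- by apply: (my G GC); apply: HvG.
Qed.

Lemma cpl_vertices H x : H \in filling d u v K -> x \in vertices cpl ->
  x = v \/ exists2 G, G \in K & x \in G.
Proof.
move=> _ /mem_vertices[G]; rewrite inE => /orP[GK xG|/fillingP[_ _ _ [G' G'K GG'] _] xG].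
  by right; exists G.
case: (eqVneq x v) => [|xv]; [by left | right; exists G' => //].
by apply: (fsubsetP GG'); rewrite !inE xv.
Qed.

(* If two facets of K are identified, K completes to the boundary of a simplex. *)
Lemma collapsed_piece G1 G2 : G1 \in K -> G2 \in K -> G1 != G2 ->
  contract u v G1 = contract u v G2 -> exists p, @grigid d.+2 cpl p.
Proof.
wlog uG1 : G1 G2 / u \in G1 => [wl|] G1K G2K G12 e.
  case: (boolP (u \in G1)) => u1; first exact: wl e.
  case: (boolP (u \in G2)) => u2.
    by apply: wl G1K _ (esym e) => //; rewrite eq_sym.
  by case/eqP: G12; move: e; rewrite /contract (negbTE u1) (negbTE u2).
have vG1 : v \notin G1 by have := aK G1K; rewrite uG1.
have uG2 : u \notin G2.
  apply: contra G12 => uG2; have vG2 : v \notin G2 by have := aK G2K; rewrite uG2.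
  move: e; rewrite /contract uG1 uG2 => /(congr1 (fun A => u |` (A `\ v))).
  by rewrite !fsetU1K ?inE ?(negbTE vG1) ?(negbTE vG2) ?andbF // !fsetD1K // => ->.
have e2 : G2 = v |` (G1 `\ u) by move: e; rewrite /contract uG1 (negbTE uG2).
have [H HF] := filling_ex; have [uH vH cH _ _] := fillingP HF.
(* By minimality: the pair alone is a relative cycle, because the two facets cancel after the
   contraction. *)
have KE : K = [fset G1; G2].
  case: mK => _ _ m; have [|| K0|//] := m [fset G1; G2].
  - by rewrite fsubUset !fsub1set G1K.
  - have pp r : par [fset G1; G2] r = (r `<=` G1) (+) (r `<=` G2).
      rewrite par_disjU ?par_fset1 //; apply/fdisjointP => x; rewrite !inE => /eqP ->; exact: G12.
    split=> [r cr ur vr|t ct ut vt]; rewrite !pp.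
      have -> : (r `<=` G2) = (r `<=` G1); last by rewrite addbb.
      rewrite e2 -fsubDset; apply/idP/idP => /fsubsetP h; apply/fsubsetP => x.
        move=> xr; have := h x; rewrite !inE xr andbT.
        by case: (eqVneq x v) => [xv|_ /(_ isT) /andP[]//]; rewrite -xv xr in vr.
      rewrite !inE => /andP[xv xr]; rewrite h // andbT.
      by apply: contraNneq ur => <-.
    rewrite !fsubUset !fsub1set uG1 (negbTE vG1) (negbTE uG2) /= addbF.
    have -> : v \in G2 by rewrite e2 !inE eqxx.
    rewrite /= e2 -fsubDset; apply/idP/idP => /fsubsetP h; apply/fsubsetP => x.
      rewrite !inE => /andP[xv xt]; rewrite h // andbT.
      by apply: contraNneq ut => <-.
    move=> xt; have := h x; rewrite !inE xt andbT.
    by case: (eqVneq x v) => [xv|_ /(_ isT) /andP[]//]; rewrite -xv xt in vt.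
  - by move: (fset1U1 G1 [fset G2]); rewrite K0 inE.
pose D := v |` G1.
have cD : #|` D| = d.+3 by rewrite cardfsU1 vG1 pK.
have iD : indep D (fun a => \row_(j < d.+3) ((j : nat) == index a D)%:R : 'rV[R]_d.+3).
  by apply: indep_ex; rewrite cD.
set p := fun a => _ in iD.
have G1c : G1 \in cpl by rewrite inE G1K.
have iG : indep G1 p by apply: indepS iD; rewrite fsubsetUr.
exists p; exists G1 => //; split=> //.
apply: (rigid_pinned G1c (pK G1K) iG) => y my y0.
(* The points of D span the space and v is joined to all of them, to u through a filling facet and
   to the others inside G2. *)
have yv : y v = 0.
  apply: (indep_dotp0 cD iD) => a; rewrite !inE => /predU1P[->|aG1].
    have vG2 : v \in G2 by rewrite e2 !inE eqxx.
    have G2c : G2 \in cpl by rewrite inE G2K.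
    by have /eqP := my G2 G2c v v vG2 vG2; rewrite -mulr2n mulrn_eq0 /= => /eqP.
  case: (eqVneq a u) => [->|au].
    have Hc : H \in cpl by rewrite inE HF orbT.
    by have := my H Hc v u vH uH; rewrite (y0 u uG1) dotp0l addr0.
  have G2c : G2 \in cpl by rewrite inE G2K.
  have := my G2 G2c v a; rewrite (y0 a aG1) dotp0l addr0; apply.
    by rewrite e2 !inE eqxx.
  by rewrite e2 !inE au aG1 orbT.
move=> a /(cpl_vertices HF)[->//|[G]]; rewrite KE !inE => /orP[/eqP->|/eqP->]; first exact: y0.
by rewrite e2 !inE => /predU1P[->//|/andP[_ /y0]].
Qed.

(** A subcycle of the image pulls back along the injective contraction to a relative subcycle of K,
    where minimality applies. *)
Lemma contract_mincycle : {in K &, injective (contract u v)} ->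
  mincycle d.+2 [fset contract u v G | G in K].
Proof.
move=> iK; case: (mK) => K0 _ m; set f := contract u v.
have uf G : u \notin f G.
  rewrite /f /contract; case: (boolP (u \in G)) => // uG.
  by rewrite !inE eqxx (negbTE uv).
have parZ Z r : Z `<=` K -> par [fset f G | G in Z] r = if u \in r then false else
    if v \in r then par Z (u |` (r `\ v)) (+) par Z r else par Z r.
  move=> ZK; case: (boolP (u \in r)) => ur.
    apply: par_none => G' /imfsetP[G /= _ ->]; apply/negP => /fsubsetP /(_ u ur).
    by rewrite (negbTE (uf G)).
  apply: par_contract => //; first exact: avoidsS ZK aK.
  by move=> x y xZ yZ; apply: iK; exact: (fsubsetP ZK).
split.
- case/fset0Pn: K0 => G GK; apply/fset0Pn; exists (f G); exact: in_imfset.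
- move=> H /imfsetP[G /= GK ->]; rewrite /f /contract; case: (boolP (u \in G)) => uG; last exact: pK.
  have vG : v \notin G by have := aK GK; rewrite uG.
  have := cardfsD1 u G; rewrite uG pK // add1n => -[e].
  by rewrite cardfsU1 !inE (negbTE vG) andbF -e add1n.
- move=> r cr; rewrite parZ //; case: (boolP (u \in r)) => // ur; case: (boolP (v \in r)) => vr.
    rewrite rK.2 ?inE ?eqxx ?(negbTE ur) ?andbF //; first by rewrite fsetD1K // addbb.
    by have := cardfsD1 v r; rewrite vr cr add1n => -[].
  by rewrite rK.1.
- move=> Z ZfK hZ; pose K' := [fset G in K | f G \in Z].
  have K'K : K' `<=` K by apply/fsubsetP => G; rewrite !inE => /andP[].
  have ZE : Z = [fset f G | G in K'].
    apply/fsetP => H; apply/idP/imfsetP => [HZ|[G /=]]; last by rewrite !inE => /andP[_ ?] ->.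
    have /imfsetP[G /= GK e] := fsubsetP ZfK H HZ.
    by exists G => //=; rewrite !inE GK -e.
  have rK' : relcycle d u v K'.
    split=> [r cr ur vr|t ct ut vt].
      by have := hZ r cr; rewrite ZE parZ // (negbTE ur) (negbTE vr).
    have := hZ (v |` t); rewrite cardfsU1 vt ct => /(_ erefl).
    rewrite ZE parZ // !inE eqxx (negbTE uv) (negbTE ut) /= fsetU1K //.
    by case: (par K' (u |` t)); case: (par K' (v |` t)).
  by case: (m K' K'K rK') => e; [left | right]; rewrite ZE e // imfset0.
Qed.

(* Vertex splitting: place u at v and move it away in a generic direction z. *)
Lemma split_piece : {in K &, injective (contract u v)} ->
  (exists q : T -> 'rV[R]_d.+3, @grigid d.+2 [fset contract u v G | G in K] q) ->
  exists p, @grigid d.+2 cpl p.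
Proof.
move=> iK exq; set f := contract u v; set Z := [fset f G | G in K].
have vu : (v == u) = false by rewrite eq_sym (negbTE uv).
have [c0 pZ cZ _] := contract_mincycle iK.
have [H HF] := filling_ex; have [uH vH cH [G1 G1K HG1] [G2 G2K HG2]] := fillingP HF.
have Hc : H \in cpl by rewrite inE HF orbT.
pose t := H `\ u `\ v.
have ct : #|` t| = d.
  have := cardfsD1 u H; rewrite uH cH add1n => -[e1].
  by have := cardfsD1 v (H `\ u); rewrite !inE vH eq_sym uv -e1 add1n => -[].
have [x xt] : exists x, x \in t by apply/fset0Pn; rewrite -cardfs_gt0 ct.
have [xv xu xH] : [/\ x != v, x != u & x \in H] by move: xt; rewrite !inE => /and3P[].
have cHx : #|` H `\ x| = d.+1 by have := cardfsD1 x H; rewrite xH cH add1n => -[].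
(* The second filling facet H' supplies a common neighbour x' of u and v outside H. With the d
   vertices of t there are then d + 1 common neighbours, and together with v they leave only one
   direction z free. *)
have [H' [H'c HxH' H'H]] : exists H', [/\ H' \in cpl, H `\ x `<=` H' & H' != H].
  apply: par_other Hc _; last by rewrite fsubD1set.
  by apply: completion_cycle.
have [uH' vH'] : u \in H' /\ v \in H'.
  by split; apply: (fsubsetP HxH'); rewrite !inE ?uH ?vH andbT eq_sym.
have H'F : H' \in filling d u v K.
  move: H'c; rewrite inE => /orP[H'K|//]; by move: (aK H'K); rewrite uH' vH'.
have [_ _ cH' [G3 G3K HG3] [G4 G4K HG4]] := fillingP H'F.
have [x' x'H' x'H] : exists2 x', x' \in H' & x' \notin H.
  have : ~~ (H' `<=` H).
    by apply: contra H'H => s; rewrite eqEfcard s cH cH' leqnn.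
  by case/fsubsetPn => x' ? ?; exists x'.
pose X := x' |` t.
have tX a : a \in X -> [/\ a != u, a != v, (exists2 G, G \in K & (a \in G) && (u \in G))
    & exists2 G, G \in K & (a \in G) && (v \in G)].
  rewrite !inE => /predU1P[->|/and3P[av au aH]].
    have x'u : x' != u by apply: contraNneq x'H => ->.
    have x'v : x' != v by apply: contraNneq x'H => ->.
    split=> //; [exists G3 | exists G4] => //; apply/andP; split.
    - by apply: (fsubsetP HG3); rewrite !inE x'v.
    - by apply: (fsubsetP HG3); rewrite !inE uv.
    - by apply: (fsubsetP HG4); rewrite !inE x'u.
    - by apply: (fsubsetP HG4); rewrite !inE eq_sym uv.
  split=> //; [exists G1 | exists G2] => //; apply/andP; split.
  - by apply: (fsubsetP HG1); rewrite !inE av.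
  - by apply: (fsubsetP HG1); rewrite !inE uv.
  - by apply: (fsubsetP HG2); rewrite !inE au.
  - by apply: (fsubsetP HG2); rewrite !inE eq_sym uv.
have cvX : #|` v |` X| = d.+2.
  rewrite /X !cardfsU1 ct !inE (negbTE x'H) eqxx !andbF orbF.
  have -> : v != x' by apply: contraNneq x'H => <-.
  by [].
have [q [_ qZ iX]] := line_open_meet (@line_closedT d.+3) (line_open_grigid pZ)
  (@line_open_indep _ _ d.+3 (v |` X)) (let: ex_intro q h := exq in ex_intro2 _ _ q I h)
  (ex_intro2 _ _ _ I (indep_ex (leq_trans (eq_leq cvX) (leqnSn _)))).
have [z hz] := indep_normal cvX iX.
case: qZ => F /imfsetP[G0 /= G0K eF] [iF rZ].
pose q0 a := if a == u then q v else q a.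
pose V := vertices cpl.
have G0c : G0 \in cpl by rewrite inE G0K.
have sG : G0 `<=` V by exact: sub_vertices.
have sV : vertices K `<=` V by apply: verticesS; exact: fsubsetUl.
have [uV vV] : u \in V /\ v \in V by split; apply/mem_vertices; exists H.
have q0f G a : a \in G -> G \in K -> f G =
   (if u \in G then v |` (G `\ u) else G) by [].
have lift G a : G \in K -> a \in f G -> exists a', [/\ a' \in G, q0 a' = q a
     & a = (if a' == u then v else a')].
  move=> GK; rewrite /f /contract; case: (boolP (u \in G)) => uG aG.
    move: aG; rewrite !inE => /predU1P[->|/andP[au aG]].
      by exists u; rewrite /q0 eqxx.
    by exists a; rewrite /q0 (negbTE au).
  have au : a != u by apply: contraNneq uG => <-.
  by exists a; rewrite /q0 (negbTE au).
pose JT := ((V * V) + (V * 'I_d.+3) + unit)%type.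
(* When u sits at v, the equation of the edge uv follows from those of u and v alone. It is replaced
   by its limit after division by the displacement: y v - y u is orthogonal to z. *)
pose al (j : JT) w : 'rV[R]_d.+3 :=
  match j with
  | inl j => motion_eq K G0 q0 j w
  | inr _ => (w == v)%:R *: z + (w == u)%:R *: (- z)
  end.
pose be (j : JT) w : 'rV[R]_d.+3 :=
  match j with
  | inl j => motion_eq K fset0 (fun a => if a == u then z else 0) j w
  | inr _ => 0
  end.
have special y t0 : \sum_(w <- V) dotp (y w) (al (inr tt) w + t0 *: be (inr tt) w) =
   dotp (y v - y u) z.
  under eq_bigr do rewrite /= scaler0 addr0 dotpDr.
  by rewrite big_split /= !sum_pick // dotpNr dotpBl.
have [|g [g0 hg]] := @sys_line _ _ d.+3 V JT al be.
  move=> y hy.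
  have [my y0] := (motion_eqP q0 y sV sG).1 (fun j => hy (inl j)).
  have hyz : dotp (y v - y u) z = 0.
    have := hy (inr tt); rewrite -(special y 0); move=> h; rewrite -[RHS]h.
    by apply: eq_bigr => w _; rewrite scale0r addr0.
  have yuv : y v - y u = 0.
    apply: hz hyz => a; rewrite in_fset1U => /predU1P[->|aX].
      have vG2 : v \in G2 by apply: (fsubsetP HG2); rewrite !inE eq_sym uv.
      have uG1 : u \in G1 by apply: (fsubsetP HG1); rewrite !inE uv.
      have vv : dotp (y v) (q v) = 0.
        have /eqP := my G2 G2K v v vG2 vG2.
        by rewrite -mulr2n mulrn_eq0 /q0 vu /= => /eqP.
      have uu : dotp (y u) (q v) = 0.
        have /eqP := my G1 G1K u u uG1 uG1.
        by rewrite -mulr2n mulrn_eq0 /q0 eqxx /= => /eqP.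
      by rewrite dotpBl vv uu subrr.
    have [au av [E EK /andP[aE uE]] [E' E'K /andP[aE' vE']]] := tX a aX.
    have := my E EK u a uE aE; have := my E' E'K v a vE' aE'.
    rewrite /q0 (negbTE au) eqxx vu dotpBl => h1 h2.
    by apply/eqP; rewrite subr_eq0; apply/eqP; apply: (addIr (dotp (y a) (q v))); rewrite h1 h2.
  have yuv' : y u = y v by apply/eqP; rewrite eq_sym -subr_eq0 yuv.
  have FZ : F \in Z by apply/imfsetP; exists G0.
  have yl a' : y (if a' == u then v else a') = y a' by case: eqP => // ->.
  have y0Z : forall a, a \in vertices Z -> y a = 0.
    apply: (pinned_rigid rZ FZ (pZ F FZ) iF).
      move=> E /imfsetP[G /= GK ->] a b aE bE.
      have [a' [a'G qa ea]] := lift G a GK aE; have [b' [b'G qb eb]] := lift G b GK bE.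
      by rewrite -qa -qb ea eb !yl; exact: my GK _ _ a'G b'G.
    move=> a; rewrite eF => aF; have [a' [a'G _ ->]] := lift G0 a G0K aF.
    by rewrite yl; apply: y0.
  have yK G a : G \in K -> a \in G -> a != u -> y a = 0.
    move=> GK aG au; apply: y0Z; apply/mem_vertices; exists (f G); first exact: in_imfset.
    by rewrite /f /contract; case: (u \in G) => //; rewrite !inE au aG orbT.
  have yv0 : y v = 0.
    by apply: (yK G2 v G2K); rewrite 1?eq_sym //; apply: (fsubsetP HG2); rewrite !inE eq_sym uv.
  move=> a /(cpl_vertices HF)[->//|[G GK aG]].
  case: (eqVneq a u) => [->|au]; [by rewrite yuv' | exact: yK aG au].
have iG0 : indep G0 q0.
  (* because the contraction is injective on G0 *)
  case: (boolP (u \in G0)) => uG; last first.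
    move: iF; rewrite eF /f /contract (negbTE uG); apply: eq_indep => a aG.
    by rewrite /q0; case: eqP => // au; rewrite -au aG in uG.
  have vG : v \notin G0 by have := aK G0K; rewrite uG.
  move=> c hc; pose c' a := if a == v then c u else c a.
  have hF : \sum_(a <- F) c' a *: q a = 0.
    rewrite eF /f /contract uG -[RHS]hc [RHS](big_fsetD1 u) //= [LHS](big_fsetD1 v) ?inE ?eqxx //=.
    have -> : (v |` G0 `\ u) `\ v = G0 `\ u by rewrite fsetU1K // !inE (negbTE vG) andbF.
    rewrite /c' /q0 !eqxx; congr (_ + _); apply: eq_big_seq => a; rewrite !inE => /andP[au aG].
    by rewrite (negbTE au); case: eqP => // av; rewrite -av aG in vG.
  move=> a aG; case: (eqVneq a u) => [->|au].
    have := iF c' hF v; rewrite /c' eqxx; apply.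
    by rewrite eF /f /contract uG !inE eqxx.
  have := iF c' hF a; rewrite /c'; case: eqP => [av|_]; first by rewrite -av aG in vG.
  by apply; rewrite eF /f /contract uG !inE au aG orbT.
pose p1 a := if a == u then q v + z else q a.
have [g' [g'0 hg']] := line_open_indep p1 iG0.
have X0 : 'X != 0 :> {poly R} by rewrite polyX_eq0.
(* The factor ['X] makes t0 nonzero, so that u really moves off v and the edge equation can be
   divided by t0. *)
have [t0] := poly_nonroot (mulf_neq0 (mulf_neq0 g0 g'0) X0).
rewrite !hornerM hornerX !mulf_eq0 !negb_or => /andP[/andP[gt g't] tn0].
pose p a := q0 a + t0 *: (p1 a - q0 a).
have pE a : p a = if a == u then q v + t0 *: z else q a.
  rewrite /p /p1 /q0; case: eqP => _; last by rewrite subrr scaler0 addr0.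
  by congr (_ + _ *: _); rewrite addrC addKr.
have iGp : indep G0 p := hg' t0 g't.
exists p; exists G0 => //; split=> //.
apply: (rigid_pinned G0c (pK G0K) iGp) => y my y0 a aV; apply: (hg t0 gt) aV => -[j|[]].
  have mK' : motion K p y by apply: motion_sub my; exact: fsubsetUl.
  have := (motion_eqP p y sV sG).2 (conj mK' y0) j => h; rewrite -[RHS]h.
  apply: eq_bigr => w _; congr dotp; case: j {h} => -[b c] /=; last first.
    by rewrite scale0r scaler0 addr0.
  have pE' e : p e = q0 e + t0 *: (if e == u then z else 0).
    by rewrite pE /q0; case: eqP => // _; rewrite scaler0 addr0.
  by rewrite !pE' !scalerDr !scalerA; apply/rowP => i; rewrite !mxE; ring.
(* Subtracting the equations of u and of v with themselves from that of the edge uv leaves t0 times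
   the pairing of y v - y u with z. *)
rewrite special; have := my H Hc u v uH vH.
have dbl w : w \in H -> dotp (y w) (p w) = 0.
  by move=> wH; have /eqP := my H Hc w w wH wH; rewrite -mulr2n mulrn_eq0 /= => /eqP.
have := dbl u uH; have := dbl v vH.
rewrite !pE eqxx vu !dotpDr !dotpZr => -> /eqP.
rewrite addr_eq0 => /eqP ->; rewrite add0r addrC -mulrN -mulrDr dotpBl => /eqP.
by rewrite mulf_eq0 (negbTE tn0) /= => /eqP.
Qed.

End Piece.

(** Contracting an edge lowers the number of vertices. The condition [0 < d] excludes polygons,
    which are flexible in the plane. A motion of C is trivial on the completion of each minimal
    piece; the pieces that carry one and the same trivial motion are shown to complete to a cycle
    inside C, which is then C. *)
Theorem mincycle_rigid d C : (0 < d)%N -> mincycle d.+2 C ->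
  exists p : T -> 'rV[R]_d.+3, @grigid d.+2 C p.
Proof.
move=> d0; elim: {C}#|` vertices C| {-2}C (leqnn #|` vertices C|) => [|n IH] C cV mC.
  case: (mC) => C0 pC _ _; case/fset0Pn: C0 => G GC.
  by move: (fsubset_leq_card (sub_vertices GC)) cV; rewrite pC //; case: #|` _|.
case: (mC) => C0 pC cC mmC; case/fset0Pn: (C0) => G GC.
have [u uG] : exists u, u \in G by apply/fset0Pn; rewrite -cardfs_gt0 pC.
have [v] : exists v, v \in G `\ u.
  by apply/fset0Pn; rewrite -cardfs_gt0; have := cardfsD1 u G; rewrite uG pC // add1n => -[<-].
rewrite !inE eq_sym => /andP[uv vG].
have euv : adjacent C u v by apply/adjacentP; exists G.
set O := outside u v C.
have OC : O `<=` C by exact: outside_sub.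
have rO : relcycle d u v O by exact: outside_relcycle.
have O0 : O != fset0.
  have cr : #|` G `\ v| = d.+1 by have := cardfsD1 v G; rewrite vG pC // add1n => -[].
  have [H [HC rH HG]] := par_other (cC _ cr) GC (fsubD1set _ _).
  apply/fset0Pn; exists H; rewrite in_outside HC /=; apply: contra HG => /andP[uH vH].
  by rewrite eq_sym eqEfcard !pC // leqnn andbT -(fsetD1K vG) fsubUset fsub1set vH rH.
have piece K : K `<=` O -> minrel d u v K -> exists p, @grigid d.+2 (completion d u v K) p.
  move=> KO mK; case: (pselect {in K &, injective (contract u v)}) => [iK|niK].
    apply: (split_piece uv d0 mC) => //; apply: IH; last exact: (contract_mincycle uv mC KO mK iK).
    rewrite -ltnS; apply: leq_trans cV; apply: fproper_ltn_card.
    have sub : vertices [fset contract u v G | G in K] `<=` vertices C `\ u.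
      apply/fsubsetP => x /mem_vertices[H /imfsetP[E /= EK ->]].
      have EC : E \in C by apply: (fsubsetP OC); exact: (fsubsetP KO).
      have vE y : y \in E -> y \in vertices C by move=> yE; apply/mem_vertices; exists E.
      rewrite /contract; case: (boolP (u \in E)) => uE; rewrite !inE.
        case/predU1P => [->|/andP[-> /vE //]]; rewrite eq_sym uv /=.
        by apply/mem_vertices; exists G.
      by move=> xE; rewrite vE // andbT; apply: contraNneq uE => <-.
    apply: fsub_proper_trans sub _; apply: fproperD1; apply/mem_vertices; by exists G.
  have [G1 [G2 [G1K G2K G12 e]]] : exists G1 G2, [/\ G1 \in K, G2 \in K, G1 != G2
      & contract u v G1 = contract u v G2].
    apply: contrapT => h; apply: niK => x y xK yK e; apply/eqP/negP => /negP xy.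
    by apply: h; exists x, y.
  exact: (collapsed_piece uv mC euv KO mK G1K G2K G12 e).
pose s : seq {fset {fset T}} := [seq K <- fpowerset O | `[< minrel d u v K >]].
(* Filling facets need not lie in C, so independence is demanded of every set of [d.+2] vertices. *)
pose s' : seq {fset T} := [seq H <- fpowerset (vertices C) | #|` H| == d.+2].
have sP K : K \in s -> K `<=` O /\ minrel d u v K.
  by rewrite mem_filter fpowersetE => /andP[/asboolP].
have s'P H : H \in s' -> #|` H| = d.+2 by rewrite mem_filter => /andP[/eqP].
have pcpl K : K \in s -> pure d.+2 (completion d u v K).
  move=> /sP[KO _]; apply: (completion_sub uv pC); first exact: fsubset_trans KO OC.
  exact: avoidsS KO (@outside_avoids _ u v C).
have clT := @line_closedT d.+3.
have T0 : exists p : T -> 'rV[R]_d.+3, True by exists (fun=> 0).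
have o1 K : K \in s -> line_open (@grigid d.+2 (completion d u v K)).
  by move=> Ks; apply: line_open_grigid; exact: pcpl.
have o2 H : H \in s' -> line_open (@indep R T d.+3 H) by move=> _; exact: line_open_indep.
have [p [_ gK iH]] := line_open_meet clT (line_open_all o1) (line_open_all o2)
  (line_open_meet_all clT T0 o1 (fun K Ks => let: ex_intro q h := piece K (sP K Ks).1 (sP K Ks).2
     in ex_intro2 _ _ q I h))
  (line_open_meet_all clT T0 o2 (fun H Hs => ex_intro2 _ _ _ I
      (indep_ex (leq_trans (eq_leq (s'P H Hs)) (leqnSn _))))).
have ind H : H `<=` vertices C -> #|` H| = d.+2 -> indep H p.
  by move=> HV cH; apply: iH; rewrite mem_filter fpowersetE HV cH eqxx.
have indC H : H \in C -> indep H p by move=> HC; apply: ind; [exact: sub_vertices | exact: pC].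
exists p; exists G => //; split; first exact: indC.
move=> y my.
have rK K : K `<=` O -> minrel d u v K ->
    exists S, S^T = - S /\ forall a, a \in vertices (completion d u v K) -> y a = p a *m S.
  move=> KO mK; have Ks : K \in s.
    by rewrite mem_filter fpowersetE KO andbT; apply/asboolP.
  case: (gK K Ks) => E _ [_ rE]; apply: rE; exact: (cpl_motion uv euv KO mK my).
have KcV K E : E \in K -> E `<=` vertices (completion d u v K).
  by move=> EK; apply: sub_vertices; rewrite inE EK.
have [K0 K0O mK0] := minrel_ex O0 rO; have [S0 [sS0 yS0]] := rK K0 K0O mK0.
(* Pieces that share a facet share their trivial motion, so no minimal piece crosses S and
   [relcycle_saturated] applies to S and to its complement. *)
pose S := [fset E in O | `[< forall a, a \in E -> y a = p a *m S0 >]].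
have SP E : E \in S -> E \in O /\ (forall a, a \in E -> y a = p a *m S0).
  by rewrite in_sep => /andP[? /asboolP].
have SO : S `<=` O by apply/fsubsetP => E /SP[].
have OV E : E \in O -> E \in C by exact: (fsubsetP OC).
have same K E : K `<=` O -> minrel d u v K -> E `<=` vertices (completion d u v K) ->
    indep E p -> #|` E| = d.+2 -> (forall a, a \in E -> y a = p a *m S0) ->
    forall a, a \in vertices (completion d u v K) -> y a = p a *m S0.
  move=> KO mK EV iE cE yE; have [SK [sSK ySK]] := rK K KO mK.
  suff -> : S0 = SK by [].
  apply: (skew_inj cE iE) => // a aE; rewrite -yE // ySK //; exact: (fsubsetP EV).
have sat K : K `<=` O -> minrel d u v K -> K `<=` S \/ [disjoint K & S].
  move=> KO mK; case: (pselect (exists2 E, E \in K & E \in S)) => [[E EK ES]|h]; [left|right].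
    have [EO yE] := SP E ES; have EC := OV E EO.
    have hK := same K E KO mK (KcV K E EK) (indC E EC) (pC E EC) yE.
    apply/fsubsetP => E' E'K; rewrite in_sep (fsubsetP KO) //=; apply/asboolP => a aE'.
    by apply: hK; exact: (fsubsetP (KcV K E' E'K)).
  by apply/fdisjointP => E EK; apply/negP => ES; apply: h; exists E.
have sat' K : K `<=` O -> minrel d u v K -> K `<=` O `\` S \/ [disjoint K & O `\` S].
  move=> KO mK; case: (sat K KO mK) => h; [right|left].
    by apply/fdisjointP => E EK; rewrite inE (fsubsetP h).
  apply/fsubsetP => E EK; rewrite inE (fsubsetP KO) // andbT; exact: (fdisjointP h).
have [rS pS] := relcycle_saturated rO SO sat.
have [_ pOS] := relcycle_saturated rO (fsubsetDl O S) sat'.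
have aS : avoids u v S := avoidsS SO (@outside_avoids _ u v C).
have yK K : K `<=` S -> minrel d u v K ->
    forall a, a \in vertices (completion d u v K) -> y a = p a *m S0.
  move=> KS mK; have KO := fsubset_trans KS SO.
  case: (mK) => /fset0Pn[E EK] _ _; have [EO yE] := SP E (fsubsetP KS E EK).
  have EC := OV E EO.
  exact: (same K E KO mK (KcV K E EK) (indC E EC) (pC E EC) yE).
have fillK K H : K `<=` O -> H \in filling d u v S -> par K (H `\ v) ->
    H \in completion d u v K.
  move=> KO; rewrite in_filling // => /and4P[uH vH cH _] pH.
  by rewrite inE in_filling ?uH ?vH ?cH ?pH ?orbT //; exact: avoidsS KO (@outside_avoids _ u v C).
have yF H : H \in filling d u v S -> forall a, a \in H -> y a = p a *m S0.
  move=> HF a aH; have := HF; rewrite in_filling // => /and4P[uH vH cH /pS[K [KS mK pK]]].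
  apply: (yK K KS mK); apply/mem_vertices; exists H => //.
  by apply: fillK => //; exact: fsubset_trans KS SO.
(* If a filling facet H of S were not in C, its ridge would be even in the whole outside, hence odd
   in some piece K outside S. Then H would also fill K, and agreement of the two trivial motions on
   H would put K into S. *)
have ZC : completion d u v S `<=` C.
  apply/fsubsetP => H; rewrite inE => /orP[/SP[/OV]//|HF].
  have := HF; rewrite in_filling // => /and4P[uH vH /eqP cH pH].
  have cr : #|` H `\ v| = d.+1 by have := cardfsD1 v H; rewrite vH cH add1n => -[].
  have := par_outside_filling pC cC cr (u:=u) (v:=v); rewrite !inE uv uH eqxx fsetD1K // => /(_ isT isT) h.
  apply: contraT => HC; rewrite -/O (negbTE HC) in h.
  have : par (O `\` S) (H `\ v).
    have e : symd O S = O `\` S.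
      by rewrite /symd; move: SO; rewrite -fsetD_eq0 => /eqP ->; rewrite fsetU0.
    by rewrite -e par_symd h pH.
  case/pOS => K [KOS mK pK]; have KO := fsubset_trans KOS (fsubsetDl O S).
  have HK := fillK K H KO HF pK.
  have HV : H `<=` vertices C.
    have [K' [K'S mK' pK']] := pS _ pH.
    case/par_ex: pK' => E EK' HE; have EC := OV E (fsubsetP SO E (fsubsetP K'S E EK')).
    rewrite -(fsetD1K vH) fsubUset fsub1set (fsubset_trans HE (sub_vertices EC)) andbT.
    by apply/mem_vertices; exists G.
  have h' := same K H KO mK (sub_vertices HK) (ind H HV cH) cH (yF H HF).
  case: (mK) => /fset0Pn[E EK] _ _; move: (fsubsetP KOS E EK); rewrite inE => /andP[/negP nES EO].
  case: nES; rewrite in_sep EO /=; apply/asboolP => a aE; apply: h'.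
  exact: (fsubsetP (KcV K E EK)).
have pS2 : pure d.+2 S by apply: pureS pC; exact: fsubset_trans SO OC.
case: (mmC _ ZC (fun r cr => completion_cycle uv pS2 aS rS cr)) => e; last first.
  exists S0; split=> // a; rewrite -e => /mem_vertices[H]; rewrite inE => /orP[/SP[_]|/yF]; exact.
case: (mK0) => /fset0Pn[E EK] _ _; have : E \in completion d u v S; last by rewrite e inE.
apply/fsetUP; left; rewrite in_sep (fsubsetP K0O) //=; apply/asboolP => a aE; apply: yS0.
exact: (fsubsetP (KcV K0 E EK)).
Qed.

End Fogelsanger.

(** * Normal complexes *)

Section Links.
Local Open Scope fset_scope.
Local Open Scope nat_scope.
Variable T : choiceType.
Implicit Types (A B G H r s t W : {fset T}) (C Z K : {fset {fset T}}) (u v w x : T).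

Definition cx C : {fset {fset T}} := \bigcup_(G <- C) fpowerset G.

Lemma in_cx C s : reflect (exists2 G, G \in C & s `<=` G) (s \in cx C).
Proof.
apply: (iffP (bigfcupP _ _ _ _)) => [[G]|[G GC sG]].
  by rewrite andbT fpowersetE => GC sG; exists G.
by exists G; rewrite ?GC ?fpowersetE.
Qed.

Lemma cx_sub C s t : t `<=` s -> s \in cx C -> t \in cx C.
Proof. by move=> ts /in_cx[G GC sG]; apply/in_cx; exists G => //; exact: fsubset_trans sG. Qed.

Lemma cx_facet C G : G \in C -> G \in cx C.
Proof. by move=> GC; apply/in_cx; exists G. Qed.

Lemma cxS C Z : C `<=` Z -> cx C `<=` cx Z.
Proof. by move=> /fsubsetP CZ; apply/fsubsetP => s /in_cx[G /CZ GZ sG]; apply/in_cx; exists G. Qed.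

Lemma cx_vertices C s : s \in cx C -> s `<=` vertices C.
Proof. by move=> /in_cx[G /sub_vertices GV sG]; exact: fsubset_trans GV. Qed.

Lemma cx1 C v : ([fset v] \in cx C) = (v \in vertices C).
Proof.
by apply/in_cx/mem_vertices => -[G GC]; rewrite ?fsub1set => h; exists G; rewrite ?fsub1set //.
Qed.

Lemma card_cx d C s : pure d C -> s \in cx C -> #|` s| <= d.
Proof. by move=> pC /in_cx[G /pC <-]; exact: fsubset_leq_card. Qed.

Lemma cx_card d C s : pure d C -> s \in cx C -> #|` s| = d -> s \in C.
Proof.
move=> pC /in_cx[G GC sG] cs; suff -> : s = G by [].
by apply/eqP; rewrite eqEfcard sG cs (pC G GC) leqnn.
Qed.

Lemma card_vertices d C : pure d C -> C != fset0 -> d <= #|` vertices C|.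
Proof.
by move=> pC /fset0Pn[G GC]; rewrite -(pC G GC); apply: fsubset_leq_card; exact: sub_vertices.
Qed.

Definition link C s : {fset {fset T}} := [fset G `\` s | G in star C s].

Lemma fsetUD s G : s `<=` G -> s `|` (G `\` s) = G.
Proof.
move=> sG; apply/fsetP => x; rewrite !inE; have := fsubsetP sG x.
by case: (x \in s) => //= ->.
Qed.

Lemma fsetDUK s t : [disjoint s & t]%fset -> (s `|` t) `\` s = t.
Proof.
move=> /fdisjointP d; apply/fsetP => x; rewrite !inE; have := d x.
by case: (x \in s) => //= /(_ isT) /negbTE.
Qed.

Lemma in_link C s t : (t \in link C s) = [disjoint s & t]%fset && (s `|` t \in C).
Proof.
apply/imfsetP/andP => [[G /=]|[d stC]].
  rewrite in_star => /andP[GC sG] ->; rewrite fsetUD // GC; split=> //.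
  by apply/fdisjointP => x xs; rewrite inE xs.
exists (s `|` t); last by rewrite fsetDUK.
by rewrite in_star stC fsubsetUl.
Qed.

Lemma cx_link C s t : (t \in cx (link C s)) = [disjoint s & t]%fset && (s `|` t \in cx C).
Proof.
apply/in_cx/andP => [[G]|[d /in_cx[G GC stG]]].
  rewrite in_link => /andP[d sGC] tG; split; first exact: fdisjointWr tG d.
  by apply/in_cx; exists (s `|` G) => //; exact: fsetUS.
exists (G `\` s).
  rewrite in_link fsetUD ?GC ?andbT; last exact: fsubset_trans (fsubsetUl _ _) stG.
  by apply/fdisjointP => x xs; rewrite inE xs.
apply/fsubsetP => x xt; rewrite inE (fsubsetP stG) ?inE ?xt ?orbT // andbT.
by apply: contraL xt; exact: (fdisjointP d).
Qed.

Lemma vertices_link C s x : (x \in vertices (link C s)) = (x \notin s) && (x |` s \in cx C).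
Proof. by rewrite -cx1 cx_link fdisjointX1 fsetUC. Qed.

Lemma vertices_link_sub C s : vertices (link C s) `<=` vertices C.
Proof.
apply/fsubsetP => x; rewrite vertices_link => /andP[_ /cx_vertices /fsubsetP]; apply.
by rewrite !inE eqxx.
Qed.

Lemma pure_link d C s : pure d C -> pure (d - #|` s|) (link C s).
Proof.
move=> pC G; rewrite in_link => /andP[dis sGC]; rewrite -(pC _ sGC).
have := cardfsUI s G; move: dis; rewrite -fsetI_eq0 => /eqP ->.
by rewrite cardfs0 addn0 => ->; rewrite addKn.
Qed.

Lemma par_link_lift C s Z r : Z `<=` link C s -> [disjoint s & r]%fset ->
  par [fset s `|` G | G in Z] (s `|` r) = par Z r.
Proof.
move=> ZL dr; rewrite /par big_imfset /=.
  apply: eq_big_seq => G GZ; have := fsubsetP ZL G GZ; rewrite in_link => /andP[dG _].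
  apply/idP/idP => h; last exact: fsetUS.
  apply/fsubsetP => x xr; have := fsubsetP h x; rewrite !inE xr orbT => /(_ isT) /orP[xs|//].
  by have := fdisjointP dr x xs; rewrite xr.
move=> G H /(fsubsetP ZL); rewrite in_link => /andP[dG _].
by move=> /(fsubsetP ZL); rewrite in_link => /andP[dH _] e; rewrite -(fsetDUK dG) e fsetDUK.
Qed.

Lemma card_disjU s t : [disjoint s & t]%fset -> #|` s `|` t| = #|` s| + #|` t|.
Proof.
move=> dis; have := cardfsUI s t; move: dis; rewrite -fsetI_eq0 => /eqP ->.
by rewrite cardfs0 addn0.
Qed.

(** Joining with s carries relative cycles in stars of the link to relative cycles in stars of C. A
    face t that meets s has an empty star in the link. *)
Lemma normal_link d C s : normal d C -> s \in cx C -> #|` s| < d ->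
  normal (d - #|` s|) (link C s).
Proof.
move=> [C0 pC cC mC] /in_cx[G0 G0C sG0] sd.
have lift Z : Z `<=` link C s -> [fset s `|` G | G in Z] `<=` star C s.
  move=> ZL; apply/fsubsetP => _ /imfsetP[G /= /(fsubsetP ZL) + ->].
  by rewrite in_link in_star => /andP[_ ->] /=; rewrite fsubsetUl.
have Lfull : [fset s `|` G | G in link C s] = star C s.
  apply/eqP; rewrite eqEfsubset lift //=; apply/fsubsetP => G; rewrite in_star => /andP[GC sG].
  apply/imfsetP; exists (G `\` s); last by rewrite fsetUD.
  rewrite in_link fsetUD // GC andbT; apply/fdisjointP => x xs; by rewrite inE xs.
have Li Z Z' : Z `<=` link C s -> Z' `<=` link C s ->
    [fset s `|` G | G in Z] = [fset s `|` G | G in Z'] -> Z = Z'.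
  move=> + + e; have h Z1 Z2 : Z1 `<=` link C s -> Z2 `<=` link C s ->
     [fset s `|` G | G in Z1] = [fset s `|` G | G in Z2] -> Z1 `<=` Z2.
    move=> Z1L Z2L e'; apply/fsubsetP => G GZ1.
    have : s `|` G \in [fset s `|` G | G in Z2] by rewrite -e'; exact: in_imfset.
    case/imfsetP => H /= HZ2 e''; have := fsubsetP Z1L G GZ1; have := fsubsetP Z2L H HZ2.
    rewrite !in_link => /andP[dH _] /andP[dG _].
    by rewrite -(fsetDUK dG) e'' fsetDUK.
  by move=> a b; apply/eqP; rewrite eqEfsubset (h _ _ a b e) (h _ _ b a (esym e)).
split.
- apply/fset0Pn; exists (G0 `\` s); rewrite in_link fsetUD // G0C andbT.
  by apply/fdisjointP => x xs; rewrite inE xs.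
- exact: pure_link.
- move=> r cr; case: (boolP [disjoint s & r]%fset) => dr; last first.
    rewrite par_none // => G; rewrite in_link => /andP[dG _].
    by apply: contra dr => rG; exact: fdisjointWr rG dG.
  rewrite -(@par_link_lift C s) // Lfull par_star ?fsubsetUl //; apply: cC.
  by rewrite card_disjU // cr; lia.
- move=> t ct Z ZS hZ; have ZL : Z `<=` link C s by apply: fsubset_trans ZS (star_sub _ _).
  case: (boolP [disjoint s & t]%fset) => dt; last first.
    left; apply/eqP; rewrite -fsubset0; apply/fsubsetP => G GZ.
    have := fsubsetP ZS G GZ; rewrite in_star in_link => /andP[/andP[dG _] tG].
    by case/negP: dt; exact: fdisjointWr tG dG.
  have cst : #|` s `|` t| < d by rewrite card_disjU //; lia.
  have e : [fset s `|` G | G in star (link C s) t] = star C (s `|` t).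
    apply/fsetP => H; rewrite in_star fsubUset; apply/imfsetP/and3P => [[G /=]|[HC sH tH]].
      rewrite in_star in_link => /andP[/andP[dG sG] tG] ->; split=> //; first exact: fsubsetUl.
      by apply: fsubset_trans tG _; exact: fsubsetUr.
    exists (H `\` s); last by rewrite fsetUD.
    rewrite /= in_star in_link fsetUD // HC andbT; apply/andP; split.
      by apply/fdisjointP => x xs; rewrite inE xs.
    apply/fsubsetP => x xt; rewrite inE (fsubsetP tH) // andbT.
    by apply: contraL xt; exact: (fdisjointP dt).
  have [||e'|e'] := mC _ cst [fset s `|` G | G in Z].
  + rewrite -e; apply/fsubsetP => _ /imfsetP[G /= GZ ->]; apply: in_imfset; exact: (fsubsetP ZS).
  + move=> r str cr; have sr : s `<=` r by apply: fsubset_trans str; exact: fsubsetUl.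
    have dr : [disjoint s & r `\` s]%fset by apply/fdisjointP => x xs; rewrite inE xs.
    rewrite -(fsetUD sr) (par_link_lift ZL dr); apply: hZ.
      apply/fsubsetP => x xt; rewrite inE (fsubsetP str) ?inE ?xt ?orbT // andbT.
      by apply: contraL xt; exact: (fdisjointP dt).
    by rewrite cardfsDS // cr; lia.
  + left; apply: Li => //; rewrite ?fsub0set // e'.
    apply/esym/eqP; rewrite -fsubset0; apply/fsubsetP => x /imfsetP[G /=]; by rewrite inE.
  + right; apply: Li => //; last by rewrite e' e.
    exact: star_sub.
Qed.

Lemma link_link C s t : [disjoint s & t]%fset -> link (link C s) t = link C (s `|` t).
Proof.
move=> d; apply/fsetP => G; rewrite !in_link fdisjointXU fdisjointUX fsetUA d /=.
by rewrite andbCA andbA.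
Qed.

(** Two facets over a ridge already form a relative cycle in its star, so minimality there leaves no
    third. *)
Lemma normal_ridge d C r G : normal d C -> #|` r| = d.-1 -> 0 < d -> G \in C -> r `<=` G ->
  exists H, [/\ H \in C, r `<=` H, H != G & forall E, E \in C -> r `<=` E -> E = G \/ E = H].
Proof.
move=> [C0 pC cC mC] cr d0 GC rG; have [H [HC rH HG]] := par_other (cC r cr) GC rG.
exists H; split=> // E EC rE.
have rd : #|` r| < d by rewrite cr prednK.
have [||e|e] := mC r rd [fset G; H].
- by rewrite fsubUset !fsub1set !in_star GC HC rG rH.
- move=> r' rr' cr'; have -> : r' = r by apply/esym/eqP; rewrite eqEfcard rr' cr cr' leqnn.
  rewrite par_disjU ?par_fset1 ?rG ?rH //.
  by apply/fdisjointP => x; rewrite !inE => /eqP ->; rewrite eq_sym.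
- by move: (fset1U1 G [fset H]); rewrite e inE.
- have : E \in star C r by rewrite in_star EC rE.
  by rewrite -e !inE => /orP[/eqP|/eqP]; [left | right].
Qed.

Lemma normal_vertices_off d C w : normal d C -> 1 < d ->
  vertices [fset G in C | w \notin G] = vertices C `\ w.
Proof.
move=> nC d1; case: (nC) => C0 pC cC _; apply/fsetP => x; rewrite !inE.
apply/mem_vertices/andP => [[G]|[xw /mem_vertices[G GC xG]]].
  rewrite in_sep => /andP[GC wG] xG; split; last by apply/mem_vertices; exists G.
  by apply: contraNneq wG => <-.
case: (boolP (w \in G)) => wG; last by exists G; rewrite // in_sep GC.
have cr : #|` G `\ w| = d.-1 by have := cardfsD1 w G; rewrite wG pC //; lia.
have [H [HC rH HG]] := par_other (cC _ cr) GC (fsubD1set _ _).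
exists H; last by apply: (fsubsetP rH); rewrite !inE xw.
rewrite in_sep HC /=; apply: contra HG => wH.
by rewrite eq_sym eqEfcard (pC _ HC) (pC _ GC) leqnn andbT -(fsetD1K wG) fsubUset fsub1set wH rH.
Qed.

End Links.

(** * Counting unknowns against equations, and coning *)

Section Counting.
Local Open Scope fset_scope.
Local Open Scope ring_scope.
Variables (R : realType) (T : choiceType).
Implicit Types (A B D G H V W : {fset T}) (C Z K : {fset {fset T}}).

Definition cells C k : {fset {fset T}} := [fset s in cx C | #|` s| == k].

Lemma in_cells C k s : (s \in cells C k) = (s \in cx C) && (#|` s| == k).
Proof. exact: in_sep. Qed.

(* A motion supported off V', except for the coordinate 0 on V' outside D, must
   vanish, so there are at least as many equations as unknowns. *)
Lemma rigid_count d C (p : T -> 'rV[R]_d.+1) V A D : rigid C p -> V `<=` vertices C ->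
  A `<=` D -> D `<=` V -> #|` A| = d -> indep A p ->
  (V `<=` D \/ forall b, b \in V -> p b ord0 ord0 = 0) ->
  (d * #|` vertices C `\` V| + #|` V| <=
     #|` [fset e in cells C 2 | ~~ (e `<=` V)]| + #|` D|)%N.
Proof.
move=> rC VC AD DV cA iA flat; set U := vertices C; set W := U `\` V.
set E := [fset e in cells C 2 | _]; rewrite leqNgt; apply/negP => lt.
(* One equation for each edge not inside V, one for each vertex off V paired with itself, the d
   coordinates other than coordinate 0 on V, and coordinate 0 on D. *)
pose J := (E + W + V * 'I_d + D)%type.
pose al (j : J) a : 'rV[R]_d.+1 := match j with
  | inl (inl (inl e)) => if a \in val e then \sum_(b <- val e `\ a) p b else 0
  | inl (inl (inr w)) => (a == val w)%:R *: p (val w)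
  | inl (inr (v, i)) => (a == val v)%:R *: delta_mx ord0 (lift ord0 i)
  | inr v => (a == val v)%:R *: delta_mx ord0 ord0 end.
have cU : #|` U| = (#|` W| + #|` V|)%N.
  by rewrite /W cardfsDS // subnK //; exact: fsubset_leq_card.
have [|y [hy [x xU xn]]] := @sys_count R T d.+1 U J al.
  by rewrite !card_sum card_prod -!cardfE card_ord cU; nia.
pose z a := if a \in U then y a else 0.
have hy1 (e : E) : \sum_(v <- U) dotp (y v) (al (inl (inl (inl e))) v) = 0 by exact: hy.
have hz (v : T) : v \in V -> forall i, z v ord0 (lift ord0 i) = 0.
  move=> vV i; have := hy (inl (inr ([` vV], i))).
  by rewrite /= sum_pick ?(fsubsetP VC) // dotp_delta /z (fsubsetP VC _ vV).
have hD v : v \in D -> z v = 0.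
  move=> vD; have vV := fsubsetP DV v vD; apply/rowP => i; rewrite mxE.
  case: (unliftP ord0 i) => [j ->|->]; first exact: hz.
  have := hy (inr [` vD]); rewrite /= sum_pick ?(fsubsetP VC) // dotp_delta.
  by rewrite /z (fsubsetP VC _ vV).
(* Inside V the equations hold for free: on V the motion z lives in coordinate 0, where either z or
   p vanishes. *)
have zV a b : a \in V -> b \in V -> dotp (z a) (p b) = 0.
  move=> aV bV; case: flat => [VD|fl]; first by rewrite hD ?dotp0l //; exact: (fsubsetP VD).
  rewrite /dotp big_ord_recl fl // mulr0 big1 ?addr0 // => i _.
  by rewrite hz // mul0r.
have mz : motion C p z.
  move=> G GC a b aG bG.
  have aU : a \in U by apply/mem_vertices; exists G.
  have bU : b \in U by apply/mem_vertices; exists G.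
  case: (boolP ((a \in V) && (b \in V))) => [/andP[aV bV]|nV]; first by rewrite !zV ?addr0.
  case: (eqVneq a b) nV => [<-|ab] nV.
    rewrite andbb in nV; have aW : a \in W by rewrite inE nV aU.
    by have := hy (inl (inl (inr [` aW]))); rewrite /= sum_pick // /z aU => ->; rewrite addr0.
  have eE : [fset a; b] \in E.
    rewrite in_sep in_cells cardfs2 ab fsubUset !fsub1set nV /= !andbT.
    by apply/in_cx; exists G; rewrite // fsubUset !fsub1set aG bG.
  have := hy1 [` eE]; rewrite /= => h; rewrite -[RHS]h.
  have eU : [fset a; b] `<=` U by rewrite fsubUset !fsub1set aU bU.
  rewrite -(big_fset_incl _ eU) /=; last by move=> v _ /negbTE ->; rewrite dotp0r.
  rewrite (big_fsetD1 a) ?fset21 //=.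
  have -> : [fset a; b] `\ a = [fset b] by rewrite fsetU1K // inE.
  rewrite !big_seq_fset1 fset22.
  have -> : [fset a; b] `\ b = [fset a] by rewrite fsetUC fsetU1K // inE eq_sym.
  by rewrite big_seq_fset1 /z aU bU.
have [S [sS zS]] := rC z mz.
have S0 : S = 0.
  apply: (skew_eq0 cA iA sS) => a aA; have aD := fsubsetP AD a aA.
  by rewrite -zS ?hD //; apply: (fsubsetP VC); exact: (fsubsetP DV).
by move: xn; have := zS x xU; rewrite /z xU S0 mulmx0 => ->; rewrite eqxx.
Qed.

(** The apex is the first basis vector and all other points lie in the hyperplane where coordinate 0
    vanishes. This is the hyperplane that later holds the vertices of the capped facet. *)
Definition cone_place n u (q : T -> 'rV[R]_n) a : 'rV[R]_n.+1 :=
  if a == u then delta_mx ord0 ord0 else row_mx (0 : 'rV_1) (q a).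

Lemma cone_place0 n u (q : T -> 'rV[R]_n) a : a != u -> cone_place u q a ord0 ord0 = 0.
Proof.
move=> /negbTE au; rewrite /cone_place au mxE.
by case: splitP => // j _; rewrite mxE.
Qed.

Lemma cone_placeS n u (q : T -> 'rV[R]_n) a i : a != u ->
  cone_place u q a ord0 (lift ord0 i) = q a ord0 i.
Proof.
move=> /negbTE au; rewrite /cone_place au.
have -> : lift ord0 i = rshift 1 i by apply: val_inj.
by rewrite (row_mxEr (0 : 'rV_1)).
Qed.

(** Coning preserves rigidity: once u is pinned, its edges force coordinate 0 of every velocity in
    the star to vanish, and the remaining coordinates form a motion of the link. *)
Lemma cone_rigid d C u q : pure d.+1 C -> @grigid R T d (link C [fset u]) q ->
  @grigid R T d.+1 (star C [fset u]) (cone_place u q).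
Proof.
move=> pC [G GL [iG rL]]; move: (GL); rewrite in_link fdisjoint1X => /andP[uG uGC].
have uGS : u |` G \in star C [fset u] by rewrite in_star uGC fsubsetUl.
have puu : cone_place u q u = delta_mx ord0 ord0 by rewrite /cone_place eqxx.
have nu a H : H \in link C [fset u] -> a \in H -> a != u.
  by rewrite in_link fdisjoint1X => /andP[uH _] aH; apply: contraNneq uH => <-.
have iuG : indep (u |` G) (cone_place u q).
  move=> c; rewrite big_fsetU1 //= => hc.
  have hG : \sum_(a <- G) c a *: q a = 0.
    apply/rowP => i; move/rowP: hc => /(_ (lift ord0 i)).
    rewrite !mxE puu !mxE /= mulr0 add0r !summxE => hc; rewrite -[RHS]hc.
    by apply: eq_big_seq => a aG; rewrite mxE [RHS]mxE cone_placeS // (nu a G).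
  have cG := iG c hG.
  have cu : c u = 0.
    move/rowP: hc => /(_ ord0); rewrite !mxE puu !mxE eqxx mulr1 summxE.
    rewrite big1_seq ?addr0 // => a /= aG; by rewrite cG // scale0r mxE.
  by move=> a; rewrite in_fset1U => /predU1P[->|/cG].
exists (u |` G) => //; split=> //.
apply: (rigid_pinned uGS) => // [|y my y0]; first exact: pC.
pose z a : 'rV[R]_d.+1 := \row_i y a ord0 (lift ord0 i).
have yu : y u = 0 by apply: y0; rewrite !inE eqxx.
have y00 a : a \in vertices (star C [fset u]) -> y a ord0 ord0 = 0.
  case/mem_vertices => H HS aH; have := HS; rewrite in_star fsub1set => /andP[HC uH].
  have := my H HS a u aH uH; by rewrite yu dotp0l addr0 puu dotp_delta.
have dz H a b : H \in link C [fset u] -> a \in H -> b \in H ->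
    dotp (z a) (q b) = dotp (y a) (cone_place u q b).
  move=> HL aH bH; rewrite [RHS]/dotp big_ord_recl cone_place0 ?(nu _ H) // mulr0 add0r.
  by apply: eq_bigr => i _; rewrite mxE cone_placeS // (nu _ H).
have mz : motion (link C [fset u]) q z.
  move=> H HL a b aH bH; have := HL; rewrite in_link => /andP[_ uHC].
  rewrite !(dz H) //; apply: (my (u |` H)); rewrite ?in_star ?uHC ?fsubsetUl // !inE.
    by rewrite aH orbT.
  by rewrite bH orbT.
have zL : forall a, a \in vertices (link C [fset u]) -> z a = 0.
  apply: (pinned_rigid rL GL _ iG mz); last first.
    by move=> a aG; apply/rowP => i; rewrite mxE y0 ?mxE // !inE aG orbT.
  by have := pC _ uGC; rewrite cardfsU1 uG add1n => -[].
move=> a aS; case: (eqVneq a u) => [->//|au].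
apply/rowP => i; rewrite mxE; case: (unliftP ord0 i) => [j ->|->]; last exact: y00.
have : z a = 0; last by move/rowP => /(_ j); rewrite !mxE.
apply: zL; rewrite vertices_link inE au /=.
case/mem_vertices: aS => H; rewrite in_star fsub1set => /andP[HC uH] aH.
by apply/in_cx; exists H => //; rewrite fsubUset !fsub1set aH uH.
Qed.

End Counting.

(** * Rigidity with a vertex link placed in a hyperplane *)

Section FlatRigidity.
Local Open Scope fset_scope.
Local Open Scope ring_scope.
Variables (R : realType) (T : choiceType).
Implicit Types (A B D G H V W : {fset T}) (C Z K X : {fset {fset T}}).

(* The link of w spans no face off its own cone: the combinatorial trace of w
   being placed beyond a single facet. *)
Definition induced_link X w : Prop :=
  forall s, s \in cx X -> s `<=` vertices (link X [fset w]) -> w |` s \in cx X.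

Definition del X w : {fset {fset T}} := [fset G in X | w \notin G].

Lemma in_del X w G : (G \in del X w) = (G \in X) && (w \notin G).
Proof. exact: in_sep. Qed.

Lemma vertices_del d X w : normal d X -> (1 < d)%N -> vertices (del X w) = vertices X `\ w.
Proof. exact: normal_vertices_off. Qed.

Lemma cone_place_indep n A u (q : T -> 'rV[R]_n) :
  u \notin A -> indep A q -> indep A (cone_place u q).
Proof.
move=> uA iA c hc; apply: iA; apply/rowP => i; move/rowP: hc => /(_ (lift ord0 i)).
rewrite !mxE !summxE => hc; rewrite -[RHS]hc; apply: eq_big_seq => a aA.
by rewrite mxE [RHS]mxE cone_placeS //; apply: contraNneq uA => <-.
Qed.

Lemma normal_size1 k X w : normal k.+2 X -> w \in vertices X -> normal k.+1 (link X [fset w]).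
Proof.
move=> nX wX; have := @normal_link _ k.+2 X [fset w] nX; rewrite cardfs1 subn1 => h.
by apply: h => //; rewrite cx1.
Qed.

(** For u off the link of w, coning the link of u puts every other vertex in the hyperplane, so the
    star of u is rigid in a flat placement. As the link of w is induced, each facet avoiding w has
    such a vertex, and equality of trivial motions spreads through these vertices. It can stop only
    at ridges inside the link of w, where normality at w leaves nothing or everything. *)
Theorem flat_rigid d X w : (0 < d)%N -> normal d.+3 X -> w \in vertices X ->
  induced_link X w ->
  exists p : T -> 'rV[R]_d.+4,
    [/\ forall a, a \in vertices (link X [fset w]) -> p a ord0 ord0 = 0,
        forall A, A `<=` vertices X `\ w -> #|` A| = d.+3 -> indep A p
      & rigid (del X w) p].
Proof.
move=> d0 nX wX ind; set F := vertices (link X [fset w]).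
case: (nX) => X0 pX cX mX.
have wF : w \notin F by rewrite /F vertices_link !inE eqxx.
pose L (p : T -> 'rV[R]_d.+4) := forall a, a \in F -> p a ord0 ord0 = 0.
have clL : line_closed L by move=> p q t hp hq a aF; rewrite !mxE hp // hq // subrr mulr0 addr0.
have exL : exists p, L p by exists (fun=> 0) => a _; rewrite mxE.
have Fcone u q : u \notin F -> L (cone_place u q).
  by move=> uF a aF; apply: cone_place0; apply: contraNneq uF => <-.
set V := vertices X `\ w; pose U := V `\` F.
pose s : seq T := enum_fset U.
pose s' : seq {fset T} := [seq H <- fpowerset V | #|` H| == d.+3].
have sP u : u \in s -> [/\ u \in vertices X, u != w & u \notin F].
  by move=> uU; have : u \in U by []; rewrite !inE => /and3P[].
have o1 u : u \in s -> line_open (@grigid R T d.+3 (star X [fset u])).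
  by move=> us; apply: line_open_grigid; apply: pureS pX; exact: star_sub.
have o2 H : H \in s' -> line_open (@indep R T d.+4 H) by move=> _; exact: line_open_indep.
have e1 u : u \in s -> exists2 p, L p & @grigid R T d.+3 (star X [fset u]) p.
  move=> us; have [uX uw uF] := sP u us.
  have nL : normal d.+2 (link X [fset u]) by exact: normal_size1.
  have [q gq] := mincycle_rigid R d0 (normal_mincycle (ltn0Sn _) nL).
  by exists (cone_place u q); [exact: Fcone | exact: cone_rigid].
have e2 H : H \in s' -> exists2 p, L p & @indep R T d.+4 H p.
  rewrite mem_filter fpowersetE => /andP[/eqP cH HV].
  exists (cone_place w (fun a => \row_(j < d.+3) ((j : nat) == index a H)%:R)); first exact: Fcone.
  apply: cone_place_indep; last by apply: indep_ex; rewrite cH.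
  by apply/negP => /(fsubsetP HV); rewrite !inE eqxx.
have [p [Lp gp ip]] := line_open_meet clL (line_open_all o1) (line_open_all o2)
  (line_open_meet_all clL exL o1 e1) (line_open_meet_all clL exL o2 e2).
have ind_p A : A `<=` V -> #|` A| = d.+3 -> indep A p.
  by move=> AV cA; apply: ip; rewrite mem_filter fpowersetE cA eqxx AV.
exists p; split=> // y my.
have Uin u G : G \in del X w -> u \in G -> u \notin F -> u \in s.
  rewrite in_del => /andP[GX wG] uG uF; suff : u \in U by [].
  rewrite !inE uF /=; apply/andP; split; first by apply: contraNneq wG => <-.
  by apply/mem_vertices; exists G.
have starD u : u \in s -> star X [fset u] `<=` del X w.
  move=> /sP[uX uw uF]; apply/fsubsetP => G; rewrite in_star fsub1set in_del => /andP[GX uG].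
  rewrite GX; apply: contra uF => wG; rewrite /F vertices_link !inE uw /=.
  by apply/in_cx; exists G => //; rewrite fsubUset !fsub1set uG.
have delV G : G \in del X w -> G `<=` V.
  rewrite in_del => /andP[GX wG]; apply/fsubsetP => x xG; rewrite !inE.
  by apply/andP; split; [apply: contraNneq wG => <- | apply/mem_vertices; exists G].
have delX G : G \in del X w -> G \in X by rewrite in_del => /andP[].
have delI G : G \in del X w -> indep G p.
  by move=> GD; apply: ind_p; [exact: delV | apply: pX; exact: delX].
have off G : G \in del X w -> exists2 u, u \in G & u \notin F.
  move=> GD; apply: contrapT => h.
  have GF : G `<=` F.
    by apply/fsubsetP => x xG; apply: contraT => xF; case: h; exists x.
  have := card_cx pX (ind G (cx_facet (delX G GD)) GF); rewrite cardfsU1.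
  by move: GD; rewrite in_del => /andP[/pX -> ->]; rewrite ltnn.
have [Gw GwX wGw] : exists2 G, G \in X & w \in G by apply/mem_vertices.
have [G0 G0D] : exists G0, G0 \in del X w.
  have cr : #|` Gw `\ w| = d.+2 by have := cardfsD1 w Gw; rewrite wGw pX // add1n => -[].
  have [H [HX rH HG]] := par_other (cX _ cr) GwX (fsubD1set _ _).
  exists H; rewrite in_del HX; apply: contra HG => wH.
  by rewrite eq_sym eqEfcard (pX _ HX) (pX _ GwX) leqnn andbT -(fsetD1K wGw) fsubUset fsub1set wH rH.
have rU u : u \in s -> exists S, S^T = - S /\
    forall a, a \in vertices (star X [fset u]) -> y a = p a *m S.
  by move=> us; case: (gp u us) => G _ [_ rS]; apply: rS; apply: motion_sub my; exact: starD.
have [u0 u0G0 u0F] := off G0 G0D.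
have [S0 [sS0 yS0]] := rU u0 (Uin _ _ G0D u0G0 u0F).
pose Z := [fset G in del X w | `[< forall a, a \in G -> y a = p a *m S0 >]].
have ZP G : G \in Z -> G \in del X w /\ (forall a, a \in G -> y a = p a *m S0).
  by rewrite in_sep => /andP[? /asboolP].
have ZI G : G \in del X w -> (forall a, a \in G -> y a = p a *m S0) -> G \in Z.
  by move=> GD h; rewrite in_sep GD; apply/asboolP.
have ZD : Z `<=` del X w by apply/fsubsetP => G /ZP[].
have ZX : Z `<=` X by apply/fsubsetP => G /ZP[/delX].
have pZ : pure d.+3 Z by exact: pureS pX.
have inst u G : G \in X -> u \in G -> G \in star X [fset u].
  by move=> GX uG; rewrite in_star fsub1set uG GX.
have spread u G H : G \in Z -> u \in G -> u \notin F -> H \in X -> u \in H -> H \in Z.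
  move=> GZ uG uF HX uH; have [GD yG] := ZP G GZ; have us := Uin u G GD uG uF.
  have [S [sS yS]] := rU u us.
  have SS : S0 = S.
    apply: (skew_inj (pX _ (delX _ GD)) (delI _ GD)) => // a aG.
    rewrite -yG // yS //; apply/mem_vertices; exists G => //; exact: inst (delX _ GD) uG.
  have HS := inst u H HX uH; apply: ZI; first exact: (fsubsetP (starD u us)).
  by move=> a aH; rewrite SS; apply: yS; apply/mem_vertices; exists H.
have G0Z : G0 \in Z.
  apply: ZI => // a aG; apply: yS0; apply/mem_vertices; exists G0 => //.
  exact: inst (delX _ G0D) u0G0.
(* At a vertex of r off the link of w the whole star has joined Z, so r would be even as in X. An
   odd ridge therefore lies in the link, which is induced. *)
have bd r : #|` r| = d.+2 -> par Z r -> w |` r \in X.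
  move=> cr pr; have [G GZ rG] := par_ex pr; have [GD yG] := ZP G GZ.
  case: (boolP (r `<=` F)) => [rF|/fsubsetPn[u ur uF]].
    have rX : r \in cx X by apply/in_cx; exists G; [exact: delX | ].
    apply: (cx_card pX (ind r rX rF)); rewrite cardfsU1 cr.
    by move: GD; rewrite in_del => /andP[_ wG]; rewrite (contra (fsubsetP rG w) wG).
  have := cX r cr; suff -> : par X r = par Z r by rewrite pr.
  rewrite (par_widen _ ZX); apply: eq_big_seq => H HX.
  case: (boolP (r `<=` H)) => rH; rewrite ?andbF // andbT.
  by apply/esym; apply: (spread u G) => //; exact: (fsubsetP rG) || exact: (fsubsetP rH).
have wZ r : w \in r -> par Z r = false.
  move=> wr; apply: par_none => G /ZP[]; rewrite in_del => /andP[_ wG] _.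
  by apply: contra wG => /fsubsetP; apply.
(* The cone with apex w over the boundary of Z. It is a cycle relative to w because that boundary
   has no boundary. *)
pose B := [fset G in star X [fset w] | par Z (G `\ w)].
have BS : B `<=` star X [fset w] by apply/fsubsetP => G; rewrite in_sep => /andP[].
have BP r : w \notin r -> #|` r| = d.+2 -> (w |` r \in B) = par Z r.
  move=> wr cr; rewrite in_sep in_star fsubsetUl andbT fsetU1K //.
  by apply/andP/idP => [[]//|pr]; split=> //; exact: bd.
have [||B0|BE] := mX [fset w] _ B BS; first by rewrite cardfs1.
- move=> r; rewrite fsub1set => wr cr.
  pose t := r `\ w; have wt : w \notin t by rewrite /t !inE eqxx.
  have ct : #|` t| = d.+1 by have := cardfsD1 w r; rewrite wr cr add1n => -[].
  have := par_double pZ ct (fun G GZ => sub_vertices GZ); rewrite big_addb_fset => /negbT.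
  set Y := [fset x in _ | _]; rewrite par_card.
  suff -> : star B r = [fset x |` r | x in Y].
    suff -> : #|` [fset x |` r | x in Y]| = #|` Y| by [].
    apply: card_in_imfset => x x'; rewrite !inE => /andP[/andP[xt xV] _] /andP[/andP[x't x'V] _].
    have nr x1 : ~~ ((x1 != w) && (x1 \in r)) -> x1 \in vertices Z -> x1 \notin r.
      move=> h /mem_vertices[G /ZP[GD _] xG]; move: h; apply: contra => ->; rewrite andbT.
      by move: GD; rewrite in_del => /andP[_]; apply: contraNneq => <-.
    move=> /fsetP /(_ x); rewrite !inE eqxx (negbTE (nr x xt xV)) !orbF => /esym/eqP; exact.
  apply/fsetP => G; apply/idP/imfsetP => [|[x /=]].
    rewrite in_star => /andP[GB rG]; have := GB; rewrite in_sep in_star fsub1set.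
    move=> /andP[/andP[GX wG] pG].
    have : #|` G `\` r| == 1%N by rewrite cardfsDS // cr pX // subSn // subnn.
    case/cardfs1P => x Gr; have : x \in G `\` r by rewrite Gr inE.
    rewrite inE => /andP[xr xG].
    have eG : G = x |` r by rewrite -(fsetUD rG) Gr fsetUC.
    have xw : x != w by apply: contraNneq xr => ->.
    have et : G `\ w = x |` t.
      by rewrite eG /t; apply/fsetP => y'; rewrite !inE; case: (eqVneq y' x) => [->|] //=; rewrite xw.
    exists x => //; rewrite in_sep -et pG andbT inE /t !inE negb_and xr orbT /=.
    have [H HZ GH] := par_ex pG; apply/mem_vertices; exists H => //.
    by apply: (fsubsetP GH); rewrite !inE xw.
  rewrite in_sep => /andP[]; rewrite inE => /andP[xt xV] px ->.
  have xw : x != w.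
    apply: contraTneq px => ->; rewrite wZ // !inE eqxx //.
  have xr : x \notin r by move: xt; rewrite /t !inE xw.
  have e : x |` r = w |` (x |` t).
    by rewrite /t; apply/fsetP => y'; rewrite !inE; case: (eqVneq y' w) => [->|] //=; rewrite wr orbT.
  rewrite in_star fsubsetUr andbT e BP //; first by rewrite in_fset1U negb_or eq_sym xw wt.
  by rewrite cardfsU1 xt ct.
- have [|||e|e] := mX fset0 _ Z.
  + by rewrite cardfs0.
  + by rewrite star0.
  + move=> r _ cr; apply/negP => pr; have wr : w \notin r.
      by apply: contraTN pr => wr; rewrite wZ.
    by have := BP r wr cr; rewrite B0 inE pr.
  + by rewrite e inE in G0Z.
  + rewrite star0 in e; have := wGw; rewrite -e in GwX; have [] := ZP _ GwX.
    by rewrite in_del => /andP[_ /negbTE ->].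
(* Here the boundary of Z is the full link, so Z and the star of w together form a cycle, hence
   X. *)
- suff e : Z = del X w.
    exists S0; split=> // a /mem_vertices[G]; rewrite -e => /ZP[_]; exact.
  have dis : [disjoint Z & star X [fset w]]%fset.
    apply/fdisjointP => G /ZP[]; rewrite in_del in_star fsub1set => /andP[-> wG] _ /=.
    exact: wG.
  have sX : Z `|` star X [fset w] `<=` X by rewrite fsubUset ZX star_sub.
  have [|||e|e] := mX fset0 _ (Z `|` star X [fset w]).
  + by rewrite cardfs0.
  + by rewrite star0.
  + move=> r _ cr; rewrite par_disjU //; case: (boolP (w \in r)) => wr.
      by rewrite wZ // par_star ?fsub1set //; exact: cX.
    have <- : par Z r = par (star X [fset w]) r; last by rewrite addbb.
    rewrite -BP // -BE par_card.
    case: (boolP (w |` r \in B)) => h.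
      have -> : star B r = [fset w |` r].
        apply/fsetP => G; rewrite in_star in_fset1; apply/andP/eqP => [[]|->]; last by rewrite h fsubsetUr.
        rewrite BE in_star fsub1set => /andP[GX wG] rG.
        by apply/esym/eqP; rewrite eqEfcard fsubUset fsub1set wG rG (pX _ GX) cardfsU1 wr cr /= add1n leqnn.
      by rewrite cardfs1.
    have -> : star B r = fset0; last by rewrite cardfs0.
    apply/eqP; rewrite -fsubset0; apply/fsubsetP => G; rewrite in_star => /andP[GB rG].
    case/negP: h; suff <- : G = w |` r by [].
    move: GB; rewrite BE in_star fsub1set => /andP[GX wG].
    by apply/esym/eqP; rewrite eqEfcard fsubUset fsub1set wG rG (pX _ GX) cardfsU1 wr cr /= add1n leqnn.
  + by have := fsubsetP (fsubsetUl Z (star X [fset w])) _ G0Z; rewrite e inE.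
  + rewrite star0 in e; apply/eqP; rewrite eqEfsubset ZD /=; apply/fsubsetP => G.
    rewrite in_del -{1}e inE => /andP[/orP[//|]]; rewrite in_star fsub1set => /andP[_ ->] //.
Qed.

End FlatRigidity.

(** * Face numbers and the lower bound *)

Section FaceNumbers.
Local Open Scope fset_scope.
Local Open Scope nat_scope.
Variable T : choiceType.
Implicit Types (A B D G H V W r s t : {fset T}) (C Z K X : {fset {fset T}}) (u v w x : T).

(** The index is the number of vertices of a face, one more than the dimension used by [nfaces]. *)
Definition fnum C k : nat := #|` cells C k|.

Lemma fnum1 C : fnum C 1 = #|` vertices C|.
Proof.
rewrite /fnum; have -> : cells C 1 = [fset [fset x] | x in vertices C].
  apply/fsetP => s; rewrite in_cells; apply/andP/imfsetP => [[sC /cardfs1P[x e]]|[x /= xC ->]].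
    by exists x => //=; rewrite -cx1 -e.
  by rewrite cx1 cardfs1.
by rewrite card_imfset //; exact: fset1_inj.
Qed.

Lemma cells_link C v k : cells (link C [fset v]) k =
  [fset s `\ v | s in [fset s in cells C k.+1 | v \in s]].
Proof.
apply/fsetP => t; rewrite in_cells cx_link fdisjoint1X.
apply/andP/imfsetP => [[/andP[vt tC] /eqP ct]|[s /=]].
  exists (v |` t); last by rewrite fsetU1K.
  by rewrite /= in_sep in_cells tC cardfsU1 vt ct add1n eqxx !inE eqxx.
rewrite in_sep in_cells => /andP[/andP[sC /eqP cs] vs] ->.
rewrite !inE eqxx fsetD1K // sC; split=> //.
by have := cardfsD1 v s; rewrite vs cs add1n => -[->].
Qed.

Lemma fnum_link C v k : fnum (link C [fset v]) k = #|` [fset s in cells C k.+1 | v \in s]|.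
Proof.
rewrite /fnum cells_link card_in_imfset //= => s t; rewrite !in_sep => /andP[_ vs] /andP[_ vt] e.
by rewrite -(fsetD1K vs) e fsetD1K.
Qed.

Lemma card_sep (U : choiceType) (Z : {fset U}) (P : pred U) :
  #|` [fset x in Z | P x]| = \sum_(x <- Z) P x.
Proof.
by rewrite card_fset_sum1 big_fset /= big_mkcond /=; apply: eq_bigr => x _; case: (P x).
Qed.

Lemma card_filter_sub A W : A `<=` W -> #|` A| = \sum_(x <- W) (x \in A).
Proof.
move=> AW; rewrite -card_sep; congr #|` _|; apply/fsetP => x; rewrite in_sep.
by case: (boolP (x \in A)) => [/(fsubsetP AW) ->|]; rewrite ?andbF.
Qed.

Lemma sum_const_fset (U : choiceType) (A : {fset U}) k : \sum_(x <- A) k = k * #|` A|.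
Proof. by rewrite card_fset_sum1 big_distrr /=; apply: eq_bigr => x _; rewrite muln1. Qed.

Lemma fnum_sum C k : k.+1 * fnum C k.+1 = \sum_(v <- vertices C) fnum (link C [fset v]) k.
Proof.
under eq_bigr do rewrite fnum_link card_sep.
rewrite exchange_big /= (eq_big_seq (fun _ => k.+1)) => [|s]; last first.
  rewrite in_cells => /andP[sC /eqP <-]; rewrite (card_filter_sub (cx_vertices sC)) //.
by rewrite /fnum card_fset_sum1 big_distrr /=; apply: eq_bigr => s _; rewrite muln1.
Qed.

(** A facet G through w shares the ridge [G \ w] with a facet that avoids w, and the ridge contains
    every face of G without w. *)
Lemma in_cx_del d X w s : normal d X -> 1 < d ->
  (s \in cx (del X w)) = (s \in cx X) && (w \notin s).
Proof.
move=> [_ pX cX _] d1; apply/in_cx/andP => [[G]|[/in_cx[G GX sG] ws]].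
  rewrite in_del => /andP[GX wG] sG; split; first by apply/in_cx; exists G.
  by apply: contra wG => /(fsubsetP sG).
case: (boolP (w \in G)) => wG; last by exists G; rewrite // in_del GX.
have cr : #|` G `\ w| = d.-1 by have := cardfsD1 w G; rewrite wG pX // => ->.
have [H [HX rH HG]] := par_other (cX _ cr) GX (fsubD1set _ _).
exists H; last by apply: fsubset_trans rH; rewrite fsubsetD1 sG.
rewrite in_del HX; apply: contra HG => wH.
by rewrite eq_sym eqEfcard (pX _ HX) (pX _ GX) leqnn andbT -(fsetD1K wG) fsubUset fsub1set wH rH.
Qed.

Lemma link_del X v w : v != w -> link (del X w) [fset v] = del (link X [fset v]) w.
Proof.
move=> vw; apply/fsetP => G; rewrite in_del !in_link in_del in_fset1U negb_or eq_sym vw /=.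
by rewrite andbA.
Qed.

Lemma del_notin X w : w \notin vertices X -> del X w = X.
Proof.
move=> wX; apply/fsetP => G; rewrite in_del; case: (boolP (G \in X)) => //= GX.
by apply: contra wX => wG; apply/mem_vertices; exists G.
Qed.

Lemma normal1_fnum X : normal 1 X -> fnum X 1 = 2.
Proof.
move=> nX; case: (nX) => X0 pX _ _; have [G GX] := fset0Pn _ X0.
have [H [HX _ HG hE]] := normal_ridge nX (cardfs0 _) isT GX (fsub0set G).
rewrite /fnum; have -> : cells X 1 = [fset G; H].
  apply/fsetP => s; rewrite in_cells !inE; apply/andP/orP => [[sX /eqP cs]|].
    have sX' := cx_card pX sX cs.
    by case: (hE s sX' (fsub0set s)) => ->; rewrite eqxx; [left|right].
  by case=> /eqP ->; rewrite cx_facet // pX.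
by rewrite cardfs2 eq_sym HG.
Qed.

Lemma normal_linkv k X v : normal k.+2 X -> v \in vertices X -> normal k.+1 (link X [fset v]).
Proof. exact: normal_size1. Qed.

Lemma normal2_fnum X : normal 2 X -> fnum X 2 = #|` vertices X|.
Proof.
move=> nX; have := fnum_sum X 1; rewrite (eq_big_seq (fun _ => 2)) => [|v vX].
  by rewrite sum_const_fset => /eqP; rewrite eqn_pmul2l // => /eqP.
by apply: normal1_fnum; exact: normal_linkv.
Qed.

Lemma edges_sum X : 2 * fnum X 2 = \sum_(v <- vertices X) #|` vertices (link X [fset v])|.
Proof. by rewrite fnum_sum; apply: eq_bigr => v _; rewrite fnum1. Qed.

Lemma normal3_fnum X : normal 3 X -> 3 * fnum X 3 = 2 * fnum X 2.
Proof.
move=> nX; rewrite edges_sum fnum_sum; apply: eq_big_seq => v vX.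
by rewrite normal2_fnum //; exact: normal_linkv.
Qed.

Lemma fnum_del d X w k : normal d X -> 1 < d ->
  fnum X k.+1 = fnum (del X w) k.+1 + fnum (link X [fset w]) k.
Proof.
move=> nX d1; rewrite fnum_link /fnum -(cardfsID [fset s in cells X k.+1 | w \in s]) addnC.
congr (_ + _); congr #|` _|; apply/fsetP => s.
  rewrite in_fsetD in_sep !in_cells (in_cx_del _ _ nX d1).
  by case: (s \in cx X); case: (w \in s); case: (_ == _).
rewrite in_fsetI !in_sep.
by case: (s \in cx X); case: (w \in s); case: (_ == _).
Qed.

End FaceNumbers.

(** * Edges needed outside a set of vertices *)

Section EdgeBounds.
Local Open Scope fset_scope.
Local Open Scope nat_scope.
Variables (R : realType) (T : choiceType).
Implicit Types (A B D G H V W r s t : {fset T}) (C Z K X : {fset {fset T}}) (u v w x : T).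

Definition edges_off X V := #|` [fset e in cells X 2 | ~~ (e `<=` V)]|.
Definition edges_in X V := #|` [fset e in cells X 2 | e `<=` V]|.

Lemma edges_split X V : fnum X 2 = edges_in X V + edges_off X V.
Proof.
rewrite /edges_in /edges_off !card_sep -big_split /= /fnum card_fset_sum1.
by apply: eq_bigr => e _; case: (e `<=` V).
Qed.

Lemma sub_card A k : k <= #|` A| -> exists2 B, B `<=` A & #|` B| = k.
Proof.
elim: k => [|k IH] h; first by exists fset0; rewrite ?fsub0set ?cardfs0.
have [B BA cB] := IH (ltnW h).
have [x] : exists x, x \in A `\` B.
  by apply/fset0Pn; rewrite -cardfs_gt0 cardfsDS // cB subn_gt0.
rewrite inE => /andP[xB xA]; exists (x |` B); first by rewrite fsubUset fsub1set xA.
by rewrite cardfsU1 xB cB.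
Qed.

(** With all of V pinned, each remaining vertex has [d.+2] degrees of freedom that only edges not
    inside V can remove. *)
Lemma closed_edges d X V : 0 < d -> mincycle d.+2 X -> V `<=` vertices X -> d.+2 <= #|` V| ->
  d.+2 * #|` vertices X `\` V| <= edges_off X V.
Proof.
move=> d0 mX VX cV; have [_ pX _ _] := mX.
have [A AV cA] := sub_card cV.
have [p gp] := mincycle_rigid R d0 mX.
have [q [_ [G _ [_ rq]] iA]] := line_open_meet (@line_closedT R T d.+3) (line_open_grigid pX)
  (@line_open_indep _ _ d.+3 A) (ex_intro2 _ _ p I gp)
  (ex_intro2 _ _ _ I (indep_ex (leq_trans (eq_leq cA) (leqnSn _)))).
have := rigid_count rq VX AV (fsubset_refl V) cA iA (or_introl (fsubset_refl V)).
by rewrite leq_add2r.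
Qed.

Section Flat.
Variables (d : nat) (X : {fset {fset T}}) (w : T).
Hypotheses (d0 : 0 < d) (nX : normal d.+3 X) (wX : w \in vertices X) (iw : induced_link X w).

Lemma flat_edges V : V `<=` vertices (del X w) -> d.+3 <= #|` V| ->
  d.+3 * #|` vertices (del X w) `\` V| <= edges_off (del X w) V.
Proof.
move=> VX cV; have [p [Lp ip rp]] := flat_rigid R d0 nX wX iw.
have [A AV cA] := sub_card cV.
have iA : indep A p.
  by apply: ip cA; apply: fsubset_trans AV _; rewrite -(vertices_del w nX).
have := rigid_count rp VX AV (fsubset_refl V) cA iA (or_introl (fsubset_refl V)).
by rewrite leq_add2r.
Qed.

(** Pinning [d.+3] vertices of V in coordinate 0 is enough to exclude trivial motions. Each other
    vertex of V can still leave the hyperplane, so it must be held by one more edge not inside V;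
    this surplus is absent from [flat_edges]. *)
Lemma flat_edges_facet V : V `<=` vertices (link X [fset w]) -> d.+3 <= #|` V| ->
  d.+3 * #|` vertices (del X w) `\` V| + #|` V| <= edges_off (del X w) V + d.+3.
Proof.
move=> VF cV; have [p [Lp ip rp]] := flat_rigid R d0 nX wX iw.
have [A AV cA] := sub_card cV.
have VX : V `<=` vertices (del X w).
  rewrite (vertices_del w nX) //; apply: fsubset_trans VF _.
  apply/fsubsetP => x xF; rewrite !inE (fsubsetP (vertices_link_sub _ _) _ xF) andbT.
  by move: xF; rewrite vertices_link inE => /andP[].
have iA : indep A p.
  by apply: ip cA; apply: fsubset_trans AV _; rewrite -(vertices_del w nX).
have fl b : b \in V -> p b ord0 ord0 = 0%R by move=> /(fsubsetP VF); exact: Lp.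
by have := rigid_count rp VX (fsubset_refl A) AV cA iA (or_intror fl); rewrite cA.
Qed.

End Flat.
End EdgeBounds.

(** * The lower bound for all face numbers *)

Section LowerBound.
Local Open Scope fset_scope.
Local Open Scope nat_scope.
Variables (R : realType) (T : choiceType).
Implicit Types (A B D G H V W r s t : {fset T}) (C Z K X : {fset {fset T}}) (u v w x : T).

Lemma normal_vertices_gt k X : normal k.+1 X -> k.+1 < #|` vertices X|.
Proof.
move=> nX; case: (nX) => X0 pX cX _; have [G GX] := fset0Pn _ X0.
have [x xG] : exists x, x \in G by apply/fset0Pn; rewrite -cardfs_gt0 pX.
have cr : #|` G `\ x| = k by have := cardfsD1 x G; rewrite xG pX // add1n => -[].
have [H [HX rH HG]] := par_other (cX _ cr) GX (fsubD1set _ _).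
rewrite -(pX G GX); apply: fproper_ltn_card; rewrite fproperE sub_vertices //=.
apply/negP => VG; case/negP: HG; rewrite eqEfcard (pX _ HX) (pX _ GX) leqnn andbT.
exact: fsubset_trans (sub_vertices HX) VG.
Qed.

Lemma link_swap X u v : u != v ->
  link (link X [fset u]) [fset v] = link (link X [fset v]) [fset u].
Proof. by move=> uv; rewrite !link_link ?fdisjoint1X ?inE // 1?fsetUC // eq_sym. Qed.

Lemma vertices_link1 X w v : (v \in vertices (link X [fset w])) = (v != w) && ([fset v; w] \in cx X).
Proof. by rewrite vertices_link inE. Qed.

Lemma vertices_linkC X w v :
  (v \in vertices (link X [fset w])) = (w \in vertices (link X [fset v])).
Proof. by rewrite !vertices_link1 eq_sym fsetUC. Qed.

Lemma induced_link_link X v w : induced_link X w -> v \in vertices (link X [fset w]) ->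
  induced_link (link X [fset v]) w.
Proof.
move=> iw vF s sL sF; rewrite cx_link fdisjoint1X in sL; case/andP: sL => vs vsX.
have vw : v != w by move: vF; rewrite vertices_link1 => /andP[].
rewrite cx_link fdisjoint1X in_fset1U negb_or vw vs /= fsetUCA.
apply: iw => //; rewrite fsubUset fsub1set vF /=; apply/fsubsetP => x /(fsubsetP sF).
rewrite link_swap // => /(fsubsetP (vertices_link_sub _ _)); by [].
Qed.

(** The number of faces with j vertices gained by stacking over a facet with d vertices; for j = d
    the d new facets replace one old facet. *)
Definition excess_coef d j := if j == d then d.-1 else 'C(d, j.-1).

(* The correction due to the facet removed with w, whose link has a vertices. *)
Definition facet_defect d j X w : nat :=
  let a := #|` vertices (link X [fset w])| in
  if w \in vertices X then (j == d.-1) * (a - d) + (j == d) * (a - d).+1 else 0.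

(** With n vertices the bound is C(d+1, j) + (n - d - 1) [excess_coef d j], the count for a simplex
    stacked n - d - 1 times. Terms are moved across to avoid truncated subtraction. *)
Definition bounded d j X w : Prop :=
  'C(d.+1, j) + #|` vertices (del X w)| * excess_coef d j <=
    fnum (del X w) j + facet_defect d j X w + d.+1 * excess_coef d j.

Lemma sum_excess X w : \sum_(v <- vertices (del X w)) #|` vertices (link (del X w) [fset v])| =
  2 * fnum (del X w) 2.
Proof. by rewrite edges_sum. Qed.

Lemma card_ksubsets A k : #|` [fset s in fpowerset A | #|` s| == k]| = 'C(#|` A|, k).
Proof.
elim: {A}#|` A| {-2}A (erefl #|` A|) k => [|n IH] A cA k.
  rewrite (cardfs0_eq cA) cardfs0 bin0n; case: k => [|k].
    have -> : [fset s in fpowerset fset0 | #|` s| == 0] = [fset (fset0 : {fset T})].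
      apply/fsetP => s; rewrite in_sep in_fset1 fpowersetE fsubset0.
      by case: eqP => // ->; rewrite cardfs0.
    by rewrite cardfs1.
  apply/eqP; rewrite cardfs_eq0 -fsubset0; apply/fsubsetP => s.
  by rewrite in_sep fpowersetE fsubset0 => /andP[/eqP -> ]; rewrite cardfs0.
have [x xA] : exists x, x \in A by apply/fset0Pn; rewrite -cardfs_gt0 cA.
have cB : #|` A `\ x| = n by have := cardfsD1 x A; rewrite xA cA add1n => -[].
case: k => [|k].
  have -> : [fset s in fpowerset A | #|` s| == 0] = [fset (fset0 : {fset T})].
    apply/fsetP => s; rewrite in_sep in_fset1 fpowersetE cardfs_eq0.
    by case: eqP => [->|]; rewrite ?fsub0set ?andbF.
  by rewrite cardfs1 bin0.
have e1 := IH _ cB k; have e2 := IH _ cB k.+1; rewrite cB in e1 e2.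
rewrite cA binS -e1 -e2 -(cardfsID [fset s in fpowerset A | x \in s]) addnC.
congr (_ + _).
  congr #|` _|; apply/fsetP => s; rewrite in_fsetD !in_sep !fpowersetE fsubsetD1.
  by case: (s `<=` A); case: (x \in s); case: (_ == _).
have -> : [fset s in fpowerset A | #|` s| == k.+1] `&` [fset s in fpowerset A | x \in s] =
   [fset x |` s | s in [fset s in fpowerset (A `\ x) | #|` s| == k]].
  apply/fsetP => s; rewrite in_fsetI !in_sep fpowersetE; apply/idP/imfsetP => [|[t /=]].
    move=> /andP[/andP[sA cs] /andP[_ xs]]; exists (s `\ x); last by rewrite fsetD1K.
    rewrite /= in_sep fpowersetE fsetSD //=.
    by have := cardfsD1 x s; rewrite xs (eqP cs) add1n => -[->].
  rewrite in_sep fpowersetE fsubsetD1 => /andP[/andP[tA xt] /eqP ct] ->.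
  by rewrite fsubUset fsub1set xA tA cardfsU1 xt ct add1n eqxx !inE eqxx.
rewrite card_in_imfset //= => s t; rewrite !in_sep !fpowersetE !fsubsetD1.
by move=> /andP[/andP[_ xs] _] /andP[/andP[_ xt] _] e; rewrite -(fsetU1K xs) e fsetU1K.
Qed.

Lemma edges_in_facet d X G : 1 < d -> pure d X -> G \in X -> edges_in X G = 'C(d, 2).
Proof.
move=> d1 pX GX; rewrite -(pX G GX) -card_ksubsets; congr #|` _|; apply/fsetP => s.
rewrite !in_sep fpowersetE; case: (boolP (s `<=` G)) => sG; rewrite ?andbF ?andbT //=.
have -> // : s \in cx X by apply/in_cx; exists G.
Qed.

(** The bound d n - C(d+1, 2) on edges, from [closed_edges] with V a facet, since a facet spans all
    its pairs. *)
Lemma closed_excess k X : mincycle k.+3 X -> k.+3 * #|` vertices X| <= fnum X 2 + 'C(k.+4, 2).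
Proof.
move=> nX; case: (nX) => X0 pX cX _; have [G GX] := fset0Pn _ X0.
have := closed_edges R (ltn0Sn k) nX (sub_vertices GX); rewrite pX // => /(_ (leqnn _)).
rewrite cardfsDS ?sub_vertices // (pX G GX) (edges_split X G) (edges_in_facet _ pX GX) //.
have h2 := card_vertices pX X0; rewrite mulnBr leq_subLR.
have : k.+3 * k.+3 = 'C(k.+3, 2) + 'C(k.+4, 2).
  by rewrite [X in _ + X]binS bin1; have := mul_bin_diag k.+3 1; rewrite bin1 /=; nia.
lia.
Qed.

Lemma del_facet k X w : normal k.+2 X -> exists2 G, G \in X & w \notin G.
Proof.
move=> nX; case: (nX) => X0 pX cX _; have [G GX] := fset0Pn _ X0.
case: (boolP (w \in G)) => wG; last by exists G.
have cr : #|` G `\ w| = k.+1 by have := cardfsD1 w G; rewrite wG pX // add1n => -[].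
have [H [HX rH HG]] := par_other (cX _ cr) GX (fsubD1set _ _).
exists H => //; apply: contra HG => wH.
by rewrite eq_sym eqEfcard (pX _ HX) (pX _ GX) leqnn andbT -(fsetD1K wG) fsubUset fsub1set wH rH.
Qed.

Lemma flat_excess k X w : normal k.+4 X -> w \in vertices X -> induced_link X w ->
  k.+4 * #|` vertices (del X w)| <= fnum (del X w) 2 + 'C(k.+4.+1, 2).
Proof.
move=> nX wX iw; case: (nX) => X0 pX cX _; have [G GX wG] := del_facet w nX.
have GD : G \in del X w by rewrite in_del GX.
have pD : pure k.+4 (del X w) by move=> H; rewrite in_del => /andP[/pX].
have := flat_edges R (ltn0Sn k) nX wX iw (sub_vertices GD); rewrite pX // => /(_ (leqnn _)).
rewrite cardfsDS ?sub_vertices // (pX G GX) (edges_split (del X w) G) (edges_in_facet _ pD GD) //.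
have h2 : k.+4 <= #|` vertices (del X w)|.
  by rewrite -(pX G GX); apply: fsubset_leq_card; exact: sub_vertices.
rewrite mulnBr leq_subLR.
have : k.+4 * k.+4 = 'C(k.+4, 2) + 'C(k.+4.+1, 2).
  by rewrite [X in _ + X]binS bin1; have := mul_bin_diag k.+4 1; rewrite bin1 /=; nia.
lia.
Qed.

Lemma link_edges d X w : normal d X -> 1 < d ->
  fnum (link X [fset w]) 2 <= edges_in (del X w) (vertices (link X [fset w])).
Proof.
move=> nX d1; apply: fsubset_leq_card; apply/fsubsetP => e eL; rewrite in_sep.
have := eL; rewrite !in_cells => /andP[eL' ->]; rewrite andbT (cx_vertices eL') andbT.
rewrite (in_cx_del _ _ nX d1); have := eL'; rewrite cx_link fdisjoint1X => /andP[-> h].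
by rewrite andbT; apply: cx_sub h; exact: fsubsetUr.
Qed.

(** The surplus in [flat_edges_facet], with V the whole link of w, controls the edges of that link.
    Their number is what the corrections of the vertex links add up to. *)
Lemma link_edges_bound k X w : normal k.+4 X -> w \in vertices X -> induced_link X w ->
  fnum (link X [fset w]) 2 + k.+4 * #|` vertices (del X w)| + #|` vertices (link X [fset w])| <=
  fnum (del X w) 2 + k.+4 * #|` vertices (link X [fset w])| + k.+4.
Proof.
move=> nX wX iw; set F := vertices (link X [fset w]).
have nL : normal k.+3 (link X [fset w]) by exact: normal_linkv.
have cF : k.+4 <= #|` F| by exact: normal_vertices_gt.
have FV : F `<=` vertices (del X w).
  rewrite (vertices_del w nX) //; apply/fsubsetP => x xF; rewrite in_fsetD1.
  rewrite (fsubsetP (vertices_link_sub _ _) _ xF) andbT.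
  by move: xF; rewrite /F vertices_link1 => /andP[].
have := flat_edges_facet R (ltn0Sn k) nX wX iw (fsubset_refl F) cF.
have := link_edges w nX isT; rewrite -/F.
rewrite (edges_split (del X w) F) cardfsDS //; have := fsubset_leq_card FV; nia.
Qed.

(** Only vertices in the link of w contribute, and the degrees inside this link sum to twice its
    edges. *)
Lemma sum_facet_defect k X w j : normal k.+4 X -> w \in vertices X ->
  \sum_(v <- vertices (del X w)) facet_defect k.+3 j (link X [fset v]) w +
    ((j == k.+2) + (j == k.+3)) * (k.+3 * #|` vertices (link X [fset w])|) =
  ((j == k.+2) + (j == k.+3)) * (2 * fnum (link X [fset w]) 2) +
    (j == k.+3) * #|` vertices (link X [fset w])|.
Proof.
move=> nX wX; set F := vertices (link X [fset w]).
have nL : normal k.+3 (link X [fset w]) by exact: normal_linkv.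
have FV : F `<=` vertices (del X w).
  rewrite (vertices_del w nX) //; apply/fsubsetP => x xF; rewrite in_fsetD1.
  rewrite (fsubsetP (vertices_link_sub _ _) _ xF) andbT.
  by move: xF; rewrite /F vertices_link1 => /andP[].
rewrite -(big_fset_incl _ FV) /=; last first.
  by move=> v _ vF; rewrite /facet_defect -vertices_linkC -/F (negbTE vF).
rewrite (eq_big_seq (fun v => ((j == k.+2) + (j == k.+3)) *
   (#|` vertices (link (link X [fset w]) [fset v])| - k.+3) + (j == k.+3))) => [|v vF]; last first.
  rewrite /facet_defect -vertices_linkC -/F vF.
  have vw : v != w by move: vF; rewrite /F vertices_link1 => /andP[].
  rewrite (link_swap X vw) /=; case: (j == k.+2); case: (j == k.+3); rewrite ?mul1n ?mul0n; lia.
rewrite big_split /= -big_distrr /= sum_const_fset.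
have -> : 2 * fnum (link X [fset w]) 2 = \sum_(v <- F)
    (#|` vertices (link (link X [fset w]) [fset v])| - k.+3) + k.+3 * #|` F|.
  rewrite edges_sum -sum_const_fset -big_split /=; apply: eq_big_seq => v vF.
  rewrite subnK //; apply: (@normal_vertices_gt k.+1); exact: normal_linkv.
by rewrite mulnDr; lia.
Qed.

Lemma sum_facet_defect0 k X w j : w \notin vertices X ->
  \sum_(v <- vertices (del X w)) facet_defect k j (link X [fset v]) w = 0.
Proof.
move=> wX; apply: big1_seq => v _; rewrite /facet_defect; case: ifP => // h.
by case/negP: wX; exact: (fsubsetP (vertices_link_sub _ _) _ h).
Qed.

(** The reduction of McMullen, Perles and Walkup: summing over the links counts each face once per
    vertex, and the vertex numbers of the links sum to twice the edges. *)
Lemma sum_bounded k X w j : normal k.+4 X ->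
  (forall v, v \in vertices (del X w) -> bounded k.+3 j (link X [fset v]) w) ->
  #|` vertices (del X w)| * 'C(k.+4, j) + 2 * fnum (del X w) 2 * excess_coef k.+3 j <=
  j.+1 * fnum (del X w) j.+1 +
    \sum_(v <- vertices (del X w)) facet_defect k.+3 j (link X [fset v]) w +
    #|` vertices (del X w)| * (k.+4 * excess_coef k.+3 j).
Proof.
move=> nX h; set V := vertices (del X w).
rewrite -sum_excess fnum_sum big_distrl /= ![#|` V| * _]mulnC -!sum_const_fset -!big_split /=.
rewrite !big_seq; apply: leq_sum => v vV; have := h v vV; rewrite /bounded.
have vw : v != w.
  by move: vV; rewrite /V (vertices_del w nX) // in_fsetD1 => /andP[].
by rewrite link_del // link_del.
Qed.

Lemma card_vertices_del k X w : normal k.+2 X -> w \in vertices X ->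
  #|` vertices X| = (#|` vertices (del X w)|).+1.
Proof. by move=> nX wX; rewrite (vertices_del w nX) // (cardfsD1 w) wX add1n. Qed.

(** The base of the induction on links. The edge bound 3n - 6 and [3 f3 = 2 f2] settle X, and
    deleting w removes exactly as many edges and triangles as its link polygon has vertices. *)
Lemma bounded3 X w j : normal 3 X -> 1 < j <= 3 -> bounded 3 j X w.
Proof.
move=> nX j13; have h := closed_excess (normal_mincycle (ltn0Sn _) nX); have h3 := normal3_fnum nX.
have jE : j = 2 \/ j = 3 by case: j j13 => [|[|[|[|j]]]] //; [left|right].
have [wX|wX] := boolP (w \in vertices X); last first.
  rewrite /bounded /facet_defect (negbTE wX) del_notin // /excess_coef.
  by case: jE => ->; move: h; rewrite /= ?binS ?bin0 ?bin1 ?bin0n /=; lia.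
have nL : normal 2 (link X [fset w]) by exact: normal_linkv.
have cF := normal_vertices_gt nL.
have e2 := fnum_del w 1 nX isT; have e3 := fnum_del w 2 nX isT.
rewrite fnum1 in e2; rewrite normal2_fnum // in e3.
rewrite (card_vertices_del nX wX) in h.
rewrite /bounded /facet_defect wX /excess_coef.
by case: jE => ->; move: h; rewrite /= ?binS ?bin0 ?bin1 ?bin0n /=; lia.
Qed.

(** Here E = C(d, i), c = C(d-1, i-1), B = C(d+1, i+1) and B2 = C(d+1, 2) enter only through their
    recurrences; x is the excess of edges, S the sum of the corrections of the links, and e the
    correction of X. *)
Lemma excess_arith_inner (d i n N2 Nj S E c B2 B x e : nat) :
  i * E = d * c -> i.+1 * B = d.+1 * E -> 2 * B2 = d.+1 * d -> N2 + B2 = d * n + x ->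
  n * E + 2 * N2 * c <= i.+1 * Nj + S + n * (d * c) -> S + 2 * x <= 2 * x * c + i.+1 * e ->
  i.+1 * (B + n * E) + 2 * x <= i.+1 * (Nj + e + d.+1 * E).
Proof.
move=> h1 h2 h3 h4 h5 h6.
have k1 : 2 * N2 * c + 2 * B2 * c = 2 * n * (d * c) + 2 * x * c.
  by rewrite -mulnDl -mulnDr h4; ring.
have k2 : 2 * B2 * c = d.+1 * (i * E) by rewrite h3 h1; ring.
rewrite -h1 in h5 k1; rewrite k2 in k1.
have k3 : i.+1 * (B + n * E) = d.+1 * E + n * E + n * (i * E).
  by rewrite mulnDr h2; ring.
have k4 : i.+1 * (Nj + e + d.+1 * E) = i.+1 * Nj + i.+1 * e + d.+1 * E + d.+1 * (i * E).
  by ring.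
have k5 : 2 * n * (i * E) = n * (i * E) + n * (i * E) by ring.
rewrite k3 k4; lia.
Qed.

Lemma excess_arith_outer (k n N2 Nj S B2 x e : nat) :
  2 * B2 = k.+4.+1 * k.+4 -> N2 + B2 = k.+4 * n + x ->
  n * k.+4 + 2 * N2 * k.+2 <= k.+4 * Nj + S + n * (k.+4 * k.+2) -> S <= 2 * x + k.+4 * e ->
  k.+4 * (k.+4.+1 + n * k.+3) + 2 * x <= k.+4 * (Nj + e + k.+4.+1 * k.+3).
Proof.
move=> h3 h4 h5 h6.
have k1 : 2 * N2 * k.+2 + 2 * B2 * k.+2 = 2 * (k.+4 * n + x) * k.+2.
  by rewrite -mulnDl -mulnDr h4.
rewrite h3 in k1; have x0 := leq0n (x * k); lia.
Qed.

(** The excess x of edges is carried into the conclusion with a factor 2, so that equality for a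
    single index forces x = 0. *)
Lemma excess_step k X w j (x : nat) : normal k.+4 X -> (w \in vertices X -> induced_link X w) ->
  1 < j <= k.+3 ->
  (forall v, v \in vertices (del X w) -> bounded k.+3 j (link X [fset v]) w) ->
  fnum (del X w) 2 + 'C(k.+4.+1, 2) = k.+4 * #|` vertices (del X w)| + x ->
  j.+1 * ('C(k.+4.+1, j.+1) + #|` vertices (del X w)| * excess_coef k.+4 j.+1) + 2 * x <=
  j.+1 * (fnum (del X w) j.+1 + facet_defect k.+4 j.+1 X w + k.+4.+1 * excess_coef k.+4 j.+1).
Proof.
move=> nX iw /andP[j1 jk] hb hx; have := sum_bounded nX hb.
set n := #|` vertices (del X w)|; set S := \sum_(v <- _) _; set e := facet_defect _ _ _ _.
set N2 := fnum _ 2; set Nj := fnum _ j.+1; set B2 := 'C(_, 2) in hx.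
have hB2 : 2 * B2 = k.+4.+1 * k.+4 by rewrite /B2 -mul_bin_diag bin1.
(* The links have corrections only in their top two indices. What e does not cover there is paid by
   the surplus of edges in the flat placement. *)
have hS : S <= 2 * x + j.+1 * e /\ (j < k.+2 -> S = 0).
  have [wX|wX] := boolP (w \in vertices X); last by rewrite /S (sum_facet_defect0 _ _ wX).
  have nL : normal k.+3 (link X [fset w]) by exact: normal_linkv.
  have cF := normal_vertices_gt nL.
  have h1 := sum_facet_defect j nX wX; have h2 := link_edges_bound nX wX (iw wX).
  rewrite -/S in h1; rewrite -/N2 -/n in h2; move: h1 h2 cF.
  rewrite /e /facet_defect wX !eqSS /=.
  set a := #|` _|; set M := fnum _ 2.
  have [jE|jE] := eqVneq j k.+2; have [jE'|jE'] := eqVneq j k.+3; try by lia.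
  - move=> h1 h2 cF; split; last by lia.
    rewrite jE in h1 *; nia.
  - move=> h1 h2 cF; split; last by lia.
    rewrite jE' in h1 *; nia.
have [jE|jE] := eqVneq j k.+3.
  rewrite /excess_coef !jE !eqxx /= => h; have [h1 _] := hS; rewrite jE in h1.
  rewrite !binSn in h *; exact: (excess_arith_outer hB2 hx h h1).
rewrite /excess_coef eqSS (negbTE jE) => h.
have h0 : 0 < 'C(k.+3, j.-1) by rewrite bin_gt0; lia.
have bj : j * 'C(k.+4, j) = k.+4 * 'C(k.+3, j.-1).
  by case: j j1 {jk hb S hS h jE h0 e Nj} => // j _; rewrite -mul_bin_diag.
apply: (excess_arith_inner (N2 := N2) (S := S) bj _ hB2 hx h).
  by rewrite -mul_bin_diag.
have [h1 h2] := hS; case: (ltnP j k.+2) => jk2.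
  rewrite h2 // add0n; apply: leq_trans (leq_addr _ _); exact: leq_pmulr.
(* Here j = k + 2. A coefficient of at least 2 covers both the corrections of the links and the 2 x
   to be kept. *)
have h3 : 2 <= 'C(k.+3, j.-1).
  have -> : j.-1 = k.+1 by lia.
  by rewrite binS binSn; lia.
have : 2 * x * 2 <= 2 * x * 'C(k.+3, j.-1) by rewrite leq_mul2l h3 orbT.
lia.
Qed.

Lemma excess_ge0 k X w : normal k.+4 X -> (w \in vertices X -> induced_link X w) ->
  exists x : nat, fnum (del X w) 2 + 'C(k.+4.+1, 2) = k.+4 * #|` vertices (del X w)| + x.
Proof.
move=> nX iw; have le : k.+4 * #|` vertices (del X w)| <= fnum (del X w) 2 + 'C(k.+4.+1, 2).
  have [wX|wX] := boolP (w \in vertices X); first by apply: flat_excess => //; exact: iw.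
  rewrite del_notin //; exact: (closed_excess (normal_mincycle (ltn0Sn _) nX)).
by exists (fnum (del X w) 2 + 'C(k.+4.+1, 2) - k.+4 * #|` vertices (del X w)|); rewrite subnKC.
Qed.

(** Induction through links: [induced_link] is inherited by the links of the neighbours of w, and
    the link of any other vertex does not contain w. *)
Theorem bounded_normal k X w j : normal k.+3 X -> (w \in vertices X -> induced_link X w) ->
  1 < j <= k.+3 -> bounded k.+3 j X w.
Proof.
elim: k X j => [|k IH] X j nX iw; first exact: bounded3.
case: j => [//|j] /andP[j1 jk].
have [x hx] := excess_ge0 nX iw.
case: (ltnP 1 j) => j2; last first.
  have -> : j = 1 by lia.
  rewrite /bounded /excess_coef /= bin1; have := hx.
  have : 2 * 'C(k.+4.+1, 2) = k.+4.+1 * k.+4 by rewrite -mul_bin_diag bin1.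
  by rewrite [X in _ -> _ -> is_true (_ <= X)]addnAC; nia.
have hb v : v \in vertices (del X w) -> bounded k.+3 j (link X [fset v]) w.
  rewrite (vertices_del w nX) // in_fsetD1 => /andP[vw vX].
  apply: IH; rewrite ?j2 ?jk //; first exact: normal_linkv.
  rewrite -vertices_linkC => vF; apply: induced_link_link => //; apply: iw.
  by move: vF; rewrite vertices_linkC; exact: (fsubsetP (vertices_link_sub _ _)).
have j2k : 1 < j <= k.+3 by rewrite j2.
have := excess_step nX iw j2k hb hx; rewrite /bounded.
by move=> h; rewrite -(leq_pmul2l (ltn0Sn j)); apply: leq_trans h; exact: leq_addr.
Qed.

Theorem bounded_eq k X w j : normal k.+4 X -> (w \in vertices X -> induced_link X w) ->
  1 < j <= k.+4 ->
  'C(k.+4.+1, j) + #|` vertices (del X w)| * excess_coef k.+4 j =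
    fnum (del X w) j + facet_defect k.+4 j X w + k.+4.+1 * excess_coef k.+4 j ->
  fnum (del X w) 2 + 'C(k.+4.+1, 2) = k.+4 * #|` vertices (del X w)|.
Proof.
move=> nX iw; case: j => [//|j] /andP[j1 jk] e.
have [x hx] := excess_ge0 nX iw.
case: (ltnP 1 j) => j2; last first.
  have j1' : j = 1 by lia.
  move: e; rewrite j1' /excess_coef /facet_defect /= bin1.
  have : 2 * 'C(k.+4.+1, 2) = k.+4.+1 * k.+4 by rewrite -mul_bin_diag bin1.
  by case: (w \in vertices X) => /=; nia.
have hb v : v \in vertices (del X w) -> bounded k.+3 j (link X [fset v]) w.
  rewrite (vertices_del w nX) // in_fsetD1 => /andP[vw vX].
  apply: bounded_normal; rewrite ?j2 ?jk //; first exact: normal_linkv.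
  rewrite -vertices_linkC => vF; apply: induced_link_link => //; apply: iw.
  by move: vF; rewrite vertices_linkC; exact: (fsubsetP (vertices_link_sub _ _)).
have j2k : 1 < j <= k.+3 by rewrite j2.
have := excess_step nX iw j2k hb hx; rewrite e.
by rewrite -[X in _ <= X]addn0 leq_add2l; lia.
Qed.

End LowerBound.

(** * The case of equality *)

Section Sparse.
Local Open Scope fset_scope.
Local Open Scope nat_scope.
Variables (R : realType) (T : choiceType).
Implicit Types (A B D G H V W r s t e : {fset T}) (C Z K X : {fset {fset T}}) (u v w x y : T).

(** Maxwell's count for sets of edges that are independent in the generic rigidity matroid of
    R^m. *)
Definition sparse m X : Prop := forall V, V `<=` vertices X -> m < #|` V| ->
  edges_in X V + 'C(m.+1, 2) <= m * #|` V|.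

Lemma in_link_cx C v s : s \in cx (link C [fset v]) -> s \in cx C.
Proof. by rewrite cx_link => /andP[_]; apply: cx_sub; exact: fsubsetUr. Qed.

Lemma edges_in_cone C v V : v \notin V -> V `<=` vertices (link C [fset v]) ->
  edges_in C (v |` V) = #|` V| + edges_in C V.
Proof.
move=> vV VL; rewrite /edges_in -(cardfsID [fset e in cells C 2 | v \in e]).
congr (_ + _).
  have <- : #|` [fset [fset v; x] | x in V]| = #|` V|.
    apply: card_imfset => x y /= exy; apply/eqP; case: (eqVneq x v) => xv.
      have : y \in [fset v; x] by rewrite exy fset22.
      by rewrite !inE xv orbb eq_sym.
    have : x \in [fset v; y] by rewrite -exy fset22.
    by rewrite !inE (negbTE xv).
  congr #|` _|; apply/fsetP => e; apply/idP/imfsetP => [|[x /= xV ->]]; last first.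
    have := fsubsetP VL x xV; rewrite vertices_link1 => /andP[xv h].
    rewrite in_fsetI !in_sep fsetUC h /= cardfs2 xv !inE eqxx !orbT !andbT /=.
    by rewrite fsubUset !fsub1set !inE xV eqxx !orbT.
  rewrite in_fsetI !in_sep => /andP[/andP[/andP[eC /eqP ce] eV] /andP[_ ve]].
  have /eqP/cardfs1P[x ex] : #|` e `\ v| = 1 by have := cardfsD1 v e; rewrite ve ce add1n => -[].
  have : x \in e `\ v by rewrite ex inE.
  rewrite in_fsetD1 => /andP[xv xe]; exists x.
    by have := fsubsetP eV x xe; rewrite in_fset1U (negbTE xv).
  by rewrite -(fsetD1K ve) ex.
congr #|` _|; apply/fsetP => e; rewrite in_fsetD !in_sep.
case: (boolP (e \in cx C)) => //= eC; case: (#|` e| == 2); rewrite //= andbC.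
have [ve|ve] /= := boolP (v \in e).
  by rewrite andbF; apply/esym/negbTE; apply: contra vV => /fsubsetP; exact.
rewrite andbT; apply/idP/idP => [/fsubsetP h|h]; last exact: fsubset_trans h (fsubsetUr _ _).
by apply/fsubsetP => x xe; have := h x xe; rewrite !inE => /predU1P[xv|//]; rewrite -xv xe in ve.
Qed.

Lemma edges_in_link C v V : edges_in (link C [fset v]) V <= edges_in C V.
Proof.
apply: fsubset_leq_card; apply/fsubsetP => e; rewrite !in_sep => /andP[/andP[eL ->] ->].
by rewrite !andbT; exact: in_link_cx eL.
Qed.

Lemma edges_in_all C : edges_in C (vertices C) = fnum C 2.
Proof.
congr #|` _|; apply/fsetP => e; rewrite in_sep; apply/andP/idP => [[]//|eC]; split=> //.
by move: eC; rewrite in_cells => /andP[/cx_vertices].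
Qed.

Lemma binS2 m : 'C(m.+1, 2) = m + 'C(m, 2).
Proof. by rewrite binS bin1 addnC. Qed.

(** Coning V from v adds |V| edges, which is exactly the difference between the bound for m + 1 on
    |V| + 1 vertices and the bound for m on |V| vertices. *)
Lemma sparse_link m C v : sparse m.+1 C -> v \in vertices C -> sparse m (link C [fset v]).
Proof.
move=> sC vC V VL cV; have vV : v \notin V.
  by apply/negP => /(fsubsetP VL); rewrite vertices_link1 eqxx.
have := sC (v |` V); rewrite fsubUset fsub1set vC cardfsU1 vV edges_in_cone //=.
rewrite (fsubset_trans VL (vertices_link_sub _ _)) add1n ltnS => /(_ isT cV).
have := edges_in_link C v V; rewrite (binS2 m.+1) !mulSn mulnS; lia.
Qed.

Lemma cx_fset0 C : C != fset0 -> fset0 \in cx C.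
Proof. by case/fset0Pn => G GC; apply/in_cx; exists G => //; exact: fsub0set. Qed.

Lemma missing_link C A v : missing_face #|` A| (cx C) A -> v \in A -> 1 < #|` A| ->
  missing_face #|` A `\ v| (cx (link C [fset v])) (A `\ v) /\ v \in vertices C.
Proof.
move=> [_ AC h] vA cA; split; last first.
  rewrite -cx1; apply: h; rewrite fproperEcard fsub1set vA cardfs1 cA //.
split=> //; first by rewrite cx_link fdisjoint1X !inE eqxx fsetD1K // (negbTE AC) andbF.
move=> B; rewrite fproperE => /andP[BA AB].
have vB : v \notin B by apply/negP => /(fsubsetP BA); rewrite !inE eqxx.
rewrite cx_link fdisjoint1X vB /=; apply: h; rewrite fproperE fsubUset fsub1set vA /=.
rewrite (fsubset_trans BA (fsubD1set _ _)) /=; apply: contra AB => /fsubsetP AB.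
apply/fsubsetP => x; rewrite in_fsetD1 => /andP[xv xA]; have := AB x xA.
by rewrite !inE (negbTE xv).
Qed.

(* The star of a vertex is already rigid, so an edge of C between two neighbours of
   v, not in the link of v, would be one edge too many. *)
Lemma no_chord k C v e : normal k.+4 C -> sparse k.+4 C -> v \in vertices C ->
  e \in cells C 2 -> e `<=` vertices (link C [fset v]) -> e \in cx (link C [fset v]).
Proof.
move=> nC sC vC eC eV; apply: contraT => eL.
have nL := normal_linkv nC vC; set L := link C [fset v] in nL eV eL.
have cV := normal_vertices_gt nL.
have vV : v \notin vertices L by rewrite vertices_link1 eqxx.
have := sC (v |` vertices L); rewrite fsubUset fsub1set vC vertices_link_sub.
rewrite cardfsU1 vV add1n ltnS => /(_ isT cV); rewrite edges_in_cone //.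
have := closed_excess R (normal_mincycle (ltn0Sn _) nL).
have : fnum L 2 < edges_in C (vertices L).
  rewrite -edges_in_all; apply: fproper_ltn_card; rewrite fproperE; apply/andP; split.
    apply/fsubsetP => e'; rewrite !in_sep => /andP[/andP[eL' ->] ->].
    by rewrite !andbT; exact: in_link_cx eL'.
  apply/negP => /fsubsetP /(_ e); rewrite !in_sep eV (negbTE eL).
  by move: eC; rewrite in_cells => /andP[-> ->] /(_ isT).
by rewrite (binS2 k.+4) mulnS; lia.
Qed.

(** In the link of one of its vertices a missing face becomes a missing face with one vertex less.
    Repetition leads to a missing triangle, whose side opposite v is a chord of the link of v. Each
    link also shrinks the facets, and the bound |A| < [k.+4] keeps them at four vertices or more, as
    [no_chord] demands. *)
Lemma no_missing_small k C A : normal k.+4 C -> sparse k.+4 C -> 2 < #|` A| < k.+4 ->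
  ~ missing_face #|` A| (cx C) A.
Proof.
have base j B X : normal j.+4 X -> sparse j.+4 X -> #|` B| = 3 -> ~ missing_face #|` B| (cx X) B.
  move=> nX sX cB mB; have [v vB] : exists v, v \in B by apply/fset0Pn; rewrite -cardfs_gt0 cB.
  have c1 : 1 < #|` B| by rewrite cB.
  have [[_ nBL hL] vX] := missing_link mB vB c1.
  have c2 : #|` B `\ v| = 2 by have := cardfsD1 v B; rewrite vB cB add1n => -[].
  case/negP: nBL; apply: (no_chord nX sX vX).
    rewrite in_cells c2 andbT; case: mB => _ _; apply.
    by rewrite fproperEcard fsubD1set /= c2 cB.
  apply/fsubsetP => x xB; rewrite -cx1; apply: hL.
  by rewrite fproperEcard fsub1set xB cardfs1 c2.
elim: k C A => [|k IH] C A nC sC cA mA; first by apply: (base _ A _ nC sC) mA; lia.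
case: (eqVneq #|` A| 3) => c3; first exact: (base _ A _ nC sC) mA.
have [v vA] : exists v, v \in A by apply/fset0Pn; rewrite -cardfs_gt0; lia.
have c1 : 1 < #|` A| by lia.
have [mL vC] := missing_link mA vA c1.
have cAv : #|` A| = (#|` A `\ v|).+1 by rewrite (cardfsD1 v) vA add1n.
by apply: (IH _ _ (normal_linkv nC vC) (sparse_link sC vC) _ mL); lia.
Qed.

Definition clique C B : Prop :=
  B `<=` vertices C /\ forall e, e `<=` B -> #|` e| = 2 -> e \in cx C.

Lemma cliqueS C B D : D `<=` B -> clique C B -> clique C D.
Proof.
move=> DB [BV h]; split; first exact: fsubset_trans BV.
by move=> e eD; apply: h; exact: fsubset_trans DB.
Qed.

Lemma clique_face m C B : C != fset0 ->
  (forall A, 2 < #|` A| <= m -> ~ missing_face #|` A| (cx C) A) ->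
  clique C B -> #|` B| <= m -> B \in cx C.
Proof.
move=> C0 nm; elim: {B}#|` B| {-2}B (leqnn #|` B|) => [|n IH] B cB qB cm.
  by move: cB; rewrite leqn0 => /eqP /cardfs0_eq ->; exact: cx_fset0.
case: (ltnP 2 #|` B|) => c2; last first.
  case: (qB) => BV h; case E: #|` B| c2 => [|[|[|c]]] // _; last exact: h.
    by rewrite (cardfs0_eq E); exact: cx_fset0.
  by move/eqP/cardfs1P: E BV => [x ->]; rewrite fsub1set cx1.
apply: contrapT => BC; apply: (nm B); rewrite ?c2 //; split=> //; first exact/negP.
move=> D DB; have lt := fproper_ltn_card DB; apply: IH; first by lia.
  by apply: cliqueS qB; exact: fproper_sub.
by lia.
Qed.

(** The boundary of a simplex is a nonempty cycle, so a minimal cycle that contains it equals it. *)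
Lemma simplex_facets m C B : mincycle m.+1 C -> #|` B| = m.+2 ->
  (forall x, x \in B -> B `\ x \in C) -> C = [fset B `\ x | x in B].
Proof.
move=> [C0 pC cC mC] cB h; set Z := [fset _ | _ in _].
have ZC : Z `<=` C by apply/fsubsetP => _ /imfsetP[x /= xB ->]; exact: h.
case: (mC Z ZC) => [r cr|Z0|//]; last first.
  have /fset0Pn[x xB] : B != fset0 by rewrite -cardfs_gt0 cB.
  by have : B `\ x \in Z; [exact: in_imfset | rewrite Z0 inE].
case: (boolP (r `<=` B)) => rB; last first.
  rewrite par_none // => _ /imfsetP[x /= xB ->]; apply: contra rB => h'.
  exact: fsubset_trans h' (fsubD1set _ _).
rewrite par_card; have -> : star Z r = [fset B `\ x | x in B `\` r].
  apply/fsetP => G; rewrite in_star; apply/andP/imfsetP => [[/imfsetP[x /= xB ->]]|[x /=]].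
    by rewrite fsubsetD1 => /andP[_ xr]; exists x; rewrite // inE xr.
  rewrite inE => /andP[xr xB] ->; split; first exact: in_imfset.
  by rewrite fsubsetD1 rB.
rewrite card_in_imfset /=; first by rewrite cardfsDS // cB cr /= subSn // subSnn.
move=> x y; rewrite !inE => /andP[_ xB] /andP[_ yB] exy; apply/eqP; apply: contraT => xy.
have : x \in B `\ y by rewrite !inE xy.
by rewrite -exy !inE eqxx.
Qed.

Lemma simplex_cx m C B : mincycle m.+1 C -> #|` B| = m.+2 ->
  (forall x, x \in B -> B `\ x \in C) -> cx C = fpowerset B `\ B.
Proof.
move=> mC cB h; have CE := simplex_facets mC cB h; apply/fsetP => s.
rewrite in_fsetD1 fpowersetE; apply/in_cx/andP => [[G]|[sB sub]].
  rewrite CE => /imfsetP[x /= xB ->]; rewrite fsubsetD1 => /andP[sB xs]; split=> //.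
  by apply: contraNneq xs => ->.
have /fsubsetPn[x xB xs] : ~~ (B `<=` s) by move: sB; rewrite eqEfsubset sub.
by exists (B `\ x); [exact: h | rewrite fsubsetD1 sub].
Qed.

(** * Contracting an edge of a sparse complex without missing faces *)

Section Prime.
Variables (k : nat) (C : {fset {fset T}}).
Hypotheses (nC : normal k.+4 C) (sC : sparse k.+4 C).
Hypothesis nm : forall A, 2 < #|` A| <= k.+4 -> ~ missing_face #|` A| (cx C) A.
Hypothesis nq : forall B, clique C B -> #|` B| = k.+4.+1 -> False.

Let C0 : C != fset0. Proof. by case: nC. Qed.
Let pC : pure k.+4 C. Proof. by case: nC. Qed.
Let mC : mincycle k.+4 C. Proof. exact: normal_mincycle nC. Qed.

Lemma clique_edge u v H : u != v -> [fset u; v] \in cx C -> H `\ u \in cx C ->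
  H `\ v \in cx C -> clique C H.
Proof.
move=> uv euv Hu Hv; split.
  apply/fsubsetP => x xH; case: (eqVneq x u) => [->|xu].
    by apply: (fsubsetP (cx_vertices euv)); rewrite fset21.
  by apply: (fsubsetP (cx_vertices Hu)); rewrite !inE xu.
move=> e eH ce; case: (boolP (u \in e)) => ue; last first.
  by apply: cx_sub Hu; rewrite fsubsetD1 eH.
case: (boolP (v \in e)) => ve; last first.
  by apply: cx_sub Hv; rewrite fsubsetD1 eH.
suff <- : [fset u; v] = e by [].
by apply/eqP; rewrite eqEfcard fsubUset !fsub1set ue ve ce cardfs2 uv.
Qed.

Section Edge.
Variables (u v : T).
Hypotheses (uv : u != v) (euv : adjacent C u v).

Let uvC : [fset u; v] \in cx C.
Proof.
by case/adjacentP: euv => G [GC uG vG]; apply/in_cx; exists G; rewrite // fsubUset !fsub1set uG.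
Qed.

Let O := outside u v C.

(** Cliques with at most [k.+4] vertices are faces, so the filling of a relative cycle Z consists of
    facets of C. The completion of Z is then a cycle in C, empty or everything; hence the
    contraction does not split into several pieces. *)
Lemma outside_minrel : minrel k.+2 u v O.
Proof.
have [_ _ cC mmC] := mC.
split; last 1 first.
- move=> Z ZO rZ; have aZ : avoids u v Z := avoidsS ZO (@outside_avoids _ u v C).
  have ZC : Z `<=` C := fsubset_trans ZO (outside_sub _ _ _).
  have cpC : completion k.+2 u v Z `<=` C.
    apply/fsubsetP => H; rewrite inE => /orP[/(fsubsetP ZC)//|HF].
    have [uH vH cH [G GZ HG] [G' G'Z HG']] := filling_facets uv aZ rZ HF.
    apply: (cx_card pC) => //; apply: (clique_face C0 nm); last by rewrite cH.
    apply: (clique_edge uv uvC).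
      by apply/in_cx; exists G' => //; exact: (fsubsetP ZC).
    by apply/in_cx; exists G => //; exact: (fsubsetP ZC).
  have [|e|e] := mmC _ cpC.
  + by move=> r cr; apply: completion_cycle => //; exact: pureS pC.
  + by left; apply/eqP; rewrite -fsubset0 -e; exact: fsubsetUl.
  + right; apply/eqP; rewrite eqEfsubset ZO; apply/fsubsetP => G GO.
    have : G \in completion k.+2 u v Z by rewrite e; exact: (fsubsetP (outside_sub _ _ _)) GO.
    rewrite inE in_filling // => /orP[//|/and4P[uG vG _ _]].
    by move: (@outside_avoids _ u v C G GO); rewrite uG vG.
- case/adjacentP: euv => G [GC uG vG].
  have cr : #|` G `\ v| = k.+3 by have := cardfsD1 v G; rewrite vG pC // add1n => -[].
  have [H [HC rH HG]] := par_other (cC _ cr) GC (fsubD1set _ _).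
  apply/fset0Pn; exists H; rewrite in_outside HC /=; apply: contra HG => /andP[uH vH].
  by rewrite eq_sym eqEfcard (pC HC) (pC GC) leqnn andbT -(fsetD1K vG) fsubUset fsub1set vH rH.
- exact: outside_relcycle.
Qed.

(** Two facets with the same image would together form a clique with k + 5 vertices, which [nq]
    excludes. *)
Lemma contract_inj_outside : {in O &, injective (contract u v)}.
Proof.
have h G G' : G \in O -> G' \in O -> u \in G -> contract u v G = contract u v G' -> G = G'.
  rewrite !in_outside => /andP[GC aG] /andP[G'C aG'] uG; rewrite uG /= in aG.
  rewrite /contract uG; case: (boolP (u \in G')) => uG'.
    rewrite uG' /= in aG'; move=> /(congr1 (fun B => u |` (B `\ v))).
    by rewrite !fsetU1K ?inE ?(negbTE aG) ?(negbTE aG') ?andbF // !fsetD1K.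
  move=> e2; case: (@nq (v |` G)); last by rewrite cardfsU1 aG (pC GC).
  apply: (clique_edge uv uvC).
    rewrite (_ : _ `\ u = G') ?cx_facet // -e2.
    by apply/fsetP => x; rewrite !inE; case: (eqVneq x u) => [->|] //=; rewrite (negbTE uv).
  by rewrite fsetU1K // cx_facet.
move=> G G' GO G'O e; case: (boolP (u \in G)) => uG; first exact: h e.
case: (boolP (u \in G')) => uG'; first by apply/esym; apply: h (esym e).
by move: e; rewrite /contract (negbTE uG) (negbTE uG').
Qed.

Let Z := [fset contract u v G | G in O].

Lemma contract_sub G : G \in O -> contract u v G `<=` vertices C `\ u.
Proof.
rewrite in_outside => /andP[GC _]; have GV := sub_vertices GC; apply/fsubsetP => x.
rewrite /contract; case: (boolP (u \in G)) => uG; rewrite !inE.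
  case/predU1P => [->|/andP[-> /(fsubsetP GV)]] //; rewrite eq_sym uv /=.
  by apply: (fsubsetP (cx_vertices uvC)); rewrite fset22.
by move=> xG; rewrite (fsubsetP GV _ xG) andbT; apply: contraNneq uG => <-.
Qed.

Lemma vertices_contract : vertices Z = vertices C `\ u.
Proof.
apply/eqP; rewrite eqEfsubset; apply/andP; split.
  by apply: vertices_sub => _ /imfsetP[G /= GO ->]; exact: contract_sub.
apply/fsubsetP => x; rewrite in_fsetD1 => /andP[xu xC].
have [xv|xv] := eqVneq x v.
  have : x \in vertices [fset G in C | u \notin G].
    by rewrite (normal_vertices_off u nC) // in_fsetD1 xu.
  case/mem_vertices => G; rewrite in_sep => /andP[GC uG] xG; apply/mem_vertices.
  exists (contract u v G); last by rewrite /contract (negbTE uG).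
  by apply: in_imfset; rewrite /= in_outside GC (negbTE uG).
have : x \in vertices [fset G in C | v \notin G].
  by rewrite (normal_vertices_off v nC) // in_fsetD1 xv.
case/mem_vertices => G; rewrite in_sep => /andP[GC vG] xG; apply/mem_vertices.
exists (contract u v G).
  by apply: in_imfset; rewrite /= in_outside GC (negbTE vG) andbF.
by rewrite /contract; case: (u \in G) => //; rewrite !inE xu xG orbT.
Qed.

Definition common_nbrs : {fset T} :=
  [fset x in vertices C | [&& x != u, x != v, [fset u; x] \in cx C & [fset v; x] \in cx C]].

Lemma common_nbrsP x : reflect [/\ x != u, x != v, [fset u; x] \in cx C & [fset v; x] \in cx C]
  (x \in common_nbrs).
Proof.
rewrite in_sep; apply: (iffP andP) => [[_ /and4P]//|[a b c e]]; split; last exact/and4P.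
by apply: (fsubsetP (cx_vertices c)); rewrite fset22.
Qed.

Lemma edge_contract e : e \in cells Z 2 -> [/\ u \notin e, #|` e| = 2
   & e \in cx C \/ v \in e /\ u |` (e `\ v) \in cx C].
Proof.
rewrite in_cells => /andP[/in_cx[_ /imfsetP[G /= GO ->] eG] /eqP ce].
have GC : G \in C by exact: (fsubsetP (outside_sub _ _ _)) GO.
have ue : u \notin e.
  by apply/negP => /(fsubsetP eG) /(fsubsetP (contract_sub GO)); rewrite !inE eqxx.
split=> //; move: eG; rewrite /contract; case: (boolP (u \in G)) => uG eG; last first.
  by left; apply/in_cx; exists G.
have eG' : e `\ v `<=` G.
  rewrite fsubDset; apply: fsubset_trans eG _; apply: fsetUS; exact: fsubD1set.
case: (boolP (v \in e)) => ve.
  by right; split=> //; apply/in_cx; exists G; rewrite // fsubUset fsub1set uG.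
left; apply/in_cx; exists G => //; apply: fsubset_trans eG'.
by rewrite fsubsetD1 fsubset_refl.
Qed.

(** The contraction loses uv and merges ux with vx for every common neighbour x. *)
Lemma edges_contract : fnum Z 2 + 1 + #|` common_nbrs| <= fnum C 2.
Proof.
(* An edge of Z returns to itself if C contains it and otherwise to the edge at u from which it
   arose. Neither uv nor an edge from u to a common neighbour is ever reached. *)
pose g e := if e \in cx C then e else u |` (e `\ v).
have gP e : e \in cells Z 2 -> e \notin cx C ->
    [/\ v \in e, u |` (e `\ v) \in cx C & #|` u |` (e `\ v)| = 2].
  move=> eZ /negbTE eC; have [ue ce [|[ve h]]] := edge_contract eZ; first by rewrite eC.
  split=> //; rewrite cardfsU1 !inE (negbTE ue) andbF /=.
  by have := cardfsD1 v e; rewrite ve ce.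
have gi : {in cells Z 2 &, injective g}.
  move=> e e' eZ e'Z; rewrite /g.
  have [ue _ _] := edge_contract eZ; have [ue' _ _] := edge_contract e'Z.
  case: (boolP (e \in cx C)) => eC; case: (boolP (e' \in cx C)) => e'C //.
  - by move=> h; case/negP: ue; rewrite h !inE eqxx.
  - by move=> h; case/negP: ue'; rewrite -h !inE eqxx.
  have [ve _ _] := gP e eZ eC; have [ve' _ _] := gP e' e'Z e'C.
  move=> /(congr1 (fun B => v |` (B `\ u))); rewrite !fsetU1K ?fsetD1K //.
    by rewrite !inE (negbTE ue') andbF.
  by rewrite !inE (negbTE ue) andbF.
have <- : #|` [fset [fset u; x] | x in common_nbrs]| = #|` common_nbrs|.
  apply: card_in_imfset => x y /common_nbrsP[xu _ _ _] _ exy.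
  have : x \in [fset u; y] by rewrite -exy fset22.
  by rewrite !inE (negbTE xu) => /eqP.
have <- : #|` [fset g e | e in cells Z 2]| = fnum Z 2 by rewrite card_in_imfset.
set E1 := [fset g e | e in _]; set E2 := [fset _ | x in common_nbrs].
rewrite -[X in _ + X + _](cardfs1 [fset u; v]).
have d1 : [disjoint E1 & [fset [fset u; v]]]%fset.
  rewrite fdisjointX1; apply/negP => /imfsetP[e /= eZ]; rewrite /g.
  have [ue ce _] := edge_contract eZ; case: ifPn => eC h.
    by case/negP: ue; rewrite -h fset21.
  have : v \in u |` (e `\ v) by rewrite -h fset22.
  by rewrite !inE eqxx eq_sym (negbTE uv).
have d2 : [disjoint E1 `|` [fset [fset u; v]] & E2]%fset.
  apply/fdisjointP => e; rewrite inE => eE; apply/negP => /imfsetP[x /= /common_nbrsP[xu xv ux vx] ee].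
  case/orP: eE => [/imfsetP[e' /= eZ]|]; last first.
    rewrite ee inE => /eqP /fsetP /(_ v); rewrite fset22 !inE eq_sym (negbTE uv) /= => /eqP h.
    by rewrite h eqxx in xv.
  rewrite /g; have [ue ce _] := edge_contract eZ; case: ifPn => eC h.
    by case/negP: ue; rewrite -h ee fset21.
  have [ve _ ce'] := gP e' eZ eC; case/negP: eC; suff <- : [fset v; x] = e' by [].
  rewrite -(fsetD1K ve); congr (_ `|` _).
  have : (u |` (e' `\ v)) `\ u = [fset u; x] `\ u by rewrite -h ee.
  rewrite fsetU1K ?inE ?(negbTE ue) ?andbF // => ->.
  by rewrite fsetU1K // inE eq_sym.
rewrite -card_disjU // -card_disjU //; apply: fsubset_leq_card; rewrite !fsubUset.
apply/andP; split; last first.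
  apply/fsubsetP => e /imfsetP[x /= /common_nbrsP[xu _ h _] ->].
  by rewrite in_cells h cardfs2 (eq_sym u) xu.
rewrite fsub1set in_cells uvC cardfs2 uv /= andbT.
apply/fsubsetP => _ /imfsetP[e /= eZ ->]; rewrite /g in_cells.
have [_ ce _] := edge_contract eZ; case: ifPn => eC; first by rewrite eC ce.
by have [_ -> ->] := gP e eZ eC.
Qed.

Lemma link_uv_nbrs : vertices (link C [fset u; v]) `<=` common_nbrs.
Proof.
apply/fsubsetP => x; rewrite vertices_link => /andP[xuv h].
have [xu xv] : x != u /\ x != v by move: xuv; rewrite in_fset2 negb_or => /andP.
apply/common_nbrsP; split=> //; apply: cx_sub h.
  by rewrite fsubUset !fsub1set !inE !eqxx !orbT.
by rewrite fsubUset !fsub1set !inE !eqxx !orbT.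
Qed.

(** The link of uv has at least [k.+3] vertices. With exactly that many they are pairwise adjacent,
    and adding u and v gives an excluded clique. *)
Lemma common_nbrs_card : k.+4 <= #|` common_nbrs|.
Proof.
apply: leq_trans (fsubset_leq_card link_uv_nbrs).
set L := link C [fset u; v].
have cuv : #|` [fset u; v]| = 2 by rewrite cardfs2 uv.
have nL : normal k.+2 L.
  have := normal_link nC uvC; rewrite cuv; exact.
have := normal_vertices_gt nL; rewrite leq_eqVlt => /orP[/eqP cL|//].
case: (@nq ([fset u; v] `|` vertices L)).
  have duv : [disjoint [fset u; v] & vertices L]%fset.
    by apply/fdisjointP => x xuv; rewrite vertices_link xuv.
  split.
    by rewrite fsubUset cx_vertices //= vertices_link_sub.
  have [L0 pL cL' _] := nL; have [t tL] := fset0Pn _ L0.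
  have tV := sub_vertices tL.
  have pair x y : x != y -> x \in vertices L -> y \in vertices L -> [fset x; y] \in cx L.
    have main x1 y1 : x1 != y1 -> x1 \in vertices L -> x1 \notin t -> y1 \in vertices L ->
        [fset x1; y1] \in cx L.
      move=> xy xV xt yV.
      have Vt : vertices L = x1 |` t.
        apply/esym/eqP; rewrite eqEfcard fsubUset fsub1set xV tV cardfsU1 xt (pL _ tL).
        by rewrite -cL add1n leqnn.
      have yt : y1 \in t by move: yV; rewrite Vt !inE eq_sym (negbTE xy).
      have [z] : exists z, z \in t `\ y1.
        by apply/fset0Pn; rewrite -cardfs_gt0; have := cardfsD1 y1 t; rewrite yt pL // add1n => -[<-].
      rewrite in_fsetD1 => /andP[zy zt].
      have cr : #|` t `\ z| = k.+1 by have := cardfsD1 z t; rewrite zt pL // add1n => -[].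
      have [H [HL rH Ht]] := par_other (cL' _ cr) tL (fsubD1set _ _).
      apply/in_cx; exists H; rewrite // fsubUset !fsub1set.
      have -> : y1 \in H by apply: (fsubsetP rH); rewrite !inE eq_sym zy.
      rewrite andbT; apply: contraR Ht => xH; rewrite eqEfcard (pL _ HL) (pL _ tL) leqnn andbT.
      apply/fsubsetP => x2 xH'; have := fsubsetP (sub_vertices HL) x2 xH'.
      by rewrite Vt in_fset1U => /predU1P[xe|//]; rewrite xe (negbTE xH) in xH'.
    move=> xy xV yV; case: (boolP (x \in t)) => xt; last exact: main.
    case: (boolP (y \in t)) => yt; last by rewrite fsetUC; apply: main => //; rewrite eq_sym.
    by apply/in_cx; exists t; rewrite // fsubUset !fsub1set xt.
  move=> e eB ce.
  have [x xe] : exists x, x \in e by apply/fset0Pn; rewrite -cardfs_gt0 ce.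
  have /eqP/cardfs1P[y ey] : #|` e `\ x| = 1 by have := cardfsD1 x e; rewrite xe ce add1n => -[].
  have : y \in e `\ x by rewrite ey inE.
  rewrite in_fsetD1 => /andP[yx ye].
  have -> : e = [fset x; y] by rewrite -(fsetD1K xe) ey.
  have /fsetUP yB := fsubsetP eB y ye; have /fsetUP xB := fsubsetP eB x xe.
  have nb a z : a \in [fset u; v] -> z \in vertices L -> [fset a; z] \in cx C.
    rewrite in_fset2 => + /(fsubsetP link_uv_nbrs) /common_nbrsP[_ _ h1 h2].
    by case/orP => /eqP ->.
  case: yB => yB; case: xB => xB.
  - suff -> : [fset x; y] = [fset u; v] by [].
    apply/eqP; rewrite eqEfcard !cardfs2 uv eq_sym yx andbT fsubUset !fsub1set.
    by rewrite xB yB.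
  - by rewrite fsetUC; exact: nb.
  - by exact: nb.
  - have := pair x y; rewrite eq_sym yx => /(_ isT xB yB); rewrite cx_link => /andP[_].
    by apply: cx_sub; exact: fsubsetUr.
rewrite card_disjU; first by rewrite cuv -cL.
by apply/fdisjointP => x xuv; rewrite vertices_link xuv.
Qed.

(** Sparsity of C and rigidity of the contraction allow at most [k.+4] edges to disappear, but uv
    and the merged edges are at least k + 5. *)
Lemma edge_absurd : False.
Proof.
have mO := outside_minrel.
have mZ : mincycle k.+4 Z := contract_mincycle uv mC (fsubset_refl O) mO contract_inj_outside.
have := closed_excess R mZ; have := edges_contract; have := common_nbrs_card.
have uC : u \in vertices C by apply: (fsubsetP (cx_vertices uvC)); rewrite fset21.
have := sC (fsubset_refl _); rewrite edges_in_all => /(_ (normal_vertices_gt nC)).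
rewrite vertices_contract (cardfsD1 u (vertices C)) uC add1n mulnS; lia.
Qed.

End Edge.
End Prime.

Theorem prime_simplex k C : normal k.+4 C -> sparse k.+4 C ->
  (forall A, ~ missing_face k.+4 (cx C) A) -> simplex_sphere k.+4 (cx C).
Proof.
move=> nC sC np; have [C0 pC _ _] := nC; have mC := normal_mincycle (ltn0Sn _) nC.
have nm A : 2 < #|` A| <= k.+4 -> ~ missing_face #|` A| (cx C) A.
  move=> /andP[a2 a4]; case: (eqVneq #|` A| k.+4) => [->|ne]; first exact: np.
  by apply: (no_missing_small nC sC); rewrite a2 ltn_neqAle ne.
case: (pselect (exists2 B, clique C B & #|` B| = k.+4.+1)) => [[B qB cB]|nq].
  exists B; split=> //; apply: (simplex_cx mC cB) => x xB.
  have cBx : #|` B `\ x| = k.+4 by have := cardfsD1 x B; rewrite xB cB add1n => -[].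
  apply: (cx_card pC) => //; apply: (clique_face C0 nm); last by rewrite cBx.
  by apply: cliqueS qB; exact: fsubD1set.
have [G GC] := fset0Pn _ C0.
have [u uG] : exists u, u \in G by apply/fset0Pn; rewrite -cardfs_gt0 pC.
have [v] : exists v, v \in G `\ u.
  by apply/fset0Pn; rewrite -cardfs_gt0; have := cardfsD1 u G; rewrite uG pC // add1n => -[<-].
rewrite in_fsetD1 eq_sym => /andP[uv vG].
case: (@edge_absurd k C nC sC nm _ u v uv).
  by move=> B qB cB; apply: nq; exists B.
by apply/adjacentP; exists G.
Qed.

End Sparse.

(** * Cutting along a missing face *)

Section Cuts.
Local Open Scope fset_scope.
Local Open Scope nat_scope.
Variables (R : realType) (T : choiceType).
Implicit Types (A B D G H V W r s t e : {fset T}) (C Z K X : {fset {fset T}}) (u v w x y : T).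

Definition top m K : {fset {fset T}} := [fset s in K | #|` s| == m].

Lemma in_top m K s : (s \in top m K) = (s \in K) && (#|` s| == m).
Proof. exact: in_sep. Qed.

Lemma top_cx m C : pure m C -> top m (cx C) = C.
Proof.
move=> pC; apply/fsetP => s; rewrite in_top; apply/andP/idP => [[sC /eqP]|sC].
  exact: cx_card pC sC.
by rewrite cx_facet // pC.
Qed.

Lemma missing_sub m K A s : missing_face m K A -> s `<=` A -> s != A -> s \in K.
Proof. by case=> _ _ h sA ne; apply: h; rewrite fproperEneq ne. Qed.

Section Cut.
Variables (k : nat) (C : {fset {fset T}}) (A : {fset T}) (K1 K2 : {fset {fset T}}).
Hypotheses (nC : normal k.+2 C) (mA : missing_face k.+2 (cx C) A).
Hypothesis cut : cut_along (cx C) A K1 K2.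

Let pC : pure k.+2 C. Proof. by case: nC. Qed.
Let cA : #|` A| = k.+2. Proof. by case: mA. Qed.
Let nA : A \notin cx C. Proof. by case: mA. Qed.
Let C1 := top k.+2 K1.
Let C2 := top k.+2 K2.

Let K12 s : (s \in K1) || (s \in K2) = (s == A) || (s \in cx C).
Proof. by case: cut => /fsetP /(_ s) h _ _ _ _; move: h; rewrite !inE. Qed.

Let KI s : (s \in K1) && (s \in K2) = (s `<=` A).
Proof. by case: cut => _ /fsetP /(_ s) h _ _ _; move: h; rewrite inE fpowersetE. Qed.

Let closed1 s t : t \in K1 -> s `<=` t -> s \in K1.
Proof.
move=> tK st; case: cut => _ _ h _ _; apply: (h t) => //; rewrite in_fset1U.
have := K12 t; rewrite tK /= => /esym /orP[/eqP tA|tC].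
  case: eqP => //= sA; apply: (missing_sub mA); last exact/eqP.
  by rewrite -tA.
by rewrite (cx_sub st tC) orbT.
Qed.

Let closed2 s t : t \in K2 -> s `<=` t -> s \in K2.
Proof.
move=> tK st; case: cut => _ _ _ h _; apply: (h t) => //; rewrite in_fset1U.
have := K12 t; rewrite tK orbT /= => /esym /orP[/eqP tA|tC].
  case: eqP => //= sA; apply: (missing_sub mA); last exact/eqP.
  by rewrite -tA.
by rewrite (cx_sub st tC) orbT.
Qed.

Let facet1 s : s \in K1 -> ~~ (s `<=` A) -> exists G, [/\ G \in C, G \in K1 & s `<=` G].
Proof.
move=> sK sA; have := K12 s; rewrite sK => /esym /orP[/eqP e|/in_cx[G GC sG]].
  by rewrite e fsubset_refl in sA.
exists G; split=> //; have := K12 G; rewrite cx_facet // orbT => /orP[//|GK2].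
by case/negP: sA; rewrite -KI sK (closed2 GK2 sG).
Qed.

Lemma cut_facet : A \in C1.
Proof.
have := KI A; rewrite fsubset_refl => /andP[AK _].
by rewrite in_top AK cA eqxx.
Qed.

Lemma cut_cx : cx C1 = K1.
Proof.
apply/fsetP => s; apply/in_cx/idP => [[G]|sK].
  by rewrite in_top => /andP[GK _] sG; exact: closed1 GK sG.
case: (boolP (s `<=` A)) => sA; first by exists A => //; exact: cut_facet.
have [G [GC GK sG]] := facet1 sK sA; exists G => //.
by rewrite in_top GK (pC GC) eqxx.
Qed.

Lemma cut_sub : C1 `\ A `<=` C.
Proof.
apply/fsubsetP => G; rewrite in_fsetD1 in_top => /and3P[GA GK /eqP cG].
have := K12 G; rewrite GK (negbTE GA) => /esym /= GC; exact: cx_card pC GC cG.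
Qed.

Lemma cut_proper : C1 `\ A != fset0.
Proof.
have [s sK sA] : exists2 s, s \in K1 & ~~ (s `<=` A).
  apply: contrapT => h; case: cut => _ _ _ _ [nK _]; apply: nK; apply/fsetP => s.
  rewrite fpowersetE; apply/idP/idP => [sK|]; last by rewrite -KI => /andP[].
  by apply: contraT => sA; case: h; exists s.
have [G [GC GK sG]] := facet1 sK sA; apply/fset0Pn; exists G.
rewrite in_fsetD1 in_top GK (pC GC) eqxx !andbT.
by apply: contraNneq nA => <-; exact: cx_facet.
Qed.

Lemma cut_in G : G \in C -> (G \in C1) || (G \in C2).
Proof.
by move=> GC; have := K12 G; rewrite !in_top (pC GC) eqxx !andbT cx_facet // orbT.
Qed.

Lemma cut_disj G : G \in C1 -> G \in C2 -> G = A.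
Proof.
rewrite !in_top => /andP[G1 /eqP cG] /andP[G2 _]; have := KI G; rewrite G1 G2 => /esym GA.
by apply/eqP; rewrite eqEfcard GA cG cA leqnn.
Qed.

Lemma cut_pure : pure k.+2 C1.
Proof. by move=> G; rewrite in_top => /andP[_ /eqP]. Qed.

Lemma cut_star s : s \in K1 -> ~~ (s `<=` A) -> star C1 s = star C s.
Proof.
move=> sK sA; apply/fsetP => G; rewrite !in_star; case: (boolP (s `<=` G)) => sG; rewrite ?andbF //.
rewrite !andbT; apply/idP/idP => GC.
  apply: (fsubsetP cut_sub); rewrite in_fsetD1 GC andbT.
  by apply: contraNneq sA => <-.
have := cut_in GC => /orP[//|]; rewrite in_top => /andP[GK _].
by case/negP: sA; rewrite -KI sK (closed2 GK sG).
Qed.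

End Cut.

Lemma cut_sym K A K1 K2 : cut_along K A K1 K2 -> cut_along K A K2 K1.
Proof.
by case=> a b c d [e f]; split=> //; [rewrite fsetUC | rewrite fsetIC].
Qed.

(** Off A the ridges stay even. As the boundary of a boundary vanishes, the ridges of A are all odd
    or all even; if they were even, the piece without A would be a proper subcycle of C. *)
Lemma cut_par k C A K1 K2 r : normal k.+2 C -> missing_face k.+2 (cx C) A ->
  cut_along (cx C) A K1 K2 -> #|` r| = k.+1 -> par (top k.+2 K1 `\ A) r = (r `<=` A).
Proof.
move=> nC mA cut; have [cA nA _] := mA; have [C0 pC cC mC] := nC.
set C1 := top k.+2 K1; set C2 := top k.+2 K2; set Z := C1 `\ A.
have ZC : Z `<=` C := cut_sub nC cut.
have pZ : pure k.+2 Z by exact: pureS pC.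
have out r' : #|` r'| = k.+1 -> ~~ (r' `<=` A) -> par Z r' = false.
  move=> cr' rA; have -> : par Z r' = par C1 r'.
    by rewrite par_D1 ?(cut_facet mA cut) // (negbTE rA) addbF.
  case: (boolP (r' \in K1)) => rK.
    by rewrite -(par_star C1 (fsubset_refl r')) (cut_star nC mA cut rK rA) par_star //; apply/negbTE/cC.
  apply: par_none => G GC1; apply: contra rK => rG; rewrite -(cut_cx nC mA cut).
  by apply/in_cx; exists G.
case: (boolP (r `<=` A)) => rA cr; last exact: out.
have same x y : x \in A -> y \in A -> par Z (A `\ x) = par Z (A `\ y).
  move=> xA yA; case: (eqVneq x y) => [->//|xy].
  pose t := A `\ x `\ y.
  have ct : #|` t| = k.
    have e1 := cardfsD1 x A; rewrite xA cA add1n in e1; case: e1 => e1.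
    by have := cardfsD1 y (A `\ x); rewrite !inE yA eq_sym xy -e1 add1n => -[].
  pose W := A `|` vertices Z.
  have ZW G : G \in Z -> G `<=` W.
    by move=> GZ; apply: fsubset_trans (sub_vertices GZ) _; exact: fsubsetUr.
  have := par_double pZ ct ZW.
  have xt : x \in W `\` t by rewrite !inE xA eqxx andbF.
  have yt : y \in (W `\` t) `\ x by rewrite !inE yA !eqxx eq_sym xy.
  rewrite (big_fsetD1 x) //= (big_fsetD1 y) //= big1_seq ?addbF => [|z /=]; last first.
    rewrite !inE => /and3P[zy zx /andP[+ _]]; rewrite zy zx /= => zA.
    apply: out; last by rewrite fsubUset fsub1set (negbTE zA).
    by rewrite cardfsU1 ct !inE (negbTE zA) !andbF.
  have -> : x |` t = A `\ y.
    by rewrite /t; apply/fsetP => z; rewrite !inE; case: (eqVneq z x) => [->|] //=; rewrite xy.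
  have -> : y |` t = A `\ x.
    by rewrite /t; apply/fsetP => z; rewrite !inE; case: (eqVneq z y) => [->|] //=; rewrite eq_sym xy.
  by case: (par Z _); case: (par Z _).
have ridge r' : r' `<=` A -> #|` r'| = k.+1 -> exists2 x, x \in A & r' = A `\ x.
  move=> r'A cr'; have /eqP/cardfs1P[x ex] : #|` A `\` r'| = 1.
    by rewrite cardfsDS // cA cr' subSn // subnn.
  have : x \in A `\` r' by rewrite ex inE.
  rewrite inE => /andP[xr xA]; exists x => //; apply/eqP.
  rewrite eqEfcard fsubsetD1 r'A xr cr'.
  by have := cardfsD1 x A; rewrite xA cA add1n => -[<-]; rewrite leqnn.
apply/negPn/negP => pr; have [x xA rE] := ridge r rA cr.
have [Z0|ZE] : Z = fset0 \/ Z = C.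
  have := mC fset0; rewrite cardfs0 star0 => /(_ isT Z ZC); apply => r' _ cr'.
  case: (boolP (r' `<=` A)) => r'A; last by rewrite out.
  by have [y yA ->] := ridge r' r'A cr'; rewrite (same y x) // -rE.
- by have := cut_proper nC mA cut; rewrite -/Z Z0 eqxx.
- have /fset0Pn[G] := cut_proper nC mA (cut_sym cut).
  have GC := fsubsetP (cut_sub nC (cut_sym cut)) G; rewrite in_fsetD1 => /andP[GA G2].
  have : G \in Z by rewrite ZE; apply: GC; rewrite in_fsetD1 GA.
  rewrite in_fsetD1 => /andP[_ G1]; case/eqP: GA; exact: (cut_disj mA cut G1 G2).
Qed.

Lemma ridge_between k s A : s `<=` A -> #|` s| < k.+2 -> #|` A| = k.+2 ->
  exists r, [/\ s `<=` r, r `<=` A & #|` r| = k.+1].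
Proof.
move=> sA cs cA; have [x] : exists x, x \in A `\` s.
  by apply/fset0Pn; rewrite -cardfs_gt0 cardfsDS // cA subn_gt0.
rewrite inE => /andP[xs xA]; exists (A `\ x); rewrite fsubsetD1 sA xs fsubD1set.
by split=> //; have := cardfsD1 x A; rewrite xA cA add1n => -[].
Qed.

(** A relative cycle of one side that uses A becomes one of C when A is replaced by the other side.
    One that does not use A is already one of C, and it cannot fill a star of C that reaches the
    other side. *)
Lemma cut_normal k C A K1 K2 : normal k.+2 C -> missing_face k.+2 (cx C) A ->
  cut_along (cx C) A K1 K2 -> normal k.+2 (top k.+2 K1).
Proof.
move=> nC mA cut; have [cA nA _] := mA; have [C0 pC cC mC] := nC.
set C1 := top k.+2 K1; set C2 := top k.+2 K2.
have A1 : A \in C1 := cut_facet mA cut.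
have p1 r : #|` r| = k.+1 -> par (C1 `\ A) r = (r `<=` A) := cut_par nC mA cut.
have p2 r : #|` r| = k.+1 -> par (C2 `\ A) r = (r `<=` A) := cut_par nC mA (cut_sym cut).
have S1 : C1 `\ A `<=` C := cut_sub nC cut.
have S2 : C2 `\ A `<=` C := cut_sub nC (cut_sym cut).
split; first by apply/fset0Pn; exists A.
- exact: cut_pure.
- by move=> r cr; have := p1 r cr; rewrite par_D1 //; case: (par C1 r); case: (r `<=` A).
move=> s cs Z ZS hZ; case: (boolP (s `<=` A)) => sA; last first.
  case: (boolP (s \in K1)) => sK.
    by move: ZS; rewrite (cut_star nC mA cut sK sA) => ZS; exact: mC.
  left; apply/eqP; rewrite -fsubset0; apply/fsubsetP => G /(fsubsetP ZS).
  rewrite in_star => /andP[GC1 sG]; case/negP: sK; rewrite -(cut_cx nC mA cut).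
  by apply/in_cx; exists G.
have [r0 [sr0 r0A cr0]] := ridge_between sA cs cA.
have ZC1 : Z `<=` C1 by apply: fsubset_trans ZS (star_sub _ _).
have nA2 : A \notin C by apply: contra nA; exact: cx_facet.
have dis2 G : G \in C1 `\ A -> G \in C2 `\ A -> False.
  rewrite !in_fsetD1 => /andP[GA G1] /andP[_ G2]; case/eqP: GA; exact: (cut_disj mA cut G1 G2).
case: (boolP (A \in Z)) => AZ.
  right; set Y := Z `\ A; set W := star (C2 `\ A) s.
  have YC1 : Y `<=` C1 `\ A by exact: fsetSD.
  have dYW : [disjoint Y & W]%fset.
    apply/fdisjointP => G /(fsubsetP YC1) G1; apply/negP => /(fsubsetP (star_sub _ _)) G2.
    exact: dis2 G1 G2.
  have YWs : Y `|` W `<=` star C s.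
    rewrite fsubUset; apply/andP; split; apply/fsubsetP => G.
      move=> GY; rewrite in_star (fsubsetP S1) ?(fsubsetP YC1) //=.
      by move: GY; rewrite in_fsetD1 => /andP[_ /(fsubsetP ZS)]; rewrite in_star => /andP[].
    by rewrite !in_star => /andP[/(fsubsetP S2) -> ->].
  case: (mC s cs _ YWs) => [r sr cr|e|e].
  - rewrite par_disjU // par_star // p2 // par_D1 //.
    by rewrite (negbTE (hZ r sr cr)) addFb addbb.
  - have : par (C2 `\ A) r0 by rewrite p2.
    case/par_ex => G G2 rG; have : G \in Y `|` W.
      by rewrite in_fsetU in_star G2 (fsubset_trans sr0 rG) orbT.
    by rewrite e inE.
  - apply/eqP; rewrite eqEfsubset ZS; apply/fsubsetP => G; rewrite in_star => /andP[G1 sG].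
    case: (eqVneq G A) => [->//|GA].
    have G1' : G \in C1 `\ A by rewrite in_fsetD1 GA.
    have : G \in Y `|` W by rewrite e in_star (fsubsetP S1 _ G1').
    rewrite in_fsetU in_star => /orP[|/andP[G2 _]]; last by case: (dis2 G G1' G2).
    by rewrite in_fsetD1 => /andP[].
have ZCs : Z `<=` star C s.
  apply/fsubsetP => G GZ; rewrite in_star; have := fsubsetP ZS G GZ.
  rewrite in_star => /andP[G1 ->]; rewrite andbT; apply: (fsubsetP S1).
  by rewrite in_fsetD1 G1 andbT; apply: contraNneq AZ => <-.
case: (mC s cs Z ZCs hZ) => [|e]; [by left|].
have : par (C2 `\ A) r0 by rewrite p2.
case/par_ex => G G2 rG; have GC := fsubsetP S2 G G2.
have : G \in Z by rewrite e in_star GC (fsubset_trans sr0 rG).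
move=> /(fsubsetP ZC1) G1; case: (dis2 G) => //; rewrite in_fsetD1 G1 andbT.
by move: G2; rewrite in_fsetD1 => /andP[].
Qed.

Lemma cut_cells k C A K1 K2 s : normal k.+2 C -> missing_face k.+2 (cx C) A ->
  cut_along (cx C) A K1 K2 -> s \in K1 -> #|` s| < k.+2 -> s \in cx C.
Proof.
move=> nC mA cut; have [cA nA hA] := mA; rewrite -(cut_cx nC mA cut).
move=> /in_cx[G GC1 sG] cs; case: (eqVneq G A) => [GA|GA].
  by apply: hA; rewrite fproperEcard -{1}GA sG cA.
by apply/in_cx; exists G => //; apply: (fsubsetP (cut_sub nC cut)); rewrite in_fsetD1 GA.
Qed.

(** The only face added by a cut is A, which has too many vertices to be an edge, so each piece has
    only edges of C. *)
Lemma cut_sparse k C A K1 K2 : normal k.+3 C -> sparse k.+3 C -> missing_face k.+3 (cx C) A ->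
  cut_along (cx C) A K1 K2 -> sparse k.+3 (top k.+3 K1).
Proof.
move=> nC sC mA cut V VV cV.
have cc s : s \in cx (top k.+3 K1) -> #|` s| < k.+3 -> s \in cx C.
  rewrite (cut_cx nC mA cut); exact: (cut_cells nC mA cut).
have VC : V `<=` vertices C.
  apply/fsubsetP => x /(fsubsetP VV); rewrite -!cx1 => h; apply: cc h _.
  by rewrite cardfs1.
have := sC V VC cV; apply: leq_trans; rewrite leq_add2r.
apply: fsubset_leq_card; apply/fsubsetP => e; rewrite !in_sep => /andP[/andP[eL /eqP ce] ->].
by rewrite ce eqxx !andbT; apply: cc eL _; rewrite ce.
Qed.

Theorem prime_factors_simplices k C L : normal k.+4 C -> sparse k.+4 C ->
  prime_decomposition k.+4 (cx C) L -> forall Q, Q \in L -> simplex_sphere k.+4 Q.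
Proof.
move=> nC sC pd; move: (erefl (cx C)) nC sC.
elim: pd {-2}C => {C L} [K np|K A K1 K2 L1 L2 mA cut _ IH1 _ IH2] C e nC sC Q.
  rewrite inE => /eqP ->; rewrite -e; apply: (prime_simplex R) => // A; rewrite e; exact: np.
rewrite -e in mA cut; have mc := cut_cx nC mA cut; have cut' := cut_sym cut.
rewrite mem_cat => /orP[|] QL.
  exact: (IH1 _ mc (cut_normal nC mA cut) (cut_sparse nC sC mA cut)).
have mc' := cut_cx nC mA cut'.
exact: (IH2 _ mc' (cut_normal nC mA cut') (cut_sparse nC sC mA cut')).
Qed.

End Cuts.

(** * Connected sums and filling a sphere by simplices *)

Section Sums.
Local Open Scope fset_scope.
Local Open Scope nat_scope.
Variables (T : choiceType).
Implicit Types (A B D G H V W r s t e : {fset T}) (C Z K X Y : {fset {fset T}}) (u v w x y : T).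

Definition simplex_boundary B : {fset {fset T}} := [fset B `\ x | x in B].

Lemma par_simplex B I r : I `<=` B -> r `<=` B ->
  par [fset B `\ x | x in I] r = odd #|` I `\` r|.
Proof.
move=> IB rB; rewrite par_card.
have -> : star [fset B `\ x | x in I] r = [fset B `\ x | x in I `\` r].
  apply/fsetP => G; rewrite in_star; apply/andP/imfsetP => [[/imfsetP[x /= xB ->]]|[x /=]].
    by rewrite fsubsetD1 => /andP[_ xr]; exists x; rewrite // inE xr.
  rewrite inE => /andP[xr xB] ->; split; first exact: in_imfset.
  by rewrite fsubsetD1 rB.
rewrite card_in_imfset //= => x y; rewrite !inE => /andP[_ xB] /andP[_ yB] exy.
apply/eqP; apply: contraT => xy.
have : x \in B `\ y by rewrite !inE xy (fsubsetP IB).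
by rewrite -exy !inE eqxx.
Qed.

(** The ridge that omits x and y lies only in the facets opposite x and y, so evenness passes
    membership in Z from any facet of the star to any other. *)
Lemma simplex_normal d B : #|` B| = d.+2 -> normal d.+1 (simplex_boundary B).
Proof.
move=> cB; have SB G : G \in simplex_boundary B -> G `<=` B.
  by move=> /imfsetP[x /= _ ->]; exact: fsubD1set.
split.
- have [x xB] : exists x, x \in B by apply/fset0Pn; rewrite -cardfs_gt0 cB.
  by apply/fset0Pn; exists (B `\ x); exact: in_imfset.
- by move=> _ /imfsetP[x /= xB ->]; have := cardfsD1 x B; rewrite xB cB add1n => -[].
- move=> r cr; case: (boolP (r `<=` B)) => rB; last first.
    by rewrite par_none // => G /SB GB; apply: contra rB => rG; exact: fsubset_trans GB.
  by rewrite par_simplex // cardfsDS // cB cr subSn // subSnn.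
- move=> s cs Z ZS hZ; pose I := [fset x in B | B `\ x \in Z].
  have IB : I `<=` B by apply/fsubsetP => x; rewrite in_sep => /andP[].
  have ZE : Z = [fset B `\ x | x in I].
    apply/fsetP => G; apply/idP/imfsetP => [GZ|[x /=]]; last by rewrite in_sep => /andP[_ +] ->.
    have := fsubsetP ZS G GZ; rewrite in_star => /andP[/imfsetP[x /= xB e] _].
    by exists x => //; rewrite in_sep xB -e.
  have same x y : x \in B -> y \in B -> x \notin s -> y \notin s -> s `<=` B -> x \in I -> y \in I.
    move=> xB yB xs ys sB xI; apply: contraT => yI; have xy : x != y by apply: contraNneq yI => <-.
    have := hZ (B `\ x `\ y); rewrite !fsubsetD1 sB xs ys => /(_ isT).
    have -> : #|` B `\ x `\ y| = d.
      have e1 := cardfsD1 x B; rewrite xB cB add1n in e1; case: e1 => e1.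
      by have := cardfsD1 y (B `\ x); rewrite !inE yB eq_sym xy -e1 add1n => -[].
    move=> /(_ erefl); rewrite ZE par_simplex //; last first.
      by apply: fsubset_trans (fsubD1set _ _) (fsubD1set _ _).
    suff -> : I `\` (B `\ x `\ y) = [fset x] by rewrite cardfs1.
    apply/fsetP => z; rewrite in_fsetD in_fset1 !in_fsetD1 negb_and negb_and !negbK.
    case: (eqVneq z x) => [->|zx] /=; first by rewrite xI orbT.
    case: (eqVneq z y) => [->|zy] /=; first by rewrite (negbTE yI).
    by apply/negbTE; rewrite negb_and negbK; case: (boolP (z \in I)) => [/(fsubsetP IB) ->|]; rewrite ?orbT.
  case: (eqVneq Z fset0) => [|/fset0Pn[G GZ]]; [by left | right].
  apply/eqP; rewrite eqEfsubset ZS; apply/fsubsetP => H; rewrite in_star => /andP[/imfsetP[y /= yB ->]].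
  rewrite fsubsetD1 => /andP[sB ys]; move: GZ; rewrite ZE => /imfsetP[x /= xI e].
  have xB := fsubsetP IB x xI; have : G \in star (simplex_boundary B) s.
    by apply: (fsubsetP ZS); rewrite ZE e; exact: in_imfset.
  rewrite in_star e fsubsetD1 => /and3P[_ _ xs].
  by apply: in_imfset; exact: (same x).
Qed.

(** Converse to [cut_normal]. Each half of a relative cycle is even off A and has constant parity on
    the ridges of A over s, hence is empty or full; evenness of the whole makes both halves choose
    alike. *)
Lemma facet_sum k X Y A : normal k.+2 X -> normal k.+2 Y -> A \in X -> A \in Y ->
  (forall s, s \in cx X -> s \in cx Y -> s `<=` A) ->
  normal k.+2 ((X `\ A) `|` (Y `\ A)).
Proof.
move=> nX nY AX AY common; have [X0 pX cX mX] := nX; have [Y0 pY cY mY] := nY.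
set C := _ `|` _.
have cA : #|` A| = k.+2 by exact: pX.
have dXY : [disjoint X `\ A & Y `\ A]%fset.
  apply/fdisjointP => G; rewrite !in_fsetD1 => /andP[GA GX]; rewrite GA /=.
  apply: contra GA => GY; rewrite eqEfcard common ?cx_facet // (pX _ GX) cA leqnn //.
have parC r : #|` r| = k.+1 -> ~~ par C r.
  move=> cr; rewrite par_disjU // !par_D1 // (negbTE (cX r cr)) (negbTE (cY r cr)).
  by rewrite addbb.
have pC : pure k.+2 C.
  by move=> G; rewrite in_fsetU !in_fsetD1 => /orP[]/andP[_]; [exact: pX | exact: pY].
split=> //.
  have [x xA] : exists x, x \in A by apply/fset0Pn; rewrite -cardfs_gt0 cA.
  have cr : #|` A `\ x| = k.+1 by have := cardfsD1 x A; rewrite xA cA add1n => -[].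
  have [H [HX rH HA]] := par_other (cX _ cr) AX (fsubD1set _ _).
  by apply/fset0Pn; exists H; rewrite in_fsetU in_fsetD1 HA HX.
move=> s cs.
have half Q Z1 : normal k.+2 Q -> A \in Q -> s `<=` A -> Z1 `<=` star (Q `\ A) s ->
   (forall r, s `<=` r -> #|` r| = k.+1 -> ~~ (r `<=` A) -> ~~ par Z1 r) ->
   exists b : bool, [/\ forall r, s `<=` r -> #|` r| = k.+1 -> r `<=` A -> par Z1 r = b
     & Z1 = if b then star (Q `\ A) s else fset0].
  move=> [Q0 pQ cQ mQ] AQ sA ZQ out.
  have pZ : pure k.+2 Z1.
    apply: pureS pQ; apply: fsubset_trans ZQ _; apply: fsubset_trans (star_sub _ _) _; exact: fsubD1set.
  have AZ : A \notin Z1 by apply/negP => /(fsubsetP ZQ); rewrite in_star in_fsetD1 eqxx.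
  have ZQs : Z1 `<=` star Q s.
    by apply/fsubsetP => G /(fsubsetP ZQ); rewrite !in_star in_fsetD1 => /andP[/andP[_ ->]].
  have same x y : x \in A -> y \in A -> x \notin s -> y \notin s ->
      par Z1 (A `\ x) = par Z1 (A `\ y).
    move=> xA yA xs ys; case: (eqVneq x y) => [->//|xy].
    pose t := A `\ x `\ y.
    have st : s `<=` t by rewrite /t !fsubsetD1 sA xs.
    have ct : #|` t| = k.
      have e1 := cardfsD1 x A; rewrite xA cA add1n in e1; case: e1 => e1.
      by have := cardfsD1 y (A `\ x); rewrite !inE yA eq_sym xy -e1 add1n => -[].
    pose W := A `|` vertices Z1.
    have ZW G : G \in Z1 -> G `<=` W.
      by move=> GZ; apply: fsubset_trans (sub_vertices GZ) _; exact: fsubsetUr.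
    have := par_double pZ ct ZW.
    have xt : x \in W `\` t by rewrite !inE xA eqxx andbF.
    have yt : y \in (W `\` t) `\ x by rewrite !inE yA !eqxx eq_sym xy.
    rewrite (big_fsetD1 x) //= (big_fsetD1 y) //= big1_seq ?addbF => [|z /=]; last first.
      rewrite !inE => /and3P[zy zx /andP[+ _]]; rewrite zy zx /= => zA.
      apply/negbTE; apply: out; last by rewrite fsubUset fsub1set (negbTE zA).
        by apply: fsubset_trans st _; exact: fsubsetUr.
      by rewrite cardfsU1 ct !inE (negbTE zA) !andbF.
    have -> : x |` t = A `\ y.
      by rewrite /t; apply/fsetP => z; rewrite !inE; case: (eqVneq z x) => [->|] //=; rewrite xy.
    have -> : y |` t = A `\ x.
      by rewrite /t; apply/fsetP => z; rewrite !inE; case: (eqVneq z y) => [->|] //=; rewrite eq_sym xy.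
    by case: (par Z1 _); case: (par Z1 _).
  have [x0] : exists x, x \in A `\` s by apply/fset0Pn; rewrite -cardfs_gt0 cardfsDS // cA subn_gt0.
  rewrite inE => /andP[x0s x0A].
  have allr r : s `<=` r -> #|` r| = k.+1 -> r `<=` A -> par Z1 r = par Z1 (A `\ x0).
    move=> sr cr rA; have /eqP/cardfs1P[x ex] : #|` A `\` r| = 1.
      by rewrite cardfsDS // cA cr subSn // subnn.
    have : x \in A `\` r by rewrite ex inE.
    rewrite inE => /andP[xr xA].
    have -> : r = A `\ x.
      apply/eqP; rewrite eqEfcard fsubsetD1 rA xr cr.
      by have := cardfsD1 x A; rewrite xA cA add1n => -[<-]; rewrite leqnn.
    by apply: same => //; apply: contra xr; exact: (fsubsetP sr).
  exists (par Z1 (A `\ x0)); split=> //.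
  case: ifP => b.
    have YQ : A |` Z1 `<=` star Q s by rewrite fsubUset fsub1set in_star AQ sA.
    case: (mQ s cs _ YQ) => [r sr cr|e|e].
    - rewrite par_disjU ?fdisjoint1X // par_fset1.
      by case: (boolP (r `<=` A)) => rA; [rewrite allr // b | rewrite (negbTE (out r sr cr rA))].
    - by have := fset1U1 A Z1; rewrite e inE.
    - apply/eqP; rewrite eqEfsubset ZQ; apply/fsubsetP => G.
      rewrite in_star in_fsetD1 => /andP[/andP[GA GQ] sG].
      have : G \in A |` Z1 by rewrite e in_star GQ.
      by rewrite in_fset1U (negbTE GA).
  case: (mQ s cs _ ZQs) => [r sr cr|//|e].
    case: (boolP (r `<=` A)) => rA; last exact: out.
    by rewrite allr // b.
  by move: AZ; rewrite e in_star AQ sA.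
move=> Z ZS hZ; pose Z1 := Z `&` X; pose Z2 := Z `&` Y.
have ZC : Z `<=` C by apply: fsubset_trans ZS (star_sub _ _).
have AZ : A \notin Z by apply/negP => /(fsubsetP ZC); rewrite in_fsetU !in_fsetD1 eqxx.
have sZ G : G \in Z -> s `<=` G by move=> /(fsubsetP ZS); rewrite in_star => /andP[].
have d12 : [disjoint Z1 & Z2]%fset.
  apply/fdisjointP => G; rewrite !in_fsetI => /andP[GZ GX]; rewrite GZ /=.
  have GA : G != A by apply: contraNneq AZ => <-.
  apply/negP => GY; have := fdisjointP dXY G; rewrite !in_fsetD1 GA GX GY; by move=> /(_ isT).
have ZE : Z = Z1 `|` Z2.
  apply/fsetP => G; rewrite in_fsetU !in_fsetI -andb_orr; case: (boolP (G \in Z)) => //= GZ.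
  by have := fsubsetP ZC G GZ; rewrite in_fsetU !in_fsetD1 => /orP[]/andP[_ ->]; rewrite ?orbT.
have out r : s `<=` r -> #|` r| = k.+1 -> ~~ (r `<=` A) -> ~~ par Z1 r /\ ~~ par Z2 r.
  move=> sr cr rA; have := hZ r sr cr; rewrite ZE par_disjU //.
  case p1 : (par Z1 r); case p2 : (par Z2 r) => //= _; case/negP: rA.
  have [G1 + rG1] := par_ex p1; have [G2 + rG2] := par_ex p2.
  rewrite !in_fsetI => /andP[_ GY] /andP[_ GX].
  by apply: common; apply/in_cx; [exists G1 | exists G2].
case: (boolP (s `<=` A)) => sA.
  have Z1s : Z1 `<=` star (X `\ A) s.
    apply/fsubsetP => G; rewrite in_fsetI in_star in_fsetD1 => /andP[GZ ->].
    by rewrite sZ // !andbT; apply: contraNneq AZ => <-.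
  have Z2s : Z2 `<=` star (Y `\ A) s.
    apply/fsubsetP => G; rewrite in_fsetI in_star in_fsetD1 => /andP[GZ ->].
    by rewrite sZ // !andbT; apply: contraNneq AZ => <-.
  have [b1 [h1 e1]] := half X Z1 nX AX sA Z1s (fun r a b c => (out r a b c).1).
  have [b2 [h2 e2]] := half Y Z2 nY AY sA Z2s (fun r a b c => (out r a b c).2).
  have [x0] : exists x, x \in A `\` s by apply/fset0Pn; rewrite -cardfs_gt0 cardfsDS // cA subn_gt0.
  rewrite inE => /andP[x0s x0A].
  have [sr cr] : s `<=` A `\ x0 /\ #|` A `\ x0| = k.+1.
    by rewrite fsubsetD1 sA x0s; split=> //; have := cardfsD1 x0 A; rewrite x0A cA add1n => -[].
  have := hZ _ sr cr; rewrite {1}ZE par_disjU // h1 // ?fsubD1set // h2 // ?fsubD1set //.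
  have stC : star C s = star (X `\ A) s `|` star (Y `\ A) s.
    by apply/fsetP => G; rewrite in_fsetU !in_star in_fsetU andb_orl.
  by rewrite ZE stC e1 e2; case: b1 {h1 e1}; case: b2 {h2 e2} => //= _; [right | left; rewrite fsetU0].
have side Q Q' : normal k.+2 Q -> s \notin cx Q' -> A \in Q ->
    (forall G, G \in star C s -> G \in Q \/ G \in Q') -> (forall G, G \in Q -> G != A -> G \in C) ->
    Z = fset0 \/ Z = star C s.
  move=> [Q0 pQ cQ mQ] sQ' AQ h1 h2.
  have e : star C s = star Q s.
    apply/fsetP => G; apply/idP/idP => GS.
      have sG : s `<=` G by move: GS; rewrite in_star => /andP[].
      case: (h1 G GS) => [GQ|GQ']; first by rewrite in_star GQ.
      by case/negP: sQ'; apply/in_cx; exists G.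
    move: GS; rewrite !in_star => /andP[GQ sG]; rewrite sG andbT; apply: h2 => //.
    by apply: contraNneq sA => <-.
  by rewrite e; apply: mQ => //; rewrite -e.
have inC G : G \in star C s -> G \in X \/ G \in Y.
  by rewrite in_star in_fsetU !in_fsetD1 => /andP[/orP[]/andP[_ ->] _]; [left|right].
have XC G : G \in X -> G != A -> G \in C by move=> GX GA; rewrite in_fsetU in_fsetD1 GX GA.
have YC G : G \in Y -> G != A -> G \in C by move=> GY GA; rewrite in_fsetU !in_fsetD1 GY GA orbT.
case: (boolP (s \in cx Y)) => sY; last exact: (side X Y).
have sX : s \notin cx X by apply: contra sA => sX; exact: common.
by apply: (side Y X) => // G /inC [|]; [right|left].
Qed.

(** As in [facet_sum], with the link of w in place of the boundary of A. The two sides share only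
    faces of this link because it is induced and contains all vertices of [del Y w]. Applied to a
    cap Y, this replaces the hole left by w with the simplices of the cap. *)
Lemma hole_sum k X Y w : normal k.+3 X -> normal k.+3 Y -> w \in vertices X ->
  induced_link X w -> link Y [fset w] = link X [fset w] ->
  vertices (del Y w) `<=` vertices (link X [fset w]) ->
  normal k.+3 (del X w `|` del Y w).
Proof.
move=> nX nY wX iw LE VY; have [X0 pX cX mX] := nX; have [Y0 pY cY mY] := nY.
set C := _ `|` _; set L := link X [fset w] in LE VY.
have wL : w \notin vertices L by rewrite vertices_link1 eqxx.
have common s : s \in cx X -> w \notin s -> s \in cx (del Y w) -> s \in cx L.
  move=> sX ws sY; rewrite cx_link fdisjoint1X ws; apply: iw => //.
  exact: fsubset_trans (cx_vertices sY) VY.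
have dX G : G \in del X w -> G \in X /\ w \notin G by rewrite in_del => /andP.
have dY G : G \in del Y w -> G \in Y /\ w \notin G by rewrite in_del => /andP.
have dXY : [disjoint del X w & del Y w]%fset.
  apply/fdisjointP => G /dX[GX wG]; apply/negP => GY.
  have := common G (cx_facet GX) wG (cx_facet GY); rewrite cx_link => /andP[_ /(card_cx pX)].
  by rewrite cardfsU1 wG (pX _ GX) ltnn.
have pC : pure k.+3 C by move=> G; rewrite in_fsetU => /orP[/dX[/pX]|/dY[/pY]].
have starL (Q : {fset {fset T}}) : pure k.+3 Q -> link Q [fset w] = L ->
    forall r, #|` r| = k.+2 -> w \notin r -> (w |` r \in Q) = (r \in L).
  by move=> pQ QL r cr wr; rewrite -QL in_link fdisjoint1X wr.
have splitQ (Q : {fset {fset T}}) : pure k.+3 Q -> (forall r, #|` r| = k.+2 -> ~~ par Q r) ->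
    link Q [fset w] = L ->
    forall r, #|` r| = k.+2 -> w \notin r -> par (del Q w) r = (r \in L).
  move=> pQ cQ QL r cr wr; rewrite -(starL Q) //.
  have : par Q r = par (del Q w) r (+) par (star Q [fset w]) r.
    rewrite -par_disjU.
      congr (par _ r); apply/fsetP => G; rewrite in_fsetU in_del in_star fsub1set.
      by case: (G \in Q) => //=; case: (w \in G).
    by apply/fdisjointP => G; rewrite in_del in_star fsub1set => /andP[-> wG].
  rewrite (negbTE (cQ r cr)); case p1 : (par (del Q w) r); case p2 : (par (star Q [fset w]) r) => //= _.
    case/par_ex: p2 => G; rewrite in_star fsub1set => /andP[GQ wG] rG.
    suff <- : G = w |` r by rewrite GQ.
    by apply/esym/eqP; rewrite eqEfcard fsubUset fsub1set wG rG (pQ _ GQ) cardfsU1 wr cr /= add1n leqnn.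
  apply/esym/negbTE; apply/negP => wrQ; move/negbT/negP: p2; apply.
  rewrite par_card; have -> : star (star Q [fset w]) r = [fset w |` r].
    apply/fsetP => G; rewrite !in_star fsub1set in_fset1; apply/andP/eqP => [[/andP[GQ wG] rG]|->].
      by apply/esym/eqP; rewrite eqEfcard fsubUset fsub1set wG rG (pQ _ GQ) cardfsU1 wr cr /= add1n leqnn.
    by rewrite wrQ !inE eqxx fsubsetUr.
  by rewrite cardfs1.
have spX := splitQ X pX cX erefl; have spY := splitQ Y pY cY LE.
have offw (Q : {fset {fset T}}) r : w \in r -> par (del Q w) r = false.
  by move=> wr; apply: par_none => G; rewrite in_del => /andP[_]; apply: contra => /fsubsetP; apply.
have nL : normal k.+2 L by exact: normal_linkv.
have pL : pure k.+2 L by case: nL.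
split=> //.
- have [G GX wG] := del_facet w nX; apply/fset0Pn; exists G.
  by rewrite in_fsetU in_del GX wG.
- move=> r cr; rewrite par_disjU //; case: (boolP (w \in r)) => wr; first by rewrite !offw.
  by rewrite spX // spY // addbb.
move=> s cs Z ZS hZ.
have ZC : Z `<=` C by apply: fsubset_trans ZS (star_sub _ _).
have sZ G : G \in Z -> s `<=` G by move=> /(fsubsetP ZS); rewrite in_star => /andP[].
have wC G : G \in C -> w \notin G by rewrite in_fsetU => /orP[/dX[]|/dY[]].
case: (boolP (w \in s)) => ws.
  left; apply/eqP; rewrite -fsubset0; apply/fsubsetP => G GZ.
  by case/negP: (wC G (fsubsetP ZC G GZ)); exact: (fsubsetP (sZ G GZ)).
pose Z1 := Z `&` del X w; pose Z2 := Z `&` del Y w.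
have d12 : [disjoint Z1 & Z2]%fset.
  apply/fdisjointP => G; rewrite !in_fsetI => /andP[_ GX]; rewrite negb_and.
  by rewrite (fdisjointP dXY G GX) orbT.
have ZE : Z = Z1 `|` Z2.
  apply/fsetP => G; rewrite in_fsetU !in_fsetI -andb_orr; case: (boolP (G \in Z)) => //= GZ.
  by have := fsubsetP ZC G GZ; rewrite in_fsetU => ->.
have stC : star C s = star (del X w) s `|` star (del Y w) s.
  by apply/fsetP => G; rewrite in_fsetU !in_star in_fsetU andb_orl.
have wZ (Z3 : {fset {fset T}}) r : Z3 `<=` Z -> w \in r -> par Z3 r = false.
  move=> Z3Z wr; apply: par_none => G /(fsubsetP Z3Z) /(fsubsetP ZC) /wC.
  by apply: contra => /fsubsetP; apply.
have s1 : Z1 `<=` Z by apply/fsubsetP => G; rewrite in_fsetI => /andP[].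
have s2 : Z2 `<=` Z by apply/fsubsetP => G; rewrite in_fsetI => /andP[].
have out r : s `<=` r -> #|` r| = k.+2 -> r \notin L -> ~~ par Z1 r /\ ~~ par Z2 r.
  move=> sr cr rL; have := hZ r sr cr; rewrite ZE par_disjU //.
  case p1 : (par Z1 r); case p2 : (par Z2 r) => //= _; case/negP: rL.
  have [G1 + rG1] := par_ex p1; have [G2 + rG2] := par_ex p2.
  rewrite !in_fsetI => /andP[_ GY] /andP[_ GX]; have [G1X wG1] := dX G1 GX.
  apply: (cx_card pL) => //; apply: common.
  - by apply/in_cx; exists G1.
  - by apply: contra wG1; exact: (fsubsetP rG1).
  - by apply/in_cx; exists G2.
have half Q Z3 : normal k.+3 Q -> link Q [fset w] = L -> s \in cx L -> Z3 `<=` star (del Q w) s ->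
   (forall r, s `<=` r -> #|` r| = k.+2 -> r \notin L -> ~~ par Z3 r) ->
   exists b : bool, [/\ forall r, s `<=` r -> r \in L -> par Z3 r = b
     & Z3 = if b then star (del Q w) s else fset0].
  move=> nQ QL sL ZQ out3; have [Q0 pQ cQ mQ] := nQ.
  have sL' := starL Q pQ QL; have spQ := splitQ Q pQ cQ QL.
  have ZQ' : Z3 `<=` star Q s.
    by apply/fsubsetP => G /(fsubsetP ZQ); rewrite !in_star in_del => /andP[/andP[-> _]].
  have pZ : pure k.+3 Z3.
    by apply: pureS pQ; apply: fsubset_trans ZQ' (star_sub _ _).
  have nw G : G \in Z3 -> w \notin G.
    by move=> /(fsubsetP ZQ); rewrite in_star in_del => /andP[/andP[]].
  have wZ3 r : w \in r -> par Z3 r = false.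
    by move=> wr; apply: par_none => G /nw; apply: contra => /fsubsetP; apply.
  have wLr r : r \in L -> w \notin r.
    by move=> rL; apply: contra wL; exact: (fsubsetP (sub_vertices rL)).
  pose B := [fset r in star L s | par Z3 r].
  have BS : B `<=` star L s by apply/fsubsetP => r; rewrite in_sep => /andP[].
  have [B0|BE] : B = fset0 \/ B = star L s.
    case: (ltnP #|` s| k.+2) => cs2; last first.
      have cLs : #|` s| = k.+2 by apply/eqP; rewrite eqn_leq cs2 (card_cx pL sL).
      have sLL : s \in L by exact: (cx_card pL).
      have e : star L s = [fset s].
        apply/fsetP => r; rewrite in_star in_fset1; apply/andP/eqP => [[rL sr]|->]; last by rewrite sLL.
        by apply/esym/eqP; rewrite eqEfcard sr cLs (pL _ rL) leqnn.
      rewrite e in BS *; have [sB|sB] := boolP (s \in B); [right|left].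
        by apply/eqP; rewrite eqEfsubset BS fsub1set.
      apply/eqP; rewrite -fsubset0; apply/fsubsetP => r rB; have := fsubsetP BS r rB.
      by rewrite in_fset1 => /eqP re; rewrite -re rB in sB.
    case: nL => _ _ _ mL; apply: mL => // t st ct.
    have wt : w \notin s by [].
    pose W := vertices L `|` vertices Z3.
    have ZW G : G \in Z3 -> G `<=` W.
      by move=> GZ; apply: fsubset_trans (sub_vertices GZ) _; exact: fsubsetUr.
    have := par_double pZ ct ZW; rewrite big_addb_fset => /negbT; rewrite par_card.
    set E := [fset x in _ | _].
    have [wt'|wt'] := boolP (w \in t).
      move=> _; suff -> : star B t = fset0 by rewrite cardfs0.
      apply/eqP; rewrite -fsubset0; apply/fsubsetP => r; rewrite in_star => /andP[/(fsubsetP BS)].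
      by rewrite in_star => /andP[/wLr + _] /fsubsetP h; rewrite h.
    suff -> : star B t = [fset x |` t | x in E].
      suff -> : #|` [fset x |` t | x in E]| = #|` E| by [].
      apply: card_in_imfset => x y; rewrite !in_sep !in_fsetD => /andP[/andP[xt _] _] _.
      by move=> /fsetP /(_ x); rewrite !inE eqxx (negbTE xt) !orbF => /esym/eqP.
    apply/fsetP => r; apply/idP/imfsetP => [|[x /=]].
      rewrite in_star in_sep => /andP[/andP[rS pr] tr]; have rL := fsubsetP (star_sub _ _) r rS.
      have /eqP/cardfs1P[x ex] : #|` r `\` t| = 1 by rewrite cardfsDS // (pL _ rL) ct subSnn.
      have : x \in r `\` t by rewrite ex inE.
      rewrite in_fsetD => /andP[xt xr]; have re : r = x |` t.
        by rewrite -(fsetUD tr) ex fsetUC.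
      exists x => //; rewrite in_sep in_fsetD xt -re pr andbT /=.
      by rewrite in_fsetU (fsubsetP (sub_vertices rL)).
    rewrite in_sep in_fsetD => /andP[/andP[xt xW] px] ->.
    rewrite in_star fsubsetUr andbT in_sep px andbT in_star.
    have sxt : s `<=` x |` t by apply: fsubset_trans st _; exact: fsubsetUr.
    rewrite sxt andbT; apply: contraLR px => xtL; apply: out3 => //.
    by rewrite cardfsU1 xt ct.
  - exists false; split=> [r sr rL|].
      by apply/negbTE/negP => pr; have : r \in B; [rewrite in_sep in_star rL sr pr | rewrite B0 inE].
    have [r sr cr|//|e] := mQ s cs _ ZQ'.
      case: (boolP (r \in L)) => rL; last exact: out3.
      by apply/negP => pr; have : r \in B; [rewrite in_sep in_star rL sr pr | rewrite B0 inE].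
    have [r rL sr] := in_cx _ _ sL.
    have wrQ : w |` r \in Q by rewrite sL' // ?pL // wLr.
    have : w |` r \in Z3 by rewrite e in_star wrQ; apply: fsubset_trans sr _; exact: fsubsetUr.
    by move=> /nw; rewrite !inE eqxx.
  - exists true; split=> [r sr rL|].
      have : r \in B by rewrite BE in_star rL.
      by rewrite in_sep => /andP[].
    pose Sw := star (star Q [fset w]) s.
    have dSw : [disjoint Z3 & Sw]%fset.
      apply/fdisjointP => G /nw wG; rewrite !in_star fsub1set (negbTE wG) andbF //.
    have ZSw : Z3 `|` Sw `<=` star Q s.
      rewrite fsubUset ZQ' /=; apply/fsubsetP => G; rewrite !in_star => /andP[/andP[-> _] ->] //.
    have parSw r : s `<=` r -> #|` r| = k.+2 -> par Sw r = if w \in r then false else r \in L.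
      move=> sr cr; rewrite par_star //; case: ifP => wr.
        by rewrite par_star ?fsub1set //; apply/negbTE; exact: cQ.
      have wr' : w \notin r by rewrite wr.
      have : par Q r = par (del Q w) r (+) par (star Q [fset w]) r.
        rewrite -par_disjU.
          congr (par _ r); apply/fsetP => G; rewrite in_fsetU in_del in_star fsub1set.
          by case: (G \in Q) => //=; case: (w \in G).
        by apply/fdisjointP => G; rewrite in_del in_star fsub1set => /andP[-> wG].
      rewrite (negbTE (cQ r cr)) spQ //; by case: (r \in L); case: (par (star _ _) r).
    have [r sr cr|e|e] := mQ s cs _ ZSw.
    + rewrite par_disjU // parSw //; case: (boolP (w \in r)) => wr; first by rewrite wZ3.
      case: (boolP (r \in L)) => rL; last by rewrite (negbTE (out3 r sr cr rL)).
      have : r \in B by rewrite BE in_star rL.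
      by rewrite in_sep => /andP[_ ->].
    + have [r rL sr] := in_cx _ _ sL.
      have wrQ : w |` r \in Q by rewrite sL' // ?pL // wLr.
      have : w |` r \in Z3 `|` Sw; last by rewrite e inE.
      rewrite in_fsetU !in_star wrQ fsub1set !inE eqxx /=.
      by rewrite (fsubset_trans sr (fsubsetUr _ _)) orbT.
    + apply/eqP; rewrite eqEfsubset ZQ; apply/fsubsetP => G.
      rewrite in_star in_del => /andP[/andP[GQ wG] sG].
      have : G \in Z3 `|` Sw by rewrite e in_star GQ.
      by rewrite in_fsetU !in_star fsub1set (negbTE wG) andbF orbF.
case: (boolP (s \in cx L)) => sL.
  have Z1s : Z1 `<=` star (del X w) s.
    by apply/fsubsetP => G; rewrite in_fsetI in_star => /andP[GZ ->]; exact: sZ.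
  have Z2s : Z2 `<=` star (del Y w) s.
    by apply/fsubsetP => G; rewrite in_fsetI in_star => /andP[GZ ->]; exact: sZ.
  have [b1 [h1 e1]] := half X Z1 nX erefl sL Z1s (fun r a b c => (out r a b c).1).
  have [b2 [h2 e2]] := half Y Z2 nY LE sL Z2s (fun r a b c => (out r a b c).2).
  have [r rL sr] := in_cx _ _ sL.
  have := hZ r sr (pL _ rL); rewrite {1}ZE par_disjU // h1 // h2 //.
  by rewrite ZE stC e1 e2; case: b1 {h1 e1}; case: b2 {h2 e2} => //= _; [right | left; rewrite fsetU0].
have side Q (Q' : {fset {fset T}}) : normal k.+3 Q -> link Q [fset w] = L -> star Q' s = fset0 ->
    star C s = star (del Q w) s `|` star Q' s -> Z = fset0 \/ Z = star C s.
  move=> [Q0 pQ cQ mQ] QL h1 h2.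
  have e : star (del Q w) s = star Q s.
    apply/fsetP => G; rewrite !in_star in_del; case: (boolP (G \in Q)) => //= GQ.
    case: (boolP (s `<=` G)) => sG; rewrite ?andbF // andbT; apply/negP => wG.
    case/negP: sL; rewrite -QL cx_link fdisjoint1X ws; apply/in_cx; exists G => //.
    by rewrite fsubUset fsub1set wG.
  have e' : star C s = star Q s by rewrite h2 h1 fsetU0 e.
  by rewrite e'; apply: mQ => //; rewrite -e'.
have star0 (Q : {fset {fset T}}) : s \notin cx Q -> star Q s = fset0.
  move=> sQ; apply/eqP; rewrite -fsubset0; apply/fsubsetP => G; rewrite in_star => /andP[GQ sG].
  by case/negP: sQ; apply/in_cx; exists G.
case: (boolP (s \in cx (del Y w))) => sY; last by apply: (side X (del Y w)) => //; exact: star0.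
apply: (side Y (del X w)) => //; last by rewrite fsetUC.
apply: star0; apply: contra sL => sX; apply: common => //.
by apply: (fsubsetP (cxS _)) sX; apply/fsubsetP => G /dX[].
Qed.

(* The simplices T_i of a decomposition of K, coned off along K itself. *)
Definition cap K (Tl : {fset {fset T}}) w : {fset {fset T}} := Tl `|` [fset w |` B | B in K].

Definition simplices (L : seq {fset {fset T}}) : {fset {fset T}} := [fset vertices Q | Q in L].

Lemma vertices_simplex A : 1 < #|` A| -> vertices (fpowerset A `\ A) = A.
Proof.
move=> cA; apply/eqP; rewrite eqEfsubset; apply/andP; split.
  by apply: vertices_sub => B; rewrite in_fsetD1 fpowersetE => /andP[].
apply/fsubsetP => x xA; apply/mem_vertices; exists [fset x]; last by rewrite inE.
rewrite in_fsetD1 fpowersetE fsub1set xA andbT.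
by apply/eqP => e; move: cA; rewrite -e cardfs1.
Qed.

Lemma decomposition_complex_cx m L : (forall Q, Q \in L -> simplex_sphere m.+1 Q) ->
  decomposition_complex L = cx (simplices L) /\ pure m.+2 (simplices L).
Proof.
move=> sL.
have VQ Q : Q \in L -> Q = fpowerset (vertices Q) `\ vertices Q /\ #|` vertices Q| = m.+2.
  by move=> /sL[A [cA ->]]; rewrite vertices_simplex // cA.
split; last by move=> _ /imfsetP[Q /= /VQ[_ ?] ->].
apply/fsetP => s; apply/bigfcupP/in_cx => [[Q]|[_ /imfsetP[Q /= QL ->] sV]].
  rewrite andbT => QL; rewrite in_fset1U => h; exists (vertices Q); first exact: in_imfset.
  case/predU1P: h => [->//|]; have [-> _] := VQ Q QL.
  rewrite in_fsetD1 fpowersetE => /andP[_ sV]; apply: fsubset_trans sV _.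
  by have [<- _] := VQ Q QL.
exists Q; first by rewrite QL.
rewrite in_fset1U; case: eqP => //= sne; have [-> _] := VQ Q QL.
by rewrite in_fsetD1 fpowersetE sV andbT; apply/eqP.
Qed.

Lemma add_ridges (a b c p q f g h : nat) : a + 1 = b + c -> b + 1 = p + f ->
  c + 1 = q + g -> h + 2 = p + q -> a + 1 = h + (f + g).
Proof. lia. Qed.

Lemma add_vertices (a b c m f g : nat) : a + m = b + c -> b = m + f -> c = m + g ->
  a = m + (f + g).
Proof. lia. Qed.

(** Coning K off from w closes the simplices up, so that each cut of K along A becomes a connected
    sum along the facet made of w and A, and [facet_sum] applies. In the counts the two sides of a
    cut share the ridge A and its vertices. *)
Theorem decomposition_cap k K w L : normal k.+2 K -> w \notin vertices K ->
  prime_decomposition k.+2 (cx K) L -> (forall Q, Q \in L -> simplex_sphere k.+2 Q) ->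
  let Tl := simplices L in
  [/\ vertices Tl `<=` vertices K, cx K `<=` cx Tl,
      forall s, s \in cx Tl -> #|` s| < k.+2 -> s \in cx K,
      #|` top k.+2 (cx Tl)| + 1 = #|` K| + #|` Tl|
    & #|` vertices K| = k.+2 + #|` Tl| /\ normal k.+3 (cap K Tl w)].
Proof.
move=> nK wK pd; move: (erefl (cx K)) nK wK.
elim: pd {-2}K => {K L} [Q np|Q A K1 K2 L1 L2 mA cut _ IH1 _ IH2] K e nK wK sL.
  have [B [cB QB]] := sL Q (mem_head _ _); set Tl := simplices _.
  have [K0 pK cK mK] := nK.
  have VQ : vertices Q = B by rewrite QB vertices_simplex // cB.
  have KE : K = simplex_boundary B.
    rewrite -(top_cx pK) e QB; apply/fsetP => s; rewrite in_top in_fsetD1 fpowersetE.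
    apply/idP/imfsetP => [/andP[/andP[_ sB] /eqP cs]|[x /= xB ->]]; last first.
      have c : #|` B `\ x| = k.+2 by have := cardfsD1 x B; rewrite xB cB add1n => -[].
      rewrite fsubD1set c eqxx !andbT; apply/eqP => h; move: c; rewrite h cB => /eqP.
      by rewrite eqn_leq ltnn.
    have /eqP/cardfs1P[x ex] : #|` B `\` s| = 1 by rewrite cardfsDS // cB cs subSnn.
    have : x \in B `\` s by rewrite ex inE.
    rewrite in_fsetD => /andP[xs xB]; exists x => //; apply/eqP.
    rewrite eqEfcard fsubsetD1 sB xs cs /=.
    by have := cardfsD1 x B; rewrite xB cB add1n => -[<-]; rewrite leqnn.
  have TE : Tl = [fset B].
    apply/fsetP => s; rewrite in_fset1; apply/imfsetP/eqP => [[Q' /=]|->].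
      by rewrite inE => /eqP -> ->.
    by exists Q; rewrite ?mem_head.
  have cxT s : (s \in cx Tl) = (s `<=` B).
    rewrite TE; apply/in_cx/idP => [[G]|sB]; last by exists B; rewrite ?in_fset1.
    by rewrite in_fset1 => /eqP ->.
  have cxK s : (s \in cx K) = (s != B) && (s `<=` B) by rewrite e QB in_fsetD1 fpowersetE.
  have VK : vertices K = B.
    apply/fsetP => x; rewrite -cx1 cxK fsub1set; case: (boolP (x \in B)) => xB; rewrite ?andbF //.
    by rewrite andbT; apply/eqP => h; move: cB; rewrite -h cardfs1.
  have wB : w \notin B by rewrite -VK.
  split.
  - by rewrite VK TE; apply: vertices_sub => G; rewrite in_fset1 => /eqP ->.
  - by apply/fsubsetP => s; rewrite cxK cxT => /andP[].
  - move=> s; rewrite cxT cxK => -> /=; rewrite andbT => cs; apply/eqP => h.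
    by move: cs; rewrite h cB ltnNge leqnSn.
  - have -> : top k.+2 (cx Tl) = K.
      rewrite -[RHS](top_cx pK); apply/fsetP => s; rewrite !in_top cxT cxK.
      case: (eqVneq s B) => [->|_] //=; rewrite cB fsubset_refl /=; apply/negbTE.
      by rewrite neq_ltn ltnSn orbT.
    by rewrite TE cardfs1.
  - split; first by rewrite VK cB TE cardfs1 addn1.
    have -> : cap K Tl w = simplex_boundary (w |` B).
      rewrite /cap TE KE; apply/fsetP => s; rewrite in_fsetU in_fset1.
      apply/orP/imfsetP => [[/eqP->|/imfsetP[_ /= /imfsetP[x /= xB ->] ->]]|[x /=]].
      + by exists w; rewrite /= ?fset1U1 // fsetU1K.
      + exists x; first by rewrite !inE xB orbT.
        have xw : w != x by apply: contraNneq wB => ->.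
        by apply/fsetP => y; rewrite !inE; case: (eqVneq y w) => [->|] //=; rewrite xw.
      rewrite in_fset1U => /predU1P[->|xB] ->; first by left; rewrite fsetU1K.
      right; apply/imfsetP; exists (B `\ x); first exact: in_imfset.
      have xw : w != x by apply: contraNneq wB => ->.
      by apply/fsetP => y; rewrite !inE; case: (eqVneq y w) => [->|] //=; rewrite xw.
    by apply: simplex_normal; rewrite cardfsU1 wB cB.
rewrite -e in mA cut; have cut' := cut_sym cut; have [K0 pK cK mK] := nK.
have [cA nA hA] := mA.
have mc1 := cut_cx nK mA cut; have mc2 := cut_cx nK mA cut'.
set C1 := top k.+2 K1 in mc1; set C2 := top k.+2 K2 in mc2.
have nC1 : normal k.+2 C1 := cut_normal nK mA cut.
have nC2 : normal k.+2 C2 := cut_normal nK mA cut'.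
have A1 : A \in C1 := cut_facet mA cut.
have A2 : A \in C2 := cut_facet mA cut'.
have VS (Q' : {fset {fset T}}) x : (forall s, s \in cx Q' -> #|` s| < k.+2 -> s \in cx K) ->
    x \in vertices Q' -> x \in vertices K.
  by move=> h; rewrite -!cx1 => xQ; apply: h xQ _; rewrite cardfs1.
have c1 s : s \in cx C1 -> #|` s| < k.+2 -> s \in cx K.
  by rewrite mc1; exact: (cut_cells nK mA cut).
have c2 s : s \in cx C2 -> #|` s| < k.+2 -> s \in cx K.
  by rewrite mc2; exact: (cut_cells nK mA cut').
have V1 : vertices C1 `<=` vertices K by apply/fsubsetP => x; exact: VS.
have V2 : vertices C2 `<=` vertices K by apply/fsubsetP => x; exact: VS.
have w1 : w \notin vertices C1 by apply: contra wK; exact: (fsubsetP V1).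
have w2 : w \notin vertices C2 by apply: contra wK; exact: (fsubsetP V2).
have sL1 Q' : Q' \in L1 -> simplex_sphere k.+2 Q' by move=> h; apply: sL; rewrite mem_cat h.
have sL2 Q' : Q' \in L2 -> simplex_sphere k.+2 Q' by move=> h; apply: sL; rewrite mem_cat h orbT.
have [a1 b1 d1 n1 [m1 N1]] := IH1 C1 mc1 nC1 w1 sL1.
have [a2 b2 d2 n2 [m2 N2]] := IH2 C2 mc2 nC2 w2 sL2.
have [_ pT1] := decomposition_complex_cx sL1; have [_ pT2] := decomposition_complex_cx sL2.
have TE : simplices (L1 ++ L2) = simplices L1 `|` simplices L2.
  apply/fsetP => s; rewrite in_fsetU; apply/imfsetP/orP => [[Q' /=]|].
    by rewrite mem_cat => /orP[] QL ->; [left|right]; exact: in_imfset.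
  by case=> /imfsetP[Q' /= QL ->]; exists Q'; rewrite //= mem_cat QL ?orbT.
set T1 := simplices L1 in a1 b1 d1 n1 m1 N1 pT1 TE; set T2 := simplices L2 in a2 b2 d2 n2 m2 N2 pT2 TE.
have VI x : x \in vertices C1 -> x \in vertices C2 -> x \in A.
  rewrite -!cx1 mc1 mc2 => x1 x2; case: cut => _ /fsetP /(_ [fset x]) h _ _ _.
  by move: h; rewrite in_fsetI x1 x2 fpowersetE fsub1set => <-.
have AV1 : A `<=` vertices C1 := sub_vertices A1.
have AV2 : A `<=` vertices C2 := sub_vertices A2.
have inK G : G \in K -> (G \in C1) || (G \in C2) by exact: (cut_in nK cut).
have KE : K = (C1 `\ A) `|` (C2 `\ A).
  apply/eqP; rewrite eqEfsubset fsubUset (cut_sub nK cut) (cut_sub nK cut') !andbT.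
  apply/fsubsetP => G GK; rewrite in_fsetU !in_fsetD1.
  have -> : G != A by apply: contraNneq nA => <-; exact: cx_facet.
  exact: inK.
have dC : [disjoint C1 `\ A & C2 `\ A]%fset.
  apply/fdisjointP => G; rewrite !in_fsetD1 => /andP[GA G1]; rewrite GA /=.
  by apply: contra GA => G2; apply/eqP; exact: (cut_disj mA cut G1 G2).
have cK' : #|` K| + 2 = #|` C1| + #|` C2|.
  have e1 := cardfsD1 A C1; have e2 := cardfsD1 A C2; rewrite A1 in e1; rewrite A2 in e2.
  by rewrite e1 e2 addnACA addnC -card_disjU // -KE.
have dT : [disjoint T1 & T2]%fset.
  apply/fdisjointP => G G1; apply/negP => G2.
  have : G `<=` A.
    apply/fsubsetP => x xG; apply: VI.
      by apply: (fsubsetP a1); apply/mem_vertices; exists G.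
    by apply: (fsubsetP a2); apply/mem_vertices; exists G.
  by move/fsubset_leq_card; rewrite (pT1 _ G1) cA ltnn.
have cT : #|` simplices (L1 ++ L2)| = #|` T1| + #|` T2| by rewrite TE card_disjU.
have cxT s : (s \in cx (simplices (L1 ++ L2))) = (s \in cx T1) || (s \in cx T2).
  rewrite TE; apply/in_cx/orP => [[G]|].
    by rewrite in_fsetU => /orP[] GT sG; [left|right]; apply/in_cx; exists G.
  by case=> /in_cx[G GT sG]; exists G; rewrite // in_fsetU GT ?orbT.
split.
- rewrite TE; apply: vertices_sub => G; rewrite in_fsetU => /orP[] GT.
    exact: fsubset_trans (sub_vertices GT) (fsubset_trans a1 V1).
  exact: fsubset_trans (sub_vertices GT) (fsubset_trans a2 V2).
- apply/fsubsetP => s /in_cx[G GK sG]; rewrite cxT.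
  case/orP: (inK G GK) => GC.
    by rewrite (fsubsetP b1) //; apply/in_cx; exists G.
  by rewrite (fsubsetP b2) ?orbT //; apply/in_cx; exists G.
- move=> s; rewrite cxT => /orP[] sT cs; first by apply: c1 => //; exact: d1.
  by apply: c2 => //; exact: d2.
- have tI : top k.+2 (cx T1) `&` top k.+2 (cx T2) = [fset A].
    apply/fsetP => s; rewrite in_fsetI in_fset1 !in_top; apply/idP/eqP => [|->]; last first.
      by rewrite cA eqxx (fsubsetP b1) ?(fsubsetP b2) ?cx_facet.
    move=> /andP[/andP[s1 /eqP cs] /andP[s2 _]]; apply/eqP; rewrite eqEfcard cs cA leqnn andbT.
    apply/fsubsetP => x xs; apply: VI.
      by apply: (fsubsetP a1); exact: (fsubsetP (cx_vertices s1)).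
    by apply: (fsubsetP a2); exact: (fsubsetP (cx_vertices s2)).
  have tU : top k.+2 (cx (simplices (L1 ++ L2))) = top k.+2 (cx T1) `|` top k.+2 (cx T2).
    by apply/fsetP => s; rewrite in_fsetU !in_top cxT andb_orl.
  have := cardfsUI (top k.+2 (cx T1)) (top k.+2 (cx T2)); rewrite tI cardfs1 -tU cT => hU.
  exact: (add_ridges hU n1 n2 cK').
- split.
    have VU : vertices K = vertices C1 `|` vertices C2.
      apply/eqP; rewrite eqEfsubset fsubUset V1 V2 !andbT; apply/fsubsetP => x /mem_vertices[G GK xG].
      rewrite in_fsetU; case/orP: (inK G GK) => GC; apply/orP; [left|right];
        by apply/mem_vertices; exists G.
    have VI' : vertices C1 `&` vertices C2 = A.
      apply/eqP; rewrite eqEfsubset fsubsetI AV1 AV2 !andbT; apply/fsubsetP => x.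
      by rewrite in_fsetI => /andP[]; exact: VI.
    have := cardfsUI (vertices C1) (vertices C2); rewrite -VU VI' cA cT => hU.
    exact: (add_vertices hU m1 m2).
  have capA (C' T' : {fset {fset T}}) : w \notin vertices C' -> vertices T' `<=` vertices C' -> A \in C' ->
      cap C' T' w `\ (w |` A) = T' `|` [fset w |` B | B in C' `\ A].
    move=> wC' TV AC'; have nw B : B \in C' -> w \notin B.
      by move=> BC; apply: contra wC'; exact: (fsubsetP (sub_vertices BC)).
    apply/fsetP => s; rewrite in_fsetD1 !in_fsetU; case: (boolP (s \in T')) => /= sT'.
      rewrite andbT; apply/eqP => h; case/negP: wC'; apply: (fsubsetP TV).
      by apply/mem_vertices; exists s; rewrite // h !inE eqxx.
    apply/andP/imfsetP => [[sA /imfsetP[B /= BC sB]]|[B /=]].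
      exists B => //=; rewrite in_fsetD1 BC andbT; apply: contraNneq sA => BA.
      by rewrite sB BA.
    rewrite in_fsetD1 => /andP[BA BC] ->; split; last exact: in_imfset.
    apply: contra BA => /eqP /(congr1 (fun D => D `\ w)).
    by rewrite !fsetU1K ?nw // => ->.
  have VC (C' T' : {fset {fset T}}) : vertices T' `<=` vertices C' ->
      vertices (cap C' T' w) `<=` w |` vertices C'.
    move=> TV; apply: vertices_sub => s; rewrite in_fsetU => /orP[sT|/imfsetP[B /= BC ->]].
      apply: fsubset_trans (fsubset_trans (sub_vertices sT) TV) _; exact: fsubsetUr.
    by apply: fsetUS; exact: sub_vertices.
  have -> : cap K (simplices (L1 ++ L2)) w =
     (cap C1 T1 w `\ (w |` A)) `|` (cap C2 T2 w `\ (w |` A)).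
    rewrite !capA // /cap TE; apply/fsetP => s; rewrite !in_fsetU.
    have -> : (s \in [fset w |` B | B in K]) =
       (s \in [fset w |` B | B in C1 `\ A]) || (s \in [fset w |` B | B in C2 `\ A]).
      apply/imfsetP/orP => [[B /=]|].
        by rewrite KE in_fsetU => /orP[] BC ->; [left|right]; exact: in_imfset.
      by case=> /imfsetP[B /= BC ->]; exists B; rewrite //= KE in_fsetU BC ?orbT.
    by case: (s \in T1); case: (s \in T2); rewrite /= ?orbT.
  apply: facet_sum => //.
  + by rewrite in_fsetU; apply/orP; right; exact: in_imfset.
  + by rewrite in_fsetU; apply/orP; right; exact: in_imfset.
  move=> s /cx_vertices s1 /cx_vertices s2; apply/fsubsetP => x xs; rewrite in_fset1U.
  have := fsubsetP (VC _ _ a1) x (fsubsetP s1 x xs).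
  have := fsubsetP (VC _ _ a2) x (fsubsetP s2 x xs).
  rewrite !in_fset1U; case: (x == w) => //= x2 x1; exact: VI.
Qed.

End Sums.

(** * The refined sphere when the number of edges is minimal *)

Section Equality.
Local Open Scope fset_scope.
Local Open Scope nat_scope.
Variables (R : realType) (T : choiceType).
Implicit Types (A B D G H V W r s t e : {fset T}) (C Z K X Y : {fset {fset T}}) (u v w x y : T).

Lemma fnum_arith_inner (d i n N2 Nj E c B2 B : nat) :
  i * E = d * c -> i.+1 * B = d.+1 * E -> 2 * B2 = d.+1 * d -> N2 + B2 = d * n ->
  i.+1 * Nj + n * (d * c) = n * E + 2 * N2 * c -> Nj + d.+1 * E = B + n * E.
Proof.
move=> h1 h2 h3 h4 h5.
have k1 : 2 * N2 * c + 2 * B2 * c = 2 * n * (d * c) by rewrite -mulnDl -mulnDr h4; ring.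
have k2 : 2 * B2 * c = d.+1 * (i * E) by rewrite h3 h1; ring.
rewrite -h1 in h5 k1; rewrite k2 in k1.
apply/eqP; rewrite -(eqn_pmul2l (ltn0Sn i)); apply/eqP.
have -> : i.+1 * (B + n * E) = d.+1 * E + n * E + n * (i * E) by rewrite mulnDr h2; ring.
have -> : i.+1 * (Nj + d.+1 * E) = i.+1 * Nj + d.+1 * E + d.+1 * (i * E) by ring.
have k5 : 2 * n * (i * E) = n * (i * E) + n * (i * E) by ring.
lia.
Qed.

Lemma fnum_arith_outer (k n N2 Nj B2 : nat) :
  2 * B2 = k.+4.+1 * k.+4 -> N2 + B2 = k.+4 * n ->
  k.+4 * Nj + n * (k.+4 * k.+2) = n * k.+4 + 2 * N2 * k.+2 ->
  Nj + k.+4.+1 * k.+3 = k.+4.+1 + n * k.+3.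
Proof.
move=> h3 h4 h5.
have k1 : 2 * N2 * k.+2 + 2 * B2 * k.+2 = 2 * (k.+4 * n) * k.+2.
  by rewrite -mulnDl -mulnDr h4.
rewrite h3 in k1.
apply/eqP; rewrite -(eqn_pmul2l (ltn0Sn k.+3)); apply/eqP; lia.
Qed.

Lemma sparse_edges k X : normal k.+3 X -> sparse k.+3 X ->
  fnum X 2 + 'C(k.+4, 2) = k.+3 * #|` vertices X|.
Proof.
move=> nX sX; have h1 := closed_excess R (normal_mincycle (ltn0Sn _) nX).
have := sX _ (fsubset_refl _) (normal_vertices_gt nX); rewrite edges_in_all.
by move: h1; lia.
Qed.

(** Sparsity passes to links and turns the edge bound into an equality everywhere, so the summation
    over links is exact. *)
Theorem sparse_fnum k X j : normal k.+3 X -> sparse k.+3 X -> 1 < j <= k.+3 ->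
  fnum X j + k.+4 * excess_coef k.+3 j =
    'C(k.+4, j) + #|` vertices X| * excess_coef k.+3 j.
Proof.
elim: k X j => [|k IH] X j nX sX j13; have h := sparse_edges nX sX.
  have h3 := normal3_fnum nX.
  have [->|->] : j = 2 \/ j = 3 by case: j j13 => [|[|[|[|j]]]] //; [left|right].
    by move: h; rewrite /excess_coef /= ?binS ?bin0 ?bin1 ?bin0n /=; lia.
  by move: h; rewrite /excess_coef /= ?binS ?bin0 ?bin1 ?bin0n /=; lia.
case: j j13 => [//|j] /andP[j1 jk].
have hB2 : 2 * 'C(k.+4.+1, 2) = k.+4.+1 * k.+4 by rewrite -mul_bin_diag bin1.
case: (ltnP 1 j) => j2; last first.
  have -> : j = 1 by lia.
  by rewrite /excess_coef /= bin1; move: h hB2; clear; nia.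
have hs : j.+1 * fnum X j.+1 + #|` vertices X| * (k.+4 * excess_coef k.+3 j) =
   #|` vertices X| * 'C(k.+4, j) + 2 * fnum X 2 * excess_coef k.+3 j.
  rewrite fnum_sum edges_sum big_distrl /= ![#|` vertices X| * _]mulnC -!sum_const_fset -!big_split /=.
  apply: eq_big_seq => v vX; apply: IH; rewrite ?j2 //.
    exact: normal_linkv.
  exact: sparse_link.
have [jE|jE] := eqVneq j k.+3.
  move: hs; rewrite /excess_coef !jE !eqxx /= !binSn; exact: fnum_arith_outer hB2 h.
move: hs; rewrite /excess_coef eqSS (negbTE jE).
have bj : j * 'C(k.+4, j) = k.+4 * 'C(k.+3, j.-1).
  by case: j j1 {jk h jE j2} => // j _; rewrite -mul_bin_diag.
apply: (fnum_arith_inner bj _ hB2 h); by rewrite -mul_bin_diag.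
Qed.

Lemma edges_link_del d X w V : normal d X -> 1 < d ->
  edges_in (link X [fset w]) V <= edges_in (del X w) V.
Proof.
move=> nX d1; apply: fsubset_leq_card; apply/fsubsetP => e; rewrite !in_sep.
move=> /andP[/andP[eL ->] ->]; rewrite !andbT (in_cx_del _ _ nX d1).
by move: eL; rewrite cx_link fdisjoint1X => /andP[-> h]; rewrite andbT; apply: cx_sub h; exact: fsubsetUr.
Qed.

Section Refinement.
Variables (k s : nat) (X : {fset {fset T}}) (w : T) (LF : seq {fset {fset T}}).
Hypotheses (nX : normal k.+4.+1 X) (wX : w \in vertices X) (iw : induced_link X w).
Let K := link X [fset w].
Let n := #|` vertices (del X w)|.
Hypothesis cF : #|` vertices K| = k.+4.+1 + s.
Hypothesis pd : prime_decomposition k.+4 (cx K) LF.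
Hypothesis eq_edges : fnum (del X w) 2 + 'C(k.+4.+2, 2) = k.+4.+1 * n.

Let nK : normal k.+4 K. Proof. exact: normal_linkv. Qed.
Let wK : w \notin vertices K. Proof. by rewrite vertices_link1 eqxx. Qed.
Let pX : pure k.+4.+1 X. Proof. by case: nX. Qed.
Let pK : pure k.+4 K. Proof. by case: nK. Qed.

Let KV : vertices K `<=` vertices (del X w).
Proof.
rewrite (vertices_del w nX) //; apply/fsubsetP => x xF; rewrite in_fsetD1.
rewrite (fsubsetP (vertices_link_sub _ _) _ xF) andbT.
by move: xF; rewrite /K vertices_link1 => /andP[].
Qed.

Lemma bin_succ2 (m : nat) : 'C(m.+2, 2) = m.+1 + 'C(m.+1, 2).
Proof. by rewrite binS2. Qed.

Lemma sparse_arith (d n' v i o N B : nat) : v <= n' -> d * (n' - v) + v <= o + d ->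
  N = i + o -> N + (d + B) = d * n' -> i + B + v <= d * v.
Proof. by move=> vn; rewrite mulnBr; have := leq_mul2l d v n'; rewrite vn orbT; lia. Qed.

Lemma sparse_arith' (d n' v i o N B : nat) : v <= n' -> d * (n' - v) <= o ->
  N = i + o -> N + B = d * n' -> i + B <= d * v.
Proof. by move=> vn; rewrite mulnBr; have := leq_mul2l d v n'; rewrite vn orbT; lia. Qed.

(** With the minimal number of edges there is no slack in [flat_edges_facet]; its extra term |V| is
    the difference between the counts in dimensions k + 5 and k + 4. *)
Lemma sparse_facet : sparse k.+4 K.
Proof.
move=> V VK cV; have VX := fsubset_trans VK KV.
have := flat_edges_facet R (ltn0Sn k.+1) nX wX iw VK cV; rewrite cardfsDS // => h.
have e := eq_edges; rewrite bin_succ2 in e.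
have := sparse_arith (fsubset_leq_card VX) h (edges_split (del X w) V) e.
have := edges_link_del w V nX isT; rewrite -/K mulSn; lia.
Qed.

Let sLF Q : Q \in LF -> simplex_sphere k.+4 Q.
Proof. exact: (prime_factors_simplices R nK sparse_facet pd). Qed.

Let Tl := simplices LF.

Definition refinement : {fset {fset T}} := del X w `|` Tl.

Let pT : pure k.+4.+1 Tl. Proof. by have [] := decomposition_complex_cx sLF. Qed.

Let capP := decomposition_cap nK wK pd sLF.

Let TK : vertices Tl `<=` vertices K. Proof. by case: capP. Qed.
Let wT G : G \in Tl -> w \notin G.
Proof. by move=> GT; apply: contra wK => wG; apply: (fsubsetP TK); apply/mem_vertices; exists G. Qed.

Let del_cap : del (cap K Tl w) w = Tl.
Proof.
apply/fsetP => G; rewrite in_del in_fsetU; case: (boolP (G \in Tl)) => [/wT -> //|_] /=.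
by apply/negbTE; apply/negP => /andP[/imfsetP[B /= _ ->]]; rewrite !inE eqxx.
Qed.

Let link_cap : link (cap K Tl w) [fset w] = K.
Proof.
apply/fsetP => G; rewrite in_link fdisjoint1X in_fsetU; apply/andP/idP => [[wG]|GK].
  case/orP => [/wT|/imfsetP[B /= BK]]; first by rewrite !inE eqxx.
  have wB : w \notin B by apply: contra wK => wB; apply/mem_vertices; exists B.
  by move=> /(congr1 (fun D => D `\ w)); rewrite !fsetU1K // => ->.
split; first by apply: contra wK => wG; apply/mem_vertices; exists G.
by apply/orP; right; exact: in_imfset.
Qed.

(** The cap over K has the same link at w as X, and deleting w from it leaves the simplices, so this
    is an instance of [hole_sum]. *)
Lemma refinement_normal : normal k.+4.+1 refinement.
Proof.
rewrite /refinement -[X in _ `|` X]del_cap; apply: hole_sum => //.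
- by have [_ _ _ _ []] := capP.
- by rewrite del_cap.
Qed.

Lemma cx_refinement t : (t \in cx refinement) = (t \in cx (del X w)) || (t \in cx Tl).
Proof.
apply/in_cx/orP => [[G]|].
  by rewrite in_fsetU => /orP[] GT tG; [left|right]; apply/in_cx; exists G.
by case=> /in_cx[G GT tG]; exists G; rewrite // in_fsetU GT ?orbT.
Qed.

Let cxK_del t : t \in cx K -> t \in cx (del X w).
Proof.
rewrite (in_cx_del _ _ nX) // cx_link fdisjoint1X => /andP[-> h]; rewrite andbT.
by apply: cx_sub h; exact: fsubsetUr.
Qed.

Let cxT_small t : t \in cx Tl -> #|` t| < k.+4 -> t \in cx (del X w).
Proof. by have [_ _ h _ _] := capP; move=> tT ct; apply: cxK_del; exact: h. Qed.

Lemma vertices_refinement : vertices refinement = vertices (del X w).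
Proof.
apply/fsetP => x; rewrite -!cx1 cx_refinement.
by case: (boolP ([fset x] \in cx Tl)) => [/cxT_small ->|]; rewrite ?cardfs1 ?orbF.
Qed.

(** Faces of the decomposition with fewer than [k.+4] vertices lie in K already, so the refinement
    adds no edge and [flat_edges] gives the count. *)
Lemma refinement_sparse : sparse k.+4.+1 refinement.
Proof.
move=> V VX cV; rewrite vertices_refinement in VX.
have := flat_edges R (ltn0Sn k.+1) nX wX iw VX (ltnW cV); rewrite cardfsDS // => h.
apply: leq_trans (sparse_arith' (fsubset_leq_card VX) h (edges_split (del X w) V) eq_edges).
rewrite leq_add2r; apply: fsubset_leq_card; apply/fsubsetP => e; rewrite !in_sep cx_refinement.
move=> /andP[/andP[+ /eqP ce] ->]; rewrite ce eqxx !andbT => /orP[//|eT].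
by apply: cxT_small eT _; rewrite ce.
Qed.

Lemma card_simplices : #|` Tl| = s.+1.
Proof. by have [_ _ _ _ [h _]] := capP; apply/eqP; move/eqP: h; rewrite -/Tl cF addSnnS eqn_add2l eq_sym. Qed.

(** F is filled by s + 1 simplices with s ridges between them, and smaller faces do not change; this
    is where the two terms of [facet_defect] come from. *)
Lemma fnum_refinement j : 1 < j <= k.+4.+1 ->
  fnum refinement j = fnum (del X w) j + facet_defect k.+4.+1 j X w.
Proof.
move=> /andP[j1 jk]; rewrite /facet_defect wX -/K cF addKn.
have [_ KT hT cT _] := capP; have cTl := card_simplices.
case: (ltnP j k.+4) => jk4.
  have -> : (j == k.+4.+1.-1) = false by lia.
  have -> : (j == k.+4.+1) = false by lia.
  rewrite !mul0n !addn0; congr #|` _|; apply/fsetP => t; rewrite !in_cells cx_refinement.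
  case: eqP => [ct|]; rewrite ?andbF // !andbT.
  by case: (boolP (t \in cx Tl)) => [/cxT_small ->|]; rewrite ?orbF ?ct.
have commonK t : t \in cx Tl -> t \in cx (del X w) -> t \in cx K.
  move=> tT; rewrite (in_cx_del _ _ nX) // => /andP[tX wt].
  rewrite cx_link fdisjoint1X wt; apply: iw => //; exact: fsubset_trans (cx_vertices tT) TK.
have cellsU : cells refinement j = cells (del X w) j `|` cells Tl j.
  by apply/fsetP => t; rewrite in_fsetU !in_cells cx_refinement andb_orl.
have := cardfsUI (cells (del X w) j) (cells Tl j); rewrite -cellsU.
have [jE|jE] := eqVneq j k.+4.
  have -> : (j == k.+4.+1) = false by lia.
  have -> : cells (del X w) j `&` cells Tl j = K.
    apply/fsetP => t; rewrite in_fsetI !in_cells; apply/idP/idP => [|tK].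
      by move=> /andP[/andP[t1 /eqP ct] /andP[t2 _]]; apply: (cx_card pK); rewrite ?ct //; exact: commonK.
    have tK' := cx_facet tK.
    by rewrite cxK_del // (fsubsetP KT) // pK // jE eqxx.
  rewrite -/Tl /fnum in cT *; have -> : cells Tl j = top k.+4 (cx Tl) by rewrite jE.
  by move: cT cTl; clear; lia.
have jE' : j = k.+4.+1 by lia.
have -> : (j == k.+4.+1) = true by rewrite jE' eqxx.
have -> : cells (del X w) j `&` cells Tl j = fset0.
  apply/eqP; rewrite -fsubset0; apply/fsubsetP => t; rewrite in_fsetI !in_cells.
  move=> /andP[/andP[t1 /eqP ct] /andP[t2 _]].
  by have := card_cx pK (commonK t t2 t1); rewrite ct jE' ltnn.
have -> : cells Tl j = Tl by rewrite jE'; exact: top_cx.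
rewrite cardfs0 /fnum; move: cTl; clear; lia.
Qed.

Theorem refinement_prime L : prime_decomposition k.+4.+1 (cx refinement) L ->
  forall Q, Q \in L -> simplex_sphere k.+4.+1 Q.
Proof. exact: (prime_factors_simplices R refinement_normal refinement_sparse). Qed.

Theorem refinement_fnum j : 1 < j <= k.+4.+1 ->
  fnum (del X w) j + facet_defect k.+4.+1 j X w + k.+4.+2 * excess_coef k.+4.+1 j =
    'C(k.+4.+2, j) + n * excess_coef k.+4.+1 j.
Proof.
move=> hj; rewrite -fnum_refinement // (sparse_fnum refinement_normal refinement_sparse) //.
by rewrite vertices_refinement.
Qed.

Lemma decomposition_simplices : decomposition_complex LF = cx Tl.
Proof. by have [] := decomposition_complex_cx sLF. Qed.

End Refinement.
End Equality.

(** * Faces of polytopes *)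

Section Functionals.
Local Open Scope fset_scope.
Local Open Scope ring_scope.
Variables (R : realType) (N : nat).
Implicit Types (A B F G H V : {fset 'rV[R]_N}) (x p q v : 'rV[R]_N) (f g h z : 'rV[R]_(1 + N)).

(* Affine functionals on R^N are linear functionals on the vectors (1, p). *)
Definition hat p : 'rV[R]_(1 + N) := row_mx (1%:M : 'M[R]_1) p.
Definition ev f p : R := dotp (hat p) f.
Definition zeros V f : {fset 'rV[R]_N} := [fset p in V | ev f p == 0].
Definition nonneg V f : Prop := forall p, p \in V -> 0 <= ev f p.
Definition hull A : 'M[R]_(1 + N) := (\sum_(p <- A) <<hat p>>)%MS.

Lemma in_zeros V f p : (p \in zeros V f) = (p \in V) && (ev f p == 0).
Proof. exact: in_sep. Qed.

Lemma zeros_sub V f : zeros V f `<=` V.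
Proof. by apply/fsubsetP => p; rewrite in_zeros => /andP[]. Qed.

Lemma evD f g p : ev (f + g) p = ev f p + ev g p. Proof. exact: dotpDr. Qed.
Lemma evZ a f p : ev (a *: f) p = a * ev f p. Proof. exact: dotpZr. Qed.

Lemma mem_hull A p : p \in A -> (hat p <= hull A)%MS.
Proof.
by move=> pA; rewrite /hull (big_fsetD1 p) //=; apply: submx_trans (addsmxSl _ _); rewrite genmxE.
Qed.

Lemma hull_subP m A (U : 'M_(m, 1 + N)) :
  (forall p, p \in A -> (hat p <= U)%MS) -> (hull A <= U)%MS.
Proof.
move=> AU; rewrite /hull big_seq; apply: (big_ind (fun W : 'M_(1 + N) => W <= U)%MS).
- exact: sub0mx.
- by move=> W1 W2 h1 h2; rewrite addsmx_sub h1.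
- by move=> p /AU; rewrite genmxE.
Qed.

Lemma hullS A B : A `<=` B -> (hull A <= hull B)%MS.
Proof. by move=> /fsubsetP AB; apply: hull_subP => p /AB; exact: mem_hull. Qed.

Lemma affrankS A B : A `<=` B -> (affrank A <= affrank B)%N.
Proof. by move=> AB; apply: mxrankS; exact: hullS. Qed.

Lemma affrank0 : affrank (fset0 : {fset 'rV[R]_N}) = 0%N.
Proof. by rewrite /affrank big_seq_fset0 mxrank0. Qed.

Lemma rank_add_row m n (U : 'M[R]_(m, n)) (z : 'rV_n) :
  \rank (U + z)%MS = (\rank U + ~~ (z <= U)%MS)%N.
Proof.
have [zU|zU] := boolP (z <= U)%MS.
  by rewrite addn0; apply/eqP; rewrite eqn_leq !mxrankS ?addsmxSl // addsmx_sub submx_refl.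
have z0 : z != 0 by apply: contra zU => /eqP ->; exact: sub0mx.
have := mxrank_sum_cap U z; rewrite (rank_rV z) z0 => <-.
suff -> : \rank (U :&: z) = 0%N by rewrite addn0.
apply/eqP; rewrite -leqn0 -ltnS; have h : (\rank (U :&: z)%MS <= \rank z)%N by rewrite mxrankS ?capmxSr.
rewrite rank_rV z0 in h; rewrite ltn_neqAle h andbT; apply: contra zU => /eqP r1.
apply: submx_trans (capmxSl U z); have /mxrank_leqif_sup [_ <-] := capmxSr U z.
by rewrite r1 rank_rV z0.
Qed.

Lemma hullU A x : (hull (x |` A) :=: hull A + hat x)%MS.
Proof.
apply/eqmxP/andP; split.
  apply: hull_subP => p; rewrite in_fset1U => /orP[/eqP ->|pA]; first exact: addsmxSr.
  by apply: submx_trans (addsmxSl _ _); exact: mem_hull.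
by rewrite addsmx_sub hullS ?mem_hull ?fset1U1 // fsubsetUr.
Qed.

Lemma affrankU A x : affrank (x |` A) = (affrank A + ~~ (hat x <= hull A)%MS)%N.
Proof. by rewrite /affrank -/(hull _) hullU rank_add_row. Qed.

Lemma hull_full A B z : A `<=` B -> affrank A = affrank B -> (z <= hull B)%MS -> (z <= hull A)%MS.
Proof.
move=> AB rAB /submx_trans -> //; have /mxrank_leqif_sup [_ <-] := hullS AB; exact/eqP.
Qed.

Lemma affrank_card A : (affrank A <= #|` A|)%N.
Proof.
elim/finSet_rect: A => A IH; have [->|[x xA]] := fset_0Vmem A; first by rewrite affrank0.
rewrite -(fsetD1K xA) affrankU cardfsU1 !inE eqxx /= addnC; apply: leq_add; first by case: (~~ _).
by apply: IH; exact: fproperD1.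
Qed.

Lemma simplexS A B : A `<=` B -> is_simplex B -> is_simplex A.
Proof.
move=> AB; move: {2}(#|` B `\` A|) (erefl #|` B `\` A|) => m.
elim: m B AB => [|m IH] B AB.
  move=> /eqP; rewrite cardfs_eq0 fsetD_eq0 => BA; suff -> : A = B by [].
  by apply/eqP; rewrite eqEfsubset AB.
move=> cm sB; have [x] : exists x, x \in B `\` A.
  by have [e|[x xBA]] := fset_0Vmem (B `\` A); [rewrite e cardfs0 in cm|exists x].
rewrite in_fsetD => /andP[xA xB].
apply: (IH (B `\ x)).
- by apply/fsubsetP => y yA; rewrite in_fsetD1 (fsubsetP AB) // andbT; apply: contraNneq xA => <-.
- have -> : (B `\ x) `\` A = (B `\` A) `\ x by apply/fsetP => y; rewrite !(in_fsetD, in_fsetD1) andbCA.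
  by move: cm; rewrite (cardfsD1 x) in_fsetD xA xB add1n => -[].
- move: sB; rewrite /is_simplex -{1}(fsetD1K xB) affrankU (cardfsD1 x B) xB => e.
  by apply/eqP; rewrite eqn_leq affrank_card /=; move: e; clear; case: (~~ _) => /=; lia.
Qed.

Lemma dotp_hull A f z : (forall p, p \in A -> ev f p = 0) -> (z <= hull A)%MS -> dotp z f = 0.
Proof.
move=> f0 zA; suff : (z <= kermx f^T)%MS by rewrite dotpE => /sub_kermxP ->; rewrite mxE.
apply: submx_trans zA _; apply: hull_subP => p /f0; rewrite /ev dotpE => e.
by apply/sub_kermxP/matrixP => i j; rewrite !ord1 e mxE.
Qed.

Lemma separate m (U : 'M[R]_(m, 1 + N)) z : ~~ (z <= U)%MS ->
  exists f, (forall y, (y <= U)%MS -> dotp y f = 0) /\ dotp z f = 1.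
Proof.
move=> zU; have : z *m cokermx U != 0 by rewrite -submxE.
move=> /rV0Pn[j aj]; set a := (_ *m _) _ _ in aj.
have e y : dotp y (a^-1 *: (col j (cokermx U))^T) = a^-1 * (y *m cokermx U) ord0 j.
  by rewrite dotpZr dotpE trmxK colE mulmxA -colE mxE.
exists (a^-1 *: (col j (cokermx U))^T); split=> [y yU|]; rewrite e; last by rewrite mulVf.
by move: yU; rewrite submxE => /eqP ->; rewrite mxE mulr0.
Qed.

Lemma evE c b p : ev (row_mx (b%:M : 'M[R]_1) (- c)) p = b - dotp p c.
Proof.
rewrite /ev /hat !dotpE tr_row_mx mul_row_col mul1mx tr_scalar_mx linearN /= mulmxN.
by rewrite !mxE eqxx mulr1n.
Qed.

Lemma functionalP f : exists c b, f = row_mx (b%:M : 'M[R]_1) (- c).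
Proof. by exists (- rsubmx f), (lsubmx f 0 0); rewrite opprK -mx11_scalar hsubmxK. Qed.

Lemma validP V c b : valid V c b <-> forall p, p \in V -> dotp p c <= b.
Proof.
split=> [h p pV|h x [w [w0 w1 ->]]].
  apply: h; exists (fun q => (q == p)%:R); split=> [q _||]; first exact: ler0n.
    rewrite (big_fsetD1 p) //= eqxx big1_seq ?addr0 // => q.
    by rewrite in_fsetD1 => /andP[_ /andP[/negbTE ->]].
  rewrite (big_fsetD1 p) //= eqxx scale1r big1_seq ?addr0 // => q.
  by rewrite in_fsetD1 => /andP[_ /andP[/negbTE -> _]]; rewrite scale0r.
rewrite dotp_suml -[b]mul1r -w1 mulr_suml big_seq [leRHS]big_seq; apply: ler_sum => p pV.
by rewrite dotpZl; apply: ler_wpM2l; [exact: w0|exact: h].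
Qed.

Lemma valid_nonneg V c b : valid V c b <-> nonneg V (row_mx (b%:M : 'M[R]_1) (- c)).
Proof.
by rewrite validP; split=> h p /h; rewrite evE subr_ge0.
Qed.

Lemma contact_zeros V c b : contact V c b = zeros V (row_mx (b%:M : 'M[R]_1) (- c)).
Proof. by apply/fsetP => p; rewrite in_zeros in_sep evE subr_eq0 eq_sym. Qed.

(** From here on convex hulls disappear: faces are handled through affine functionals that are
    nonnegative on the finite vertex set. *)
Lemma faceP V A : is_face V A <-> exists f, nonneg V f /\ A = zeros V f.
Proof.
split=> [[c [b [/valid_nonneg h ->]]]|[f [h ->]]].
  by exists (row_mx (b%:M : 'M[R]_1) (- c)); rewrite contact_zeros.
by have [c [b e]] := functionalP f; exists c, b; rewrite valid_nonneg contact_zeros -e.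
Qed.

Lemma in_faces V A : A \in faces V <-> is_face V A.
Proof.
rewrite /faces in_sep fpowersetE; split=> [/andP[_ /asboolP] //|h].
apply/andP; split; last exact/asboolP.
by have /faceP[f [_ ->]] := h; exact: zeros_sub.
Qed.

Lemma fproperP (T : choiceType) (D E : {fset T}) :
  reflect ({subset D <= E} /\ exists2 x, x \in E & x \notin D) (D `<` E).
Proof.
rewrite fproperE; apply: (iffP andP) => [[/fsubsetP DE ED]|[/fsubsetP DE [x xE xD]]]; last first.
  by split=> //; apply: contra xD => /fsubsetP; apply.
split=> //; have [e|[x]] := fset_0Vmem (E `\` D); first by rewrite -fsetD_eq0 e eqxx in ED.
by rewrite in_fsetD => /andP[xD xE]; exists x.
Qed.

Lemma small_enough (T : eqType) (s : seq T) (a b : T -> R) :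
  (forall t, t \in s -> 0 < a t) -> exists2 e, 0 < e & forall t, t \in s -> 0 < a t - e * b t.
Proof.
elim: s => [|t s IH] h; first by exists 1.
have [u us|e e0 he] := IH; first by apply: h; rewrite in_cons us orbT.
have a0 := h t (mem_head _ _); have b0 : 0 < `|b t| + 1 by rewrite ltr_wpDl.
have q0 : 0 < a t / (`|b t| + 1) by rewrite divr_gt0.
exists (Num.min e (a t / (`|b t| + 1)) / 2); first by rewrite divr_gt0 // lt_min e0.
set m := Num.min _ _; have m0 : 0 < m by rewrite lt_min e0.
move=> u; rewrite in_cons => /orP[/eqP ->|us].
  have : m <= a t / (`|b t| + 1) by rewrite ge_min lexx orbT.
  rewrite ler_pdivlMr // => h1; have := ler_norm (b t) => h2.
  have : m / 2 * b t <= m / 2 * `|b t| by rewrite ler_wpM2l // divr_ge0 // ltW.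
  by nra.
have h1 : m <= e by rewrite ge_min lexx.
have := he u us; have := h u; rewrite in_cons us orbT => /(_ isT) au h2.
have [bu|bu] := leP 0 (b u).
  have : m / 2 * b u <= e * b u by rewrite ler_wpM2r //; lra.
  by lra.
have : m / 2 * b u <= 0 by rewrite mulr_ge0_le0 ?divr_ge0 ?ltW.
by lra.
Qed.

End Functionals.

(** * Tilting and rotating supporting hyperplanes *)

Section Faces.
Local Open Scope fset_scope.
Local Open Scope ring_scope.
Variables (R : realType) (N : nat).
Implicit Types (A B F G H V : {fset 'rV[R]_N}) (x p q v : 'rV[R]_N) (f g h z : 'rV[R]_(1 + N)).

Lemma face_sub V A : is_face V A -> A `<=` V.
Proof. by move=> /faceP[f [_ ->]]; exact: zeros_sub. Qed.

Lemma face_full V : is_face V V.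
Proof.
apply/faceP; exists 0; have e p : ev 0 p = 0 :> R by exact: dotp0r.
split=> [p _|]; first by rewrite e.
by apply/fsetP => p; rewrite in_zeros e eqxx andbT.
Qed.

Lemma face_of_sub V A B : is_face V A -> A `<=` B -> B `<=` V -> is_face B A.
Proof.
move=> /faceP[f [f0 ->]] AB BV; apply/faceP; exists f; split.
  by move=> p /(fsubsetP BV); exact: f0.
apply/fsetP => p; rewrite !in_zeros; have [pB|pB] := boolP (p \in B).
  by rewrite (fsubsetP BV _ pB).
by rewrite -in_zeros /=; apply: contraNF pB; exact: (fsubsetP AB).
Qed.

Lemma face_rank_eq V A B : is_face V A -> A `<=` B -> B `<=` V -> affrank A = affrank B -> A = B.
Proof.
move=> fA AB BV rAB; have /faceP[f [f0 e]] := fA.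
apply/eqP; rewrite eqEfsubset AB /=; apply/fsubsetP => p pB.
rewrite e in_zeros (fsubsetP BV) // /ev; apply/eqP; apply: (dotp_hull (A := A)).
  by move=> q; rewrite e in_zeros => /andP[_ /eqP].
by apply: (hull_full AB rAB); exact: mem_hull.
Qed.

Lemma face_rank_lt V A B : is_face V A -> A `<` B -> B `<=` V -> (affrank A < affrank B)%N.
Proof.
move=> fA AB BV; have [_ [x xB xA]] := fproperP _ _ AB.
rewrite ltn_neqAle affrankS ?fproper_sub // andbT.
by apply: contra xA => /eqP rAB; rewrite (face_rank_eq fA (fproper_sub AB) BV rAB).
Qed.

Lemma face_rank_proper V A : is_face V A -> A <> V -> (affrank A < affrank V)%N.
Proof.
by move=> fA AV; apply: (face_rank_lt fA); rewrite ?fsubset_refl // fproperEneq face_sub // andbT; apply/eqP.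
Qed.

Lemma facet_proper V G : is_facet V G -> exists2 v, v \in V & v \notin G.
Proof.
move=> [fG rG]; have [/fproperP[_ [v vV vG]]|] := boolP (G `<` V); first by exists v.
rewrite fproperEneq (face_sub fG) andbT negbK => /eqP e.
by move: rG; rewrite -e; lia.
Qed.

Lemma facet_neq V G : is_facet V G -> G <> V.
Proof. by move=> /facet_proper[v vV vG] e; rewrite e vV in vG. Qed.

Lemma facet_maximal V G A : is_facet V G -> is_face V A -> G `<=` A -> A = G \/ A = V.
Proof.
move=> [fG rG] fA GA; have [->|/eqP AV] := eqVneq A V; [by right|left].
have := face_rank_proper fA AV; rewrite -rG ltnS => rA.
by symmetry; apply: (face_rank_eq fG GA (face_sub fA)); apply/eqP; rewrite eqn_leq affrankS.
Qed.

(** A large multiple of f dominates g at the vertices where f is positive and changes nothing where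
    f vanishes. Hence a face of a face is a face. *)
Lemma tilt V f g : nonneg V f -> nonneg (zeros V f) g ->
  exists2 t, 0 < t & nonneg V (g + t *: f) /\ zeros V (g + t *: f) = zeros (zeros V f) g.
Proof.
move=> f0 g0; pose s := [seq p <- enum_fset V | ev f p != 0].
have [p|e e0 he] := @small_enough R _ s (ev f) (fun p => - ev g p).
  by rewrite mem_filter => /andP[fp /f0]; rewrite le_eqVlt eq_sym (negbTE fp).
have pos p : p \in V -> ev f p != 0 -> 0 < ev (g + e^-1 *: f) p.
  move=> pV fp; have := he p; rewrite mem_filter fp => /(_ pV) h.
  rewrite evD evZ -(pmulr_rgt0 _ e0) mulrDr mulVKf ?gt_eqF //; lra.
have zero p : ev f p = 0 -> ev (g + e^-1 *: f) p = ev g p.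
  by rewrite evD evZ => ->; rewrite mulr0 addr0.
exists e^-1; rewrite ?invr_gt0 //; split=> [p pV|].
  have [/eqP fp|fp] := boolP (ev f p == 0); last exact/ltW/pos.
  by rewrite zero //; apply: g0; rewrite in_zeros pV fp eqxx.
apply/fsetP => p; rewrite !in_zeros; have [pV|//] := boolP (p \in V).
have [/eqP fp|fp] := boolP (ev f p == 0) => /=; first by rewrite zero.
by rewrite gt_eqF // pos.
Qed.

Lemma face_trans V A B : is_face V A -> is_face A B -> is_face V B.
Proof.
move=> /faceP[f [f0 ->]] /faceP[g [g0 ->]]; have [t _ [h1 h2]] := tilt f0 g0.
by apply/faceP; exists (g + t *: f).
Qed.

Lemma simplex_notin_hull A x : is_simplex A -> x \in A -> ~~ (hat x <= hull (A `\ x))%MS.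
Proof.
move=> sA xA; apply/negP => xh; have := affrankU (A `\ x) x; rewrite fsetD1K // xh addn0 sA.
by have := affrank_card (A `\ x); rewrite (cardfsD1 x A) xA; lia.
Qed.

Lemma simplex_face A B : is_simplex B -> A `<=` B -> is_face B A.
Proof.
elim/finSet_rect: B => B IH sB AB.
have [e|[x]] := fset_0Vmem (B `\` A).
  suff -> : A = B by exact: face_full.
  by apply/eqP; rewrite eqEfsubset AB -fsetD_eq0 e eqxx.
rewrite in_fsetD => /andP[xA xB]; apply: (@face_trans _ (B `\ x)).
  have [f [f0 f1]] := separate (simplex_notin_hull sB xB).
  have fE p : p \in B -> p != x -> ev f p = 0.
    by move=> pB px; apply: f0; apply: mem_hull; rewrite in_fsetD1 px.
  apply/faceP; exists f; split=> [p pB|].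
    by have [->|px] := eqVneq p x; [rewrite /ev f1 ler01|rewrite fE].
  apply/fsetP => p; rewrite in_zeros in_fsetD1; have [->|px] := eqVneq p x.
    by rewrite /ev f1 oner_eq0 andbF.
  by have [pB|//] := boolP (p \in B); rewrite fE // eqxx.
have DB : B `\ x `<` B by exact: fproperD1.
apply: IH => //; first by apply: simplexS sB; exact: fsubD1set.
by apply/fsubsetP => y yA; rewrite in_fsetD1 (fsubsetP AB) // andbT; apply: contraNneq xA => <-.
Qed.

(** The ratio test of linear programming: t is the least value of f / (-g) over the vertices where g
    is negative, and a minimizer becomes the new zero. *)
Lemma rotate V f g p : nonneg V f -> (forall q, q \in zeros V f -> ev g q = 0) ->
  p \in V -> ev g p < 0 ->
  exists2 t, 0 < t & nonneg V (f + t *: g) /\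
    exists q, [/\ q \in V, q \notin zeros V f & ev (f + t *: g) q = 0].
Proof.
move=> f0 g0 pV gp.
have fpos q : q \in V -> ev g q < 0 -> 0 < ev f q.
  move=> qV gq; rewrite lt_neqAle f0 // andbT eq_sym; apply: contraTneq gq => fq.
  by rewrite g0 ?ltxx // in_zeros qV fq eqxx.
case: (@Order.TotalTheory.arg_minP _ _ _ [` pV] (fun q : V => ev g (val q) < 0)
  (fun q : V => ev f (val q) / - ev g (val q))) => //= q gq qmin.
have qV := fsvalP q; have fq := fpos _ qV gq.
exists (ev f (val q) / - ev g (val q)); first by rewrite divr_gt0 // oppr_gt0.
split=> [r rV|].
  rewrite evD evZ; have [gr|gr] := leP 0 (ev g r).
    by rewrite addr_ge0 ?f0 // mulr_ge0 // divr_ge0 ?ltW // oppr_gt0.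
  have := qmin [` rV] gr; rewrite /= ler_pdivlMr ?oppr_gt0 //; lra.
exists (val q); split=> //; first by rewrite in_zeros (gt_eqF fq) andbF.
by rewrite evD evZ invrN mulrN mulNr divfK ?subrr // lt_eqF.
Qed.

Lemma zeros_rotate V f g t : (forall q, q \in zeros V f -> ev g q = 0) ->
  zeros V f `<=` zeros V (f + t *: g).
Proof.
move=> g0; apply/fsubsetP => q qz; rewrite in_zeros evD evZ g0 // mulr0 addr0.
by rewrite -in_zeros.
Qed.

Lemma outside_ex V (U : 'M[R]_(1 + N)) : (\rank U < affrank V)%N ->
  exists2 u, u \in V & ~~ (hat u <= U)%MS.
Proof.
move=> rU; apply: contrapT => h; move: rU; rewrite ltnNge => /negP; apply.
apply: mxrankS; apply: hull_subP => p pV; apply: contrapT => /negP pU; apply: h.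
by exists p.
Qed.

(** The hyperplane is rotated about the span of A and v. The rotating functional vanishes at v, so
    the value there stays nonzero while the face grows. *)
Lemma facet_avoiding V A v : is_face V A -> v \in V -> v \notin A ->
  exists G, [/\ is_facet V G, A `<=` G & v \notin G].
Proof.
move: {2}#|` V `\` A| (leqnn #|` V `\` A|) => m.
elim: m A => [|m IH] A cm fA vV vA.
  by move: cm; rewrite leqn0 cardfs_eq0 fsetD_eq0 => /fsubsetP/(_ _ vV) h; rewrite h in vA.
have AV : (affrank A < affrank V)%N.
  by apply: face_rank_proper => // e; rewrite e vV in vA.
have [rA|rA] := eqVneq (affrank A).+1 (affrank V); first by exists A; split.
have [|u uV uU] := @outside_ex V (hull (v |` A)).
  by rewrite -/(affrank _) affrankU; have := leq_b1 (~~ (hat v <= hull A)%MS); move: AV rA; lia.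
have [g [g0 gu]] := separate uU.
have /faceP[f [f0 e]] := fA.
have gA (g' := -g) q : q \in zeros V f -> ev g' q = 0.
  by rewrite -e => qA; rewrite /ev dotpNr g0 ?oppr0 // mem_hull // fset1Ur.
have [|t t0 [h1 [q [qV qA hq]]]] := rotate f0 gA uV; first by rewrite /ev dotpNr gu ltrN10.
have fv : ev (f + t *: - g) v != 0.
  rewrite evD evZ /ev dotpNr g0 ?mem_hull ?fset1U1 // oppr0 mulr0 addr0.
  by move: vA; rewrite e in_zeros vV.
have AA : A `<=` zeros V (f + t *: - g) by rewrite e; exact: zeros_rotate.
have [||//||G [h2 h3 h4]] := IH (zeros V (f + t *: - g)).
- rewrite -ltnS; apply: leq_trans cm; apply: fproper_ltn_card; apply/fproperP; split.
    by move=> y; rewrite !in_fsetD => /andP[yA ->]; rewrite andbT; apply: contra yA; exact: (fsubsetP AA).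
  by exists q; rewrite in_fsetD ?qV ?andbT ?e // in_zeros qV hq eqxx.
- by apply/faceP; exists (f + t *: - g).
- by rewrite in_zeros vV.
by exists G; split=> //; exact: fsubset_trans h3.
Qed.

(** The growth process of [facet_avoiding], with the sign of the rotating functional chosen so that
    the value at z never becomes positive. *)
Lemma facet_below V f z : nonneg V f -> zeros V f <> V -> dotp z f <= 0 ->
  exists g, [/\ nonneg V g, is_facet V (zeros V g), zeros V f `<=` zeros V g & dotp z g <= 0].
Proof.
move: {2}#|` V `\` zeros V f| (leqnn #|` V `\` zeros V f|) => m.
elim: m f => [|m IH] f cm f0 fV zf.
  by move: cm; rewrite leqn0 cardfs_eq0 fsetD_eq0 => h; case: fV; apply/eqP; rewrite eqEfsubset zeros_sub.
have fA : is_face V (zeros V f) by apply/faceP; exists f.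
have AV := face_rank_proper fA fV.
have [rA|rA] := eqVneq (affrank (zeros V f)).+1 (affrank V); first by exists f; split.
have [v vV vA] : exists2 v, v \in V & v \notin zeros V f.
  have [/fproperP[_ [v vV vG]]|] := boolP (zeros V f `<` V); first by exists v.
  by rewrite fproperEneq zeros_sub andbT negbK => /eqP.
have [|u uV uU] := @outside_ex V (hull (v |` zeros V f)).
  by rewrite -/(affrank _) affrankU; have := leq_b1 (~~ (hat v <= hull (zeros V f))%MS); move: AV rA; lia.
have [g' [g0' gu']] := separate uU.
have [g [g0 gu gz]] : exists g, [/\ forall y, (y <= hull (v |` zeros V f))%MS -> dotp y g = 0,
    ev g u != 0 & dotp z g <= 0].
  have [h|h] := leP (dotp z g') 0; first by exists g'; rewrite /ev gu' oner_neq0.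
  exists (- g'); split=> [y yU||]; first by rewrite dotpNr g0' ?oppr0.
    by rewrite /ev dotpNr oppr_eq0 gu' oner_neq0.
  by rewrite dotpNr oppr_le0 ltW.
have gA q : q \in zeros V f -> ev g q = 0 by move=> qA; apply: g0; rewrite mem_hull // fset1Ur.
have gv : ev g v = 0 by apply: g0; rewrite mem_hull // fset1U1.
have step h y : nonneg V h -> y \in V -> ev h y != 0 -> dotp z h <= 0 ->
    zeros V f `<=` zeros V h -> (exists2 q, q \notin zeros V f & q \in zeros V h) ->
    exists g, [/\ nonneg V g, is_facet V (zeros V g), zeros V f `<=` zeros V g & dotp z g <= 0].
  move=> h0 yV hy zh fh [q qf qh].
  have [|//||//|g2 [k1 k2 k3 k4]] := IH h.
  - rewrite -ltnS; apply: leq_trans cm; apply: fproper_ltn_card; apply/fproperP; split.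
      by move=> w; rewrite !in_fsetD => /andP[wA ->]; rewrite andbT; apply: contra wA; exact: (fsubsetP fh).
    by exists q; rewrite in_fsetD ?qf ?qh //; move: qh; rewrite in_zeros => /andP[->].
  - by move=> e; move: yV; rewrite -e in_zeros (negbTE hy) andbF.
  by exists g2; split=> //; exact: fsubset_trans k3.
have [[p pV gp]|ge] := EM (exists2 p, p \in V & ev g p < 0).
  have [t t0 [h1 [q [qV qA hq]]]] := rotate f0 gA pV gp.
  apply: (step (f + t *: g) v) => //.
  - by rewrite evD evZ gv mulr0 addr0; move: vA; rewrite in_zeros vV.
  - rewrite dotpDr dotpZr; have h : t * dotp z g <= 0 by rewrite mulr_ge0_le0 // ltW.
    by lra.
  - exact: zeros_rotate.
  - by exists q => //; rewrite in_zeros qV hq eqxx.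
apply: (step g u) => //.
- by move=> p pV; rewrite leNgt; apply/negP => gp; apply: ge; exists p.
- by apply/fsubsetP => q qA; rewrite in_zeros gA // eqxx andbT; move: qA; rewrite in_zeros => /andP[].
- by exists v => //; rewrite in_zeros vV gv eqxx.
Qed.

Lemma facet_unique V f g : is_facet V (zeros V f) ->
  (forall q, q \in zeros V f -> ev g q = 0) ->
  exists c, forall z, (z <= hull V)%MS -> dotp z g = c * dotp z f.
Proof.
move=> fG g0; have [v vV vG] := facet_proper fG; have fv : ev f v != 0.
  by move: vG; rewrite in_zeros vV.
exists (ev g v / ev f v) => z zV; apply/eqP; rewrite -subr_eq0 -dotpZr -dotpBr; apply/eqP.
apply: (dotp_hull (A := v |` zeros V f)).
  move=> q; rewrite in_fset1U /ev dotpBr dotpZr => /orP[/eqP ->|qG]; first by rewrite divfK ?subrr.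
  by rewrite [dotp _ g]g0 // -/(ev f q); move: qG; rewrite in_zeros => /andP[_ /eqP ->]; rewrite mulr0 subrr.
apply: (@hull_full _ _ _ V) => //.
  by apply/fsubsetP => q; rewrite in_fset1U in_zeros => /orP[/eqP ->|/andP[]].
have [fF rG] := fG; rewrite -rG affrankU.
suff -> : ~~ (hat v <= hull (zeros V f))%MS by rewrite addn1.
apply: contra vG => vh; rewrite in_zeros vV; apply/eqP; apply: dotp_hull vh.
by move=> q; rewrite in_zeros => /andP[_ /eqP].
Qed.

End Faces.

(** * The facets of a simplicial polytope form a normal complex *)

Section SimplicialPolytopes.
Local Open Scope fset_scope.
Local Open Scope ring_scope.
Variables (R : realType) (N : nat).
Implicit Types (A B F G H V : {fset 'rV[R]_N}) (x p q v : 'rV[R]_N) (f g h z : 'rV[R]_(1 + N)).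

Definition facets V : {fset {fset 'rV[R]_N}} := [fset G in faces V | (affrank G).+1 == affrank V].

Lemma in_facets V G : G \in facets V <-> is_facet V G.
Proof.
rewrite /facets in_sep; split=> [/andP[/in_faces fG /eqP rG] //|[fG rG]].
by apply/andP; split; [exact/in_faces|exact/eqP].
Qed.

Lemma fset_argmin (K : choiceType) (Z : {fset K}) (h : K -> R) k : k \in Z ->
  exists2 m, m \in Z & forall y, y \in Z -> h m <= h y.
Proof.
move=> kZ; case: (@Order.TotalTheory.arg_minP _ _ _ [` kZ] xpredT (fun y : Z => h (val y))) => //= m _ hm.
by exists (val m); [exact: fsvalP|move=> y yZ; exact: (hm [` yZ])].
Qed.

Lemma facet_positive V f p : nonneg V f -> p \in V -> p \notin zeros V f -> 0 < ev f p.
Proof. by move=> f0 pV; rewrite in_zeros pV lt_neqAle f0 // andbT eq_sym. Qed.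

Lemma hull_comb A z : (z <= hull A)%MS -> exists a : 'rV[R]_N -> R, z = \sum_(p <- A) a p *: hat p.
Proof.
elim/finSet_rect: A z => A IH z; have [->|[x xA]] := fset_0Vmem A.
  by rewrite /hull big_seq_fset0 submx0 => /eqP ->; exists (fun=> 0); rewrite big_seq_fset0.
rewrite -{1}(fsetD1K xA) hullU => /sub_addsmxP[[u1 u2] /= ->].
have [a ->] := IH (A `\ x) (fproperD1 xA) (u1 *m hull (A `\ x)) (submxMl _ _).
exists (fun p => if p == x then u2 0 0 else a p).
rewrite [RHS](big_fsetD1 x) //= eqxx addrC [u2]mx11_scalar mul_scalar_mx mxE eqxx mulr1n; congr (_ + _).
by apply: eq_big_seq => p; rewrite in_fsetD1 => /andP[/negbTE ->].
Qed.

Lemma facet_kernel V f z : is_facet V (zeros V f) -> (z <= hull V)%MS -> dotp z f = 0 ->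
  (z <= hull (zeros V f))%MS.
Proof.
move=> fG zV zf; apply: contrapT => /negP /separate[g [g0 gz]].
have [q qG|c /(_ z zV)] := facet_unique fG (g := g); first by apply: g0; exact: mem_hull.
by rewrite gz zf mulr0 => /eqP; rewrite oner_eq0.
Qed.

(** The hyperplane of H is turned about the ridge: g vanishes on the ridge and is 1 at v, and the
    least ratio g / f off H gives the next facet, with functional f'. Any other facet over the ridge
    has a functional a f' + c f with a > 0 and c nonnegative; since it vanishes at a vertex off H, c
    is zero. *)
Lemma ridge_facets V H v : is_facet V H -> is_simplex H -> v \in H ->
  exists G, [/\ is_facet V G, G != H, H `\ v `<=` G &
    forall G', is_facet V G' -> H `\ v `<=` G' -> G' = H \/ G' = G].
Proof.
move=> fH sH vH; have [u uV uH] := facet_proper fH.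
have [/faceP[f [f0 eH]] rH] := fH; have HV := face_sub (proj1 fH).
have [g [g0 gv]] := separate (simplex_notin_hull sH vH).
have gH p : p \in H -> p != v -> ev g p = 0.
  by move=> pH pv; apply: g0; apply: mem_hull; rewrite in_fsetD1 pv.
have fE p : p \in H -> ev f p = 0 by rewrite eH in_zeros => /andP[_ /eqP].
have fP p : p \in V -> p \notin H -> 0 < ev f p by rewrite eH; exact: facet_positive.
have [q] : exists2 q, q \in V `\` H & forall y, y \in V `\` H -> ev g q / ev f q <= ev g y / ev f y.
  by apply: (@fset_argmin _ _ (fun q => ev g q / ev f q) u); rewrite in_fsetD uH.
rewrite in_fsetD => /andP[qH qV] qmin; set m := ev g q / ev f q in qmin.
have fq := fP _ qV qH; pose f' := g - m *: f.
have f'E p : ev f' p = ev g p - m * ev f p by rewrite /f' /ev dotpBr dotpZr.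
have f'H p : p \in H -> ev f' p = ev g p by move=> /fE e; rewrite f'E e mulr0 subr0.
have f'q : ev f' q = 0 by rewrite f'E /m divfK ?subrr ?gt_eqF.
have f'0 : nonneg V f'.
  move=> p pV; have [pH|pH] := boolP (p \in H).
    by rewrite f'H //; have [->|pv] := eqVneq p v; [rewrite /ev gv ler01|rewrite gH].
  by rewrite f'E subr_ge0 -ler_pdivlMr ?fP // qmin // in_fsetD pH.
have f'v : ev f' v = 1 by rewrite f'H.
have fA : is_face V (zeros V f') by apply/faceP; exists f'.
have rA : H `\ v `<=` zeros V f'.
  apply/fsubsetP => p; rewrite in_fsetD1 => /andP[pv pH].
  by rewrite in_zeros (fsubsetP HV) // f'H // gH // eqxx.
have facA : is_facet V (zeros V f').
  split=> //; have lt : (affrank (zeros V f') < affrank V)%N.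
    apply: face_rank_proper => // e; have := fsubsetP HV v vH.
    by rewrite -e in_zeros f'v oner_eq0 andbF.
  apply/eqP; rewrite eqn_leq lt -rH ltnS; have <- : affrank (q |` (H `\ v)) = affrank H.
    rewrite affrankU -[in RHS](fsetD1K vH) affrankU (simplex_notin_hull sH vH).
    suff -> : ~~ (hat q <= hull (H `\ v))%MS by [].
    apply/negP => qh; suff e : dotp (hat q) f = 0 by rewrite /ev e ltxx in fq.
    by apply: dotp_hull qh => p; rewrite in_fsetD1 => /andP[_ /fE].
  apply: affrankS; apply/fsubsetP => p; rewrite in_fset1U => /orP[/eqP ->|/(fsubsetP rA) //].
  by rewrite in_zeros qV f'q eqxx.
exists (zeros V f'); split=> //.
  apply: contraTneq vH => <-; by rewrite in_zeros f'v oner_eq0 andbF.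
move=> G fG rG; have [->|GH] := eqVneq G H; [by left|right].
have GV := face_sub (proj1 fG).
have vG : v \notin G.
  apply: contra GH => vG; have HG : H `<=` G.
    by apply/fsubsetP => p pH; have [->//|pv] := eqVneq p v; rewrite (fsubsetP rG) // in_fsetD1 pv.
  by have [->//|e] := facet_maximal fH (proj1 fG) HG; case: (facet_neq fG).
have [/faceP[g' [g'0 eG]] _] := fG.
have vV := fsubsetP HV v vH.
have [|p|c hc] := facet_unique (V := V) (f := f) (g := g' - ev g' v *: f').
- by rewrite -eH.
- rewrite -eH => pH; rewrite /ev dotpBr dotpZr -!/(ev _ _); have [->|pv] := eqVneq p v.
    by rewrite f'v mulr1 subrr.
  rewrite f'H // gH // mulr0 subr0; have : p \in G by rewrite (fsubsetP rG) // in_fsetD1 pv.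
  by rewrite eG in_zeros => /andP[_ /eqP].
have g'E p : p \in V -> ev g' p = ev g' v * ev f' p + c * ev f p.
  move=> pV; have := hc _ (mem_hull pV); rewrite dotpBr dotpZr => /eqP.
  by rewrite subr_eq addrC => /eqP.
have g'v : 0 < ev g' v by apply: (facet_positive (V := V)) => //; rewrite -eG.
have c0 : 0 <= c.
  by have := g'0 q qV; rewrite g'E // f'q mulr0 add0r pmulr_lge0.
have [w wG wH] : exists2 w, w \in G & w \notin H.
  have [e|[w]] := fset_0Vmem (G `\` H); last by rewrite in_fsetD => /andP[]; exists w.
  have GsH : G `<=` H by rewrite -fsetD_eq0 e eqxx.
  have [e'|e'] := facet_maximal fG (proj1 fH) GsH; first by rewrite e' eqxx in GH.
  by case: (facet_neq fH).
have c00 : c = 0.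
  have wV := fsubsetP GV w wG; have := g'E w wV.
  have -> : ev g' w = 0 by move: wG; rewrite eG in_zeros => /andP[_ /eqP].
  have := mulr_ge0 (ltW g'v) (f'0 w wV); have := fP w wV wH; move: c0; clear.
  rewrite le_eqVlt => /orP[/eqP <- //|c0 h1 h2 h3]; have := mulr_gt0 c0 h1; lra.
rewrite eG; apply/fsetP => p; rewrite !in_zeros; case: (boolP (p \in V)) => //= pV.
by rewrite g'E // c00 mul0r addr0 mulf_eq0 gt_eqF.
Qed.

Section Normality.
Variables (V : {fset 'rV[R]_N}) (d : nat).
Hypotheses (rV : affrank V = d.+1) (simplicial : forall G, is_facet V G -> is_simplex G).

Lemma facet_card G : is_facet V G -> #|` G| = d.
Proof. by move=> fG; rewrite -(simplicial fG); case: fG => _; rewrite rV => -[]. Qed.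

Lemma facet_eq G H : is_facet V G -> is_facet V H -> G `<=` H -> G = H.
Proof. by move=> fG fH GH; apply/eqP; rewrite eqEfcard GH !facet_card /=. Qed.

Let center := \sum_(p <- V) hat p.

Lemma normalized_facet G : is_facet V G -> exists f, [/\ nonneg V f, G = zeros V f & dotp center f = 1].
Proof.
move=> fG; have [v vV vG] := facet_proper fG; have [/faceP[f [f0 e]] _] := fG.
have cf : 0 < dotp center f.
  rewrite dotp_suml (big_fsetD1 v) //= ltr_pwDl //.
    by rewrite (facet_positive (V := V)) // -e.
  by rewrite big_seq; apply: sumr_ge0 => p; rewrite in_fsetD1 => /andP[_ /f0].
exists ((dotp center f)^-1 *: f); split.
- by move=> p pV; rewrite evZ; apply: mulr_ge0; [rewrite invr_ge0 ltW|exact: f0].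
- by rewrite e; apply/fsetP => p; rewrite !in_zeros evZ mulf_eq0 invr_eq0 (gt_eqF cf).
- by rewrite dotpZr mulVf // gt_eqF.
Qed.

Lemma facets_par (r : {fset 'rV[R]_N}) : #|` r| = d.-1 -> (0 < d)%N -> ~~ par (facets V) r.
Proof.
move=> cr d0; have [[H]|none] := EM (exists2 H, H \in facets V & r `<=` H); last first.
  by rewrite par_none // => G GV; apply/negP => rG; apply: none; exists G.
move=> /in_facets fH rH; have [v] : exists v, v \in H `\` r.
  have [e|[v]] := fset_0Vmem (H `\` r); last by exists v.
  have := cardfsDS rH; rewrite e cardfs0 facet_card // cr; lia.
rewrite in_fsetD => /andP[vr vH]; have rE : r = H `\ v.
  apply/eqP; rewrite eqEfcard; apply/andP; split.
    by apply/fsubsetP => y yr; rewrite in_fsetD1 (fsubsetP rH) // andbT; apply: contraNneq vr => <-.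
  by rewrite cr -(facet_card fH) (cardfsD1 v H) vH.
have [G [fG GH rG hG]] := ridge_facets fH (simplicial fH) vH.
rewrite par_card; have -> : star (facets V) r = [fset H; G].
  apply/fsetP => K; rewrite in_star in_fset2; apply/andP/orP.
    by move=> [/in_facets fK]; rewrite rE => rK; have [->|->] := hG K fK rK; rewrite eqxx; [left|right].
  by case=> /eqP ->; split; rewrite ?rE //; apply/in_facets || rewrite -rE.
by rewrite cardfs2 eq_sym GH.
Qed.

(* Among the facets of Z take the one whose hyperplane is nearest, in the
   normalization at the centre, to the sum Y of the vertices of a facet outside
   Z; writing Y in the basis of that facet and the centre, minimality makes all
   coefficients off s nonnegative. *)
Lemma facets_star_connected s Z : (#|` s| < d)%N -> Z `<=` star (facets V) s ->
  (forall r, s `<=` r -> #|` r| = d.-1 -> ~~ par Z r) -> Z = fset0 \/ Z = star (facets V) s.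
Proof.
move=> cs Zs hZ; have [->|[H0 H0Z]] := fset_0Vmem Z; [by left|right].
apply/eqP; rewrite eqEfsubset Zs /=; apply/fsubsetP => G; rewrite in_star => /andP[/in_facets fG sG].
apply: contrapT => /negP GZ.
have /choice[l hl] : forall K, exists f, is_facet V K -> [/\ nonneg V f, K = zeros V f & dotp center f = 1].
  by move=> K; have [/normalized_facet[f hf]|nK] := EM (is_facet V K); [exists f|exists 0].
have Zfac K : K \in Z -> is_facet V K by move=> /(fsubsetP Zs); rewrite in_star => /andP[/in_facets].
have Zsub K : K \in Z -> s `<=` K by move=> /(fsubsetP Zs); rewrite in_star => /andP[].
pose Y := \sum_(p <- G) hat p.
have [H HZ hmin] := fset_argmin (fun K => dotp Y (l K)) H0Z.
have fH := Zfac _ HZ; have [lH0 eH lH1] := hl _ fH.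
set mu := dotp Y (l H) in hmin.
have YV : (Y - mu *: center <= hull V)%MS.
  apply: addmx_sub; last rewrite -scaleNr scalemx_sub //.
    rewrite /Y big_seq; apply: summx_sub => p pG; apply: mem_hull.
    exact: (fsubsetP (face_sub (proj1 fG))).
  by rewrite /center big_seq; apply: summx_sub => p; exact: mem_hull.
have Y0 : dotp (Y - mu *: center) (l H) = 0 by rewrite dotpBl dotpZl lH1 mulr1 subrr.
(* The multiple of the centre is chosen so that the difference vanishes under the functional of H,
   and is therefore a combination of the vertices of H. *)
have [|a] := hull_comb (A := H) (z := Y - mu *: center).
  by rewrite eH; apply: facet_kernel => //; rewrite -eH.
move=> /eqP; rewrite subr_eq => /eqP YE.
have lY K : is_facet V K -> dotp Y (l K) = \sum_(p <- H) a p * ev (l K) p + mu.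
  move=> /hl[_ _ lK]; rewrite YE dotpDl dotpZl lK mulr1 dotp_suml; congr (_ + _).
  by apply: eq_bigr => p _; rewrite dotpZl.
have HV := fsubsetP (face_sub (proj1 fH)).
(* Across the ridge opposite v lies another facet K of Z. Its functional vanishes on the rest of H
   and is positive at v, so minimality of H gives the sign of the coefficient. *)
have a0 v : v \in H -> v \notin s -> 0 <= a v.
  move=> vH vs; have : ~~ par Z (H `\ v).
    apply: hZ; last by rewrite -(facet_card fH) (cardfsD1 v H) vH.
    apply/fsubsetP => y ys; rewrite in_fsetD1 (fsubsetP (Zsub _ HZ)) // andbT.
    by apply: contraNneq vs => <-.
  move=> /par_other /(_ HZ (fsubD1set _ _))[K [KZ rK KH]].
  have fK := Zfac _ KZ; have [lK0 eK lK1] := hl _ fK.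
  have := hmin _ KZ; rewrite lY // (big_fsetD1 v) //= big1_seq => [|p /=].
    rewrite addr0 lerDr pmulr_lge0 //; apply: (facet_positive (V := V)); rewrite ?HV // -eK.
    apply: contra KH => vK; apply/eqP; symmetry; apply: facet_eq => //.
    by rewrite -(fsetD1K vH) fsubUset fsub1set vK.
  by move=> /(fsubsetP rK); rewrite {1}eK in_zeros => /andP[_ /eqP ->]; rewrite mulr0.
have [lG0 eG lG1] := hl _ fG.
have GV := fsubsetP (face_sub (proj1 fG)).
(* The functional of G vanishes on Y and on s and is nonnegative on the rest of H, so mu cannot be
   positive. But G has a vertex off H, which makes mu positive. *)
have : mu <= 0.
  have e : dotp Y (l G) = 0.
    by rewrite dotp_suml big1_seq // => p /=; rewrite {1}eG in_zeros => /andP[_ /eqP].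
  rewrite -e lY // lerDr big_seq; apply: sumr_ge0 => v vH; have [vs|vs] := boolP (v \in s).
    have := fsubsetP sG _ vs; rewrite {1}eG in_zeros => /andP[_ /eqP ->]; by rewrite mulr0.
  by rewrite mulr_ge0 ?a0 // lG0 ?HV.
apply/negP; rewrite -ltNge /mu dotp_suml.
have [v vG vH] : exists2 v, v \in G & v \notin H.
  have [e|[v]] := fset_0Vmem (G `\` H); last by rewrite in_fsetD => /andP[]; exists v.
  have e' : G = H by apply: facet_eq => //; rewrite -fsetD_eq0 e eqxx.
  by rewrite e' HZ in GZ.
rewrite (big_fsetD1 v) //= ltr_pwDl //.
  by apply: (facet_positive (V := V)); rewrite ?GV // -eH.
by rewrite big_seq; apply: sumr_ge0 => p; rewrite in_fsetD1 => /andP[_ /GV /lH0].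
Qed.

Lemma empty_face : is_face V fset0.
Proof.
apply/faceP; exists (row_mx (1%:M : 'M[R]_1) (- 0)).
have e p : ev (row_mx (1%:M : 'M[R]_1) (- 0)) p = 1 by rewrite evE dotp0r subr0.
split=> [p _|]; first by rewrite e ler01.
by apply/fsetP => p; rewrite in_zeros e oner_eq0 andbF.
Qed.

Theorem facets_normal : (0 < d)%N -> normal d (facets V).
Proof.
move=> d0; split.
- have [e|[v vV]] := fset_0Vmem V; first by move: rV; rewrite e affrank0.
  have [|G [fG _ _]] := facet_avoiding empty_face vV; first by rewrite in_fset0.
  by apply/fset0Pn; exists G; apply/in_facets.
- by move=> G /in_facets; exact: facet_card.
- by move=> r cr; exact: facets_par.
- by move=> s cs Z; exact: facets_star_connected.
Qed.

Lemma boundary_facets : boundary V = cx (facets V).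
Proof.
apply/fsetP => A; rewrite /boundary in_fsetD1; apply/andP/in_cx => [[AV /in_faces fA]|[G /in_facets fG AG]].
  have AsV := face_sub fA.
  have [v vV vA] : exists2 v, v \in V & v \notin A.
    have [e|[v]] := fset_0Vmem (V `\` A); last by rewrite in_fsetD => /andP[]; exists v.
    by move: AV; rewrite eqEfsubset AsV -fsetD_eq0 e eqxx.
  have [G [fG AG _]] := facet_avoiding fA vV vA.
  by exists G => //; apply/in_facets.
have fA : is_face V A by apply: (face_trans (proj1 fG)); apply: simplex_face AG; exact: simplicial.
split; last exact/in_faces.
apply/eqP => e; case: (facet_neq fG); apply/eqP.
by rewrite eqEfsubset (face_sub (proj1 fG)) -e.
Qed.

End Normality.
End SimplicialPolytopes.

(** * Adding a vertex beyond a single facet *)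

Section Beyond.
Local Open Scope fset_scope.
Local Open Scope ring_scope.
Variables (R : realType) (N : nat).
Implicit Types (A B F G H V : {fset 'rV[R]_N}) (x p q v : 'rV[R]_N) (f g h z : 'rV[R]_(1 + N)).

Lemma proper_ex (T : choiceType) (D E : {fset T}) : D `<=` E -> D <> E ->
  exists2 v, v \in E & v \notin D.
Proof.
move=> DE /eqP ne; have /fproperP[_ //] : D `<` E by rewrite fproperEneq ne.
Qed.

Lemma facet_scale V f g : nonneg V f -> nonneg V g -> is_facet V (zeros V f) -> zeros V g = zeros V f ->
  exists2 c, 0 < c & forall z, (z <= hull V)%MS -> dotp z g = c * dotp z f.
Proof.
move=> f0 g0 fG e; have [|q|c hc] := facet_unique (V := V) (f := f) (g := g) => //.
  by rewrite -e in_zeros => /andP[_ /eqP].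
have [v vV vG] := facet_proper fG; exists c => //.
have fv := facet_positive f0 vV vG; have gv : 0 < ev g v by apply: (facet_positive (V := V)); rewrite ?e.
by move: gv; rewrite /ev hc ?mem_hull // pmulr_lgt0.
Qed.

Lemma other_facet V G A : is_facet V G -> is_face V A -> A <> V -> A <> G ->
  exists H, [/\ is_facet V H, H <> G & A `<=` H].
Proof.
move=> fG fA AV AG; have [v vV vA] := proper_ex (face_sub fA) AV.
have [GA|GA] := boolP (G `<=` A).
  have [H [fH AH vH]] := facet_avoiding fA vV vA; exists H; split=> // e; apply: AG.
  by have [//|/AV //] := facet_maximal fG fA GA.
have [e|[u]] := fset_0Vmem (G `\` A); first by rewrite -fsetD_eq0 e eqxx in GA.
rewrite in_fsetD => /andP[uA uG]; have uV := fsubsetP (face_sub (proj1 fG)) _ uG.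
have [H [fH AH uH]] := facet_avoiding fA uV uA; exists H; split=> // e.
by rewrite e uG in uH.
Qed.

Section BeyondOnly.
Variables (V G : {fset 'rV[R]_N}) (x : 'rV[R]_N).
Hypotheses (fG : is_facet V G) (bx : beyond_only V G x).

Lemma beyond_rank : affrank (x |` V) = affrank V. Proof. by case: bx. Qed.

Lemma beyond_hull : (hat x <= hull V)%MS.
Proof.
by apply: contrapT => /negP h; move: beyond_rank; rewrite affrankU h; lia.
Qed.

Lemma beyond_facet : exists f, [/\ nonneg V f, zeros V f = G & ev f x < 0].
Proof.
have [_ [c [b [h1 h2 h3]]] _] := bx; exists (row_mx (b%:M : 'M[R]_1) (- c)); split.
- exact/valid_nonneg.
- by rewrite -contact_zeros.
- by rewrite evE subr_lt0.
Qed.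

Lemma beneath_facet H : is_facet V H -> H <> G -> exists f, [/\ nonneg V f, zeros V f = H & 0 < ev f x].
Proof.
move=> fH HG; have [_ _ /(_ H fH HG) [c [b [h1 h2 h3]]]] := bx.
exists (row_mx (b%:M : 'M[R]_1) (- c)); split.
- exact/valid_nonneg.
- by rewrite -contact_zeros.
- by rewrite evE subr_gt0.
Qed.

Lemma beyond_notin : x \notin V.
Proof. by have [f [f0 _ fx]] := beyond_facet; apply: contraL fx => /f0; rewrite -leNgt. Qed.

Lemma beyond_notinS A : A `<=` V -> x \notin A.
Proof. by move=> AV; apply: contra beyond_notin; exact: (fsubsetP AV). Qed.

Lemma zerosU f : zeros V f = zeros (x |` V) f `\ x.
Proof.
apply/fsetP => p; rewrite in_fsetD1 !in_zeros in_fset1U; have [->|//] := eqVneq p x.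
by rewrite (negbTE beyond_notin).
Qed.

Lemma beneath_face A : is_face V A -> A <> V -> A <> G -> is_face (x |` V) A.
Proof.
move=> fA AV AG; have [H [fH HG AH]] := other_facet fG fA AV AG.
have [f [f0 eH fx]] := beneath_facet fH HG.
apply: (@face_trans _ _ _ H); last exact: face_of_sub fA AH (face_sub (proj1 fH)).
apply/faceP; exists f; split=> [p|].
  by rewrite in_fset1U => /orP[/eqP ->|/f0 //]; exact: ltW.
apply/fsetP => p; rewrite -eH !in_zeros in_fset1U; have [->|//] := eqVneq p x.
by rewrite (negbTE beyond_notin) gt_eqF.
Qed.

(** A functional exposing A is positive at x and that of G is negative at x, so a positive
    combination vanishes there. On V it has no zeros besides A, because the first functional is
    positive off A. *)
Lemma visible_face A : is_face V A -> A `<` G -> is_face (x |` V) (x |` A).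
Proof.
move=> fA; rewrite fproperEneq => /andP[/eqP AG sAG].
have AV : A <> V.
  by move=> e; apply: AG; apply/eqP; rewrite eqEfsubset sAG e; exact: face_sub (proj1 fG).
have /faceP[f [f0 eA]] := beneath_face fA AV AG; have [g [g0 eG gx]] := beyond_facet.
have xA := beyond_notinS (face_sub fA).
have fx : 0 < ev f x by apply: (facet_positive (V := x |` V)); rewrite ?fset1U1 // -eA.
pose t := ev f x / - ev g x; have t0 : 0 < t by rewrite divr_gt0 // oppr_gt0.
have hx : ev (f + t *: g) x = 0.
  by rewrite evD evZ /t invrN mulrN mulNr divfK ?subrr // lt_eqF.
apply/faceP; exists (f + t *: g); split=> [p|].
  rewrite in_fset1U => /orP[/eqP ->|pV]; first by rewrite hx.
  rewrite evD evZ; apply: addr_ge0; first by apply: f0; exact: fset1Ur.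
  by apply: mulr_ge0; [exact: ltW|exact: g0].
apply/fsetP => p; rewrite in_zeros !in_fset1U; have [->|px] := eqVneq p x; first by rewrite hx eqxx.
have [pV|pV] := boolP (p \in V); last by apply: contraNF pV => /(fsubsetP (face_sub fA)).
have pxV : p \in x |` V by rewrite fset1Ur.
have [pA|pA] := boolP (p \in A).
  have := fsubsetP sAG _ pA; rewrite -eG in_zeros evD evZ => /andP[_ /eqP ->].
  by move: pA; rewrite eA in_zeros => /andP[_ /eqP ->]; rewrite mulr0 addr0 eqxx.
have fp : 0 < ev f p by apply: (facet_positive (V := x |` V)); rewrite // -eA.
by rewrite /= evD evZ gt_eqF // ltr_pwDl // mulr_ge0 ?g0 // ltW.
Qed.

(** If the functional of A vanishes at x, [facet_below] yields a facet over [A \ x] whose functional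
    is not positive at x, and only G qualifies. If it is positive at x, it cannot be a positive
    multiple of the functional of G. *)
Lemma face_beyond A : is_face (x |` V) A -> A <> x |` V ->
  if x \in A then is_face V (A `\ x) /\ A `\ x `<` G else [/\ is_face V A, A <> V & A <> G].
Proof.
move=> /faceP[f [f0 eA]] AxV; have [g [g0 eG gx]] := beyond_facet.
have f0V : nonneg V f by move=> p pV; apply: f0; exact: fset1Ur.
have fV : is_face V (A `\ x) by apply/faceP; exists f; rewrite zerosU -eA.
have zf : zeros V f = A `\ x by rewrite zerosU eA.
have AG : A `\ x = G -> ev f x < 0.
  move=> e; have [||c c0 hc] := facet_scale g0 f0V; rewrite ?eG ?zf //.
  by rewrite /ev hc ?beyond_hull // pmulr_rlt0.
case: ifP => xA.
  have fx : ev f x = 0 by move: xA; rewrite eA in_zeros => /andP[_ /eqP].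
  split=> //; rewrite fproperEneq; apply/andP; split.
    by apply/eqP => /AG; rewrite fx ltxx.
  have [||h [h0 fH fh hx]] := facet_below (z := hat x) f0V => //.
  - by rewrite zf => e; apply: AxV; rewrite -(fsetD1K xA) e.
  - by rewrite -/(ev f x) fx.
  have [hG|hG] := eqVneq (zeros V h) G; first by rewrite -hG -zf.
  have [k [k0 eH kx]] := beneath_facet fH (elimN eqP hG).
  have [||c c0 hc] := facet_scale k0 h0; rewrite ?eH //.
  by move: hx; rewrite hc ?beyond_hull // pmulr_rle0 // leNgt -/(ev k x) kx.
have Ax : A `\ x = A.
  by apply/fsetP => p; rewrite in_fsetD1; have [->|//] := eqVneq p x; rewrite xA.
rewrite Ax in fV zf AG.
have fx : 0 < ev f x by apply: (facet_positive (V := x |` V)); rewrite ?fset1U1 // -eA xA.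
split=> // [e|/AG]; last by rewrite ltNge ltW.
have := dotp_hull (A := V) (f := f) (z := hat x).
rewrite -/(ev f x) => h; rewrite h ?ltxx ?beyond_hull // in fx => p.
by rewrite -{1}e -zf in_zeros => /andP[_ /eqP].
Qed.

Lemma visible_rank A : A `<=` G -> affrank (x |` A) = (affrank A).+1.
Proof.
move=> AG; rewrite affrankU; suff -> : ~~ (hat x <= hull A)%MS by rewrite addn1.
have [g [g0 eG gx]] := beyond_facet; apply: contraL gx => xA.
rewrite -leNgt /ev (dotp_hull _ xA) // => p /(fsubsetP AG).
by rewrite -eG in_zeros => /andP[_ /eqP].
Qed.

Lemma facet_beyond H : is_facet (x |` V) H ->
  [/\ is_facet V H, H <> G & x \notin H] \/
  exists A, [/\ is_face V A, A `<` G, (affrank A).+2 = affrank V & H = x |` A].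
Proof.
move=> fH; have HV := facet_neq fH; have [fcH rH] := fH.
have := face_beyond fcH HV; case: ifP => xH [fA AG].
  right; exists (H `\ x); split=> //; last by rewrite fsetD1K.
  by rewrite -visible_rank ?fproper_sub // fsetD1K // rH beyond_rank.
by left; split=> //; rewrite ?xH // /is_facet rH beyond_rank.
Qed.

Lemma boundary_beyond :
  boundary (x |` V) = (boundary V `\ G) `|` [fset x |` A | A in [fset A in faces V | A `<` G]].
Proof.
apply/fsetP => A; rewrite in_fsetU in_fsetD1; apply/idP/idP.
  rewrite in_fsetD1 => /andP[/eqP AV /in_faces fA]; have := face_beyond fA AV.
  case: ifP => [xA [fAx AG]|xA [fAV nV nG]].
    apply/orP; right; apply/imfsetP; exists (A `\ x); rewrite ?fsetD1K //=.
    by rewrite in_sep AG andbT; exact/in_faces.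
  by apply/orP; left; rewrite in_fsetD1; apply/and3P; split; [exact/eqP|exact/eqP|exact/in_faces].
have xV := beyond_notin.
case/orP => [/andP[/eqP AG]|/imfsetP[B /= + ->]].
  rewrite !in_fsetD1 => /andP[/eqP AV /in_faces fA]; apply/andP; split; last exact/in_faces/beneath_face.
  by apply/eqP => e; have := beyond_notinS (face_sub fA); rewrite e fset1U1.
rewrite in_sep => /andP[/in_faces fB BG]; rewrite in_fsetD1; apply/andP; split; last exact/in_faces/visible_face.
have xB := beyond_notinS (face_sub fB).
apply/eqP => /(congr1 (fun D => D `\ x)); rewrite !fsetU1K // => e.
by move: BG; rewrite e fproperE (face_sub (proj1 fG)) andbF.
Qed.

End BeyondOnly.
End Beyond.

(** * Face numbers of stacked polytopes *)

Section StackedPolytopes.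
Local Open Scope fset_scope.
Local Open Scope nat_scope.
Variables (R : realType) (N : nat).
Implicit Types (A B F G H V : {fset 'rV[R]_N}) (x p q v : 'rV[R]_N) (f g h z : 'rV[R]_(1 + N)).

(** Indexing by affine rank, one more than the dimension, includes the empty face, on which the apex
    of a pyramid stands. *)
Definition rank_num V j := #|` [fset A in faces V | affrank A == j]|.

Definition simplicial V := forall G, is_facet V G -> is_simplex G.

Lemma rank_num0 V : rank_num V 0 = 1.
Proof.
rewrite /rank_num; have -> : [fset A in faces V | affrank A == 0] = [fset fset0]; last exact: cardfs1.
apply/fsetP => A; rewrite in_sep in_fset1; apply/andP/eqP => [[_ rA]|->]; last first.
  by rewrite affrank0; split=> //; apply/in_faces; exact: empty_face.
have [//|[x xA]] := fset_0Vmem A; have : affrank [fset x] <= affrank A by rewrite affrankS // fsub1set.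
rewrite (eqP rA) -[[fset x]]fsetU0 affrankU affrank0 add0n /hull big_seq_fset0 submx0 row_mx_eq0 negb_and.
suff -> : (1%:M : 'M[R]_1)%R != 0%R by [].
by apply/eqP => /matrixP/(_ 0 0)%R; rewrite !mxE eqxx; apply/eqP; rewrite oner_eq0.
Qed.

Lemma rank_num_boundary V j : rank_num V j = #|` [fset A in boundary V | affrank A == j]| + (j == affrank V).
Proof.
rewrite /rank_num (cardfsD1 V) in_sep addnC; have -> : V \in faces V by apply/in_faces; exact: face_full.
rewrite /= [j == _]eq_sym; congr (#|` _| + _).
by apply/fsetP => A; rewrite in_fsetD1 in_sep [RHS]in_sep /boundary in_fsetD1 andbA.
Qed.

Lemma card_fsetU1_image x (K : {fset {fset 'rV[R]_N}}) : (forall A, A \in K -> x \notin A) ->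
  #|` [fset x |` A | A in K]| = #|` K|.
Proof.
move=> xK; rewrite card_in_imfset //= => A B AK BK /(congr1 (fun D => D `\ x)).
by rewrite !fsetU1K ?xK.
Qed.

Lemma rank_num_simplex V j : is_simplex V -> rank_num V j = 'C(affrank V, j).
Proof.
move=> sV; rewrite sV -card_ksubsets; congr #|` _|; apply/fsetP => A; rewrite in_sep [RHS]in_sep fpowersetE.
have [AV|AV] := boolP (A `<=` V); last first.
  by apply/negbTE; apply: contra AV => /andP[/in_faces fA _]; exact: face_sub fA.
by rewrite (simplexS AV sV); have /in_faces -> := simplex_face sV AV.
Qed.

(** Both Boolean terms concern G: it is lost as a face, and unlike its proper faces it does not
    become the base of a new one. *)
Lemma rank_num_beyond V G x j : is_facet V G -> beyond_only V G x -> is_simplex G ->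
  rank_num (x |` V) j.+1 + (j.+1 == affrank G) + (j == affrank G) =
  rank_num V j.+1 + 'C(affrank G, j).
Proof.
move=> fG bx sG; rewrite !rank_num_boundary (beyond_rank bx).
pose S := [fset A in boundary V | affrank A == j.+1].
pose T := [fset A in fpowerset G | #|` A| == j].
have GV := face_sub (proj1 fG).
have -> : [fset A in boundary (x |` V) | affrank A == j.+1] =
    (S `\ G) `|` [fset x |` A | A in T `\ G].
  apply/fsetP => A; rewrite in_sep (boundary_beyond fG bx) !in_fsetU andb_orl; congr orb.
    by rewrite in_fsetD1 [RHS]in_fsetD1 -andbA; congr andb; rewrite [RHS]in_sep.
  apply/andP/imfsetP => [[/imfsetP[B /= + ->]]|[B /= + ->]].
    rewrite in_sep => /andP[fB BG]; rewrite (visible_rank bx (fproper_sub BG)) eqSS => rB.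
    exists B => //; rewrite in_fsetD1 in_sep fpowersetE (fproper_sub BG).
    rewrite -(simplexS (fproper_sub BG) sG) rB !andbT.
    by move: BG; rewrite fproperEneq => /andP[].
  rewrite in_fsetD1 in_sep fpowersetE => /andP[BG /andP[sBG cB]].
  rewrite (visible_rank bx sBG) eqSS (simplexS sBG sG) cB; split=> //.
  apply: in_imfset => /=; rewrite in_sep fproperEneq BG sBG !andbT; apply/in_faces.
  by apply: face_trans (proj1 fG) _; exact: simplex_face.
have xT A : A \in T `\ G -> x \notin A.
  rewrite in_fsetD1 in_sep fpowersetE => /andP[_ /andP[AG _]].
  by apply: (beyond_notinS bx); exact: fsubset_trans AG GV.
rewrite card_disjU; last first.
  apply/fdisjointP => A; rewrite in_fsetD1 in_sep in_fsetD1 => /andP[_ /andP[/andP[_ /in_faces fA] _]].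
  apply/negP => /imfsetP[B _ e]; have := beyond_notinS bx (face_sub fA).
  by rewrite e fset1U1.
have <- : #|` T| = 'C(affrank G, j) by rewrite /T card_ksubsets sG.
rewrite card_fsetU1_image //.
have := cardfsD1 G S; have := cardfsD1 G T.
have -> : (G \in T) = (j == affrank G) by rewrite in_sep fpowersetE fsubset_refl sG eq_sym.
have -> : (G \in S) = (j.+1 == affrank G).
  rewrite in_sep in_fsetD1; have -> : G \in faces V by apply/in_faces; case: fG.
  by have /eqP -> := facet_neq fG; rewrite eq_sym.
by move=> -> ->; rewrite -/S; lia.
Qed.

Lemma simplexU A x : is_simplex A -> x \notin A -> affrank (x |` A) = (affrank A).+1 -> is_simplex (x |` A).
Proof. by rewrite /is_simplex => sA xA ->; rewrite sA cardfsU1 xA. Qed.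

Theorem stacked_rank_num B : stacked B -> simplicial B /\
  exists2 s, #|` B| = affrank B + s & forall j,
    rank_num B j.+1 + s * ((j.+2 == affrank B) + (j.+1 == affrank B)) =
    'C(affrank B, j.+1) + s * 'C((affrank B).-1, j).
Proof.
elim=> {B} [V sV|V G x _ [simV [s cV IH]] fG bx].
  split=> [G [fG _]|]; first exact: simplexS (face_sub fG) sV.
  by exists 0 => [|j]; rewrite ?addn0 ?sV // rank_num_simplex // sV.
have sG := simV G fG; have xV := beyond_notin bx; have rG := proj2 fG.
split=> [H /(facet_beyond fG bx) [[fH _ _]|[A [fA AG rA ->]]]|].
- exact: simV.
- apply: simplexU; first exact: simplexS (fproper_sub AG) sG.
    by apply: (beyond_notinS bx); exact: face_sub fA.
  by apply: (visible_rank bx); exact: fproper_sub.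
exists s.+1; first by rewrite cardfsU1 xV (beyond_rank bx) cV addnS.
move=> j; rewrite (beyond_rank bx) -rG /=.
have := rank_num_beyond j fG bx sG; have := IH j; rewrite -rG /= !eqSS !mulSn; lia.
Qed.

Section Pyramid.
Variables (B : {fset 'rV[R]_N}) (x : 'rV[R]_N).
Hypothesis rx : affrank (x |` B) = (affrank B).+1.

Let xh : ~~ (hat x <= hull B)%MS.
Proof. by move: rx; rewrite affrankU; case: (~~ _) => //=; lia. Qed.

Let xB : x \notin B.
Proof. by apply: contra xh; exact: mem_hull. Qed.

Lemma pyramid_rank A : A `<=` B -> affrank (x |` A) = (affrank A).+1.
Proof.
move=> AB; rewrite affrankU; suff -> : ~~ (hat x <= hull A)%MS by rewrite addn1.
by apply: contra xh => h; apply: submx_trans h (hullS AB).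
Qed.

(** The apex is affinely independent of the base, so the value of a functional at the apex can be
    prescribed without changing it on the base. *)
Lemma pyramid_face A : A `<=` x |` B -> is_face (x |` B) A <-> is_face B (A `\ x).
Proof.
move=> AxB; split=> [/faceP[f [f0 e]]|fA].
  apply/faceP; exists f; split=> [p pB|]; first by apply: f0; exact: fset1Ur.
  apply/fsetP => p; rewrite e in_fsetD1 !in_zeros in_fset1U; have [->|//] := eqVneq p x.
  by rewrite (negbTE xB).
have [g [g0 gx]] := separate xh.
have gB p : p \in B -> ev g p = 0%R by move=> pB; apply: g0; exact: mem_hull.
have [xA|xA] := boolP (x \in A).
  have /faceP[f [f0 e]] := fA; apply/faceP; exists (f - ev f x *: g)%R.
  have hB p : p \in B -> ev (f - ev f x *: g)%R p = ev f p.
    by move=> pB; rewrite /ev dotpBr dotpZr -/(ev g p) gB // mulr0 subr0.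
  have hx : ev (f - ev f x *: g)%R x = 0%R by rewrite /ev dotpBr dotpZr gx mulr1 subrr.
  split=> [p|]; first by rewrite in_fset1U => /orP[/eqP ->|pB]; rewrite ?hx // hB // f0.
  apply/fsetP => p; rewrite in_zeros in_fset1U; have [->|px] := eqVneq p x; first by rewrite xA hx eqxx.
  have -> : (p \in A) = (p \in A `\ x) by rewrite in_fsetD1 px.
  by rewrite e in_zeros /=; case: (boolP (p \in B)) => // pB; rewrite hB.
have fB : is_face (x |` B) B.
  apply/faceP; exists g; split=> [p|].
    by rewrite in_fset1U => /orP[/eqP ->|/gB ->]; rewrite // /ev gx ler01.
  apply/fsetP => p; rewrite in_zeros in_fset1U; have [->|px] := eqVneq p x.
    by rewrite (negbTE xB) /ev gx oner_eq0.
  by case: (boolP (p \in B)) => // /gB ->; rewrite eqxx.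
apply: face_trans fB _; suff <- : A `\ x = A by [].
by apply/fsetP => p; rewrite in_fsetD1; have [->|//] := eqVneq p x; rewrite (negbTE xA).
Qed.

Lemma pyramid_rank_num j : rank_num (x |` B) j.+1 = rank_num B j.+1 + rank_num B j.
Proof.
have xF A : is_face B A -> x \notin A by move=> fA; apply: contra xB; exact: (fsubsetP (face_sub fA)).
rewrite /rank_num -[X in _ + X](card_fsetU1_image (x := x)); last first.
  by move=> A; rewrite in_sep => /andP[/in_faces /xF].
rewrite -card_disjU; last first.
  apply/fdisjointP => A; rewrite in_sep => /andP[/in_faces /xF xA _]; apply: contra xA => /imfsetP[D _ ->].
  exact: fset1U1.
congr #|` _|; apply/fsetP => A; rewrite in_sep in_fsetU [X in X || _]in_sep; apply/andP/orP.
  move=> [/in_faces fA rA]; have := (pyramid_face (face_sub fA)).1 fA => fAx.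
  have [xA|xA] := boolP (x \in A); [right|left].
    apply/imfsetP; exists (A `\ x); rewrite /= ?fsetD1K // in_sep; apply/andP; split; first exact/in_faces.
    by rewrite -eqSS -pyramid_rank ?fsetD1K // face_sub.
  rewrite rA andbT; apply/in_faces; suff <- : A `\ x = A by [].
  by apply/fsetP => p; rewrite in_fsetD1; have [->|//] := eqVneq p x; rewrite (negbTE xA).
case=> [/andP[/in_faces fA ->]|/imfsetP[D /= + ->]].
  split=> //; apply/in_faces/pyramid_face; first exact: fsubset_trans (face_sub fA) (fsubsetUr _ _).
  suff -> : A `\ x = A by [].
  by apply/fsetP => p; rewrite in_fsetD1; have [->|//] := eqVneq p x; rewrite (negbTE (xF A fA)).
rewrite in_sep => /andP[/in_faces fD rD]; have DB := face_sub fD.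
rewrite pyramid_rank // eqSS; split=> //; apply/in_faces/pyramid_face; first exact: fsetUS.
by rewrite fsetU1K // xF.
Qed.

Lemma pyramid_facet G : simplicial B -> is_facet (x |` B) G -> G <> B -> is_simplex G.
Proof.
move=> simB [fG]; rewrite rx => -[rG] GB; have fGx := (pyramid_face (face_sub fG)).1 fG.
have [xG|xG] := boolP (x \in G); last first.
  case: GB; move: fGx; have -> : G `\ x = G.
    by apply/fsetP => p; rewrite in_fsetD1; have [->|//] := eqVneq p x; rewrite (negbTE xG).
  by move=> fG'; apply: face_rank_eq fG' (face_sub fG') (fsubset_refl _) rG.
have GB' := face_sub fGx; rewrite -(fsetD1K xG); apply: simplexU.
- by apply: simB; split=> //; rewrite -pyramid_rank // fsetD1K.
- by rewrite in_fsetD1 eqxx.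
- exact: pyramid_rank.
Qed.

End Pyramid.

Theorem stacked_pyramid_rank_num B V : simplicial B -> stacked_pyramid B V ->
  [/\ affrank V = (affrank B).+1, forall G, is_facet V G -> G <> B -> is_simplex G &
    exists2 m, #|` V| = #|` B|.+1 + m & forall j,
      rank_num V j.+1 + m * ((j.+1 == affrank B) + (j == affrank B)) =
      rank_num B j.+1 + rank_num B j + m * 'C(affrank B, j)].
Proof.
move=> simB; elim=> {V} [x rx|V G x _ [rV simV [m cV IH]] fG GB bx].
  split=> //; first by move=> G; exact: pyramid_facet.
  exists 0 => [|j]; last by rewrite pyramid_rank_num // !mul0n.
  rewrite addn0 cardfsU1; suff -> : x \notin B by [].
  by apply/negP => xB; move: rx; rewrite (mem_fset1U xB); lia.
have sG := simV G fG GB; have xV := beyond_notin bx; have rG := proj2 fG.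
rewrite rV in rG; case: rG => rG.
split; first by rewrite (beyond_rank bx).
  move=> H /(facet_beyond fG bx) [[fH _ _]|[A [fA AG rA ->]] _]; first exact: simV.
  apply: simplexU; first exact: simplexS (fproper_sub AG) sG.
    by apply: (beyond_notinS bx); exact: face_sub fA.
  by apply: (visible_rank bx); exact: fproper_sub.
exists m.+1; first by rewrite cardfsU1 xV cV add1n addnS.
by move=> j; have := rank_num_beyond j fG bx sG; have := IH j; rewrite rG !mulSn; lia.
Qed.

Lemma S_arith (a b c e d C1 C3 C4 h s n : nat) : n = d.+1 + s + 1 + h ->
  b + s * (e + 0) = C1 + s * C4 -> c + s * 0 = (C4 + C3) + s * C3 ->
  a + h * 0 = b + c + h * (C4 + C3) ->
  a + e * s + 0 * s + d.+2 * (C4 + C3) = C1 + (C4 + C3) + n * (C4 + C3).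
Proof. by move=> ->; nia. Qed.

Theorem S_nfaces d n s (S : {fset 'rV[R]_N}) j : is_S d n s S -> 1 < j <= d ->
  nfaces S j.-1 + (j == d.-1) * s + (j == d) * s + d.+1 * excess_coef d j =
  'C(d.+1, j) + n * excess_coef d j.
Proof.
move=> [B [sB rB cB spS cS]]; case: j => [|[|i]] // /andP[_ jd].
have [simB [s' cB' hB]] := stacked_rank_num sB.
have {cB'} ss : s' = s by move: cB'; rewrite cB rB => /eqP; rewrite eqn_add2l => /eqP.
subst s'; have [rS _ [m cS' hS]] := stacked_pyramid_rank_num simB spS.
have := hS i.+1; have := hB i; have := hB i.+1; rewrite rB -/(rank_num S i.+2).
have -> : nfaces S i.+2.-1 = rank_num S i.+2 by [].
have e3 : (i.+1 == d) = false by lia.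
have nE : n = d + s + 1 + m by rewrite -cS cS' cB addn1.
rewrite e3 !addn0; case: d rB cB jd e3 nE hB hS => [//|d] rB cB jd e3 nE hB hS /= h1 h2 h3.
rewrite [in RHS]binS /excess_coef /=.
have [id|id] := eqVneq i.+2 d.+1.
  have e1 : (i.+2 == d) = false by lia.
  have e4 : (i.+3 == d.+1) = false by lia.
  have id' : i = d.-1 by lia.
  move: h1 h2 h3; rewrite e1 e4 id !eqxx !binn !mul1n.
  have -> : 'C(d.+1, i.+1) = d.+1 by case: (id) => ->; rewrite binSn.
  have -> : 'C(d, i.+1) = 1 by case: (id) => ->; rewrite binn.
  have -> : 'C(d, i) = d by case: (id) => <-; rewrite binSn.
  by rewrite nE; nia.
have -> : (i.+2 == d) = (i.+3 == d.+1) by [].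
by move: h1 h2 h3; rewrite (negbTE id) ['C(d.+1, i.+1)]binS; exact: S_arith nE.
Qed.

(** By definition S has n points; that each of them is a vertex is read off from the number of faces
    of rank one. *)
Lemma S_vertices d n s (S : {fset 'rV[R]_N}) : 2 < d -> is_S d n s S -> nfaces S 0 = n.
Proof.
move=> d2 [B [sB rB cB spS cS]]; have [simB [s' cB' hB]] := stacked_rank_num sB.
have {cB'} ss : s' = s by move: cB'; rewrite cB rB => /eqP; rewrite eqn_add2l => /eqP.
subst s'; have [rS _ [m cS' hS]] := stacked_pyramid_rank_num simB spS.
have -> : nfaces S 0 = rank_num S 1 by [].
have := hS 0; have := hB 0; rewrite rB rank_num0 !bin1 !bin0.
have -> : (1 == d) = false by lia.
have -> : (2 == d) = false by lia.
have -> : (0 == d) = false by lia.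
by rewrite -cS cS' cB; lia.
Qed.

End StackedPolytopes.

(** * Capping the distinguished facet *)

Section CappedFacet.
Local Open Scope fset_scope.
Local Open Scope ring_scope.
Variables (R : realType) (N : nat).
Implicit Types (A B F G H V : {fset 'rV[R]_N}) (x p q v w : 'rV[R]_N) (f g h z : 'rV[R]_(1 + N)).

(* Start from the barycentre of G and move slightly away from that of V. *)
Lemma beyond_ex V G : is_facet V G -> G <> fset0 -> exists w, beyond_only V G w.
Proof.
move=> fG G0; have GV := fsubsetP (face_sub (proj1 fG)).
have /choice[l hl] : forall H, exists f, is_facet V H -> nonneg V f /\ zeros V f = H.
  move=> H; have [fH|nH] := EM (is_facet V H); last by exists 0.
  by have [/faceP[f [f0 e]] _] := fH; exists f.
pose b := \sum_(p <- G) hat p; pose o := \sum_(p <- V) hat p.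
pose one := row_mx (1%:M : 'M[R]_1) (- 0 : 'rV[R]_N).
have oneE p : ev one p = 1 by rewrite evE dotp0r subr0.
have pos f A v : nonneg V f -> A `<=` V -> v \in A -> v \notin zeros V f -> 0 < dotp (\sum_(p <- A) hat p) f.
  move=> f0 AV vA vf; have vV := fsubsetP AV v vA.
  rewrite dotp_suml (big_fsetD1 v) //= ltr_pwDl //; first exact: (facet_positive f0 vV vf).
  rewrite big_seq; apply: sumr_ge0 => p; rewrite in_fsetD1 => /andP[_ /(fsubsetP AV)]; exact: f0.
have [e|[v0 v0G]] := fset_0Vmem G; first by case: G0.
(* The functional [one] is included so that the perturbed vector has a positive first coordinate and
   can be scaled to the form [hat w]. *)
pose s := one :: [seq l H | H <- enum_fset (facets V `\ G)].
have [f|e e0 he] := @small_enough R _ s (dotp b) (dotp o).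
  rewrite in_cons => /orP[/eqP ->|/mapP[H]].
    apply: (pos _ _ v0) => //; first by move=> p _; rewrite oneE ler01.
      exact: face_sub (proj1 fG).
    by rewrite in_zeros oneE oner_eq0 andbF.
  rewrite in_fsetD1 => /andP[/eqP HG /in_facets fH] ->; have [f0 eH] := hl _ fH.
  have [v vG vH] : exists2 v, v \in G & v \notin H.
    have [e|[v]] := fset_0Vmem (G `\` H); last by rewrite in_fsetD => /andP[]; exists v.
    have [|e'|e'] := facet_maximal fG (proj1 fH); first by rewrite -fsetD_eq0 e eqxx.
      by case: HG.
    by case: (facet_neq fH).
  by apply: (pos _ _ v) => //; [exact: face_sub (proj1 fG)|rewrite eH].
pose z := b - e *: o; have zf f : dotp z f = dotp b f - e * dotp o f by rewrite dotpBl dotpZl.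
have z0 : 0 < dotp z one by rewrite zf he // mem_head.
pose w := rsubmx ((dotp z one)^-1 *: z).
have hw : hat w = (dotp z one)^-1 *: z.
  rewrite /hat /w -[RHS]hsubmxK; congr row_mx; rewrite linearZ /= [lsubmx z]mx11_scalar.
  have -> : lsubmx z 0 0 = dotp z one.
    rewrite /one dotpE tr_row_mx -[in RHS](hsubmxK z) mul_row_col tr_scalar_mx mulmx1 linearN /= trmx0.
    by rewrite oppr0 mulmx0 addr0.
  by rewrite scale_scalar_mx mulVf // gt_eqF.
have evw f : (0 < ev f w) = (0 < dotp z f) by rewrite /ev hw dotpZl pmulr_rgt0 // invr_gt0.
have conv f A : nonneg V f -> zeros V f = A -> exists c b', [/\ valid V c b', contact V c b' = A & ev f w = b' - dotp w c].
  move=> f0 fA; have [c [b' e']] := functionalP f; exists c, b'; rewrite e' in f0 fA *.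
  by split; [exact/valid_nonneg|rewrite contact_zeros|rewrite evE].
exists w; split.
- rewrite affrankU hw; suff -> : ((dotp z one)^-1 *: z <= hull V)%MS by rewrite addn0.
  apply: scalemx_sub; apply: addmx_sub; last rewrite -scaleNr scalemx_sub //.
    by rewrite /b big_seq; apply: summx_sub => p /GV; exact: mem_hull.
  by rewrite /o big_seq; apply: summx_sub => p; exact: mem_hull.
- have [f0 eG] := hl _ fG; have [c [b' [h1 h2 h3]]] := conv _ _ f0 eG; exists c, b'; split=> //.
  rewrite -subr_lt0 -h3 /ev hw dotpZl pmulr_rlt0 ?invr_gt0 // zf.
  have -> : dotp b (l G) = 0.
    by rewrite dotp_suml big1_seq // => p /=; rewrite -{1}eG in_zeros => /andP[_ /eqP].
  have [v vV vG] := facet_proper fG.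
  by rewrite sub0r oppr_lt0 mulr_gt0 // (pos _ _ v) ?fsubset_refl ?eG.
- move=> H fH HG; have [f0 eH] := hl _ fH; have [c [b' [h1 h2 h3]]] := conv _ _ f0 eH.
  exists c, b'; split=> //; rewrite -subr_gt0 -h3 evw zf he // in_cons; apply/orP; right.
  by apply/mapP; exists H; rewrite // in_fsetD1; apply/andP; split; [exact/eqP|exact/in_facets].
Qed.

Lemma boundary_face V F A : is_facet V F -> (A \in boundary F) <-> (is_face V A /\ A `<` F).
Proof.
move=> fF; have FV := face_sub (proj1 fF); rewrite /boundary in_fsetD1; split.
  move=> /andP[AF /in_faces fA]; split; first exact: face_trans (proj1 fF) fA.
  by rewrite fproperEneq AF face_sub.
move=> [fA]; rewrite fproperEneq => /andP[-> AF]; apply/in_faces; exact: face_of_sub fA AF FV.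
Qed.

Section Cap.
Variables (P F : {fset 'rV[R]_N}) (w : 'rV[R]_N) (d : nat).
Hypotheses (d1 : (1 < d)%N) (polyP : is_polytope P) (rP : affrank P = d.+1) (fF : is_facet P F).
Hypothesis simp : forall G, is_facet P G -> G <> F -> is_simplex G.
Hypothesis bw : beyond_only P F w.

Let d0 : (0 < d)%N. Proof. exact: ltnW. Qed.
Let wP : w \notin P. Proof. exact: beyond_notin bw. Qed.
Let FP : F `<=` P. Proof. exact: face_sub (proj1 fF). Qed.
Let rF : affrank F = d. Proof. by case: fF => _; rewrite rP => -[]. Qed.

Let wface A : is_face P A -> w \notin A.
Proof. by move=> /face_sub AP; apply: contra wP; exact: (fsubsetP AP). Qed.

Lemma face_simplex A : is_face P A -> A <> P -> A <> F -> is_simplex A.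
Proof.
move=> fA AP AF; have [H [fH HF AH]] := other_facet fF fA AP AF.
exact: simplexS AH (simp fH HF).
Qed.

Let FneP : F <> P. Proof. exact: facet_neq fF. Qed.

Let proper_neqP A : A `<` F -> A <> P.
Proof.
move=> AF e; move: AF; rewrite e fproperE => /andP[PF]; rewrite FP //.
Qed.

Lemma capped_simplicial : simplicial (w |` P).
Proof.
move=> H /(facet_beyond fF bw) [[fH HF _]|[A [fA AF rA ->]]]; first exact: simp.
have AneF : A <> F by move=> e; move: AF; rewrite e fproperE fsubset_refl andbF.
apply: simplexU; [exact: face_simplex (proper_neqP AF) AneF|exact: wface|].
by apply: (visible_rank bw); exact: fproper_sub.
Qed.

Definition capped_facets := facets (w |` P).
Let X := capped_facets.

Lemma capped_normal : normal d X.
Proof. by apply: facets_normal => //; [rewrite (beyond_rank bw)|exact: capped_simplicial]. Qed.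

Let cxX : cx X = boundary (w |` P).
Proof. by rewrite (boundary_facets capped_simplicial). Qed.

Lemma cx_capped_del : cx (del X w) = boundary P `\ F.
Proof.
apply/fsetP => t; rewrite (in_cx_del _ _ capped_normal) // cxX (boundary_beyond fF bw) in_fsetU.
apply/andP/idP => [[/orP[//|/imfsetP[A _ ->]]]|tP]; first by rewrite fset1U1.
rewrite tP; split=> //; move: tP; rewrite in_fsetD1 => /andP[_]; rewrite in_fsetD1 => /andP[_ /in_faces].
exact: wface.
Qed.

Lemma cx_capped_link : cx (link X [fset w]) = boundary F.
Proof.
apply/fsetP => t; rewrite cx_link fdisjoint1X cxX (boundary_beyond fF bw) in_fsetU.
apply/andP/idP => [[wt /orP[]]|/(boundary_face t fF)[ft tF]].
- rewrite in_fsetD1 => /andP[_]; rewrite in_fsetD1 => /andP[_ /in_faces /wface].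
  by rewrite fset1U1.
- move=> /imfsetP[A /= +]; rewrite in_sep => /andP[/in_faces fA AF].
  move=> /(congr1 (fun D => D `\ w)); rewrite !fsetU1K ?(wface fA) // => ->.
  exact/(boundary_face A fF).
split; first exact: wface.
by apply/orP; right; apply/imfsetP; exists t => //=; rewrite in_sep tF andbT; apply/in_faces.
Qed.

Lemma singleton_neq (B : {fset 'rV[R]_N}) p : (1 < affrank B)%N -> [fset p] <> B.
Proof. by move=> rB e; have := affrank_card B; rewrite -e cardfs1 e; move: rB; lia. Qed.

Lemma vertices_capped_link : vertices (link X [fset w]) = F.
Proof.
apply/fsetP => p; rewrite -cx1 cx_capped_link; apply/idP/idP => [/(boundary_face _ fF)[_ /fproper_sub]|pF].
  by rewrite fsub1set.
apply/(boundary_face _ fF).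
split; first exact: polyP (fsubsetP FP p pF).
by rewrite fproperEneq fsub1set pF andbT; apply/eqP; apply: singleton_neq; rewrite rF.
Qed.

Lemma vertices_capped_del : vertices (del X w) = P.
Proof.
apply/fsetP => p; rewrite -cx1 cx_capped_del in_fsetD1; apply/andP/idP => [[_]|pP].
  by rewrite in_fsetD1 => /andP[_ /in_faces /face_sub]; rewrite fsub1set.
split; first by apply/eqP; apply: singleton_neq; rewrite rF.
rewrite in_fsetD1; apply/andP; split; first by apply/eqP; apply: singleton_neq; rewrite rP ltnW.
by apply/in_faces; exact: polyP.
Qed.

Lemma capped_vertex : w \in vertices X.
Proof.
rewrite -cx1 cxX (boundary_beyond fF bw) in_fsetU; apply/orP; right.
apply/imfsetP; exists fset0; rewrite /= ?fsetU0 // in_sep; apply/andP; split.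
  by apply/in_faces; exact: empty_face.
rewrite fproperE fsub0set fsubset0; apply/eqP => e.
by move: rF; rewrite e affrank0; move: d0; lia.
Qed.

(** A face of P inside F is F, which the cap has removed, or a proper face of F, which the cap has
    joined to w. *)
Lemma capped_induced : induced_link X w.
Proof.
move=> t tX; rewrite vertices_capped_link => tF.
have wt : w \notin t by apply: contra wP => /(fsubsetP tF); exact: (fsubsetP FP).
have : t \in cx (del X w) by rewrite (in_cx_del _ _ capped_normal) // tX.
rewrite cx_capped_del in_fsetD1 => /andP[tneF]; rewrite in_fsetD1 => /andP[_ /in_faces ft].
have : t \in boundary F by apply/(boundary_face _ fF); rewrite fproperEneq tneF.
by rewrite -cx_capped_link cx_link => /andP[_].
Qed.

(** Deleting w from the capped polytope gives back all proper faces of P except F, which has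
    dimension d - 1; all these faces are simplices, so rank and number of vertices agree. *)
Lemma nfaces_capped i : (i < d)%N -> nfaces P i = (fnum (del X w) i.+1 + (i.+1 == d))%N.
Proof.
move=> id; rewrite -[nfaces P i]/(rank_num P i.+1) rank_num_boundary rP.
have -> : (i.+1 == d.+1) = false by move: id; lia.
rewrite addn0 (cardfsD1 F) addnC in_sep rF; have -> : F \in boundary P.
  by rewrite in_fsetD1; apply/andP; split; [exact/eqP|apply/in_faces; case: fF].
rewrite /= [d == _]eq_sym; congr (#|` _| + _)%N; apply/fsetP => A.
rewrite in_cells cx_capped_del in_fsetD1 in_sep in_fsetD1 andbA; apply: andb_id2l => /andP[AF].
by rewrite in_fsetD1 => /andP[AP /in_faces fA]; rewrite (face_simplex fA) //; exact/eqP.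
Qed.

End Cap.
End CappedFacet.
Local Open Scope fset_scope.
Local Open Scope nat_scope.

Theorem theorem3p2 (R : realType) (N d n s : nat)
    (P F S : {fset 'rV[R]_N}) (LF : seq {fset {fset 'rV[R]_N}})
    (hd : (4 < d)%N)
    (hP : in_P d n s P F)
    (hS : is_S d n s S)
    (hLF : prime_decomposition d.-1 (boundary F) LF)
    (hf : exists i : nat, (1 <= i <= d.-1)%N /\ nfaces P i = nfaces S i) :
  (forall L : seq {fset {fset 'rV[R]_N}},
     prime_decomposition d (refined_boundary P F (decomposition_complex LF)) L ->
     forall Q : {fset {fset 'rV[R]_N}}, Q \in L -> simplex_sphere d Q) /\
  fvector d P = fvector d S.
Proof.
(* Writing d = k + 5 gives the boundary of F facets with k + 4 vertices, the size that
   [prime_simplex] requires. *)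
case: d hd hP hS hLF hf => [//|[|[|[|[|k]]]]] // _ [polyP rP cP [fF cF] simp] hS hLF [i [i1 eqi]].
have F0 : F <> fset0 by move=> e; move: cF; rewrite e cardfs0.
have [w bw] := beyond_ex fF F0.
set D := k.+4.+1 in polyP rP cP fF cF simp hS hLF i1 *.
have D1 : 1 < D by [].
pose X := capped_facets P w.
have nX : normal D X by exact: (capped_normal D1 rP fF simp bw).
have wX : w \in vertices X by exact: (capped_vertex D1 rP fF simp bw).
have iw : induced_link X w by exact: (capped_induced D1 polyP rP fF simp bw).
have vK : #|` vertices (link X [fset w])| = D + s by rewrite (vertices_capped_link D1 polyP rP fF simp bw).
have vD : #|` vertices (del X w)| = n by rewrite (vertices_capped_del D1 polyP rP fF simp bw).
have cxD : cx (del X w) = boundary P `\ F by exact: (cx_capped_del D1 rP fF simp bw).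
have pd : prime_decomposition k.+4 (cx (link X [fset w])) LF by rewrite (cx_capped_link fF simp bw).
have nfP j : j < D -> nfaces P j = fnum (del X w) j.+1 + (j.+1 == D) by exact: (nfaces_capped D1 rP fF simp bw).
have defect j : facet_defect D j X w = (j == D.-1) * s + (j == D) * s.+1.
  by rewrite /facet_defect wX vK addKn.
(* The coincidence of f_i with its value for S is equality in [bounded] at index i + 1, because
   [fnum] counts vertices. *)
have eq2 : fnum (del X w) 2 + 'C(D.+1, 2) = D * #|` vertices (del X w)|.
  apply: (bounded_eq R nX (fun=> iw) (j := i.+1)); first by move: i1; rewrite /D; lia.
  have := S_nfaces (j := i.+1) hS; rewrite -eqi nfP ?defect ?vD; last by move: i1; rewrite /D; lia.
  move=> <-; last by move: i1; rewrite /D; lia.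
  by congr addn; rewrite mulnS; lia.
split=> [L|].
  have -> : refined_boundary P F (decomposition_complex LF) = cx (refinement X w LF).
    rewrite (decomposition_simplices R nX wX iw vK pd eq2); apply/fsetP => t.
    by rewrite cx_refinement cxD in_fsetU.
  exact: (refinement_prime R nX wX iw vK pd eq2).
rewrite /fvector; congr cons; apply/eq_in_map => j; rewrite mem_iota add0n => /andP[_ jD].
(* The bounds begin with edges, so f_0 is compared directly: both polytopes have n vertices. *)
case: j jD => [|j] jD; first by rewrite (S_vertices _ hS) // nfP // fnum1 vD (_ : (1 == D) = false) ?addn0.
have e : fnum (del X w) j.+2 + facet_defect D j.+2 X w + D.+1 * excess_coef D j.+2 =
    'C(D.+1, j.+2) + n * excess_coef D j.+2.
  by rewrite -vD; exact: (refinement_fnum R nX wX iw vK pd eq2 (j := j.+2) jD).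
have := S_nfaces (j := j.+2) hS jD; rewrite -e defect nfP // mulnS.
by move: (_ * excess_coef _ _) (nfaces S _) => E m; lia.
Qed.
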